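(* Let $M$ be either the 2-dimensional sphere $\mathbb{S}^2$ or the hyperbolic plane $\mathbb{H}^2$, with distance function $d$. Let $p_1,\dots,p_k,q_1,\dots,q_k\in M$ and let $r_1,\dots,r_k>0$. Assume that $d(q_i,q_j)\le d(p_i,p_j)$ for all $i,j\in\{1,\dots,k\}$, and that the interior of the union $\bigcup_{i=1}^k B_{p_i}(r_i)$ is simply connected. Then $$\mathrm{Area}\Big(\bigcup_{i=1}^k B_{q_i}(r_i)\Big)\le \mathrm{Area}\Big(\bigcup_{i=1}^k B_{p_i}(r_i)\Big).$$
   Context: For $p\in M$ and $r>0$, $B_p(r)=\{x\in M: d(p,x)\le r\}$ is the closed disk of radius $r$ centered at $p$, where $d$ is the intrinsic (geodesic) distance. The radii $r_i$ need not be equal. *)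

(* Defs.v *)
From HB Require Import structures.
From mathcomp Require Import all_boot all_order all_algebra.
From mathcomp Require Import all_classical all_reals all_analysis.

Set Implicit Arguments.
Unset Strict Implicit.
Unset Printing Implicit Defensive.

Import Order.TTheory GRing.Theory Num.Theory.
Import numFieldNormedType.Exports.

Local Open Scope classical_set_scope.
Local Open Scope ring_scope.

Section SimplyConnected.
Context (R : realType) {T : topologicalType}.
Implicit Types (U : set T).

Definition path_connected U : Prop :=
  forall x y, U x -> U y -> exists g : R -> T,
    [/\ {within `[0, 1], continuous g}, g @` `[0, 1] `<=` U, g 0 = x & g 1 = y].

Definition null_homotopic_in U (g : R -> T) : Prop :=
  exists H : R * R -> T,
    [/\ {within `[0, 1] `*` `[0, 1], continuous H},
        H @` (`[0, 1] `*` `[0, 1]) `<=` U,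
        forall t, t \in `[0, 1] -> H (0, t) = g t,
        forall t, t \in `[0, 1] -> H (1, t) = g 0 &
        forall s, s \in `[0, 1] -> H (s, 0) = g 0 /\ H (s, 1) = g 0].

Definition simply_connected U : Prop :=
  path_connected U /\
  forall g : R -> T, {within `[0, 1], continuous g} -> g @` `[0, 1] `<=` U ->
    g 0 = g 1 -> null_homotopic_in U g.

End SimplyConnected.

Inductive plane := Sphere | Hyperbolic.

Section Geometry.
Context {R : realType}.
Implicit Types (M : plane) (x y p : 'rV[R]_3) (A : set 'rV[R]_3).

(* The Euclidean inner product for the sphere, the Lorentzian product
   x0 y0 + x1 y1 - x2 y2 for the hyperboloid model of the hyperbolic plane.
   Its restriction to tangent vectors of the surface below is the Riemannian
   metric. *)
Definition metric_form M x y : R :=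
  x 0 0 * y 0 0 + x 0 1 * y 0 1 +
  match M with
  | Sphere => x 0 2 * y 0 2
  | Hyperbolic => - (x 0 2 * y 0 2)
  end.

Definition surface M : set 'rV[R]_3 :=
  match M with
  | Sphere => [set x | metric_form M x x = 1]
  | Hyperbolic => [set x | metric_form M x x = -1 /\ 0 < x 0 2]
  end.

(* Only the values of g on [0, 1] matter: a C^1 map on [0, 1] extends to a C^1
   map on the line, so nothing is lost by asking for derivatives on R. *)
Definition C1_path M x y (g : R -> 'rV[R]_3) : Prop :=
  [/\ forall t, derivable g t 1, continuous (derive1 g),
      forall t, t \in `[0, 1] -> surface M (g t), g 0 = x & g 1 = y].

Definition path_length M (g : R -> 'rV[R]_3) : R :=
  \int[lebesgue_measure]_(t in `[0, 1]) Num.sqrt (metric_form M (derive1 g t) (derive1 g t)).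

Definition dist M x y : R := inf [set path_length M g | g in C1_path M x y].

Definition disk M p (r : R) : set 'rV[R]_3 :=
  [set x | surface M x /\ dist M p x <= r].

Definition sinh (t : R) : R := (expR t - expR (- t)) / 2.
Definition cosh (t : R) : R := (expR t + expR (- t)) / 2.

(* Geodesic polar coordinates around (0, 0, 1): a bijection from polar_domain
   onto the surface minus that point (and, on the sphere, its antipode). *)
Definition polar M (z : R * R) : 'rV[R]_3 :=
  match M with
  | Sphere =>
      \row_i [:: sin z.1 * cos z.2; sin z.1 * sin z.2; cos z.1]`_i
  | Hyperbolic =>
      \row_i [:: sinh z.1 * cos z.2; sinh z.1 * sin z.2; cosh z.1]`_i
  end.

Definition polar_domain M : set (R * R) :=
  match M with
  | Sphere => `]0, pi[ `*` `[0, 2 * pi[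
  | Hyperbolic => `]0, +oo[ `*` `[0, 2 * pi[
  end.

(* The Riemannian area density sqrt (E G - F^2) of the polar chart. *)
Definition area_density M (z : R * R) : R :=
  let u := derive1 (fun s => polar M (s, z.2)) z.1 in
  let v := derive1 (fun t => polar M (z.1, t)) z.2 in
  Num.sqrt (metric_form M u u * metric_form M v v - metric_form M u v ^+ 2).

Definition area M A : \bar R :=
  (\int[lebesgue_measure \x lebesgue_measure]_(z in
     polar_domain M `&` polar M @^-1` A) (area_density M z)%:E)%E.

(* In the library topology of [subspace S] the points of S have their relative
   neighbourhoods and the points outside S are isolated, so for A included in S
   this is the interior of A relative to S. *)
Definition relative_interior (S A : set 'rV[R]_3) : set 'rV[R]_3 :=
  @interior (subspace S) A.

End Geometry.

(* Main.v *)
Require Import Defs.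
From HB Require Import structures.
From mathcomp Require Import all_boot all_order all_algebra.
From mathcomp Require Import all_classical all_reals all_analysis.
From mathcomp Require Import measurable_realfun ring lra.

Set Implicit Arguments.
Unset Strict Implicit.
Unset Printing Implicit Defensive.

Import Order.TTheory GRing.Theory Num.Theory.
Import numFieldNormedType.Exports.

Local Open Scope classical_set_scope.
Local Open Scope ring_scope.

(* Let O be the interior of the union of the disks B_{p_i}(r_i). A disc contained in O and
   two points a, b of its boundary circle outside O can be turned about a and b, over the
   pencil of circles through them, until it meets a third such point e, where the side of
   the disc under consideration splits into a side for (a, e) and one for (e, b). As O is
   simply connected, the sides of a disc are well defined and this process yields a finite
   tree of discs in O such that every B_{p_i} lies in one of them and the root disc and the
   lunes (child minus parent) are pairwise disjoint.

   By Kirszbraun's theorem the assignment p_i |-> q_i extends to the centres of the tree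
   without increasing distances. The moved discs of the tree cover every B_{q_i}, by the
   triangle inequality, and the area of a lune decreases when the centres of its two discs
   approach each other. Hence
     Area (U B_{q_i}) <= Area (moved root) + sum Area (moved lunes)
                      <= Area (root) + sum Area (lunes) <= Area (U B_{p_i}). *)

(** * The quadratic form *)

(** Both surfaces are quadrics in R^3 and a disc is the part of the surface in a half-space. A
    contraction is then a family of inequalities [mf x y <= mf x' y'] between products.

    The sides of a disc with boundary points a, b outside O come from an angle. The pair (mf c - k,
    mf m - l), where the plane mf m = l cuts the circle in a and b, does not vanish on O, so simple
    connectivity gives it a continuous argument q there. The disc lies in |q| < pi/2, its sides are
    q > pi/2 and q < -pi/2, and turning by t replaces q by q - t. On each B_{p_i} the argument stays
    in an open interval of length pi, hence B_{p_i} cannot reach both sides.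

    The circle of a disc can meet the complement of O in infinitely many points, even in a whole
    arc, so contacts cannot be counted. The induction counts the B_{p_i} that reach the side; for
    this number to drop, the arc is first cut down to a gap between two neighbouring contacts. *)

Lemma sqr3_eq0 {R : realDomainType} (x y z : R) :
  x ^+ 2 + y ^+ 2 + z ^+ 2 = 0 -> [/\ x = 0, y = 0 & z = 0].
Proof.
have := sqr_ge0 x; have := sqr_ge0 y; have := sqr_ge0 z => z2 y2 x2 e.
by split; apply/eqP; rewrite -sqrf_eq0; apply/eqP; lra.
Qed.

Section Form.
Context {R : realType} (M : plane).
Implicit Types (a b c m u v w x y z : 'rV[R]_3) (h k s t : R).

Local Notation mf := (@metric_form R M).

Definition form_sign : R := match M with Sphere => 1 | Hyperbolic => -1 end.
Local Notation sg := form_sign.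

Definition vec (a b c : R) : 'rV[R]_3 := \row_i [:: a; b; c]`_i.

Lemma vec0 (a b c : R) : vec a b c 0 0 = a. Proof. by rewrite mxE. Qed.
Lemma vec1 (a b c : R) : vec a b c 0 1 = b. Proof. by rewrite mxE. Qed.
Lemma vec2 (a b c : R) : vec a b c 0 2 = c. Proof. by rewrite mxE. Qed.

Lemma vec_eta x : x = vec (x 0 0) (x 0 1) (x 0 2).
Proof.
apply/rowP => i; rewrite mxE.
by case: i => -[|[|[|//]]] ? /=; congr (x 0 _); apply/val_inj.
Qed.

Lemma vecP x y : x 0 0 = y 0 0 -> x 0 1 = y 0 1 -> x 0 2 = y 0 2 -> x = y.
Proof. by move=> e0 e1 e2; rewrite (vec_eta x) (vec_eta y) e0 e1 e2. Qed.

Lemma sg2 : sg * sg = 1 :> R.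
Proof. by rewrite /sg; case: M; lra. Qed.

Lemma mfE x y :
  mf x y = x 0 0 * y 0 0 + x 0 1 * y 0 1 + sg * (x 0 2 * y 0 2).
Proof. by rewrite /metric_form /sg; case: M; lra. Qed.

Lemma mfC x y : mf x y = mf y x. Proof. by rewrite !mfE; ring. Qed.
Lemma mfDl x y z : mf (x + y) z = mf x z + mf y z.
Proof. by rewrite !mfE !mxE; ring. Qed.
Lemma mfDr x y z : mf x (y + z) = mf x y + mf x z.
Proof. by rewrite !mfE !mxE; ring. Qed.
Lemma mfZl s x y : mf (s *: x) y = s * mf x y.
Proof. by rewrite !mfE !mxE; ring. Qed.
Lemma mfZr s x y : mf x (s *: y) = s * mf x y.
Proof. by rewrite !mfE !mxE; ring. Qed.
Lemma mfNl x y : mf (- x) y = - mf x y.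
Proof. by rewrite !mfE !mxE; ring. Qed.
Lemma mfNr x y : mf x (- y) = - mf x y.
Proof. by rewrite !mfE !mxE; ring. Qed.
Lemma mf0l x : mf 0 x = 0. Proof. by rewrite mfE !mxE; ring. Qed.
Lemma mf0r x : mf x 0 = 0. Proof. by rewrite mfE !mxE; ring. Qed.
Definition mflin := (mfDl, mfDr, mfNl, mfNr, mfZl, mfZr).

Lemma surface_mf x : surface M x -> mf x x = sg.
Proof. by rewrite /surface /sg; case: M => [//|[]]. Qed.

(** Tangent vectors are spacelike. On the hyperboloid, eliminating the last coordinate of [v] turns
    [c 0 2 ^+ 2 * mf v v] into a sum of squares. *)
Lemma surface_orth_ge0 c v : surface M c -> mf c v = 0 -> 0 <= mf v v.
Proof.
case: M => /= [_ _|[cc c2]]; first by rewrite /metric_form; nra.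
rewrite /metric_form in cc * => cv.
have : 0 <= c 0 2 ^+ 2 * (v 0 0 * v 0 0 + v 0 1 * v 0 1 + - (v 0 2 * v 0 2)).
  have -> : c 0 2 ^+ 2 * (v 0 0 * v 0 0 + v 0 1 * v 0 1 + - (v 0 2 * v 0 2)) =
     v 0 0 ^+ 2 + v 0 1 ^+ 2 + (c 0 0 * v 0 1 - c 0 1 * v 0 0) ^+ 2.
    have e : c 0 2 ^+ 2 = 1 + c 0 0 ^+ 2 + c 0 1 ^+ 2 by lra.
    have e' : c 0 2 * v 0 2 = c 0 0 * v 0 0 + c 0 1 * v 0 1 by lra.
    transitivity ((c 0 2 ^+ 2) * (v 0 0 ^+ 2 + v 0 1 ^+ 2) - (c 0 2 * v 0 2) ^+ 2).
      by ring.
    by rewrite e e'; ring.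
  by rewrite !addr_ge0// sqr_ge0.
by rewrite pmulr_rge0// exprn_gt0.
Qed.

Lemma surface_orth_eq0 c v : surface M c -> mf c v = 0 -> mf v v = 0 -> v = 0.
Proof.
case: M => /= [_ _|[cc c2]].
  rewrite /metric_form -!expr2 => /sqr3_eq0[v0 v1 v2].
  by apply: vecP; rewrite mxE.
rewrite /metric_form in cc * => cv vv.
have e : v 0 0 ^+ 2 + v 0 1 ^+ 2 + (c 0 0 * v 0 1 - c 0 1 * v 0 0) ^+ 2 = 0.
  have e : c 0 2 ^+ 2 = 1 + c 0 0 ^+ 2 + c 0 1 ^+ 2 by lra.
  have e' : c 0 2 * v 0 2 = c 0 0 * v 0 0 + c 0 1 * v 0 1 by lra.
  transitivity ((c 0 2 ^+ 2) * (v 0 0 ^+ 2 + v 0 1 ^+ 2) - (c 0 2 * v 0 2) ^+ 2).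
    by rewrite e e'; ring.
  transitivity (c 0 2 ^+ 2 * (v 0 0 * v 0 0 + v 0 1 * v 0 1 + - (v 0 2 * v 0 2))).
    by ring.
  by rewrite vv mulr0.
have [v0 v1 _] := sqr3_eq0 e.
apply: vecP; rewrite !mxE//.
move/eqP: cv; rewrite v0 v1 !mulr0 !add0r oppr_eq0 mulf_eq0 (gt_eqF c2).
by move/eqP.
Qed.

(** The component of [y] tangent at [x] has nonnegative square, so the product is at most 1 in
    absolute value on the sphere and at least 1 on the hyperboloid; there both points lie on the
    upper sheet, which makes it negative. *)
Lemma mf_le_sg x y : surface M x -> surface M y -> mf x y <= sg.
Proof.
move=> xM yM; set v := y - (sg * mf x y) *: x.
have xv : mf x v = 0.
  rewrite /v !mflin (surface_mf xM).
  by transitivity (mf x y * (1 - sg * sg)); [ring|rewrite sg2; ring].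
have := surface_orth_ge0 xM xv.
rewrite /v !mflin (surface_mf xM) (surface_mf yM) (mfC y x).
move: xM yM; rewrite /sg; case: M => /= [_ _|[xx x2] [yy y2]]; first by nra.
rewrite /metric_form in xx yy *.
have e1 : x 0 0 ^+ 2 + x 0 1 ^+ 2 < x 0 2 ^+ 2 by lra.
have e2 : y 0 0 ^+ 2 + y 0 1 ^+ 2 < y 0 2 ^+ 2 by lra.
have neg : x 0 0 * y 0 0 + x 0 1 * y 0 1 < x 0 2 * y 0 2.
  have p : 0 < x 0 2 * y 0 2 by exact: mulr_gt0.
  apply: le_lt_trans (ler_norm _) _.
  rewrite -(ltr_pXn2r (_ : 0 < 2)%N)// ?nnegrE ?normr_ge0 ?ltW//.
  rewrite real_normK ?num_real// exprMn.
  apply: (@le_lt_trans _ _ ((x 0 0 ^+ 2 + x 0 1 ^+ 2) * (y 0 0 ^+ 2 + y 0 1 ^+ 2))).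
    have := sqr_ge0 (x 0 0 * y 0 1 - x 0 1 * y 0 0); lra.
  by apply: ltr_pM; rewrite // addr_ge0// sqr_ge0.
nra.
Qed.

Lemma mf_eq_sg x y : surface M x -> surface M y -> mf x y = sg -> x = y.
Proof.
move=> xM yM e; apply/eqP; rewrite -subr_eq0; apply/eqP.
apply: (surface_orth_eq0 xM); rewrite !mflin ?(mfC y x) (surface_mf xM) ?(surface_mf yM) e; ring.
Qed.

Lemma mf_lt_sg x y : surface M x -> surface M y -> x != y -> mf x y < sg.
Proof.
move=> xM yM xy; rewrite lt_neqAle mf_le_sg// andbT.
by apply: contra xy => /eqP /(mf_eq_sg xM yM)/eqP.
Qed.

Lemma mf_geN1 x y : M = Sphere -> surface M x -> surface M y -> -1 <= mf x y.
Proof.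
move=> MS xM yM; have := surface_orth_ge0 xM (_ : mf x (y - (sg * mf x y) *: x) = 0).
rewrite !mflin (surface_mf xM) (surface_mf yM) (mfC y x) /sg MS => /(_ ltac:(by ring)).
nra.
Qed.

(** The bound on [mf c x] chooses the sheet: were [x] on the lower one, [- x] would be on the
    surface and [mf c x] at least 1. *)
Lemma surface_of c x : surface M c -> mf x x = sg -> mf c x <= sg -> surface M x.
Proof.
move=> cM xx cx; have := @mf_le_sg c (- x) cM.
move: cM xx cx; rewrite /surface /sg; case: M => //= -[cc c2] xx cx H; split=> //.
rewrite ltNge; apply/negP => x2.
have : metric_form Hyperbolic c (- x) <= -1.
  apply: H; rewrite /metric_form !mxE; rewrite /metric_form in xx.
  split; first lra.
  rewrite oppr_gt0 lt_neqAle x2 andbT; apply/eqP => e.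
  by move: xx; rewrite e; have := sqr_ge0 (x 0 0); have := sqr_ge0 (x 0 1); lra.
have -> : metric_form Hyperbolic c (- x) = - metric_form Hyperbolic c x.
  by rewrite /metric_form !mxE; ring.
lra.
Qed.

(** Reflection in the plane orthogonal to [v] for the form; when [0 < mf v v] it restricts to the
    reflection of the surface in a geodesic. *)
Definition refl v x := x - (2 * mf x v / mf v v) *: v.

Lemma mf_refl v x y : mf v v != 0 -> mf (refl v x) (refl v y) = mf x y.
Proof. by move=> v0; rewrite /refl !mflin (mfC v y); field. Qed.

Lemma reflK v x : mf v v != 0 -> refl v (refl v x) = x.
Proof.
move=> v0; rewrite /refl !mflin -addrA -opprD -scalerDl.
by rewrite [X in X *: _](_ : _ = 0) ?scale0r ?subr0//; field.
Qed.

Lemma refl_surface v x : 0 < mf v v -> surface M x -> surface M (refl v x).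
Proof.
move=> v0 xM; have v0' : mf v v != 0 by rewrite gt_eqF.
apply: (surface_of xM); first by rewrite mf_refl// surface_mf.
rewrite /refl !mflin surface_mf// gerBl.
rewrite mulrAC divr_ge0 ?(ltW v0)//.
by rewrite -mulrA mulr_ge0// -expr2 sqr_ge0.
Qed.

Lemma mf_sub_gt0 x y : surface M x -> surface M y -> x != y -> 0 < mf (x - y) (x - y).
Proof.
move=> xM yM /(mf_lt_sg xM yM); rewrite !mflin (mfC y x) !surface_mf//; lra.
Qed.

Lemma refl_swap x y : surface M x -> surface M y -> x != y -> refl (x - y) x = y.
Proof.
move=> xM yM xy; have := mf_sub_gt0 xM yM xy => d0.
rewrite /refl [X in X *: _](_ : _ = 1); first by rewrite scale1r subKr.
move: d0; rewrite !mflin (mfC y x) !surface_mf// => d0.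
by field; lra.
Qed.

(** For [c] on the surface, a closed disc about [c]: [h] is the cosine of its radius, minus the
    hyperbolic cosine in the hyperbolic plane, so that a larger [h] means a smaller disc. *)
Definition cap c h : set 'rV[R]_3 := [set x | surface M x /\ h <= mf c x].
Definition ocap c h : set 'rV[R]_3 := [set x | surface M x /\ h < mf c x].

Lemma ocap_cap c h : ocap c h `<=` cap c h.
Proof. by move=> x [xM /ltW]. Qed.

(** The sign in the last coordinate makes the product orthogonal to both factors for the form
    instead of the Euclidean product; [det] is then the usual determinant. *)
Definition cross a b : 'rV[R]_3 :=
  vec (a 0 1 * b 0 2 - a 0 2 * b 0 1) (a 0 2 * b 0 0 - a 0 0 * b 0 2)
      (sg * (a 0 0 * b 0 1 - a 0 1 * b 0 0)).

Lemma mf_cross_l a b : mf (cross a b) a = 0.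
Proof.
rewrite mfE vec0 vec1 vec2.
by have -> : sg = sg * 1 :> R; [ring|rewrite -sg2]; have := sg2; rewrite /sg; case: M; lra.
Qed.

Lemma mf_cross_r a b : mf (cross a b) b = 0.
Proof. by rewrite mfE vec0 vec1 vec2 /sg; case: M; ring. Qed.

Lemma mf_cross a b c d : mf (cross a b) (cross c d) =
  sg * (mf a c * mf b d - mf a d * mf b c).
Proof. by rewrite !mfE !vec0 !vec1 !vec2 /sg; case: M; ring. Qed.

Definition det a b c : R := mf (cross a b) c.

Lemma detE a b c : det a b c =
  a 0 0 * (b 0 1 * c 0 2 - b 0 2 * c 0 1)
  - a 0 1 * (b 0 0 * c 0 2 - b 0 2 * c 0 0)
  + a 0 2 * (b 0 0 * c 0 1 - b 0 1 * c 0 0).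
Proof. by rewrite /det mfE !vec0 !vec1 !vec2 /sg; case: M; ring. Qed.

Lemma cramer a b c v :
  det a b c *: v = det v b c *: a + det a v c *: b + det a b v *: c.
Proof. by apply: vecP; rewrite !detE !mxE; ring. Qed.

(** The form is nondegenerate. Vector identities are often proved this way below, by comparing
    products with three independent vectors. *)
Lemma det_orth a b c v : det a b c != 0 ->
  mf v a = 0 -> mf v b = 0 -> mf v c = 0 -> v = 0.
Proof.
move=> d0 va vb vc.
have key w : mf v w = 0.
  have /(congr1 (mf v)) := cramer a b c w.
  rewrite !mflin va vb vc !mulr0 !addr0 => /eqP.
  by rewrite mulf_eq0 (negbTE d0) => /eqP.
apply: vecP; rewrite mxE.
- by have := key (vec 1 0 0); rewrite mfE vec0 vec1 vec2; lra.
- by have := key (vec 0 1 0); rewrite mfE vec0 vec1 vec2; lra.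
- by have := key (vec 0 0 1); rewrite mfE vec0 vec1 vec2 /sg; case: M; lra.
Qed.

(** Subtracting [mf y y = sg] from [sg * (p + q + r) ^+ 2 = sg] leaves twice a sum of nonnegative
    terms such as [p * q * (sg - mf a b)], so two of the weights vanish. *)
Lemma strict_convex a b c y (p q r : R) :
  surface M a -> surface M b -> surface M c -> surface M y ->
  a != b -> b != c -> c != a ->
  y = p *: a + q *: b + r *: c -> p + q + r = 1 ->
  0 <= p -> 0 <= q -> 0 <= r -> [\/ y = a, y = b | y = c].
Proof.
move=> aM bM cM yM ab bc ca e s p0 q0 r0.
have := surface_mf yM; rewrite {1 2}e !mflin.
rewrite (surface_mf aM) (surface_mf bM) (surface_mf cM) (mfC b a) (mfC c a) (mfC c b) => E.
have ha := mf_lt_sg aM bM ab; have hb := mf_lt_sg bM cM bc.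
have hc := mf_lt_sg cM aM ca; rewrite mfC in hc.
have E0 : p * q * (sg - mf a b) + q * r * (sg - mf b c) + p * r * (sg - mf a c) = 0.
  have : sg * (p + q + r) ^+ 2 = sg by rewrite s; ring.
  by move: E; nra.
have z1 : p * q * (sg - mf a b) = 0.
  have : 0 <= p * q * (sg - mf a b) by rewrite !mulr_ge0//; lra.
  have : 0 <= q * r * (sg - mf b c) by rewrite !mulr_ge0//; lra.
  have : 0 <= p * r * (sg - mf a c) by rewrite !mulr_ge0//; lra.
  lra.
have z2 : q * r * (sg - mf b c) = 0.
  have : 0 <= q * r * (sg - mf b c) by rewrite !mulr_ge0//; lra.
  have : 0 <= p * r * (sg - mf a c) by rewrite !mulr_ge0//; lra.
  lra.
have z3 : p * r * (sg - mf a c) = 0 by lra.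
have {z1} : p * q = 0 by apply/eqP; move/eqP: z1; rewrite mulf_eq0 subr_eq0 (gt_eqF ha) orbF.
have {z2} : q * r = 0 by apply/eqP; move/eqP: z2; rewrite mulf_eq0 subr_eq0 (gt_eqF hb) orbF.
have {z3} : p * r = 0 by apply/eqP; move/eqP: z3; rewrite mulf_eq0 subr_eq0 (gt_eqF hc) orbF.
case: (eqVneq p 0) => [P|P].
  case: (eqVneq q 0) => [Q|Q].
    move=> _ _ _; apply: Or33; rewrite e P Q !scale0r !add0r.
    by rewrite (_ : r = 1) ?scale1r//; lra.
  move=> _ /eqP; rewrite mulf_eq0 (negbTE Q) /= => /eqP r1 _.
  apply: Or32; rewrite e P r1 !scale0r addr0 add0r.
  by rewrite (_ : q = 1) ?scale1r//; lra.
move=> /eqP; rewrite mulf_eq0 (negbTE P) /= => /eqP Q _ /eqP.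
rewrite mulf_eq0 (negbTE P) /= => /eqP r1.
apply: Or31; rewrite e Q r1 !scale0r !addr0.
by rewrite (_ : p = 1) ?scale1r//; lra.
Qed.

End Form.

(** * Lifting angles on simply connected sets *)

Section AngleLift.
Context {R : realType}.
Implicit Types (r s t u v : R).
(** An argument of the point [(u, v)], kept as a relation because all its values modulo [2 * pi] are
    wanted. *)
Definition ang (q u v : R) : Prop :=
  exists2 r, 0 < r & u = r * cos q /\ v = r * sin q.

(** The fraction is the tangent of the angle from [(u, v)] to [(u', v')], a cross product over an
    inner product; that angle is acute, so [atan] returns it. *)
Lemma ang_step q u v u' v' : ang q u v -> 0 < u * u' + v * v' ->
  ang (q + atan ((u * v' - v * u') / (u * u' + v * v'))) u' v'.
Proof.
move=> [r r0 [-> ->]].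
set d := (X in 0 < X) => d0; set w := (X in atan X).
have ca : 0 < cos (atan w) by rewrite cos_gt0_pihalf// atan_gtNpi2 atan_ltpi2.
have sa : sin (atan w) = w * cos (atan w).
  have := atanK w; rewrite /tan => /(congr1 (fun x => x * cos (atan w))).
  by rewrite divfK ?gt_eqF.
exists (d / (r * cos (atan w))); first by rewrite divr_gt0// mulr_gt0.
rewrite cosD sinD sa; have cs := cos2Dsin2 q.
have wd : w * d = r * cos q * v' - r * sin q * u' by rewrite /w divfK// gt_eqF.
have r0' := gt_eqF r0; have ca' := gt_eqF ca.
have e1 : cos q * d - sin q * (w * d) = r * u'.
  rewrite wd /d; transitivity (r * u' * (cos q ^+ 2 + sin q ^+ 2)); first by ring.
  by rewrite cs mulr1.
have e2 : sin q * d + cos q * (w * d) = r * v'.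
  rewrite wd /d; transitivity (r * v' * (cos q ^+ 2 + sin q ^+ 2)); first by ring.
  by rewrite cs mulr1.
split.
  apply: (mulfI (negbT r0')); rewrite -e1; field.
  by rewrite ca' r0'.
apply: (mulfI (negbT r0')); rewrite -e2; field.
by rewrite ca' r0'.
Qed.

Lemma ang_uniq q q' u v : ang q u v -> ang q' u v -> cos (q' - q) = 1.
Proof.
move=> [r r0 [-> ->]] [r' r0' [e1 e2]].
have rr : r = r'.
  have : r ^+ 2 = r' ^+ 2.
    transitivity ((r * cos q) ^+ 2 + (r * sin q) ^+ 2).
      by rewrite !exprMn -mulrDr cos2Dsin2 mulr1.
    by rewrite e1 e2 !exprMn -mulrDr cos2Dsin2 mulr1.
  by move=> /eqP; rewrite eqrXn2 ?ltW// => /eqP.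
subst r'; have := mulfI (negbT (gt_eqF r0)) e1; have := mulfI (negbT (gt_eqF r0)) e2.
by move=> s1 c1; rewrite cosB s1 c1 -!expr2 cos2Dsin2.
Qed.

Lemma ang_exists u v : u ^+ 2 + v ^+ 2 != 0 -> exists q, ang q u v.
Proof.
move=> uv; set r := Num.sqrt (u ^+ 2 + v ^+ 2).
have r0 : 0 < r.
  by rewrite sqrtr_gt0 lt_neqAle eq_sym uv addr_ge0// sqr_ge0.
have r2 : r ^+ 2 = u ^+ 2 + v ^+ 2 by rewrite sqr_sqrtr// addr_ge0// sqr_ge0.
have ur : -1 <= u / r <= 1.
  rewrite -ler_norml normrM normfV (gtr0_norm r0) ler_pdivrMr// mul1r.
  rewrite -ler_sqr ?nnegrE ?normr_ge0 ?(ltW r0)//.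
  by rewrite real_normK ?num_real// r2 lerDl sqr_ge0.
have ca : cos (acos (u / r)) = u / r by rewrite acosK// in_itv.
have sa : sin (acos (u / r)) = `|v| / r.
  rewrite sin_acos//; have -> : 1 - (u / r) ^+ 2 = (v / r) ^+ 2.
    rewrite !expr_div_n r2; apply/eqP; rewrite subr_eq -mulrDl (addrC (v ^+ 2)).
    by rewrite divff.
  by rewrite sqrtr_sqr normrM normfV (gtr0_norm r0).
case: (leP 0 v) => v0.
  exists (acos (u / r)); exists r => //; rewrite ca sa ger0_norm//.
  by split; rewrite mulrC divfK ?gt_eqF.
exists (- acos (u / r)); exists r => //; rewrite cosN sinN ca sa ltr0_norm//.
by split; rewrite mulrC ?mulNr ?opprK divfK ?gt_eqF.
Qed.

Lemma cos_eq1_const (f : R -> R) : continuous f ->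
  (forall t, t \in `[0, 1] -> cos (f t - f 0) = 1) -> f 1 = f 0.
Proof.
wlog le01 : f / f 0 <= f 1.
  move=> H cf f1; case: (leP (f 0) (f 1)) => [le|/ltW ge]; first exact: H.
  have /oppr_inj// : - f 1 = - f 0.
  apply: (H (fun t => - f t)); rewrite ?lerN2//.
    by move=> t; apply: continuousN; exact: cf.
  by move=> t /f1; rewrite opprK addrC -cosN opprD opprK addrC.
move=> cf f1; apply/eqP/negPn/negP => ne.
have lt : f 0 < f 1 by rewrite lt_neqAle le01 eq_sym ne.
(* A value taken by [f] above [f 0] by at most [pi / 2], where the cosine of the increment cannot be
   1. *)
pose w := Num.min (f 1) (f 0 + pi / 2).
have pi0 := pi_gt0 R.
have w0 : f 0 < w by rewrite lt_min lt ltrDl divr_gt0.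
have [c c01 fc] : exists2 c, c \in `[0, 1] & f c = w.
  apply: IVT => //; first exact: continuous_subspaceT.
  by rewrite (min_l le01) (max_r le01) ltW//= ge_min lexx.
have := f1 _ c01; rewrite fc -cos0 => /cos_inj.
rewrite !in_itv/= lexx pi_ge0 subr_ge0 (ltW w0)/=.
have -> : w - f 0 <= pi.
  by rewrite lerBlDr ge_min; apply/orP; right; lra.
by move=> /(_ isT isT)/eqP; rewrite subr_eq0 (gt_eqF w0).
Qed.


(* [(kz/n)_k] runs from the origin to [z]; for [n] large the successive
   increments of the angle along it are principal values. *)
Lemma square_lift (u v : R * R -> R) : continuous u -> continuous v ->
  (forall z, (`[0, 1] `*` `[0, 1]) z -> u z ^+ 2 + v z ^+ 2 != 0) ->
  exists q : R * R -> R, forall z, (`[0, 1] `*` `[0, 1]) z ->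
    ang (q z) (u z) (v z) /\ {for z, continuous q}.
Proof.
move=> cu cv uv0; set K := `[0, 1] `*` `[0, 1].
have cK : compact K by apply: compact_setX; exact: segment_compact.
pose dot z z' := u z * u z' + v z * v z'.
pose crs z z' := u z * v z' - v z * u z'.
have cdot (f g : R * R -> R * R) : continuous f -> continuous g -> continuous (fun z => dot (f z) (g z)).
  move=> cf cg z; apply: (@continuousD _ _ _ (fun z => u (f z) * u (g z)) (fun z => v (f z) * v (g z))); apply: continuousM;
  by apply: continuous_comp; [exact: cf||exact: cg|by [exact: cu|exact: cv]].
have ccrs (f g : R * R -> R * R) : continuous f -> continuous g -> continuous (fun z => crs (f z) (g z)).
  move=> cf cg z; apply: (@continuousB _ _ _ (fun z => u (f z) * v (g z)) (fun z => v (f z) * u (g z))); apply: continuousM;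
  by apply: continuous_comp; [exact: cf||exact: cg|by [exact: cu|exact: cv]].
have cu2 z : {for (z, z), continuous (fun p : (R * R) * (R * R) => dot p.1 p.2)}.
  have [c1 c2] : {for (z, z), continuous (@fst (R * R) (R * R))} /\ {for (z, z), continuous (@snd (R * R) (R * R))}.
    by split; [exact: cvg_fst|exact: cvg_snd].
  have comp (w : R * R -> R) : continuous w ->
      {for (z, z), continuous (fun p : (R * R) * (R * R) => w p.1 * w p.2)}.
    move=> cw; apply: (@continuousM R _ (fun p => w p.1) (fun p => w p.2)).
      by apply: (@continuous_comp _ _ _ (@fst (R * R) (R * R)) w) => //; exact: cw.
    by apply: (@continuous_comp _ _ _ (@snd (R * R) (R * R)) w) => //; exact: cw.
  exact: (@continuousD R R _ _ _ _ (comp u cu) (comp v cv)).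
(* By compactness, a uniform distance below which the vectors at two points form an acute angle. *)
have [d d0 Hd] : exists2 d : R, 0 < d & forall z, K z -> forall z', `|z - z'| < d -> 0 < dot z z'.
  have /compact_near_coveringP/(_ R 0^'+ (fun d z => forall z', `|z - z'| < d -> 0 < dot z z') _) := cK.
  case=> [z Kz|d /= d0 Hd].
  - have dz : 0 < dot z z by rewrite /dot -!expr2 lt_neqAle eq_sym uv0// addr_ge0// sqr_ge0.
    have /cvgr_gt /(_ _ dz) /nbhs_ballP[e /= e0 He] := cu2 z.
    have He' z1 z2 : `|z - z1| < e -> `|z - z2| < e -> 0 < dot z1 z2.
      move=> h1 h2; apply: (He (z1, z2)); split => /=.
        by move: h1; rewrite -ball_normE.
      by move: h2; rewrite -ball_normE.
    exists (ball z (e / 2), [set d | d < e / 2]) => /=.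
      split; first by apply: nbhsx_ballx; rewrite divr_gt0.
      by apply: nbhs_right_lt; rewrite divr_gt0.
    move=> [z1 d] /= [Bz1 de] z2 hz2.
    have hz1 : `|z - z1| < e / 2 by move: Bz1; rewrite -ball_normE.
    apply: He'; first by apply: lt_trans hz1 _; lra.
    by rewrite -(subrK z1 z) -addrA (le_lt_trans (ler_normD _ _))// (splitr e) ltrD// (lt_trans hz2).
  - exists (d / 2); first by rewrite divr_gt0.
    by move=> z Kz z'; apply: Hd => //=; rewrite ?sub0r ?normrN ?gtr0_norm ?divr_gt0//; lra.
pose n := (Num.truncn d^-1).+1.
have n0 : 0 < n%:R :> R by rewrite ltr0n.
have nd : n%:R^-1 < d.
  by rewrite invf_plt ?posrE// /n truncnS_gt.
pose p (k : nat) (z : R * R) : R * R := (k%:R / n%:R) *: z.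
have cp k : continuous (p k) by move=> z; apply: continuousZr; exact: cvg_id.
have Kp k z : (k <= n)%N -> K z -> K (p k z).
  have h (t : R) : (k <= n)%N -> 0 <= t <= 1 -> 0 <= k%:R / n%:R * t <= 1.
    move=> kn /andP[t0 t1]; rewrite mulr_ge0 ?divr_ge0//=.
    by rewrite mulr_ile1// ?divr_ge0// ler_pdivrMr// mul1r ler_nat.
  by move=> kn [/= z1 z2]; split; move: z1 z2; rewrite /= !in_itv /=; [move=> + _|move=> _]; exact: h.
have pp k z : K z -> `|p k z - p k.+1 z| <= n%:R^-1.
  move=> [/= z1 z2]; rewrite /p -scalerBl -mulrBl -natr1 opprD addrA subrr add0r mulN1r scaleNr normrN.
  rewrite normrZ ger0_norm ?invr_ge0// ler_piMr ?invr_ge0//.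
  rewrite prod_normE /=; move: z1 z2; rewrite !in_itv /= => /andP[? ?] /andP[? ?].
  by rewrite ge_max !ger0_norm//; apply/andP.
have dp k z : (k < n)%N -> K z -> 0 < dot (p k z) (p k.+1 z).
  move=> kn Kz; apply: Hd; first by apply: Kp => //; exact: ltnW.
  by apply: le_lt_trans nd; exact: pp.
have [q0 Hq0] : exists q0, ang q0 (u 0) (v 0).
  by apply: ang_exists; apply: uv0; split; rewrite /= in_itv /= lexx ler01.
pose q := fix q k z := if k is k'.+1 then
  q k' z + atan (crs (p k' z) (p k'.+1 z) / dot (p k' z) (p k'.+1 z)) else q0.
suff H k : (k <= n)%N -> forall z, K z -> ang (q k z) (u (p k z)) (v (p k z)) /\ {for z, continuous (q k)}.
  exists (q n) => z Kz; have [//|h1 h2] := H n _ z Kz; split=> //.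
  by move: h1; rewrite /p divff ?gt_eqF// scale1r.
elim: k => [|k IH] kn z Kz.
  by split; [rewrite /p mul0r scale0r|exact: cst_continuous].
have [h1 h2] := IH (ltnW kn) z Kz; split.
  by apply: ang_step => //; exact: dp.
apply: (@continuousD _ _ _ (q k) (fun z => atan (crs (p k z) (p k.+1 z) / dot (p k z) (p k.+1 z)))) => //.
apply: continuous_comp; last exact: continuous_atan.
apply: continuousM; first exact: ccrs.
by apply: continuousV; [rewrite gt_eqF// dp|exact: cdot].
Qed.
(** The retraction of the line onto [[0, 1]]: composing with it turns paths continuous within
    [[0, 1]] into paths continuous on the line. *)
Definition cl (t : R) : R := (1 + `|t| - `|t - 1|) / 2.

Lemma cl_in t : cl t \in `[0, 1].
Proof.
rewrite in_itv /cl /=; case: (ger0P t); case: (ger0P (t - 1)); lra.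
Qed.

Lemma cl_id t : t \in `[0, 1] -> cl t = t.
Proof.
rewrite in_itv /cl /= => /andP[t0 t1]; rewrite ger0_norm// ler0_norm; lra.
Qed.

Lemma cl_le0 t : t <= 0 -> cl t = 0.
Proof. by rewrite /cl => t0; rewrite !ler0_norm; lra. Qed.

Lemma cl_ge1 t : 1 <= t -> cl t = 1.
Proof. by rewrite /cl => t0; rewrite !ger0_norm; lra. Qed.

Lemma cl0 : cl 0 = 0. Proof. exact: cl_le0. Qed.
Lemma cl1 : cl 1 = 1. Proof. exact: cl_ge1. Qed.

Lemma in01_0 : (0 : R) \in `[0, 1].
Proof. by rewrite in_itv /= lexx ler01. Qed.

Lemma in01_1 : (1 : R) \in `[0, 1].
Proof. by rewrite in_itv /= lexx ler01. Qed.

Lemma cl_continuous : continuous cl.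
Proof.
have h (t : R) : {for t, continuous (fun s : R => (1 + `|s| - `|s - 1|) / 2)}.
  apply: continuousM; last exact: cst_continuous.
  apply: continuousB.
    by apply: continuousD; [exact: cst_continuous|exact: norm_continuous].
  apply: continuous_comp; last exact: norm_continuous.
  by apply: continuousB; [exact: cvg_id|exact: cst_continuous].
exact: h.
Qed.

Lemma within_comp {S T W : topologicalType} (A : set T) (f : T -> W) (g : S -> T) :
  {within A, continuous f} -> continuous g -> (forall x, A (g x)) ->
  continuous (f \o g).
Proof.
move=> /subspace_continuousP cf cg gA x; apply: cvg_trans (cf _ (gA x)).
move=> B; rewrite /within /= nbhs_simpl /= => nB.
have := cg x _ nB; rewrite /= nbhs_simpl /=; apply: filterS => y; exact.
Qed.

Lemma continuous_pair {S T W : topologicalType} (f : S -> T) (g : S -> W) x :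
  {for x, continuous f} -> {for x, continuous g} ->
  {for x, continuous (fun y => (f y, g y))}.
Proof. by move=> cf cg; apply: (cvg_pair cf cg). Qed.

Section Global.
Context {V : normedModType R} (O : set V) (u v : V -> R).
Context (cu : continuous u) (cv : continuous v).
Context (uv0 : forall x, O x -> u x ^+ 2 + v x ^+ 2 != 0).

(* [q] is a continuous choice along [g] of the angle of [(u, v)]. *)
Definition lifted_path x y (d : R) : Prop := exists (g : R -> V) (q : R -> R),
  [/\ continuous g, continuous q,
      forall t, t \in `[0, 1] -> O (g t) /\ ang (q t) (u (g t)) (v (g t)),
      g 0 = x /\ g 1 = y & q 1 - q 0 = d].

Lemma lifted_path_rev x y d : lifted_path x y d -> lifted_path y x (- d).
Proof.
move=> [g [q [cg cq gq [g0 g1] dq]]].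
have cB : continuous (fun t : R => 1 - t).
  by move=> t; apply: continuousB; [exact: cst_continuous|exact: cvg_id].
exists (fun t => g (1 - t)), (fun t => q (1 - t)); split.
- by move=> t; apply: continuous_comp; [exact: cB|exact: cg].
- by move=> t; apply: continuous_comp; [exact: cB|exact: cq].
- by move=> t t01; apply: gq; move: t01; rewrite !in_itv /=; lra.
- by rewrite subr0 subrr.
- by rewrite subrr subr0 -dq opprB.
Qed.

Lemma lifted_path_cat x y z d e :
  lifted_path x y d -> lifted_path y z e -> lifted_path x z (d + e).
Proof.
move=> [g [q [cg cq gq [g0 g1] dq]]] [g' [q' [cg' cq' gq' [g0' g1'] dq']]].
have c1 : continuous (fun t : R => cl (2 * t)).
  move=> t; apply: continuous_comp; last exact: cl_continuous.
  by apply: continuousM; [exact: cst_continuous|exact: cvg_id].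
have c2 : continuous (fun t : R => cl (2 * t - 1)).
  move=> t; apply: (@continuous_comp _ _ _ (fun t : R => 2 * t - 1) cl); last exact: cl_continuous.
  apply: (@continuousB _ _ _ (fun t : R => 2 * t) (fun=> 1)); last exact: cst_continuous.
  by apply: continuousM; [exact: cst_continuous|exact: cvg_id].
have e1 t : t <= 1 / 2 -> cl (2 * t - 1) = 0 by move=> t2; apply: cl_le0; lra.
have e2 t : 1 / 2 <= t -> cl (2 * t) = 1 by move=> t2; apply: cl_ge1; lra.
have E0 : cl (2 * 0) = 0 by apply: cl_le0; lra.
have E1 : cl (2 * 0 - 1) = 0 by apply: cl_le0; lra.
have E2 : cl (2 * 1) = 1 by apply: cl_ge1; lra.
have E3 : cl (2 * 1 - 1) = 1 by apply: cl_ge1; lra.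
exists (fun t => g (cl (2 * t)) + (g' (cl (2 * t - 1)) - y)).
exists (fun t => q (cl (2 * t)) + (q' (cl (2 * t - 1)) - q' 0)); split.
- move=> t; apply: (@continuousD _ _ _ (fun t => g (cl (2 * t))) (fun t => g' (cl (2 * t - 1)) - y)).
    by apply: continuous_comp; [exact: c1|exact: cg].
  apply: (@continuousB _ _ _ (fun t => g' (cl (2 * t - 1))) (fun=> y)); last exact: cst_continuous.
  by apply: continuous_comp; [exact: c2|exact: cg'].
- move=> t; apply: (@continuousD _ _ _ (fun t => q (cl (2 * t))) (fun t => q' (cl (2 * t - 1)) - q' 0)).
    by apply: continuous_comp; [exact: c1|exact: cq].
  apply: (@continuousB _ _ _ (fun t => q' (cl (2 * t - 1))) (fun=> q' 0)); last exact: cst_continuous.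
  by apply: continuous_comp; [exact: c2|exact: cq'].
- move=> t _; case: (leP t (1 / 2)) => [t2|/ltW t2].
    by rewrite (e1 _ t2) g0' !subrr !addr0; apply: gq; exact: cl_in.
  have [Oa A1] := gq 1 in01_1.
  have [Ob A2] := gq' 0 in01_0.
  have [Oc A3] := gq' (cl (2 * t - 1)) (cl_in _).
  rewrite (e2 _ t2) g1 addrC subrK; split=> //.
  rewrite g1 -g0' in A1; have := ang_uniq A2 A1; set w := q 1 - q' 0 => cw.
  have sw : sin w = 0 by have := cos2Dsin2 w; rewrite cw => ?; apply/eqP; rewrite -sqrf_eq0; apply/eqP; lra.
  have [r r0 [-> ->]] := A3; exists r => //.
  have -> : q 1 + (q' (cl (2 * t - 1)) - q' 0) = w + q' (cl (2 * t - 1)) by rewrite /w; ring.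
  by rewrite cosD sinD cw sw; split; ring.
- by rewrite E0 E1 E2 E3 g0 g0' g1' subrr addr0 g1 addrC subrK.
- by rewrite E0 E1 E2 E3 -dq -dq'; ring.
Qed.

Lemma lifted_path_of x y (g : R -> V) : continuous g ->
  (forall t, t \in `[0, 1] -> O (g t)) -> g 0 = x -> g 1 = y ->
  exists d, lifted_path x y d.
Proof.
move=> cg gO g0 g1.
have cfst : continuous (fun z : R * R => g (cl z.1)).
  move=> z; apply: continuous_comp; last exact: cg.
  by apply: continuous_comp; [exact: cvg_fst|exact: cl_continuous].
have [||z _|q Hq] := @square_lift (fun z => u (g (cl z.1))) (fun z => v (g (cl z.1))).
- by move=> z; apply: continuous_comp; [exact: cfst|exact: cu].
- by move=> z; apply: continuous_comp; [exact: cfst|exact: cv].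
- by apply: uv0; apply: gO; exact: cl_in.
have Kt t : (`[0, 1] `*` `[0, 1]) (cl t, 0 : R).
  by split; rewrite /= ?cl_in// in_itv /= lexx ler01.
exists (q (cl 1, 0) - q (cl 0, 0)), (fun t => g (cl t)), (fun t => q (cl t, 0)); split=> //.
- by move=> t; apply: continuous_comp; [exact: cl_continuous|exact: cg].
- move=> t; have [_ c] := Hq _ (Kt t).
  apply: (@continuous_comp _ _ _ (fun t => (cl t, 0 : R)) q) => //.
  by apply: continuous_pair; [exact: cl_continuous|exact: cst_continuous].
- move=> t t01; have [a _] := Hq _ (Kt t); split; first by apply: gO; exact: cl_in.
  by move: a => /=; rewrite (cl_id (cl_in _)).
- by rewrite cl0 cl1.
Qed.

Context (scO : simply_connected R O).

(** Lift the angle over the square of a null homotopy. On three sides the homotopy stays at the base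
    point, so the lift is constant there and agrees at both ends of the fourth side, where it
    differs from [q] by a constant. *)
Lemma lifted_path_loop x d : lifted_path x x d -> d = 0.
Proof.
move=> [g [q [cg cq gq [g0 g1] dq]]].
have [_ /(_ g)] := scO.
case=> [||//|H [cH HO H0 H1 Hs]].
- exact: continuous_subspaceT.
- by move=> _ [t t01 <-]; have [] := gq t t01.
- by rewrite g0 g1.
pose cc (z : R * R) := (cl z.1, cl z.2).
have cK z : (`[0, 1] `*` `[0, 1]) (cc z) by split; exact: cl_in.
have ccc : continuous cc.
  move=> z; apply: (@continuous_pair _ _ _ (fun z : R * R => cl z.1) (fun z => cl z.2)).
    by apply: continuous_comp; [exact: cvg_fst|exact: cl_continuous].
  by apply: continuous_comp; [exact: cvg_snd|exact: cl_continuous].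
have cHc : continuous (H \o cc) by exact: within_comp.
have HOc z : O (H (cc z)) by apply: HO; exists (cc z).
have [||z _|p Hp] := @square_lift (fun z => u (H (cc z))) (fun z => v (H (cc z))).
- by move=> z; apply: (@continuous_comp _ _ _ (H \o cc) u); [exact: cHc|exact: cu].
- by move=> z; apply: (@continuous_comp _ _ _ (H \o cc) v); [exact: cHc|exact: cv].
- exact: uv0.
have in0 : (0 : R) \in `[0, 1] by rewrite in_itv /= lexx ler01.
have in1 : (1 : R) \in `[0, 1] by rewrite in_itv /= lexx ler01.
have cstep (a b : R -> R) : continuous a -> continuous b ->
  (forall t, a t \in `[0, 1]) -> (forall t, b t \in `[0, 1]) ->
  (forall t, t \in `[0, 1] -> H (cc (a t, b t)) = H (cc (a 0, b 0))) ->
  p (a 1, b 1) = p (a 0, b 0).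
  move=> ca cb aK bK e; apply: (cos_eq1_const (f := fun t => p (a t, b t))).
    move=> t; apply: (@continuous_comp _ _ _ (fun t => (a t, b t)) p).
      by apply: continuous_pair; [exact: ca|exact: cb].
    by have [] := Hp (a t, b t) (conj (aK t) (bK t)).
  move=> t t01; have [A1 _] := Hp (a t, b t) (conj (aK t) (bK t)).
  have [A2 _] := Hp (a 0, b 0) (conj (aK 0) (bK 0)).
  by rewrite (e _ t01) in A1; exact: ang_uniq A2 A1.
have ccE s t : s \in `[0, 1] -> t \in `[0, 1] -> cc (s, t) = (s, t).
  by move=> s1 t1; rewrite /cc /= !cl_id.
have c0 : continuous (fun _ : R => 0 : R) by move=> t; exact: cst_continuous.
have c1 : continuous (fun _ : R => 1 : R) by move=> t; exact: cst_continuous.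
have p1 : p (cl 1, 0) = p (cl 0, 0).
  apply: (cstep cl (fun=> 0) cl_continuous c0 cl_in (fun=> in0)) => t _.
  by rewrite !ccE ?cl_in// (Hs _ (cl_in _)).1 (Hs _ (cl_in _)).1.
have p2 : p (cl 1, 1) = p (cl 0, 1).
  apply: (cstep cl (fun=> 1) cl_continuous c1 cl_in (fun=> in1)) => t _.
  by rewrite !ccE ?cl_in// (Hs _ (cl_in _)).2 (Hs _ (cl_in _)).2.
have p3 : p (1, cl 1) = p (1, cl 0).
  apply: (cstep (fun=> 1) cl c1 cl_continuous (fun=> in1) cl_in) => t _.
  by rewrite !ccE ?cl_in// !H1 ?cl_in.
rewrite !cl1 !cl0 in p1 p2 p3.
have p4 : p (0, 1) = p (0, 0) by rewrite -p1 -p2.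
have cp : continuous (fun t => p (0, cl t)).
  move=> t; apply: (@continuous_comp _ _ _ (fun t => (0 : R, cl t)) p).
    by apply: continuous_pair; [exact: cst_continuous|exact: cl_continuous].
  by have [] := Hp (0, cl t) (conj in0 (cl_in _)).
have := @cos_eq1_const (fun t => q t - p (0, cl t) - (q 0 - p (0, cl 0))).
rewrite /= -dq cl1 cl0 p4 subrr => e.
suff : q 1 - p (0, 0) - (q 0 - p (0, 0)) = 0 by lra.
apply: e => [t|t t01].
  apply: (@continuousB _ _ _ (fun t => q t - p (0, cl t)) (fun=> q 0 - p (0, 0))); last exact: cst_continuous.
  by apply: (@continuousB _ _ _ q (fun t => p (0, cl t))); [exact: cq|exact: cp].
have A t' : t' \in `[0, 1] -> cos (q t' - p (0, t')) = 1 /\ sin (q t' - p (0, t')) = 0.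
  move=> h; have [A1 _] := Hp (0, t') (conj in0 h).
  rewrite /= ccE// H0// in A1; have [_ A2] := gq _ h.
  have c := ang_uniq A1 A2; split=> //.
  by have := cos2Dsin2 (q t' - p (0, t')); rewrite c => ?; apply/eqP; rewrite -sqrf_eq0; apply/eqP; lra.
rewrite subr0 cl_id// cosB (A _ t01).1 (A _ t01).2 (A _ in0).1 (A _ in0).2; ring.
Qed.

Lemma lifted_path_exists x y : O x -> O y -> exists d, lifted_path x y d.
Proof.
move=> Ox Oy; have [/(_ x y Ox Oy)[g [cg gO g0 g1]] _] := scO.
apply: (@lifted_path_of x y (g \o cl)).
- by apply: within_comp; [exact: cg|exact: cl_continuous|exact: cl_in].
- by move=> t _; apply: gO; exists (cl t); rewrite //= cl_in.
- by rewrite /= cl0.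
- by rewrite /= cl1.
Qed.

Context (locO : forall x e, O x -> 0 < e -> exists2 d, 0 < d & forall y,
  O y -> `|y - x| < d -> exists g : R -> V, [/\ continuous g, g 0 = x, g 1 = y &
    forall t, t \in `[0, 1] -> O (g t) /\ `|g t - x| < e]).

(** The angle at [x] is the one at [x0] plus the change along any path, independent of the path by
    [lifted_path_loop]. Continuity comes from the short paths of [locO], along which the change is
    an [atan]. *)
Lemma angle_lift x0 q0 : O x0 -> ang q0 (u x0) (v x0) ->
  exists q : V -> R, [/\ q x0 = q0,
    forall x, O x -> ang (q x) (u x) (v x) &
    forall x e, O x -> 0 < e -> exists2 d, 0 < d & forall y,
      O y -> `|y - x| < d -> `|q y - q x| < e].
Proof.
move=> Ox0 A0.
have /choice[f Hf] : forall x, exists d, O x -> lifted_path x0 x d.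
  move=> x; have [Ox|nOx] := pselect (O x); last by exists 0.
  by have [d Hd] := lifted_path_exists Ox0 Ox; exists d.
have fE x y d : O x -> O y -> lifted_path x y d -> f y - f x = d.
  move=> Ox Oy l; apply/eqP; rewrite -subr_eq0; apply/eqP.
  have := lifted_path_cat (lifted_path_cat (Hf x Ox) l) (lifted_path_rev (Hf y Oy)).
  by move=> /lifted_path_loop; lra.
exists (fun x => q0 + f x); split.
- suff : f x0 = 0 by move=> ->; rewrite addr0.
  by apply: lifted_path_loop; exact: Hf.
- move=> x Ox; have [g [q [_ _ gq [g0 g1] <-]]] := Hf x Ox.
  have [_ A1] := gq 1 in01_1.
  have [_ A2] := gq 0 in01_0.
  rewrite g1 in A1; rewrite g0 in A2; have c := ang_uniq A2 A0.
  have s : sin (q0 - q 0) = 0.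
    by have := cos2Dsin2 (q0 - q 0); rewrite c => ?; apply/eqP; rewrite -sqrf_eq0; apply/eqP; lra.
  have [r r0 [-> ->]] := A1; exists r => //.
  have -> : q0 + (q 1 - q 0) = (q0 - q 0) + q 1 by ring.
  by move: c s; set w := q0 - q 0 => c s; rewrite cosD sinD c s; split; ring.
- move=> x e Ox e0.
  pose dot y := u x * u y + v x * v y; pose crs y := u x * v y - v x * u y.
  have cdot : continuous dot.
    have h (y : V) : {for y, continuous (fun y => u x * u y + v x * v y)}.
      apply: continuousD; apply: continuousM; by [exact: cst_continuous|exact: cu|exact: cv].
    exact: h.
  have ccrs : continuous crs.
    have h (y : V) : {for y, continuous (fun y => u x * v y - v x * u y)}.
      apply: continuousB; apply: continuousM; by [exact: cst_continuous|exact: cu|exact: cv].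
    exact: h.
  have dx : 0 < dot x by rewrite /dot -!expr2 lt_neqAle eq_sym uv0// addr_ge0// sqr_ge0.
  have catan y : 0 < dot y -> {for y, continuous (fun y => atan (crs y / dot y))}.
    move=> dy; apply: continuous_comp; last exact: continuous_atan.
    apply: continuousM; first exact: ccrs.
    by apply: continuousV; [rewrite gt_eqF|exact: cdot].
  have a0 : atan (crs x / dot x) = 0 by rewrite /crs (mulrC (v x)) subrr mul0r atan0.
  have N : \near x, 0 < dot x /\ `|atan (crs x / dot x)| < e.
    have h1 : \near x, 0 < dot x by apply: (cvgr_gt (dot x)) => //; exact: cdot.
    have h2 : \near x, `|atan (crs x / dot x)| < e.
      have /cvgrPdist_lt/(_ e e0) := catan x dx.
      by apply: filterS => y; rewrite a0 sub0r normrN.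
    by near do split.
  have [e' /= e0' He'] := (nbhs_ballP _ _).1 N.
  have [d d0 Hd] := locO Ox e0'.
  exists d => // y Oy yx; have [g [cg g0 g1 gO]] := Hd y Oy yx.
  have B t : 0 < dot (g (cl t)) /\ `|atan (crs (g (cl t)) / dot (g (cl t)))| < e.
    by apply: He'; rewrite -ball_normE /= distrC; exact: (gO _ (cl_in t)).2.
  have [qx Hqx] := ang_exists (uv0 Ox).
  suff l : lifted_path x y (atan (crs y / dot y)).
    have -> : q0 + f y - (q0 + f x) = f y - f x by ring.
    rewrite (fE _ _ _ Ox Oy l).
    by have [_] := B 1; rewrite cl1 g1.
  exists (fun t => g (cl t)), (fun t => qx + atan (crs (g (cl t)) / dot (g (cl t)))); split.
  + by move=> t; apply: continuous_comp; [exact: cl_continuous|exact: cg].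
  + move=> t; apply: continuousD; first exact: cst_continuous.
    apply: (@continuous_comp _ _ _ (g \o cl) (fun y => atan (crs y / dot y))).
      by apply: continuous_comp; [exact: cl_continuous|exact: cg].
    by apply: catan; exact: (B t).1.
  + move=> t _; split; first exact: (gO _ (cl_in t)).1.
    by apply: ang_step => //; exact: (B t).1.
  + by rewrite cl0 cl1.
  + by rewrite cl0 cl1 g0 g1 a0 addr0 addrAC subrr add0r.
Unshelve. all: by end_near. Qed.

End Global.
End AngleLift.

(** * Change of variables and invariance of the area *)

Section Hyperbolic.
Context {R : realType}.
Implicit Types t x y : R.

Lemma is_derive_expRN t : is_derive t 1 (fun s : R => expR (- s)) (- expR (- t)).
Proof.
have dN : is_derive t 1 (fun s : R => - s) (- 1) by apply: is_deriveN.
apply: (is_derive_eq (is_derive1_comp (is_derive_expR (- t)) dN)).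
by rewrite mulrN1.
Qed.

Lemma is_derive_cosh t : is_derive t 1 (@cosh R) (sinh t).
Proof.
have e := is_derive_expR t; have eN := is_derive_expRN t.
have h := is_deriveZ 2^-1 (is_deriveD e eN).
have -> : @cosh R = 2^-1 \*: (expR + (fun s => expR (- s))).
  by apply/funext => s; rewrite /cosh mulrC.
by apply: (is_derive_eq h); rewrite /sinh mulrC.
Qed.

Lemma is_derive_sinh t : is_derive t 1 (@sinh R) (cosh t).
Proof.
have e := is_derive_expR t; have eN := is_derive_expRN t.
have h := is_deriveZ 2^-1 (is_deriveB e eN).
have -> : @sinh R = 2^-1 \*: (expR - (fun s => expR (- s))).
  by apply/funext => s; rewrite /sinh mulrC.
by apply: (is_derive_eq h); rewrite /cosh mulrC opprK.
Qed.

Lemma cosh2Bsinh2 t : cosh t ^+ 2 - sinh t ^+ 2 = 1.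
Proof.
have e : expR t * expR (- t) = 1 by rewrite -expRD subrr expR0.
by rewrite /cosh /sinh; transitivity (expR t * expR (- t)); [field|].
Qed.

Lemma cosh0 : cosh (0 : R) = 1.
Proof. by rewrite /cosh oppr0 expR0; lra. Qed.

Lemma sinh0 : sinh (0 : R) = 0.
Proof. by rewrite /sinh oppr0 expR0; lra. Qed.

Lemma cosh_ge1 t : 1 <= cosh t.
Proof.
have e : expR t * expR (- t) = 1 by rewrite -expRD subrr expR0.
have p := expR_gt0 t; have n := expR_gt0 (- t).
have := sqr_ge0 (expR t - expR (- t)); rewrite /cosh.
nra.
Qed.

Lemma cosh_gt0 t : 0 < cosh t.
Proof. exact: lt_le_trans ltr01 (cosh_ge1 t). Qed.

Lemma sinh_gt0 t : 0 < t -> 0 < sinh t.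
Proof. by move=> t0; rewrite /sinh divr_gt0// subr_gt0 ltr_expR; lra. Qed.

Lemma sinh_ge0 t : 0 <= t -> 0 <= sinh t.
Proof. by rewrite le_eqVlt => /predU1P[<-|/sinh_gt0/ltW//]; rewrite sinh0. Qed.

Lemma cosh_lt : {in Num.nneg &, {homo @cosh R : x y / x < y}}.
Proof.
move=> x y; rewrite !nnegrE => x0 y0 xy.
rewrite /cosh ltr_pM2r//; rewrite -subr_gt0.
have -> : expR y + expR (- y) - (expR x + expR (- x)) =
    (expR y - expR x) * (1 - expR (- (x + y))).
  have e z : expR z * expR (- z) = 1 by rewrite -expRD subrr expR0.
  have -> : expR (- (x + y)) = expR (- x) * expR (- y) by rewrite opprD expRD.
  transitivity (expR y - expR x - expR (- x) * (expR y * expR (- y)) + (expR x * expR (- x)) * expR (- y)).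
    by rewrite !e; ring.
  by ring.
apply: mulr_gt0; first by rewrite subr_gt0 ltr_expR.
by rewrite subr_gt0 -expR0 ltr_expR; lra.
Qed.

Lemma cosh_mono : {in Num.nneg &, {mono @cosh R : x y / x <= y}}.
Proof. exact: le_mono_in cosh_lt. Qed.

Definition acosh x : R := ln (x + Num.sqrt (x ^+ 2 - 1)).

Lemma acoshK x : 1 <= x -> cosh (acosh x) = x.
Proof.
move=> x1; rewrite /acosh; set y := Num.sqrt _.
have y2 : y ^+ 2 = x ^+ 2 - 1 by rewrite sqr_sqrtr//; nra.
have y0 : 0 <= y by exact: sqrtr_ge0.
have xy : 0 < x + y by lra.
rewrite /cosh expRN lnK ?posrE//.
have e : (x + y) * (x - y) = 1 by rewrite mulrC -subr_sqr y2; ring.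
have -> : (x + y)^-1 = x - y by rewrite -[LHS]mulr1 -e mulKf// gt_eqF.
lra.
Qed.

Lemma acosh_ge0 x : 1 <= x -> 0 <= acosh x.
Proof. by move=> x1; rewrite /acosh ln_ge0//; have := sqrtr_ge0 (x ^+ 2 - 1); lra. Qed.

Lemma coshK t : 0 <= t -> acosh (cosh t) = t.
Proof.
move=> t0; have e := acoshK (cosh_ge1 t).
apply/eqP; rewrite eq_le; apply/andP; split;
  by rewrite -cosh_mono ?nnegrE ?acosh_ge0 ?cosh_ge1// e lexx.
Qed.

End Hyperbolic.

(** * Measures with a density and substitutions on the line *)

Section Density.
Local Open Scope ereal_scope.
Context d (T : measurableType d) (R : realType) (mu : {measure set T -> \bar R}).

(** The proofs are arguments of the set function so that its measure structure can be found from the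
    term alone. *)
Definition density (w : T -> R) of measurable_fun setT w & (forall x, 0 <= w x)%R :=
  fun A : set T => \int[mu]_(x in A) (w x)%:E.

Section measure.
Context (w : T -> R) (mw : measurable_fun setT w) (w0 : forall x, (0 <= w x)%R).

Let density0 : density mw w0 set0 = 0.
Proof. by rewrite /density integral_set0. Qed.

Let density_ge0 A : 0 <= density mw w0 A.
Proof. by rewrite /density integral_ge0// => x _; rewrite lee_fin. Qed.

Let density_sigma_additive : semi_sigma_additive (density mw w0).
Proof.
apply: semi_sigma_additive_nng_induced => [|x]; last by rewrite lee_fin.
exact/measurable_EFinP.
Qed.

HB.instance Definition _ := isMeasure.Build _ _ _
  (density mw w0) density0 density_ge0 density_sigma_additive.

Import HBNNSimple.

Lemma ge0_integral_density (f : T -> \bar R) : measurable_fun setT f ->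
  (forall x, 0 <= f x) -> \int[density mw w0]_x f x = \int[mu]_x (f x * (w x)%:E).
Proof.
move=> mf f0; pose f_ := nnsfun_approx measurableT mf.
transitivity (limn (fun n => \int[density mw w0]_x (f_ n x)%:E)).
  rewrite -monotone_convergence//.
  - apply: eq_integral => x _; apply/esym/cvg_lim => //.
    exact: cvg_nnsfun_approx.
  - by move=> n; exact/measurable_EFinP/measurable_funP.
  - by move=> n x _; rewrite lee_fin.
  - by move=> x _ m n mn; rewrite lee_fin; exact/lefP/nd_nnsfun_approx.
have mwE : measurable_fun setT (EFin \o w) by exact/measurable_EFinP.
rewrite [X in limn X](_ : _ = (fun n => \int[mu]_x ((f_ n x)%:E * (w x)%:E))).
  rewrite -monotone_convergence//.
  - apply: eq_integral => x _; apply/cvg_lim => //.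
    by apply: cvgeZr => //; exact: cvg_nnsfun_approx.
  - by move=> n; apply: emeasurable_funM => //; exact/measurable_EFinP/measurable_funP.
  - by move=> n x _; rewrite mule_ge0// lee_fin.
  - by move=> x _ m n mn; rewrite lee_wpmul2r ?lee_fin//; exact/lefP/nd_nnsfun_approx.
apply/funext => n.
transitivity (\sum_(k \in range (f_ n))
    \int[mu]_x ((k * \1_(f_ n @^-1` [set k]) x)%:E * (w x)%:E)).
  under eq_integral do rewrite fimfunE -fsumEFin//.
  rewrite ge0_integral_fsum//; last 2 first.
  - by move=> y; exact/measurable_EFinP/measurable_funM.
  - by move=> y x _; rewrite nnfun_muleindic_ge0.
  apply: eq_fsbigr => r /[!inE] -[z _ fz]; rewrite integralZl_indic_nnsfun// integral_indic//=.
  have r0 : (0 <= r)%R by rewrite -fz.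
  under [RHS]eq_integral do rewrite EFinM -muleA.
  rewrite ge0_integralZl//; last 2 first.
  - by apply: emeasurable_funM => //; exact/measurable_EFinP.
  - by move=> x _; rewrite mule_ge0// lee_fin.
  congr (_ * _); rewrite setIT /density integral_mkcond.
  by apply: eq_integral => x _; rewrite patchE indicE; case: ifPn; rewrite ?mul1e ?mul0e.
rewrite -ge0_integral_fsum//.
- apply: eq_integral => x _; rewrite [in RHS]fimfunE -fsumEFin// ge0_mule_fsuml//.
  by move=> r; rewrite nnfun_muleindic_ge0.
- move=> r; apply: emeasurable_funM => //.
  by apply/measurable_EFinP; apply: measurable_funM.
- by move=> r x _; rewrite mule_ge0 ?lee_fin// -lee_fin nnfun_muleindic_ge0.
Qed.

End measure.
End Density.

Section Rays.
Local Open Scope ereal_scope.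
Context {R : realType}.

Local Notation mu := (@lebesgue_measure R).

Lemma measure_eq_rays (m1 m2 : {measure set (measurableTypeR R) -> \bar R}) :
  (forall x : R, m1 `]-oo, x[%classic = m2 `]-oo, x[%classic) ->
  (forall x : R, m1 `]-oo, x[%classic < +oo) ->
  forall A, measurable A -> m1 A = m2 A.
Proof.
move=> e fin; apply: (@measure_unique _ R (measurableTypeR R) (@RGenInftyO.G R) (fun n => `]-oo, (n%:R : R)[%classic)).
- exact: RGenInftyO.measurableE.
- move=> _ _ [x ->] [y ->]; exists (Order.min x y).
  apply/seteqP; split => z /=; rewrite !in_itv /= lt_min; first by case=> -> ->.
  by move/andP.
- by move=> i; exists i%:R.
- apply/seteqP; split => // x _.
  by exists (Num.truncn x).+1 => //=; rewrite in_itv /= truncnS_gt.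
- by move=> _ [x ->]; exact: e.
- by move=> k; exact: fin.
Qed.

(** Both sides integrate [h]: one for the image under [F] of the measure with density [w] on [D],
    the other for Lebesgue measure on [J]. The hypothesis says that these two measures agree on
    rays, hence on all Borel sets. *)
Lemma ge0_change_of_variables (D J : set R) (F w : R -> R) :
  measurable D -> measurable J -> measurable_fun setT F -> measurable_fun setT w ->
  (forall t, D t -> (0 <= w t)%R) ->
  (forall x : R, \int[mu]_(t in D `&` F @^-1` `]-oo, x[%classic) (w t)%:E =
     mu (J `&` `]-oo, x[%classic)) ->
  (forall x : R, mu (J `&` `]-oo, x[%classic) < +oo) ->
  forall h : R -> \bar R, measurable_fun setT h -> (forall x, 0 <= h x) ->
  \int[mu]_(t in D) (h (F t) * (w t)%:E) = \int[mu]_(x in J) h x.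
Proof.
move=> mD mJ mF mw w0 e fin h mh h0.
pose w' t := (w t * \1_D t)%R.
have mw' : measurable_fun setT w' by apply: measurable_funM => //.
have w0' t : (0 <= w' t)%R.
  rewrite /w' indicE; have [/set_mem Dt|_] := boolP (t \in D); last by rewrite mulr0.
  by rewrite mulr1 w0.
have mF' : measurable_fun setT (F : measurableTypeR R -> measurableTypeR R) := mF.
pose Fm : {mfun measurableTypeR R >-> measurableTypeR R} :=
  HB.pack F (isMeasurableFun.Build _ _ _ _ _ mF').
have wE A : measurable A -> density mu mw' w0' A = \int[mu]_(t in D `&` A) (w t)%:E.
  move=> mA; rewrite /density integral_mkcond [RHS]integral_mkcond.
  apply: eq_integral => t _; rewrite !patchE /w' indicE in_setI.
  by case: (t \in D); case: (t \in A); rewrite ?mulr1 ?mulr0.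
have mJ1 : measurable_fun setT (\1_J : R -> R) by exact: measurable_indic.
have J0 t : (0 <= \1_J t :> R)%R by rewrite indicE ler0n.
have JE A : measurable A -> density mu mJ1 J0 A = mu (J `&` A).
  by move=> mA; rewrite /density integral_indic.
have key A : measurable A -> pushforward (density mu mw' w0') Fm A = density mu mJ1 J0 A.
  apply: (measure_eq_rays (m1 := pushforward (density mu mw' w0') Fm) (m2 := density mu mJ1 J0)) => x.
    rewrite /= /pushforward wE ?e ?JE//.
    by rewrite -[X in measurable X]setTI; apply: mF.
  rewrite /= /pushforward wE ?e//.
  by rewrite -[X in measurable X]setTI; apply: mF.
transitivity (\int[density mu mw' w0']_t h (F t)).
  rewrite ge0_integral_density//; last by apply: measurableT_comp.
  rewrite [LHS]integral_mkcond; apply: eq_integral => t _; rewrite patchE /w' indicE.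
  by case: (t \in D); rewrite ?mulr1 ?mulr0 ?mule0.
transitivity (\int[pushforward (density mu mw' w0') Fm]_x h x).
  by rewrite ge0_integral_pushforward.
transitivity (\int[density mu mJ1 J0]_x h x).
  by apply: eq_measure_integral => A mA _; exact: key.
rewrite ge0_integral_density// [RHS]integral_mkcond; apply: eq_integral => t _.
by rewrite patchE indicE; case: (t \in J); rewrite ?mule1 ?mule0.
Qed.

End Rays.

Section Substitution.
Local Open Scope ereal_scope.
Context {R : realType}.
Local Notation mu := (@lebesgue_measure R).

Lemma integral_derive_oo (f F : R -> R) (a b : R) : (a <= b)%R -> continuous f ->
  (forall x : R, is_derive x (1%R : R) F (f x)) ->
  \int[mu]_(x in `]a, b[) (f x)%:E = (F b - F a)%:E.
Proof.
move=> ab cf dF.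
have mf (A : set R) : measurable_fun A (EFin \o f).
  apply/measurable_EFinP; apply: measurable_funTS.
  exact: continuous_measurable_fun.
have cF : continuous F by move=> x; apply/differentiable_continuous/derivable1_diffP.
move: ab; rewrite le_eqVlt => /predU1P[<-|ab].
  by rewrite set_itvoo0 integral_set0 subrr.
rewrite integral_itv_obnd_cbnd ?integral_itv_bndo_bndc//.
rewrite (@continuous_FTC2 _ f F)//.
- exact: continuous_subspaceT.
- split; first by move=> x _.
  + by apply: cvg_at_right_filter; exact: cF.
  + by apply: cvg_at_left_filter; exact: cF.
- by move=> x _; rewrite derive1E; apply: derive_val.
Qed.

Lemma ge0_integral_cos (r : R) (h : R -> \bar R) : (0 < r)%R ->
  measurable_fun setT h -> (forall x, 0 <= h x) ->
  \int[mu]_(t in `]0%R, pi[) (h (r * cos t)%R * (r * sin t)%:E) =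
  \int[mu]_(x in `](- r)%R, r[) h x.
Proof.
move=> r0 mh h0.
apply: (@ge0_change_of_variables _ `]0%R, pi[ `](- r)%R, r[ (fun t => r * cos t)%R (fun t => r * sin t)%R) => //.
- by apply: measurable_funM => //; apply: continuous_measurable_fun => t; exact: continuous_cos.
- by apply: measurable_funM => //; apply: continuous_measurable_fun => t; exact: continuous_sin.
- by move=> t /=; rewrite in_itv /= => t0; rewrite mulr_ge0 ?(ltW r0)// ltW// sin_gt0_pi.
(* [x] clamped to [[- r, r]], so that an arc cosine describes the preimage of the ray whatever [x]
   is. *)
- move=> x; set x' := (Num.max (- r) (Num.min r x))%R.
  have x'1 : (-1 <= x' / r <= 1)%R.
    rewrite ler_pdivlMr// ler_pdivrMr// mulN1r mul1r /x' le_max lexx/=.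
    by rewrite ge_max ge_min lexx/= andbT; lra.
  pose a := acos (x' / r).
  have a0 : (0 <= a)%R by exact: acos_ge0.
  have ap : (a <= pi)%R by exact: acos_lepi.
  have ca : (r * cos a = x')%R by rewrite acosK ?in_itv// mulrC divfK// gt_eqF.
  have -> : `]0%R, pi[%classic `&` (fun t => r * cos t)%R @^-1` `]-oo, x[ = `]a, pi[%classic.
    apply/seteqP; split => t /=; rewrite !in_itv /=.
      move=> [/andP[t0 tp] tx]; rewrite tp andbT.
      rewrite -ltr_cos ?in_itv/= ?a0 ?ap ?(ltW t0) ?(ltW tp)//.
      rewrite -(ltr_pM2l r0) ca /x' lt_max lt_min tx andbT.
      by rewrite gtr_pMr// -cos0 ltr_cos ?t0 ?orbT// in_itv/= ?lexx ?pi_ge0 ?(ltW t0) ?(ltW tp).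
    move=> /andP[t0 tp]; rewrite (le_lt_trans a0 t0) tp; split=> //.
    move: (t0); rewrite -ltr_cos ?in_itv/= ?a0 ?ap ?(ltW tp) ?(ltW (le_lt_trans a0 t0))//.
    rewrite -(ltr_pM2l r0) ca /x' lt_max lt_min => /orP[|/andP[]//].
    rewrite ltNge => /negP[]; rewrite -[leLHS]mulrN1 ler_pM2l// cos_geN1.
    by [].
  have cf : continuous (fun t : R => r * sin t)%R.
    move=> t; apply: (@continuousM _ _ (fun=> r) sin); [exact: cst_continuous|exact: continuous_sin].
  have dF (t : R) : is_derive t (1%R : R) (fun t : R => - r * cos t)%R (r * sin t)%R.
    have := is_deriveZ (- r)%R (is_derive_cos t).
    by rewrite -[_ *: _]/(- r * _)%R mulrN mulNr opprK.
  rewrite (integral_derive_oo ap cf dF).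
  have -> : `](- r)%R, r[%classic `&` `]-oo, x[%classic = `](- r)%R, x'[%classic.
    apply/seteqP; split => t /=; rewrite !in_itv /= lt_max lt_min.
      by move=> [/andP[-> ->] ->]; rewrite orbT.
    move=> /andP[rt /orP[tr|/andP[-> ->]]]; last by rewrite rt.
    by move: (lt_trans tr rt); rewrite ltxx.
  rewrite lebesgue_measure_itv /= lte_fin cospi.
  have [lt|ge] := ltP (- r)%R x'; first by rewrite -EFinB; congr EFin; rewrite -ca; ring.
  have e : x' = (- r)%R by apply/eqP; rewrite eq_le ge /x' le_max lexx.
  by congr EFin; have := ca; rewrite e; lra.
- move=> x; apply: (@le_lt_trans _ _ (mu `](- r)%R, r[%classic)).
    by apply: le_measure; rewrite ?inE//; exact: measurableI.
  by rewrite lebesgue_measure_itv; case: ifP => _; rewrite ?ltry// -EFinB ltry.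
Qed.

Lemma ge0_integral_cosh (h : R -> \bar R) :
  measurable_fun setT h -> (forall x, 0 <= h x) ->
  \int[mu]_(t in `]0%R, +oo[) (h (cosh t) * (sinh t)%:E) =
  \int[mu]_(x in `]1%R, +oo[) h x.
Proof.
move=> mh h0.
have cc : continuous (@cosh R).
  by move=> t; apply/differentiable_continuous/derivable1_diffP; have := is_derive_cosh t; case.
have cs : continuous (@sinh R).
  by move=> t; apply/differentiable_continuous/derivable1_diffP; have := is_derive_sinh t; case.
have lt_cosh : {in Num.nneg &, {mono @cosh R : x y / (x < y)%R}} by exact: leW_mono_in cosh_mono.
apply: (@ge0_change_of_variables _ `]0%R, +oo[ `]1%R, +oo[ (@cosh R) (@sinh R)) => //.
- exact: continuous_measurable_fun.
- exact: continuous_measurable_fun.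
- by move=> t /=; rewrite in_itv /= andbT => /ltW/sinh_ge0.
- move=> x; have [x1|x1] := leP x 1%R.
    rewrite (_ : _ `&` _ = set0) ?integral_set0; last first.
      rewrite -subset0 => t [_] /=; rewrite in_itv /=.
      by rewrite ltNge (le_trans x1 (cosh_ge1 _)).
    rewrite (_ : _ `&` _ = set0) ?measure0//.
    rewrite -subset0 => t [] /=; rewrite !in_itv /= andbT => h1 h2.
    by have := lt_trans h1 h2; rewrite ltNge x1.
  have a0 := acosh_ge0 (ltW x1); have ca := acoshK (ltW x1).
  have -> : `]0%R, +oo[%classic `&` @cosh R @^-1` `]-oo, x[ = `]0%R, acosh x[%classic.
    apply/seteqP; split => t /=; rewrite !in_itv /= andbT.
      by move=> [t0 tx]; rewrite t0 -lt_cosh ?nnegrE ?(ltW t0)// ca.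
    by move=> /andP[t0 ta]; rewrite t0 -ca lt_cosh// nnegrE ltW.
  rewrite (integral_derive_oo a0 cs (@is_derive_cosh R)).
  rewrite ca cosh0.
  have -> : `]1%R, +oo[%classic `&` `]-oo, x[%classic = `]1%R, x[%classic.
    by apply/seteqP; split => t /=; rewrite !in_itv /= andbT; [case=> -> ->|move/andP].
  by rewrite lebesgue_measure_itv /= lte_fin x1.
- move=> x; apply: (@le_lt_trans _ _ (mu `]1%R, x[%classic)).
    apply: le_measure; rewrite ?inE//; first exact: measurableI.
    by move=> t [] /=; rewrite !in_itv /= andbT => -> ->.
  by rewrite lebesgue_measure_itv; case: ifP => _; rewrite ?ltry// -EFinB ltry.
Qed.

Lemma ge0_integral_shift (c : R) (h : R -> \bar R) :
  measurable_fun setT h -> (forall x, 0 <= h x) ->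
  \int[mu]_t h (t + c)%R = \int[mu]_t h t.
Proof.
move=> mh h0.
have mF' : measurable_fun setT (fun t : measurableTypeR R => t + c : measurableTypeR R)%R.
  by apply: measurable_funD.
pose F : {mfun measurableTypeR R >-> measurableTypeR R} :=
  HB.pack (fun t : measurableTypeR R => t + c : measurableTypeR R)%R (isMeasurableFun.Build _ _ _ _ _ mF').
transitivity (\int[pushforward mu F]_t h t).
  by rewrite ge0_integral_pushforward// setTI.
apply: eq_measure_integral => A mA _; apply/esym.
apply: lebesgue_measure_unique mA => _ [[a b]] _ <-.
rewrite /= /pushforward.
have -> : F @^-1` `]a, b]%classic = `](a - c)%R, (b - c)%R]%classic.
  by apply/seteqP; split => t /=; rewrite !in_itv /= ltrBlDr lerBrDr.
by rewrite !lebesgue_measure_itv /= !lte_fin ltrD2r; case: ifP => // _; rewrite -!EFinB; congr EFin; ring.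
Qed.

Lemma ge0_integral_opp (h : R -> \bar R) :
  measurable_fun setT h -> (forall x, 0 <= h x) ->
  \int[mu]_t h (- t)%R = \int[mu]_t h t.
Proof.
move=> mh h0.
have mF' : measurable_fun setT (fun t : measurableTypeR R => - t : measurableTypeR R)%R.
  by apply: measurable_funN.
pose F : {mfun measurableTypeR R >-> measurableTypeR R} :=
  HB.pack (fun t : measurableTypeR R => - t : measurableTypeR R)%R (isMeasurableFun.Build _ _ _ _ _ mF').
transitivity (\int[pushforward mu F]_t h t).
  by rewrite ge0_integral_pushforward// setTI.
by apply: eq_measure_integral => A mA _; exact: lebesgue_measureN.
Qed.

End Substitution.

(** * Integrals over the plane and linear substitutions of determinant -1 *)

Section PlaneIntegral.
Context {R : realType}.
Implicit Types (r s x y z : R).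
Local Notation mu := (@lebesgue_measure R).

Lemma measurable_invsqrt :
  measurable_fun setT (fun x : R => (Num.sqrt x)^-1).
Proof.
have -> : [set: R] = `]-oo, 0] `|` `]0, +oo[.
  by apply/seteqP; split => // x _ /=; rewrite !in_itv /= andbT; case: (leP x 0); [left|right].
apply/measurable_funU => //; split.
  have e : {in `]-oo, (0 : R)]%classic, (fun=> 0 : R) =1 (fun x => (Num.sqrt x)^-1)}.
    by move=> x; rewrite inE /= in_itv /= => x0; rewrite ler0_sqrtr ?invr0.
  by apply: (eq_measurable_fun _ e); exact: measurable_cst.
apply: open_continuous_measurable_fun => [|x]; first exact: interval_open.
rewrite inE /= in_itv /= andbT => x0.
by apply: continuousV; [rewrite gt_eqF// sqrtr_gt0|exact: sqrt_continuous].
Qed.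

Lemma measurable_cos : measurable_fun setT (@cos R).
Proof. by apply: continuous_measurable_fun => t; exact: continuous_cos. Qed.

Lemma measurable_sin : measurable_fun setT (@sin R).
Proof. by apply: continuous_measurable_fun => t; exact: continuous_sin. Qed.

Lemma measurable_shear1 (a : R) :
  measurable_fun setT (fun t : R * R => (t.1 + a * t.2, t.2)).
Proof.
apply: measurable_fun_pair; last exact: measurable_snd.
apply: measurable_funD; first exact: measurable_fst.
by apply: measurable_funM; [exact: measurable_cst|exact: measurable_snd].
Qed.

Lemma measurable_shear2 (a : R) :
  measurable_fun setT (fun t : R * R => (t.1, t.2 + a * t.1)).
Proof.
apply: measurable_fun_pair; first exact: measurable_fst.
apply: measurable_funD; first exact: measurable_snd.
by apply: measurable_funM; [exact: measurable_cst|exact: measurable_fst].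
Qed.

Definition plane_integral (G : R * R -> R) : \bar R :=
  (\int[mu]_z \int[mu]_x (G (z, x))%:E)%E.

Context (G : R * R -> R).
Context (mG : measurable_fun setT G) (G0 : forall t, 0 <= G t).

Let mGE : measurable_fun setT (fun t : measurableTypeR R * measurableTypeR R => (G t)%:E).
Proof. exact/measurable_EFinP. Qed.

Lemma plane_integral_swap :
  plane_integral G = (\int[mu]_x \int[mu]_z (G (z, x))%:E)%E.
Proof.
rewrite /plane_integral.
by rewrite (fubini_tonelli (m1 := mu) (m2 := mu) (fun t => (G t)%:E))// => t; rewrite lee_fin.
Qed.

Let mG1 z : measurable_fun setT (fun x : R => (G (z, x))%:E).
Proof.
by apply: (measurableT_comp mGE); apply: measurable_fun_pair.
Qed.

Let mG2 x : measurable_fun setT (fun z : R => (G (z, x))%:E).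
Proof.
by apply: (measurableT_comp mGE); apply: measurable_fun_pair.
Qed.

Lemma plane_integral_shear2 s :
  plane_integral (fun t => G (t.1, t.2 + s * t.1)) = plane_integral G.
Proof.
apply: eq_integral => z _ /=.
rewrite (ge0_integral_shift (s * z) (mG1 z))// => x.
by rewrite lee_fin.
Qed.

Lemma plane_integral_flip2 :
  plane_integral (fun t => G (t.1, - t.2)) = plane_integral G.
Proof.
apply: eq_integral => z _ /=.
by rewrite (ge0_integral_opp (mG1 z))// => x; rewrite lee_fin.
Qed.

Lemma plane_integral_flip1 :
  (\int[mu]_x \int[mu]_z (G (- z, x))%:E = \int[mu]_x \int[mu]_z (G (z, x))%:E)%E.
Proof.
apply: eq_integral => x _ /=.
by rewrite (ge0_integral_opp (mG2 x))// => z; rewrite lee_fin.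
Qed.

Lemma plane_integral_shear1_aux s :
  (\int[mu]_x \int[mu]_z (G (z + s * x, x))%:E = \int[mu]_x \int[mu]_z (G (z, x))%:E)%E.
Proof.
apply: eq_integral => x _ /=.
by rewrite (ge0_integral_shift (s * x) (mG2 x))// => z; rewrite lee_fin.
Qed.

End PlaneIntegral.

Section PlaneLinear.
Context {R : realType}.
Implicit Types (G : R * R -> R).

Lemma plane_integral_shear1 G (s : R) : measurable_fun setT G -> (forall t, 0 <= G t) ->
  plane_integral (fun t => G (t.1 + s * t.2, t.2)) = plane_integral G.
Proof.
move=> mG G0; pose G' (t : R * R) := G (t.1 + s * t.2, t.2).
have ms : measurable_fun setT G'.
  exact: (measurableT_comp mG (measurable_shear1 s)).
have s0 t : 0 <= G' t by exact: G0.
rewrite (plane_integral_swap mG G0); apply: etrans (plane_integral_swap ms s0) _.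
exact: (plane_integral_shear1_aux mG G0).
Qed.

(** The matrix has trace 0 and determinant -1. For [c] nonzero it is the product of three shears,
    with coefficients [s], [c] and [s], and the flip of the second coordinate. *)
Lemma plane_integral_linear G (a b c : R) : measurable_fun setT G -> (forall t, 0 <= G t) ->
  c != 0 -> a ^+ 2 + b * c = 1 ->
  plane_integral (fun t => G (a * t.1 + b * t.2, c * t.1 - a * t.2)) = plane_integral G.
Proof.
move=> mG G0 c0 e; pose s := (a - 1) / c.
pose G1 t := G (t.1 + s * t.2, t.2).
pose G2 t := G1 (t.1, t.2 + c * t.1).
pose G3 t := G2 (t.1 + s * t.2, t.2).
have m1 : measurable_fun setT G1.
  exact: (measurableT_comp mG (measurable_shear1 s)).
have m2 : measurable_fun setT G2.
  exact: (measurableT_comp m1 (measurable_shear2 c)).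
have m3 : measurable_fun setT G3.
  exact: (measurableT_comp m2 (measurable_shear1 s)).
transitivity (plane_integral (fun t => G3 (t.1, - t.2))).
  congr plane_integral; apply/funext => -[z x]; rewrite /G3 /G2 /G1 /=.
  have sc : s * c = a - 1 by rewrite /s divfK.
  have -> : b = - (s * (1 + a)).
    apply: (mulIf c0); transitivity (1 - a ^+ 2); first by rewrite -e; ring.
    by transitivity (- (s * c) * (1 + a)); [rewrite sc; ring|ring].
  congr (G (_, _)).
    by transitivity ((1 + s * c) * z + (- s - s * (1 + s * c)) * x); [rewrite sc; ring|ring].
  by transitivity (c * z - (1 + s * c) * x); [rewrite sc; ring|ring].
have G10 t : 0 <= G1 t by exact: G0.
have G20 t : 0 <= G2 t by exact: G0.
have G30 t : 0 <= G3 t by exact: G0.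
rewrite (plane_integral_flip2 m3 G30).
have -> : plane_integral G3 = plane_integral G2 by exact: plane_integral_shear1 m2 G20.
have -> : plane_integral G2 = plane_integral G1 by exact: plane_integral_shear2 m1 G10 c.
exact: plane_integral_shear1 mG G0.
Qed.

End PlaneLinear.

(** * Integrals over a period *)

Section Periodic.
Context {R : realType}.
Implicit Types (r s t x y z : R).
Local Notation mu := (@lebesgue_measure R).
Local Open Scope ereal_scope.

Lemma ge0_integral_shift_itv (f : R -> \bar R) (a b c : R) : measurable_fun setT f ->
  (forall t, 0 <= f t) ->
  \int[mu]_(t in `[a, b[) f (t + c)%R = \int[mu]_(t in `[(a + c)%R, (b + c)%R[) f t.
Proof.
move=> mf f0; rewrite integral_mkcond [RHS]integral_mkcond.
rewrite -(ge0_integral_shift c (h := f \_ `[(a + c)%R, (b + c)%R[)).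
- apply: eq_integral => t _; rewrite !patchE !mem_setE !in_itv /=.
  by rewrite lerD2r ltrD2r.
- by apply/(measurable_restrictT _ _).1 => //; exact: measurable_funTS.
- by move=> t; rewrite patchE; case: ifP.
Qed.

Lemma ge0_integral_itv_split (f : R -> \bar R) (a b c : R) : measurable_fun setT f ->
  (forall t, 0 <= f t) -> (a <= b)%R -> (b <= c)%R ->
  \int[mu]_(t in `[a, c[) f t = \int[mu]_(t in `[a, b[) f t + \int[mu]_(t in `[b, c[) f t.
Proof.
move=> mf f0 ab bc; rewrite -ge0_integral_setU//; last 2 first.
- exact: measurable_funTS.
- apply/eqP; rewrite -subset0 => t [] /=; rewrite !in_itv /= => /andP[_ h] /andP[h' _].
  by move: (lt_le_trans h h'); rewrite ltxx.
congr integral; apply/seteqP; split => t /=; rewrite !in_itv /=.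
  by move=> /andP[-> ->]; rewrite andbT /=; case: (ltP t b); [left|right].
by move=> [/andP[-> h]|/andP[h ->]]; rewrite ?(lt_le_trans h bc)// (le_trans ab h).
Qed.

Lemma ge0_integral_periodic (f : R -> \bar R) (a p : R) : measurable_fun setT f ->
  (forall t, 0 <= f t) -> (forall t, f (t + p)%R = f t) -> (0 <= a <= p)%R ->
  \int[mu]_(t in `[0%R, p[) f (t + a)%R = \int[mu]_(t in `[0%R, p[) f t.
Proof.
move=> mf f0 fp /andP[a0 ap].
rewrite ge0_integral_shift_itv// add0r.
rewrite (@ge0_integral_itv_split f a p)//; last by rewrite lerDl.
rewrite [RHS](@ge0_integral_itv_split f 0%R a)// addeC; congr (_ + _).
rewrite -[X in `[X, _[]add0r [X in `[_, X[]addrC -ge0_integral_shift_itv//.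
by apply: eq_integral => t _; rewrite fp.
Qed.

(** The two terms are the upper and the lower half of the circle. *)
Lemma ge0_integral_circle (f : R -> \bar R) : measurable_fun setT f ->
  (forall t, 0 <= f t) -> (forall t, f (t + 2 * pi)%R = f t) ->
  \int[mu]_(t in `[0%R, (2 * pi)%R[) f t =
  \int[mu]_(t in `]0%R, pi[) (f t + f (- t)%R).
Proof.
move=> mf f0 fp; have p0 := pi_gt0 R.
have mfo : measurable_fun setT (fun t => f (- t)%R).
  by apply: measurableT_comp => //; exact: measurable_funN.
rewrite (@ge0_integral_itv_split f 0%R pi)//; [|lra..].
have e (g : R -> \bar R) : measurable_fun setT g ->
    \int[mu]_(t in `[0%R, pi[) g t = \int[mu]_(t in `]0%R, pi[) g t.
  by move=> mg; rewrite -integral_itv_obnd_cbnd//; exact: measurable_funTS.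
rewrite ge0_integralD//; [|exact: measurable_funTS..].
rewrite e//; congr (_ + _).
have -> : `[pi, (2 * pi)%R[ = `[(- pi + 2 * pi)%R, (0 + 2 * pi)%R[ :> interval R by congr (Interval (BLeft _) (BLeft _)); ring.
rewrite -(@ge0_integral_shift_itv f (- pi)%R 0%R (2 * pi)%R)//.
have -> : \int[mu]_(t in `[(- pi)%R, 0%R[) f (t + 2 * pi)%R = \int[mu]_(t in `[(- pi)%R, 0%R[) f t.
  by apply: eq_integral => t _; exact: fp.
rewrite [LHS]integral_mkcond [RHS]integral_mkcond.
rewrite -(ge0_integral_opp (h := f \_ `[(- pi)%R, 0%R[)); last 2 first.
- by apply/(measurable_restrictT _ _).1 => //; exact: measurable_funTS.
- by move=> t; rewrite patchE; case: ifP.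
transitivity (\int[mu]_t ((fun t => f (- t)%R) \_ `]0%R, pi]) t).
  by apply: eq_integral => t _; rewrite !patchE !mem_setE !in_itv /= lerN2 oppr_lt0 andbC.
rewrite -!integral_mkcond -integral_itv_bndo_bndc//.
exact: measurable_funTS.
Qed.

End Periodic.

Lemma ord3P (P : 'I_3 -> Prop) : P 0 -> P 1 -> P 2 -> forall j, P j.
Proof.
move=> p0 p1 p2 [[|[|[|//]]] lt].
- by rewrite (_ : Ordinal lt = 0)//; apply/val_inj.
- by rewrite (_ : Ordinal lt = 1)//; apply/val_inj.
- by rewrite (_ : Ordinal lt = 2)//; apply/val_inj.
Qed.

(** * The area as an integral over parallels *)

Section AreaChart.
Context {R : realType} (M : plane).
Implicit Types (r s t x y z : R) (A : set 'rV[R]_3).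
Local Notation mu := (@lebesgue_measure R).
Local Notation mf := (@metric_form R M).
Local Notation sg := (@form_sign R M).

Definition gsin t : R := match M with Sphere => sin t | Hyperbolic => sinh t end.
Definition gcos t : R := match M with Sphere => cos t | Hyperbolic => cosh t end.
Definition srange : set R :=
  match M with Sphere => `]0, pi[%classic | Hyperbolic => `]0, +oo[%classic end.
Definition zrange : set R :=
  match M with Sphere => `](-1), 1[%classic | Hyperbolic => `]1, +oo[%classic end.

Lemma polarE s t : polar M (s, t) = vec (gsin s * cos t) (gsin s * sin t) (gcos s).
Proof. by rewrite /polar /gsin /gcos; case: M. Qed.

Lemma polar_domainE : polar_domain M = srange `*` `[0, (2 * pi)[%classic.
Proof. by rewrite /polar_domain /srange; case: M. Qed.

Lemma Cn2Sn2 s : gcos s ^+ 2 + sg * gsin s ^+ 2 = 1.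
Proof.
rewrite /gcos /gsin /form_sign; case: M; first by rewrite mul1r cos2Dsin2.
by rewrite mulN1r cosh2Bsinh2.
Qed.

Lemma Sn_gt0 s : srange s -> 0 < gsin s.
Proof.
rewrite /srange /gsin; case: M => /=; rewrite in_itv /=; first exact: sin_gt0_pi.
by rewrite andbT; exact: sinh_gt0.
Qed.

Lemma is_derive_Cn s : is_derive s 1 gcos (- (sg * gsin s)).
Proof.
rewrite /gcos /gsin /form_sign; case: M; first by rewrite mul1r; exact: is_derive_cos.
by rewrite mulN1r opprK; exact: is_derive_cosh.
Qed.

Lemma is_derive_Sn s : is_derive s 1 gsin (gcos s).
Proof.
rewrite /gcos /gsin; case: M; first exact: is_derive_sin.
exact: is_derive_sinh.
Qed.

Lemma derive1_vec (f g h : R -> R) t : derivable f t 1 -> derivable g t 1 ->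
  derivable h t 1 ->
  derive1 (fun s => vec (f s) (g s) (h s)) t = vec (derive1 f t) (derive1 g t) (derive1 h t).
Proof.
move=> df dg dh.
have e (i : 'I_1) : [/\ (fun s => vec (f s) (g s) (h s) i 0) = f,
    (fun s => vec (f s) (g s) (h s) i 1) = g & (fun s => vec (f s) (g s) (h s) i 2) = h].
  by split; apply/funext => s; rewrite mxE.
have d : derivable (fun s => vec (f s) (g s) (h s)) t 1.
  apply/derivable_mxP => i; have [e0 e1 e2] := e i; apply: ord3P.
  - exact: (eq_ind_r (fun F : R -> R => derivable F t 1) df e0).
  - exact: (eq_ind_r (fun F : R -> R => derivable F t 1) dg e1).
  - exact: (eq_ind_r (fun F : R -> R => derivable F t 1) dh e2).
rewrite derive1E derive_mx//; apply/rowP; apply: ord3P; rewrite !mxE /=;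
  have [e0 e1 e2] := e 0.
- by rewrite e0 -derive1E.
- by rewrite e1 -derive1E.
- by rewrite e2 -derive1E.
Qed.

Lemma area_densityE s t : srange s -> area_density M (s, t) = gsin s.
Proof.
move=> sI; rewrite /area_density.
have dS := is_derive_Sn s; have dC := is_derive_Cn s.
have dc := is_derive_cos t; have ds := is_derive_sin t.
have -> : (fun s => polar M (s, (s, t).2)) = (fun s => vec (cos t * gsin s) (sin t * gsin s) (gcos s)).
  by apply/funext => s'; rewrite polarE ![gsin s' * _]mulrC.
have -> : (fun t' => polar M ((s, t).1, t')) = (fun t' => vec (gsin s * cos t') (gsin s * sin t') (gcos s)).
  by apply/funext => t'; rewrite polarE.
have d1 := is_deriveZ (cos t) dS.
have d2 := is_deriveZ (sin t) dS.
have d3 := is_deriveZ (gsin s) dc.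
have d4 := is_deriveZ (gsin s) ds.
have d5 := is_derive_cst (gcos s) t (1 : R).
have e1 : derive1 (fun s => vec (cos t * gsin s) (sin t * gsin s) (gcos s)) s = vec (cos t * gcos s) (sin t * gcos s) (- (sg * gsin s)).
  rewrite derive1_vec; [|by case: d1|by case: d2|by case: dC].
  by rewrite !derive1E; congr vec; [case: d1|case: d2|case: dC].
have e2 : derive1 (fun t' => vec (gsin s * cos t') (gsin s * sin t') (gcos s)) t = vec (gsin s * - sin t) (gsin s * cos t) 0.
  rewrite derive1_vec; [|by case: d3|by case: d4|by case: d5].
  by rewrite !derive1E; congr vec; [case: d3|case: d4|case: d5].
rewrite [(s, t).1]/= [(s, t).2]/= e1 e2 !mfE !vec0 !vec1 !vec2.
have cs := cos2Dsin2 t; have CS := Cn2Sn2 s; have g2 := @sg2 R M.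
rewrite (_ : _ - _ = gsin s ^+ 2); first by rewrite sqrtr_sqr gtr0_norm// Sn_gt0.
have -> : cos t * gcos s * (cos t * gcos s) + sin t * gcos s * (sin t * gcos s) + sg * (- (sg * gsin s) * - (sg * gsin s)) = 1.
  transitivity (gcos s ^+ 2 * (cos t ^+ 2 + sin t ^+ 2) + (sg * sg) * (sg * gsin s ^+ 2)); first by ring.
  by rewrite cs g2 mulr1 mul1r.
transitivity (gsin s ^+ 2 * (cos t ^+ 2 + sin t ^+ 2)); first by ring.
by rewrite cs mulr1.
Qed.

Definition ind A x y z : R := \1_A (vec x y z).

Lemma ind_ge0 A x y z : 0 <= ind A x y z.
Proof. by rewrite /ind indicE ler0n. Qed.

(** Measurability of [A] as a set of triples of coordinates. It is preserved by Boolean operations,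
    reflections and rotations. *)
Definition nice A : Prop :=
  measurable_fun setT (fun p : R * R * R => ind A p.1.1 p.1.2 p.2).

Lemma nice_comp d (T : measurableType d) A (f g h : T -> R) : nice A ->
  measurable_fun setT f -> measurable_fun setT g -> measurable_fun setT h ->
  measurable_fun setT (fun p => ind A (f p) (g p) (h p)).
Proof.
move=> nA mf mg mh.
have mp : measurable_fun setT (fun p => ((f p, g p), h p)).
  by apply: measurable_fun_pair => //; apply: measurable_fun_pair.
exact: (measurableT_comp nA mp).
Qed.

(** The Euclidean radius of the parallel at height [z]. *)
Definition rho z : R := Num.sqrt (sg * (1 - z ^+ 2)).

Lemma rho_Cn s : srange s -> rho (gcos s) = gsin s.
Proof.
move=> sI; rewrite /rho.
have -> : sg * (1 - gcos s ^+ 2) = gsin s ^+ 2.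
  have -> : 1 - gcos s ^+ 2 = sg * gsin s ^+ 2 by have := Cn2Sn2 s; lra.
  by rewrite mulrA sg2 mul1r.
by rewrite sqrtr_sqr gtr0_norm// Sn_gt0.
Qed.

Lemma measurable_rho : measurable_fun setT rho.
Proof.
apply: continuous_measurable_fun => z.
apply: continuous_comp; last exact: sqrt_continuous.
apply: continuousM; first exact: cst_continuous.
apply: continuousB; first exact: cst_continuous.
by apply: continuousM; exact: cvg_id.
Qed.

(** The angular measure of the part of the parallel at height [z] that lies in [A]. *)
Definition parallel A z : \bar R :=
  (\int[mu]_(t in `[0%R, (2 * pi)%R[) (ind A (rho z * cos t) (rho z * sin t) z)%:E)%E.

Lemma measurable_parallel A : nice A -> measurable_fun setT (parallel A).
Proof.
move=> nA.
pose K (p : measurableTypeR R * measurableTypeR R) : \bar R :=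
  (ind A (rho p.1 * cos p.2) (rho p.1 * sin p.2) p.1 * \1_(`[0, (2 * pi)[%classic : set R) p.2)%:E.
have mK : measurable_fun setT K.
  apply/measurable_EFinP; apply: measurable_funM.
    apply: nice_comp => //.
    - apply: measurable_funM.
        exact: (measurableT_comp measurable_rho measurable_fst).
      exact: (measurableT_comp measurable_cos measurable_snd).
    - apply: measurable_funM.
        exact: (measurableT_comp measurable_rho measurable_fst).
      exact: (measurableT_comp measurable_sin measurable_snd).
  have m1 : measurable_fun setT (\1_(`[0, (2 * pi)[%classic : set R) : R -> R).
    exact: measurable_indic.
  exact: (measurableT_comp m1 measurable_snd).
have K0 p : (0 <= K p)%E by rewrite lee_fin mulr_ge0 ?ind_ge0// indicE ler0n.
have := measurable_fun_fubini_tonelli_F (m2 := mu) K mK K0.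
rewrite (_ : fubini_F mu K = parallel A)//.
apply/funext => z; rewrite /fubini_F /parallel [RHS]integral_mkcond.
apply: eq_integral => t _; rewrite patchE /K indicE /=.
by case: (t \in _); rewrite ?mulr1 ?mulr0.
Qed.

Lemma parallel_ge0 A z : (0 <= parallel A z)%E.
Proof. by apply: integral_ge0 => t _; rewrite lee_fin ind_ge0. Qed.

Lemma ge0_integral_Cn (h : R -> \bar R) :
  measurable_fun setT h -> (forall x, (0 <= h x)%E) ->
  (\int[mu]_(s in srange) (h (gcos s) * (gsin s)%:E) = \int[mu]_(z in zrange) h z)%E.
Proof.
move=> mh h0; rewrite /srange /zrange /gcos /gsin; case: M.
  have := ge0_integral_cos (@ltr01 R) mh h0 => <-.
  by apply: eq_integral => t _; rewrite !mul1r.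
exact: ge0_integral_cosh.
Qed.

Lemma measurable_srange : measurable srange.
Proof. by rewrite /srange; case: M. Qed.

Lemma measurable_Sn : measurable_fun setT gsin.
Proof.
apply: continuous_measurable_fun => t.
by apply/differentiable_continuous/derivable1_diffP; have [] := is_derive_Sn t.
Qed.

Lemma measurable_Cn : measurable_fun setT gcos.
Proof.
apply: continuous_measurable_fun => t.
by apply/differentiable_continuous/derivable1_diffP; have [] := is_derive_Cn t.
Qed.

(** Archimedes' theorem: up to sign [gcos] has derivative [gsin], so the substitution [z = gcos s]
    turns the density of the polar chart into 1. *)
Lemma area_parallel A : nice A -> area M A = (\int[mu]_(z in zrange) parallel A z)%E.
Proof.
move=> nA; rewrite -ge0_integral_Cn; [|exact: measurable_parallel|exact: parallel_ge0].
pose J : set R := `[0, (2 * pi)[%classic.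
pose K (p : measurableTypeR R * measurableTypeR R) : R :=
  \1_srange p.1 * gsin p.1 * (ind A (gsin p.1 * cos p.2) (gsin p.1 * sin p.2) (gcos p.1) * \1_J p.2).
have mfst : measurable_fun setT (fun p : measurableTypeR R * measurableTypeR R => p.1).
  exact: measurable_fst.
have msnd : measurable_fun setT (fun p : measurableTypeR R * measurableTypeR R => p.2).
  exact: measurable_snd.
have mJ : measurable_fun setT (\1_J : R -> R).
  by apply: measurable_indic; exact: measurable_itv.
have mI : measurable_fun setT (\1_srange : R -> R).
  by apply: measurable_indic; exact: measurable_srange.
have mS := measurableT_comp measurable_Sn mfst.
have mC := measurableT_comp measurable_Cn mfst.
have mK : measurable_fun setT K.
  apply: measurable_funM.
    by apply: measurable_funM => //; exact: (measurableT_comp mI mfst).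
  apply: measurable_funM; last exact: (measurableT_comp mJ msnd).
  apply: nice_comp => //.
  - by apply: measurable_funM => //; exact: (measurableT_comp measurable_cos msnd).
  - by apply: measurable_funM => //; exact: (measurableT_comp measurable_sin msnd).
have K0 p : 0 <= K p.
  rewrite /K [in X in X * gsin _]indicE.
  have [/set_mem/Sn_gt0/ltW S0|_] := boolP (p.1 \in srange); last by rewrite !mul0r.
  apply: mulr_ge0; first by rewrite mulr_ge0.
  by apply: mulr_ge0; [exact: ind_ge0|rewrite indicE ler0n].
transitivity (\int[mu \x mu]_p (K p)%:E)%E.
  rewrite /area [LHS]integral_mkcond; apply: eq_integral => -[s t] _.
  rewrite patchE in_setI polar_domainE in_setX /K !indicE /=.
  case: (boolP (s \in srange)) => sI /=; last by rewrite !mul0r.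
  rewrite -/J; case: (boolP (t \in J)) => tJ /=; last by rewrite !mulr0.
  rewrite area_densityE; last exact: set_mem.
  rewrite /ind indicE mul1r mulr1.
  have -> : ((s, t) \in polar M @^-1` A) = (vec (gsin s * cos t) (gsin s * sin t) (gcos s) \in A).
    by rewrite -polarE; apply/idP/idP; rewrite !inE.
  by case: ifP; rewrite ?mulr1 ?mulr0.
rewrite fubini_tonelli1; [|exact/measurable_EFinP|by move=> p; rewrite lee_fin].
rewrite [RHS]integral_mkcond; apply: eq_integral => s _.
rewrite patchE /fubini_F /K /=.
case: (boolP (s \in srange)) => sI; last first.
  under eq_integral do rewrite indicE (negbTE sI) !mul0r.
  by rewrite integral0.
rewrite muleC /parallel [X in (_ * X)%E]integral_mkcond -ge0_integralZl//.
- apply: eq_integral => t _; rewrite patchE !indicE sI mul1r rho_Cn; last exact: set_mem.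
  by rewrite -/J; case: (t \in J); rewrite ?mulr1 ?mulr0 ?mule0.
- apply/(measurable_restrictT _ _).1 => //.
  apply/measurable_funTS/measurable_EFinP; apply: nice_comp => //.
  + by apply: measurable_funM => //; exact: measurable_cos.
  + by apply: measurable_funM => //; exact: measurable_sin.
- by move=> t _; rewrite patchE; case: ifP => // _; rewrite lee_fin ind_ge0.
- by rewrite lee_fin ltW// Sn_gt0//; exact: set_mem.
Qed.

End AreaChart.

(** * Measurable sets, rotations and the projection along the second axis *)

Section AreaInvariance.
Context {R : realType} (M : plane).
Implicit Types (r s x y z : R) (u v p : 'rV[R]_3) (A B : set 'rV[R]_3).
Local Notation mu := (@lebesgue_measure R).
Local Notation mf := (@metric_form R M).
Local Notation sg := (@form_sign R M).

Lemma nice_preimage A (L : 'rV[R]_3 -> 'rV[R]_3) : nice A ->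
  (forall j, measurable_fun setT (fun t : R * R * R => L (vec t.1.1 t.1.2 t.2) 0 j)) ->
  nice (L @^-1` A).
Proof.
move=> nA mL; have := nice_comp nA (mL 0) (mL 1) (mL 2).
congr measurable_fun; apply/funext => t; rewrite /ind -vec_eta.
by rewrite !indicE; congr ((_ : bool)%:R); apply/idP/idP; rewrite !inE.
Qed.

Lemma nice_in (f : 'rV[R]_3 -> R) (B : set R) :
  measurable_fun setT (fun t : R * R * R => f (vec t.1.1 t.1.2 t.2)) ->
  measurable B -> nice [set x | B (f x)].
Proof.
move=> mf mB; have m1 : measurable_fun setT (\1_B : R -> R) by exact: measurable_indic.
have := measurableT_comp m1 mf.
by congr measurable_fun; apply/funext => t; rewrite /ind /= !indicE.
Qed.

Lemma niceI A B : nice A -> nice B -> nice (A `&` B).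
Proof.
move=> nA nB; have := measurable_funM nA nB.
congr measurable_fun; apply/funext => t; rewrite /ind /= !indicE in_setI.
by case: (_ \in A); rewrite ?mul1r ?mul0r.
Qed.

Lemma niceC A : nice A -> nice (~` A).
Proof.
move=> nA; have := measurable_funB (measurable_cst (1 : R)) nA.
congr measurable_fun; apply/funext => t; rewrite /ind /= !indicE in_setC.
by case: (_ \in A); rewrite ?subr0 ?subrr.
Qed.

Lemma niceD A B : nice A -> nice B -> nice (A `\` B).
Proof. by move=> nA nB; rewrite setDE; apply: niceI => //; exact: niceC. Qed.

Lemma niceU A B : nice A -> nice B -> nice (A `|` B).
Proof.
move=> nA nB; rewrite -[A `|` B]setCK setCU.
by apply: niceC; apply: niceI; exact: niceC.
Qed.

Let mx : measurable_fun setT (fun t : R * R * R => t.1.1).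
Proof. exact: (measurableT_comp measurable_fst measurable_fst). Qed.

Let my : measurable_fun setT (fun t : R * R * R => t.1.2).
Proof. exact: (measurableT_comp measurable_snd measurable_fst). Qed.

Let mz : measurable_fun setT (fun t : R * R * R => t.2).
Proof. exact: measurable_snd. Qed.

Lemma measurable_coord j :
  measurable_fun setT (fun t : R * R * R => vec t.1.1 t.1.2 t.2 0 j).
Proof.
move: j; apply: ord3P.
- by rewrite (_ : (fun _ => _) = (fun t : R * R * R => t.1.1))//; apply/funext => t; rewrite vec0.
- by rewrite (_ : (fun _ => _) = (fun t : R * R * R => t.1.2))//; apply/funext => t; rewrite vec1.
- by rewrite (_ : (fun _ => _) = (fun t : R * R * R => t.2))//; apply/funext => t; rewrite vec2.
Qed.

Lemma measurable_mf (f g : R * R * R -> 'rV[R]_3) :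
  (forall j, measurable_fun setT (fun t => f t 0 j)) ->
  (forall j, measurable_fun setT (fun t => g t 0 j)) ->
  measurable_fun setT (fun t => mf (f t) (g t)).
Proof.
move=> mf mg.
rewrite (_ : (fun _ => _) = (fun t => f t 0 0 * g t 0 0 + f t 0 1 * g t 0 1 + sg * (f t 0 2 * g t 0 2))); last first.
  by apply/funext => t; rewrite mfE.
apply: measurable_funD.
  by apply: measurable_funD; apply: measurable_funM.
by apply: measurable_funM; [exact: measurable_cst|apply: measurable_funM].
Qed.

Lemma nice_surface : nice (surface M : set 'rV[R]_3).
Proof.
have n1 : nice [set x | [set sg] (mf x x)].
  by apply: nice_in => //; apply: measurable_mf; exact: measurable_coord.
have n2 : nice [set x : 'rV[R]_3 | `]0%R, +oo[%classic (x 0 2)].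
  by apply: nice_in => //; exact: measurable_coord.
have := niceI n1 n2; move: n1; rewrite /surface /form_sign; case: M => //= n1.
congr nice; apply/seteqP; split => x /=; rewrite in_itv /= andbT => -[e h]; split=> //.
Qed.

Lemma nice_cap (c : 'rV[R]_3) (h : R) : nice (cap M c h).
Proof.
have -> : cap M c h = surface M `&` [set x | `[h, +oo[%classic (mf c x)].
  by apply/seteqP; split => x /=; rewrite in_itv /= andbT.
apply: niceI; first exact: nice_surface.
apply: nice_in => //; apply: measurable_mf; last exact: measurable_coord.
by move=> j; exact: measurable_cst.
Qed.

Lemma nice_ocap (c : 'rV[R]_3) (h : R) : nice (ocap M c h).
Proof.
have -> : ocap M c h = surface M `&` [set x | `]h, +oo[%classic (mf c x)].
  by apply/seteqP; split => x /=; rewrite in_itv /= andbT.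
apply: niceI; first exact: nice_surface.
apply: nice_in => //; apply: measurable_mf; last exact: measurable_coord.
by move=> j; exact: measurable_cst.
Qed.

Definition rotz r s p : 'rV[R]_3 :=
  vec (r * p 0 0 - s * p 0 1) (s * p 0 0 + r * p 0 1) (p 0 2).

Lemma nice_rotz r s A : nice A -> nice (rotz r s @^-1` A).
Proof.
move=> nA; apply: nice_preimage => //; apply: ord3P.
- rewrite (_ : (fun _ => _) = (fun t : R * R * R => r * t.1.1 - s * t.1.2)); last first.
    by apply/funext => t; rewrite /rotz !vec0 vec1.
  by apply: measurable_funB; apply: measurable_funM => //; exact: measurable_cst.
- rewrite (_ : (fun _ => _) = (fun t : R * R * R => s * t.1.1 + r * t.1.2)); last first.
    by apply/funext => t; rewrite /rotz !vec0 !vec1.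
  by apply: measurable_funD; apply: measurable_funM => //; exact: measurable_cst.
- by rewrite (_ : (fun _ => _) = (fun t : R * R * R => t.2))//; apply/funext => t; rewrite /rotz !vec2.
Qed.

Lemma nice_refl u A : nice A -> nice (refl M u @^-1` A).
Proof.
move=> nA; apply: nice_preimage => // j.
rewrite (_ : (fun _ => _) = (fun t : R * R * R => vec t.1.1 t.1.2 t.2 0 j -
   (2 / mf u u * u 0 j) * mf (vec t.1.1 t.1.2 t.2) u)); last first.
  by apply/funext => t; rewrite /refl [in LHS]mxE [X in _ + X = _]mxE [X in _ - X = _]mxE; ring.
apply: measurable_funB; first exact: measurable_coord.
apply: measurable_funM; first exact: measurable_cst.
apply: measurable_mf; first exact: measurable_coord.
by move=> i; exact: measurable_cst.
Qed.

(** A rotation shifts the angle on every parallel, and integrals over a full period are invariant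
    under shifts. *)
Lemma area_rotz (a : R) A : 0 <= a <= 2 * pi -> nice A ->
  area M (rotz (cos a) (sin a) @^-1` A) = area M A.
Proof.
move=> a2 nA.
apply: etrans (area_parallel M (nice_rotz _ _ nA)) _.
apply: etrans (esym (area_parallel M nA)).
apply: eq_integral => z _; rewrite /parallel.
pose f (t : R) : \bar R := (ind A (rho M z * cos t) (rho M z * sin t) z)%:E.
have mf : measurable_fun setT f.
  apply/measurable_EFinP; apply: nice_comp => //.
  - by apply: measurable_funM; [exact: measurable_cst|exact: measurable_cos].
  - by apply: measurable_funM; [exact: measurable_cst|exact: measurable_sin].
have f0 t : (0 <= f t)%E by rewrite lee_fin ind_ge0.
have fp t : f (t + 2 * pi) = f t.
  by rewrite /f [2 * pi]mulr_natl cosD2pi sinD2pi.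
rewrite -(ge0_integral_periodic mf f0 fp a2).
apply: eq_integral => t _; rewrite /f cosD sinD /ind !indicE; congr ((_ : bool)%:R%:E).
have e : rotz (cos a) (sin a) (vec (rho M z * cos t) (rho M z * sin t) z) =
  vec (rho M z * (cos t * cos a - sin t * sin a)) (rho M z * (sin t * cos a + cos t * sin a)) z.
  by rewrite /rotz vec0 vec1 vec2; congr vec; ring.
by apply/idP/idP; rewrite !inE /= e.
Qed.

(** Excludes the lower sheet of the hyperboloid, which the condition [0 < quad] does not distinguish
    from the upper one. *)
Definition zpos : set R :=
  match M with Sphere => setT | Hyperbolic => `]0, +oo[%classic end.

(* The area element [dz dx / |y|] on the two graphs [y = + or - sqrt q]. *)
Definition quad (t : R * R) : R := sg * (1 - t.1 ^+ 2) - t.2 ^+ 2.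
Definition chart A (t : R * R) : R :=
  (ind A t.2 (Num.sqrt (quad t)) t.1 + ind A t.2 (- Num.sqrt (quad t)) t.1) *
  (Num.sqrt (quad t))^-1 * \1_zpos t.1.

Lemma measurable_quad : measurable_fun setT quad.
Proof.
apply: measurable_funB.
  apply: measurable_funM; first exact: measurable_cst.
  apply: measurable_funB; first exact: measurable_cst.
  by apply: measurable_funM; exact: measurable_fst.
by apply: measurable_funM; exact: measurable_snd.
Qed.

Lemma measurable_chart A : nice A -> measurable_fun setT (chart A).
Proof.
move=> nA.
have ms : measurable_fun setT (fun t => Num.sqrt (quad t)).
  apply: (measurableT_comp _ measurable_quad).
  by apply: continuous_measurable_fun; exact: sqrt_continuous.
apply: measurable_funM; last first.
  have m1 : measurable_fun setT (\1_zpos : R -> R).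
    by apply: measurable_indic; rewrite /zpos; case: M.
  exact: (measurableT_comp m1 measurable_fst).
apply: measurable_funM; last exact: (measurableT_comp measurable_invsqrt measurable_quad).
apply: measurable_funD; apply: nice_comp => //.
by apply: measurable_funN.
Qed.

Lemma chart_ge0 A t : 0 <= chart A t.
Proof.
rewrite /chart mulr_ge0 ?indicE ?ler0n//.
by rewrite mulr_ge0 ?invr_ge0 ?sqrtr_ge0// addr_ge0// ind_ge0.
Qed.

End AreaInvariance.

(** * Invariance of the area under reflections *)

Section AreaReflection.
Context {R : realType} (M : plane).
Implicit Types (r s x y z : R) (u v p : 'rV[R]_3) (A B : set 'rV[R]_3).
Local Notation mu := (@lebesgue_measure R).
Local Notation mf := (@metric_form R M).
Local Notation sg := (@form_sign R M).

Lemma zrange_gt0 z : zrange M z -> 0 < sg * (1 - z ^+ 2).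
Proof. by rewrite /zrange /form_sign; case: M => /=; rewrite in_itv /=; nra. Qed.

Lemma zrange_zpos z : zrange M z -> zpos M z.
Proof. by rewrite /zrange /zpos; case: M => //=; rewrite !in_itv /= !andbT; lra. Qed.

Lemma zrange_of z : zpos M z -> 0 < sg * (1 - z ^+ 2) -> zrange M z.
Proof.
rewrite /zrange /zpos /form_sign; case: M => /=; rewrite ?in_itv /= ?andbT => z0 z1.
  by apply/andP; split; nra.
by nra.
Qed.

Lemma chart_eq0 A (t : R * R) : quad M t <= 0 -> chart M A t = 0.
Proof. by move=> q0; rewrite /chart (ler0_sqrtr q0) invr0 mulr0 mul0r. Qed.

(** The two halves of the parallel are parametrised by [x = r * cos t], where up to sign [dt] is
    [dx] divided by [|y|]. *)
Lemma parallel_chart A z : nice A -> zrange M z ->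
  parallel M A z = (\int[mu]_x (chart M A (z, x))%:E)%E.
Proof.
move=> nA zr; set r := rho M z.
have r2 : r ^+ 2 = sg * (1 - z ^+ 2) by rewrite sqr_sqrtr// ltW// zrange_gt0.
have r0 : 0 < r by rewrite sqrtr_gt0 zrange_gt0.
pose f (t : R) : \bar R := (ind A (r * cos t) (r * sin t) z)%:E.
have mf : measurable_fun setT f.
  apply/measurable_EFinP; apply: nice_comp => //.
  - by apply: measurable_funM; [exact: measurable_cst|exact: measurable_cos].
  - by apply: measurable_funM; [exact: measurable_cst|exact: measurable_sin].
have f0 t : (0 <= f t)%E by rewrite lee_fin ind_ge0.
have fp t : f (t + 2 * pi) = f t.
  by rewrite /f [2 * pi]mulr_natl cosD2pi sinD2pi.
pose h x : \bar R := (chart M A (z, x))%:E.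
have mh : measurable_fun setT h.
  apply/measurable_EFinP.
  apply: (measurableT_comp (measurable_chart M nA)).
  by apply: measurable_fun_pair; [exact: measurable_cst|exact: measurable_id].
have h0 x : (0 <= h x)%E by rewrite lee_fin chart_ge0.
rewrite /parallel -/r (ge0_integral_circle mf f0 fp).
transitivity (\int[mu]_(x in `](- r)%R, r[) h x)%E; last first.
  rewrite integral_mkcond; apply: eq_integral => x _; rewrite patchE.
  have [//|] := boolP (x \in _); rewrite mem_setE in_itv /= negb_and -!leNgt => xr.
  rewrite /h chart_eq0// /quad /= -r2 subr_le0.
  by move: xr => /orP[]; nra.
rewrite -(ge0_integral_cos r0 mh h0); apply: eq_integral => t.
rewrite inE /= in_itv /= => t0.
have st : 0 < r * sin t by rewrite mulr_gt0// sin_gt0_pi.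
rewrite /f /h cosN sinN -EFinD -EFinM; congr EFin.
rewrite /chart.
have -> : quad M (z, r * cos t) = (r * sin t) ^+ 2.
  rewrite /quad /= -r2 !exprMn -(mulr1 (r ^+ 2)) -{1}(cos2Dsin2 t); ring.
rewrite sqrtr_sqr (gtr0_norm st) indicE mem_set; last exact: zrange_zpos.
by rewrite mulr1 divfK ?gt_eqF// mulrN.
Qed.

Lemma area_plane A : nice A -> area M A = plane_integral (chart M A).
Proof.
move=> nA; apply: etrans (area_parallel M nA) _.
rewrite /plane_integral [LHS]integral_mkcond.
apply: eq_integral => z _; rewrite patchE.
have [/set_mem zr|zr] := boolP (z \in _); first exact: parallel_chart.
rewrite (eq_integral (fun=> 0%E)) ?integral0// => x _; congr EFin.
have [q0|q0] := leP (quad M (z, x)) 0; first exact: chart_eq0.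
rewrite /chart indicE memNset ?mulr0// => zp.
move/negP: zr; apply; apply/mem_set; apply: zrange_of => //.
by move: q0; rewrite /quad /= subr_gt0; apply: le_lt_trans; exact: sqr_ge0.
Qed.

Lemma surface_chart x z : zpos M z -> 0 < quad M (z, x) ->
  surface M (vec x (Num.sqrt (quad M (z, x))) z).
Proof.
move=> zp q0; have sq : Num.sqrt (quad M (z, x)) ^+ 2 = quad M (z, x) by rewrite sqr_sqrtr// ltW.
have e : mf (vec x (Num.sqrt (quad M (z, x))) z) (vec x (Num.sqrt (quad M (z, x))) z) = sg.
  by rewrite mfE vec0 vec1 vec2 -(expr2 (Num.sqrt _)) sq /quad /=; ring.
move: zp e; rewrite /surface /zpos /form_sign; case: M => //= + e.
by rewrite vec2 in_itv /= andbT.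
Qed.

Lemma zpos_surface p : surface M p -> zpos M (p 0 2).
Proof. by rewrite /surface /zpos; case: M => //= -[_]; rewrite in_itv /= andbT. Qed.

(** Such a reflection keeps the second coordinate, acts linearly on [(z, x)] and preserves [quad],
    hence the density of the chart; this is the situation of [plane_integral_linear]. *)
Lemma area_refl_xz u A : u 0 1 = 0 -> 0 < mf u u -> nice A ->
  area M (refl M u @^-1` A) = area M A.
Proof.
move=> u1 u0 nA; have n0 : mf u u != 0 by rewrite gt_eqF.
apply: etrans (area_plane (nice_refl M u nA)) _.
apply: etrans (esym (area_plane nA)).
set n := mf u u in n0.
have nE : n = u 0 0 ^+ 2 + sg * u 0 2 ^+ 2 by rewrite /n mfE u1; ring.
pose a := 1 - 2 * sg * u 0 2 ^+ 2 / n.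
pose b := - (2 * u 0 0 * u 0 2 / n).
pose c := - (2 * sg * u 0 0 * u 0 2 / n).
have rE x y z : refl M u (vec x y z) = vec (c * z - a * x) y (a * z + b * x).
  have mE : mf (vec x y z) u = u 0 0 * x + sg * u 0 2 * z.
    by rewrite mfE vec0 vec1 vec2 u1; ring.
  have aE : a = 2 * u 0 0 ^+ 2 / n - 1.
    have e2 : sg * u 0 2 ^+ 2 = n - u 0 0 ^+ 2 by rewrite nE; ring.
    by rewrite /a -(mulrA 2 sg) e2; field.
  apply: vecP; rewrite /refl -/n mE !mxE /=.
  - by rewrite aE /c; field.
  - by rewrite u1; ring.
  - by rewrite /a /b; field.
have n2 : n ^+ 2 != 0 by rewrite sqrf_eq0.
have g2 := @sg2 R M.
have abc : a ^+ 2 + b * c = 1.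
  apply: (mulIf n2); rewrite mul1r.
  transitivity ((n - 2 * (sg * u 0 2 ^+ 2)) ^+ 2 + 4 * (sg * u 0 2 ^+ 2) * u 0 0 ^+ 2).
    by rewrite /a /b /c; field.
  by rewrite nE; ring.
have qE z x : quad M (a * z + b * x, c * z - a * x) = quad M (z, x).
  have := mf_refl (vec x 0 z) (vec x 0 z) n0.
  by rewrite rE !mfE !vec0 !vec1 !vec2 /quad /=; lra.
have key t : chart M (refl M u @^-1` A) t = chart M A (a * t.1 + b * t.2, c * t.1 - a * t.2).
  case: t => z x /=; rewrite /chart qE /=.
  have [q0|q0] := leP (quad M (z, x)) 0.
    by rewrite (ler0_sqrtr q0) invr0 !mulr0 !mul0r.
  have iE y : ind (refl M u @^-1` A) x y z = ind A (c * z - a * x) y (a * z + b * x).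
    by rewrite /ind -rE !indicE; congr ((_ : bool)%:R); apply/idP/idP; rewrite !inE.
  rewrite !iE; congr (_ * _); rewrite !indicE; congr ((_ : bool)%:R).
  apply/idP/idP; rewrite !inE => zp.
    have := zpos_surface (refl_surface u0 (surface_chart zp q0)).
    by rewrite rE vec2.
  have q0' : 0 < quad M (a * z + b * x, c * z - a * x) by rewrite qE.
  have := zpos_surface (refl_surface u0 (surface_chart zp q0')).
  by rewrite qE -rE reflK// vec2.
have mc := measurable_chart M nA; have c0 := chart_ge0 M A.
(* For [c = 0] the normal is along a coordinate axis and the reflection flips one coordinate. *)
have [e|e] := eqVneq c 0; last first.
  by rewrite -(plane_integral_linear mc c0 e abc); congr plane_integral; apply/funext => t; exact: key.
have uu : u 0 0 * u 0 2 = 0.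
  have : c * n = - (2 * sg * (u 0 0 * u 0 2)) by rewrite /c; field.
  rewrite e mul0r => /esym/eqP; rewrite oppr_eq0 !mulf_eq0 pnatr_eq0 /=.
  have -> : (sg == 0) = false by rewrite /form_sign; case: M; rewrite ?oppr_eq0 oner_eq0.
  by move=> /= /orP[] /eqP ->; rewrite ?mul0r ?mulr0.
have b0 : b = 0 by rewrite /b -(mulrA 2) uu mulr0 mul0r oppr0.
move/eqP: uu; rewrite mulf_eq0 => /orP[] /eqP uz.
  have a1 : a = -1.
    have e2 : sg * u 0 2 ^+ 2 = n by rewrite nE uz; ring.
    by rewrite /a -(mulrA 2 sg) e2; field.
  have keyE t : chart M (refl M u @^-1` A) t = chart M A (- t.1, t.2).
    by rewrite key a1 b0 e; congr chart; congr pair; ring.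
  rewrite (plane_integral_swap mc c0) -(plane_integral_flip1 mc c0).
  have mc' := measurable_chart M (nice_refl M u nA).
  have c0' := chart_ge0 M (refl M u @^-1` A).
  rewrite (plane_integral_swap mc' c0').
  by apply: eq_integral => x _; apply: eq_integral => z _; rewrite keyE.
have a1 : a = 1 by rewrite /a uz; field.
have keyE t : chart M (refl M u @^-1` A) t = chart M A (t.1, - t.2).
  by rewrite key a1 b0 e; congr chart; congr pair; ring.
by rewrite -(plane_integral_flip2 mc c0); congr plane_integral; apply/funext => t; exact: keyE.
Qed.

Lemma mf_rotz r s p v : r ^+ 2 + s ^+ 2 = 1 -> mf (rotz r s p) (rotz r s v) = mf p v.
Proof.
move=> e; rewrite /rotz !mfE !vec0 !vec1 !vec2.
transitivity ((r ^+ 2 + s ^+ 2) * (p 0 0 * v 0 0 + p 0 1 * v 0 1) + sg * (p 0 2 * v 0 2)).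
  by ring.
by rewrite e; ring.
Qed.

Lemma rotzK r s p : r ^+ 2 + s ^+ 2 = 1 -> rotz r (- s) (rotz r s p) = p.
Proof.
move=> e; apply: vecP; rewrite /rotz !vec0 ?vec1 ?vec2//.
  by transitivity ((r ^+ 2 + s ^+ 2) * p 0 0); [ring|rewrite e mul1r].
by transitivity ((r ^+ 2 + s ^+ 2) * p 0 1); [ring|rewrite e mul1r].
Qed.

Lemma refl_rotz r s u p : r ^+ 2 + s ^+ 2 = 1 ->
  refl M u p = rotz r (- s) (refl M (rotz r s u) (rotz r s p)).
Proof.
move=> e; rewrite -[LHS](rotzK _ e); congr rotz.
rewrite {2}/refl !mf_rotz// /refl.
by apply: vecP; rewrite /rotz /vec !mxE /=; ring.
Qed.

Lemma rotz_xz u : exists a : R, 0 <= a <= 2 * pi /\ rotz (cos a) (sin a) u 0 1 = 0.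
Proof.
have p0 := pi_gt0 R.
have [e|e] := eqVneq (u 0 0 ^+ 2 + u 0 1 ^+ 2) 0.
  exists 0; split; first by rewrite lexx; lra.
  have u1 : u 0 1 = 0 by nra.
  by rewrite /rotz vec1 sin0 cos0 u1; ring.
set n := u 0 0 ^+ 2 + u 0 1 ^+ 2 in e.
have n0 : 0 < n by rewrite lt_neqAle eq_sym e /n addr_ge0// sqr_ge0.
pose r := Num.sqrt n; have r0 : 0 < r by rewrite sqrtr_gt0.
have r2 : r ^+ 2 = n by rewrite sqr_sqrtr// ltW.
have key (w : R) : w ^+ 2 = u 0 0 ^+ 2 -> exists a : R,
    [/\ 0 <= a <= 2 * pi, cos a = w / r & sin a = `|u 0 1| / r].
  move=> w2.
  have wr : -1 <= w / r <= 1.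
    rewrite -ler_norml normrM normfV (gtr0_norm r0) ler_pdivrMr// mul1r.
    rewrite -ler_sqr ?nnegrE ?normr_ge0 ?(ltW r0)//.
    by rewrite real_normK ?num_real// r2 w2 lerDl sqr_ge0.
  exists (acos (w / r)); split.
  - rewrite acos_ge0//= (le_trans (acos_lepi wr))//; lra.
  - by rewrite acosK// in_itv.
  - rewrite sin_acos//; have -> : 1 - (w / r) ^+ 2 = (u 0 1 / r) ^+ 2.
      rewrite !expr_div_n r2 w2 /n; field.
      by rewrite -/n.
    by rewrite sqrtr_sqr normrM normfV (gtr0_norm r0).
have [u1|u1] := leP (u 0 1) 0.
  have [a [a2 ca sa]] := key (u 0 0) erefl; exists a; split=> //.
  by rewrite /rotz vec1 ca sa ler0_norm//; ring.
have [a [a2 ca sa]] := key (- u 0 0) (sqrrN _); exists a; split=> //.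
by rewrite /rotz vec1 ca sa gtr0_norm//; ring.
Qed.

(** A rotation about the last axis brings the normal into the plane treated by [area_refl_xz]. *)
Lemma area_refl u A : 0 < mf u u -> nice A -> area M (refl M u @^-1` A) = area M A.
Proof.
move=> u0 nA; have [a [a2 ua]] := rotz_xz u.
have cs := cos2Dsin2 a; set r := cos a in ua cs *; set s := sin a in ua cs *.
have nB := nice_rotz r (- s) nA.
have u0' : 0 < mf (rotz r s u) (rotz r s u) by rewrite mf_rotz.
have nC := nice_refl M (rotz r s u) nB.
have -> : refl M u @^-1` A = rotz r s @^-1` (refl M (rotz r s u) @^-1` (rotz r (- s) @^-1` A)).
  by apply/funext => p; rewrite /preimage /= -refl_rotz.
apply: etrans (area_rotz M a2 nC) _.
apply: etrans (area_refl_xz ua u0' nB) _.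
apply: etrans (esym (area_rotz M a2 nB)) _.
by congr area; apply/funext => p; rewrite /preimage /= rotzK.
Qed.

End AreaReflection.

(** * Additivity of the area and comparison of lunes *)

Section AreaMeasure.
Context {R : realType} (M : plane).
Implicit Types (u c e : 'rV[R]_3) (h k : R) (A B : set 'rV[R]_3).
Local Notation mu := (@lebesgue_measure R).
Local Notation mf := (@metric_form R M).
Local Notation sg := (@form_sign R M).

(** The absolute value makes the density nonnegative everywhere; on [polar_domain] it agrees with
    [area_density]. *)
Let W (p : measurableTypeR R * measurableTypeR R) : R := `|gsin M p.1|.

Let mW : measurable_fun setT W.
Proof.
apply: (measurableT_comp (@normr_measurable R setT)).
exact: (measurableT_comp (measurable_Sn M) measurable_fst).
Qed.

Let W0 : forall p, 0 <= W p. Proof. move=> p; exact: normr_ge0. Qed.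

Let nu := density (mu \x mu)%E mW W0.

Let dom A : set (measurableTypeR R * measurableTypeR R) :=
  polar_domain M `&` polar M @^-1` A.

Let mdom A : nice A -> measurable (dom A).
Proof.
move=> nA.
pose K (p : measurableTypeR R * measurableTypeR R) : R := ind A (gsin M p.1 * cos p.2) (gsin M p.1 * sin p.2) (gcos M p.1).
have mS := measurableT_comp (measurable_Sn M) (@measurable_fst _ _ (measurableTypeR R) (measurableTypeR R)).
have mC := measurableT_comp (measurable_Cn M) (@measurable_fst _ _ (measurableTypeR R) (measurableTypeR R)).
have mK : measurable_fun setT K.
  have mc := measurableT_comp (@measurable_cos R) (@measurable_snd _ _ (measurableTypeR R) (measurableTypeR R)).
  have ms := measurableT_comp (@measurable_sin R) (@measurable_snd _ _ (measurableTypeR R) (measurableTypeR R)).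
  exact: (nice_comp nA (measurable_funM mS mc) (measurable_funM mS ms) mC).
apply: measurableI.
  by rewrite polar_domainE; apply: measurableX; [exact: measurable_srange|exact: measurable_itv].
have := mK measurableT _ (measurable_set1 (1 : R)); rewrite setTI.
congr measurable; apply/seteqP; split => -[s t]; rewrite /preimage /= polarE /K /ind indicE /=.
  by case: (boolP (_ \in A)) => [/set_mem//|_] /eqP; rewrite eq_sym oner_eq0.
by move=> h; rewrite mem_set.
Qed.

Let area_nu A : nice A -> area M A = nu (dom A).
Proof.
move=> nA; rewrite /area /nu /density -/(dom A).
apply: eq_integral => -[s t] /set_mem [+ _].
rewrite polar_domainE => -[/= sI _].
by rewrite area_densityE// /W gtr0_norm// Sn_gt0.
Qed.

Lemma polar_surface (p : R * R) : polar_domain M p -> surface M (polar M p).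
Proof.
case: p => s t; rewrite polar_domainE polarE => -[/= sI _].
have e : mf (vec (gsin M s * cos t) (gsin M s * sin t) (gcos M s))
    (vec (gsin M s * cos t) (gsin M s * sin t) (gcos M s)) = sg.
  rewrite mfE vec0 vec1 vec2.
  transitivity (gsin M s ^+ 2 * (cos t ^+ 2 + sin t ^+ 2) + sg * gcos M s ^+ 2); first by ring.
  rewrite cos2Dsin2 mulr1; have := Cn2Sn2 M s; have := @sg2 R M.
  by rewrite /form_sign; case: M; lra.
move: e; rewrite /surface /form_sign /gcos /gsin; case: M => //= e.
by split=> //; rewrite vec2 cosh_gt0.
Qed.

Lemma le_area A B : nice A -> nice B -> A `&` surface M `<=` B ->
  (area M A <= area M B)%E.
Proof.
move=> nA nB AB; rewrite !area_nu//; apply: le_measure; rewrite ?inE; [exact: mdom..|].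
move=> p [pd pA]; split=> //; apply: AB; split=> //; exact: polar_surface.
Qed.

Lemma areaU A B : nice A -> nice B -> A `&` B `&` surface M `<=` set0 ->
  area M (A `|` B) = (area M A + area M B)%E.
Proof.
move=> nA nB AB; rewrite !area_nu//; last exact: niceU.
rewrite -measureU; [|exact: mdom..|].
  congr (nu _); apply/seteqP; split => p; rewrite /dom /=.
    by move=> [pd []]; [left|right].
  by move=> [] [pd h]; split=> //; [left|right].
rewrite -subset0 => p [[pd pA] [_ pB]].
by apply: (AB (polar M p)); split=> //; exact: polar_surface.
Qed.

Lemma area_leU A B : nice A -> nice B ->
  (area M (A `|` B) <= area M A + area M B)%E.
Proof.
move=> nA nB; have nD := niceD nB nA.
have -> : A `|` B = A `|` (B `\` A).
  by rewrite setUDr setDv setD0.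
rewrite areaU//; first by rewrite leeD2l// le_area// => p [[]].
by move=> p [[pA [_ /(_ pA)]]].
Qed.

Lemma refl_cap u c h : 0 < mf u u -> refl M u @^-1` cap M c h = cap M (refl M u c) h.
Proof.
move=> u0; have u0' : mf u u != 0 by rewrite gt_eqF.
apply/seteqP; split => p /= [pM hp]; split.
- by rewrite -(reflK p u0'); exact: refl_surface.
- by rewrite -(reflK p u0') mf_refl.
- exact: refl_surface.
- by rewrite -(reflK c u0') mf_refl.
Qed.

(** Let a reflection exchange [e1] and [e2]. Points outside both of their discs count equally on the
    two sides. A point of the disc about [e1] only is reflected to the side of [e2], which is also
    that of [c], so that it stays in the disc about [c]. *)
Lemma area_lune_closer c e1 e2 h k :
  surface M e1 -> surface M e2 -> mf c e1 <= mf c e2 ->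
  (area M (cap M c h `\` cap M e2 k) <= area M (cap M c h `\` cap M e1 k))%E.
Proof.
move=> e1M e2M ce; have [->//|ne] := eqVneq e1 e2.
have u0 := mf_sub_gt0 e1M e2M ne; set u := e1 - e2 in u0.
have u0' : mf u u != 0 by rewrite gt_eqF.
have r1 : refl M u e1 = e2 by exact: refl_swap.
have r2 : refl M u e2 = e1 by rewrite -r1 reflK.
set C := cap M c h; set B1 := cap M e1 k; set B2 := cap M e2 k.
have nC : nice C := nice_cap M c h.
have n1 : nice B1 := nice_cap M e1 k.
have n2 : nice B2 := nice_cap M e2 k.
have -> : C `\` B2 = (C `\` (B1 `|` B2)) `|` ((C `&` B1) `\` B2).
  apply/seteqP; split => p.
    move=> [pC p2]; have [p1|p1] := pselect (B1 p); [by right|left].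
    by split=> // -[].
  by move=> [[pC p12]|[[pC _] p2]]; split=> // p2; apply: p12; right.
have -> : C `\` B1 = (C `\` (B1 `|` B2)) `|` ((C `&` B2) `\` B1).
  apply/seteqP; split => p.
    move=> [pC p1]; have [p2|p2] := pselect (B2 p); [by right|left].
    by split=> // -[].
  by move=> [[pC p12]|[[pC _] p1]]; split=> // p1; apply: p12; left.
have n12 := niceD nC (niceU n1 n2).
have nD1 := niceD (niceI nC n2) n1; have nD2 := niceD (niceI nC n1) n2.
rewrite !areaU//; last 2 first.
- by move=> p [[[_ n] [[_ p2] _]] _]; apply: n; right.
- by move=> p [[[_ n] [[_ p1] _]] _]; apply: n; left.
rewrite leeD2l// -(area_refl u0 nD1); apply: le_area => //; first exact: nice_refl.
move=> p [[[[pM pc] [_ p1]] p2] _].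
have p2' : mf e2 p < k by rewrite ltNge; apply/negP => ?; apply: p2.
have rM : surface M (refl M u p) by exact: refl_surface.
split; last first.
  by move=> [_]; rewrite -r2 mf_refl// leNgt p2'.
split; last by split=> //; rewrite -r1 mf_refl.
split=> //; rewrite /refl mfDr mfNr mfZr.
have h1 : mf c u <= 0 by rewrite /u !mflin; lra.
have h2 : 0 <= mf p u.
  by rewrite /u !mflin (mfC M p e1) (mfC M p e2) subr_ge0; exact: le_trans (ltW p2') p1.
apply: (le_trans pc); rewrite lerDl -mulrN mulr_ge0// ?oppr_ge0//.
by rewrite divr_ge0 ?(ltW u0)// mulr_ge0.
Qed.

(** A reflection taking [c'] to [c] reduces this to two discs removed from the same disc. *)
Lemma area_lune_contract c e c' e' h k :
  surface M c -> surface M e -> surface M c' -> surface M e' -> mf c e <= mf c' e' ->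
  (area M (cap M c' h `\` cap M e' k) <= area M (cap M c h `\` cap M e k))%E.
Proof.
move=> cM eM c'M e'M ce; have [cc|ne] := eqVneq c' c.
  by subst c'; exact: area_lune_closer.
have u0 := mf_sub_gt0 c'M cM ne; set u := c' - c in u0.
have u0' : mf u u != 0 by rewrite gt_eqF.
have r1 : refl M u c' = c by exact: refl_swap.
have nD := niceD (nice_cap M c' h) (nice_cap M e' k).
rewrite -(area_refl u0 nD).
rewrite (_ : _ @^-1` _ = (refl M u @^-1` cap M c' h) `\` (refl M u @^-1` cap M e' k))//.
rewrite !refl_cap// r1.
apply: area_lune_closer => //; first exact: refl_surface.
by rewrite -[in leRHS]r1 mf_refl.
Qed.

Lemma area_cap c c' h : surface M c -> surface M c' ->
  area M (cap M c h) = area M (cap M c' h).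
Proof.
move=> cM c'M; have [->//|ne] := eqVneq c c'.
have u0 := mf_sub_gt0 cM c'M ne.
by rewrite -(area_refl u0 (nice_cap M c h)) refl_cap// refl_swap.
Qed.

(** A reflection moves [c] to [(0, 0, 1)], and a circle about that point is contained in a single
    parallel, at height [sg * h]. *)
Lemma area_circle c h : surface M c -> area M (cap M c h `\` ocap M c h) = 0%E.
Proof.
move=> cM; set n : 'rV[R]_3 := vec 0 0 1.
have nM : surface M n.
  rewrite /surface /n; case: M => /=; rewrite /metric_form !vec0 !vec1 !vec2; first by lra.
  by split; lra.
have nice_c e : nice (cap M e h `\` ocap M e h).
  by apply: niceD; [exact: nice_cap|exact: nice_ocap].
suff -> : area M (cap M c h `\` ocap M c h) = area M (cap M n h `\` ocap M n h).
  rewrite area_parallel// integral_mkcond.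
  set A := _ `\` _.
  set f := _ \_ _.
  have -> : f = f \_ [set sg * h].
    apply/funext => z; rewrite [RHS]patchE; have [//|zh] := boolP (z \in [set _]).
    rewrite /f patchE; case: ifP => // _; rewrite /parallel.
    rewrite (eq_integral (fun=> 0%E)) ?integral0// => t _; congr EFin.
    rewrite /ind indicE memNset// => -[[pM h1] h2].
    move/negP: zh; apply; apply/mem_set => /=.
    have h3 : mf n (vec (rho M z * cos t) (rho M z * sin t) z) <= h.
      rewrite leNgt; apply/negP => h3; exact: h2.
    have : mf n (vec (rho M z * cos t) (rho M z * sin t) z) = sg * z.
      by rewrite mfE /n !vec0 !vec1 !vec2; ring.
    move=> e; have : sg * z = h by apply/eqP; rewrite eq_le -e h1 h3.
    by move=> <-; rewrite mulrA sg2 mul1r.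
  by rewrite -integral_mkcond integral_set1.
have [->//|ne] := eqVneq c n.
have u0 := mf_sub_gt0 cM nM ne; have u0' : mf (c - n) (c - n) != 0 by rewrite gt_eqF.
have ne' : n != c by rewrite eq_sym.
rewrite -(area_refl u0 (nice_c c)).
rewrite (_ : _ @^-1` _ = (refl M (c - n) @^-1` cap M c h) `\` (refl M (c - n) @^-1` ocap M c h))//.
rewrite refl_cap// refl_swap//.
congr (area M (_ `\` _)).
apply/seteqP; split => p /= [pM hp]; split.
- by rewrite -(reflK p u0'); exact: refl_surface.
- by rewrite -(refl_swap cM nM ne) -(reflK p u0') mf_refl.
- exact: refl_surface.
- by rewrite -(mf_refl _ _ u0') (reflK p u0') refl_swap.
Qed.

End AreaMeasure.

(** * Circles and geodesics *)

Lemma cts_near {R : realType} {V W : normedModType R} (f : V -> W) (x : V) :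
  (forall e : R, 0 < e -> exists2 d, 0 < d & forall y, `|y - x| < d -> `|f y - f x| < e) ->
  {for x, continuous f}.
Proof.
move=> H; apply/cvgrPdist_lt => e e0; have [d d0 hd] := H e e0.
apply/nbhs_ballP; exists d => //= y; rewrite -ball_normE /= => h.
by rewrite distrC; apply: hd; rewrite distrC.
Qed.

Lemma near_cts {R : realType} {V W : normedModType R} (f : V -> W) (x : V) (e : R) :
  {for x, continuous f} -> 0 < e ->
  exists2 d, 0 < d & forall y, `|y - x| < d -> `|f y - f x| < e.
Proof.
move=> /cvgrPdist_lt/[apply] /nbhs_ballP[d /= d0 hd]; exists d => // y h.
by rewrite distrC; apply: hd; rewrite -ball_normE /= distrC.
Qed.

Section LocalGeometry.
Context {R : realType} (M : plane).
Implicit Types (a b c e m u v w x y z : 'rV[R]_3) (h k s t : R).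
Local Notation mf := (@metric_form R M).
Local Notation sg := (@form_sign R M).

Lemma coord_norm x i : `|x 0 i| <= `|x|.
Proof. by rewrite -[`|x|]/(mx_norm x) mx_normrE; apply: (le_bigmax _ (fun j => `|x j.1 j.2|) (0, i)). Qed.

Definition fnorm m : R := `|m 0 0| + `|m 0 1| + `|m 0 2|.

Lemma fnorm_ge0 m : 0 <= fnorm m. Proof. by rewrite !addr_ge0. Qed.

Lemma mf_bound m x : `|mf m x| <= fnorm m * `|x|.
Proof.
have e0 := coord_norm x 0; have e1 := coord_norm x 1; have e2 := coord_norm x 2.
have h (p q : R) : `|q| <= `|x| -> - (`|p| * `|x|) <= p * q <= `|p| * `|x|.
  move=> qx; rewrite -ler_norml normrM; exact: ler_wpM2l.
have /andP[h0 h0'] := h (m 0 0) _ e0; have /andP[h1 h1'] := h (m 0 1) _ e1.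
have /andP[h2 h2'] := h (m 0 2) _ e2.
rewrite ler_norml /fnorm /metric_form; case: M; apply/andP; split; lra.
Qed.

Lemma mf_near m x (e : R) : 0 < e -> exists2 d, 0 < d &
  forall y, `|y - x| < d -> `|mf m y - mf m x| < e.
Proof.
move=> e0; have n0 := fnorm_ge0 m; exists (e / (fnorm m + 1)); first by rewrite divr_gt0//; lra.
move=> y yx; rewrite -mfNr -mfDr; apply: le_lt_trans (mf_bound _ _) _.
move: yx; rewrite ltr_pdivlMr; last by lra.
by have := normr_ge0 (y - x); nra.
Qed.

Lemma mf_continuous m : continuous (fun x => mf m x).
Proof. by move=> x; apply: (@cts_near _ _ R^o) => e e0; exact: mf_near. Qed.

Lemma surface_neq0 c : surface M c -> c != 0.
Proof.
move=> cM; apply/eqP => c0; have := surface_mf cM; rewrite c0 mf0l /form_sign.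
by case: (M); lra.
Qed.

Lemma line_surface a b (l : R) : surface M a -> surface M b -> a != b ->
  surface M (a + l *: (b - a)) -> l = 0 \/ l = 1.
Proof.
move=> aM bM ab /surface_mf; rewrite !mflin (mfC M b a) !surface_mf// => E.
have := mf_lt_sg aM bM ab => lt.
have : l * (1 - l) = 0 by nra.
by move/eqP; rewrite mulf_eq0 subr_eq0 => /orP[/eqP|/eqP]; [left|right].
Qed.

(** A plane with this normal contains the direction [c]; when it passes through [a] and [b] it meets
    the plane of a circle about [c] through them along the line from [a] to [b]. *)
Definition perp c a b : 'rV[R]_3 := cross M c (b - a).

Section Circle.
Variables (c a b : 'rV[R]_3) (h : R).
Hypotheses (cM : surface M c) (aM : surface M a) (bM : surface M b) (ab : a != b).
Hypotheses (ca : mf c a = h) (cb : mf c b = h).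

Lemma perp_gt0 : 0 < mf (perp c a b) (perp c a b).
Proof.
have cd : mf c (b - a) = 0 by rewrite !mflin ca cb subrr.
have ba : b != a by rewrite eq_sym.
rewrite /perp mf_cross cd surface_mf// mul0r subr0 mulrA sg2 mul1r.
exact: mf_sub_gt0.
Qed.

Lemma circle_h_lt : h < sg.
Proof.
rewrite -ca lt_neqAle mf_le_sg// andbT; apply/eqP => e.
have e1 := mf_eq_sg cM aM e; have e2 := mf_eq_sg cM bM (etrans cb (etrans (esym ca) e)).
by move/eqP: ab; rewrite -e1 -e2.
Qed.

Lemma circle_h_gt : M = Sphere -> -1 < h.
Proof.
move=> MS; have cM' : surface M (- c).
  by move: cM; rewrite /surface MS /= => <-; rewrite /metric_form !mxE; ring.
have := @mf_le_sg R M (- c) a cM' aM; have := @mf_eq_sg R M (- c) a cM' aM.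
have := @mf_eq_sg R M (- c) b cM' bM; rewrite !mfNl ca cb => eb ea le.
rewrite ltNge; apply/negP => h1; have E : - h = sg by move: le; rewrite /form_sign MS; lra.
by move/eqP: ab; rewrite -(ea E) -(eb E).
Qed.

(** The quantity is the squared sine of the radius, or its hyperbolic analogue; a circle with two
    points is not reduced to one. *)
Lemma circle_gap : 0 < sg * (sg ^+ 2 - h ^+ 2).
Proof.
have := circle_h_lt; have := circle_h_gt; rewrite /form_sign; case: M => [/(_ erefl)|_]; nra.
Qed.

Lemma perp_line x : mf c x = h -> mf (perp c a b) (x - a) = 0 -> exists l, x = a + l *: (b - a).
Proof.
move=> cx px; set d := b - a; set m := perp c a b in px *.
have dd : 0 < mf d d by apply: mf_sub_gt0 => //; rewrite eq_sym.
have m0 := perp_gt0; rewrite -/m in m0.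
exists (mf d (x - a) / mf d d); rewrite -/d.
apply/eqP; rewrite -subr_eq0 opprD addrA; apply/eqP.
apply: (@det_orth _ M c d m) => //.
- by rewrite /det -/m gt_eqF.
- have cd : mf c d = 0 by rewrite /d !mflin ca cb subrr.
  have cx' : mf c (x - a) = 0 by rewrite !mflin ca cx subrr.
  move: (_ / _) => r; by rewrite (mfC M _ c) (mfDr M c (x - a)) mfNr mfZr cd cx' mulr0 subrr.
- by rewrite (mfDl M (x - a)) mfNl mfZl (mfC M (x - a) d); field; rewrite gt_eqF.
- move: (_ / _) => r; rewrite (mfC M _ m) (mfDr M m (x - a)) mfNr mfZr px [mf m d](_ : _ = 0); last exact: mf_cross_r.
  by rewrite mulr0 subrr.
Qed.

Lemma perp_nondeg x : surface M x -> mf c x = h -> mf (perp c a b) (x - a) = 0 ->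
  x = a \/ x = b.
Proof.
move=> xM cx /(perp_line cx)[l e]; rewrite e in xM; have [l0|l1] := line_surface aM bM ab xM.
  by left; rewrite e l0 scale0r addr0.
by right; rewrite e l1 scale1r addrC subrK.
Qed.

(** Three distinct points of the circle span its plane affinely. *)
Lemma bary e x : surface M e -> mf c e = h -> e != a -> e != b -> mf c x = h ->
  exists p q r : R, p + q + r = 1 /\ x = p *: a + q *: b + r *: e.
Proof.
move=> eM ce ea eb cx; set d1 := b - a; set d2 := e - a.
have d12 : det M c d1 d2 != 0.
  apply/eqP => E; have [/eqP|/eqP] := perp_nondeg eM ce E; first by rewrite (negbTE ea).
  by rewrite (negbTE eb).
have orth w : mf c w = h -> mf (w - a) c = 0 by move=> cw; rewrite mfC !mflin ca cw subrr.
have z : det M (x - a) d1 d2 = 0.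
  apply/eqP; apply/negPn/negP => nz.
  have := @det_orth _ M (x - a) d1 d2 c nz.
  rewrite !(mfC M c) !orth// => /(_ erefl erefl erefl) c0.
  by move: (surface_neq0 cM); rewrite c0 eqxx.
have := cramer M c d1 d2 (x - a); rewrite z scale0r add0r.
set D := det M c d1 d2 in d12 *; set q := det _ _ _ _; set r := det _ _ _ _ => E.
exists (1 - q / D - r / D), (q / D), (r / D); split; first ring.
have -> : x = a + D^-1 *: (D *: (x - a)) by rewrite scalerA mulVf// scale1r addrC subrK.
by rewrite E /d1 /d2; apply/rowP => i; rewrite !mxE; field.
Qed.

End Circle.

(** With [K = 2 * |mf y e|] the quotient is the length of the displacement in [refl_near]. *)
Lemma small_perturb w e (K eps : R) : 0 < mf w w -> 0 <= K -> 0 < eps ->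
  exists2 d0, 0 < d0 & forall d, 0 < d -> d < d0 ->
    0 < mf (w + d *: e) (w + d *: e) /\
    K * d * `|w + d *: e| / mf (w + d *: e) (w + d *: e) < eps.
Proof.
move=> ww K0 eps0; set A := 2 * `|mf w e| + `|mf e e|; set B := (K + 1) * (`|w| + `|e| + 1).
have A0 : 0 <= A by rewrite /A addr_ge0// mulr_ge0.
have n1 := normr_ge0 w; have n2 := normr_ge0 e.
have B0 : 0 < B by rewrite /B mulr_gt0; lra.
exists (Num.min 1 (Num.min (mf w w / (2 * (A + 1))) (eps * mf w w / (2 * B)))).
  by rewrite !lt_min ltr01 !divr_gt0 ?mulr_gt0//; lra.
move=> d d0; rewrite !lt_min => /and3P[d1 dA dB].
have E : mf (w + d *: e) (w + d *: e) = mf w w + d * (2 * mf w e) + d ^+ 2 * mf e e.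
  by rewrite !mflin (mfC M e w); ring.
have hA : d * (2 * (A + 1)) < mf w w by rewrite -ltr_pdivlMr//; lra.
have hB : d * (2 * B) < eps * mf w w by rewrite -ltr_pdivlMr//; lra.
have hw : mf w w / 2 <= mf (w + d *: e) (w + d *: e).
  have l1 : - `|mf w e| <= mf w e by rewrite lerNl ler_normr lexx orbT.
  have l2 : - `|mf e e| <= mf e e by rewrite lerNl ler_normr lexx orbT.
  have h1 : - (d * (2 * `|mf w e|)) <= d * (2 * mf w e).
    by rewrite -mulrN -mulrN !ler_wpM2l// ltW.
  have h2 : - (d * `|mf e e|) <= d ^+ 2 * mf e e.
    have := normr_ge0 (mf e e); set u := `|_| in l2 *; move: (mf e e) l2 => z l2 u0.
    have h3 : d ^+ 2 * u <= d * u by rewrite ler_wpM2r// expr2 ler_piMr// ltW.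
    have h4 : d ^+ 2 * - u <= d ^+ 2 * z by rewrite ler_wpM2l// sqr_ge0.
    by clear -R M h3 h4; lra.
  by rewrite E; move: hA; rewrite /A; clear -R M h1 h2 d0; lra.
split; first lra.
rewrite ltr_pdivrMr; last by lra.
have nv : `|w + d *: e| <= `|w| + `|e|.
  apply: le_trans (ler_normD _ _) _; rewrite lerD2l normrZ gtr0_norm//.
  by nra.
have : K * d * `|w + d *: e| <= d * B.
  have := normr_ge0 (w + d *: e); rewrite /B; set u := `|w + _| in nv *.
  move: nv n1 n2; move: `|w| `|e| => p q nv n1 n2 u0.
  have : K * u <= (K + 1) * (p + q + 1) by apply: ler_pM; clear -R M K0 nv n1 n2 u0; lra.
  by move=> h; rewrite -mulrA mulrCA ler_wpM2l// ltW.
have h3 := ler_wpM2l (ltW eps0) hw.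
by clear -R M hB h3 => h; lra.
Qed.

(* Reflecting [y] in a mirror that is nearly orthogonal to the tangent vector [w] moves it
   a little in the direction of [w] or [- w]. *)
Lemma refl_near y w e (eps : R) : surface M y -> mf y w = 0 -> 0 < mf w w -> 0 < eps ->
  exists2 d0, 0 < d0 & forall d, 0 < d -> d < d0 -> exists l : R, let v := w + d *: e in
    [/\ l * mf v v = - (2 * d * mf y e), 0 < mf v v, surface M (y + l *: v)
      & `|l *: v| < eps].
Proof.
move=> yM yw ww eps0.
have K0 : 0 <= 2 * `|mf y e| by rewrite mulr_ge0.
have [d0 d00 hd] := small_perturb e ww K0 eps0.
exists d0 => // d dp dd0; have [vv hv] := hd _ dp dd0.
set v := w + d *: e in vv hv *; exists (- (2 * d * mf y e / mf v v)); split=> //.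
- by field; rewrite gt_eqF.
- rewrite scaleNr; have := refl_surface vv yM; rewrite /refl.
  have -> // : 2 * mf y v = 2 * d * mf y e by rewrite /v mfDr mfZr yw; ring.
rewrite normrZ normrN normrM normfV (gtr0_norm vv) !normrM (gtr0_norm dp) ger0_norm//.
by move: hv; lra.
Qed.

Section Arc.
Variables (c a b : 'rV[R]_3) (h : R).
Hypotheses (cM : surface M c) (aM : surface M a) (bM : surface M b) (ab : a != b).
Hypotheses (ca : mf c a = h) (cb : mf c b = h).

(** Reflect [a] in mirrors whose normals are orthogonal to [c] and close to the tangent [w] of the
    circle: the image stays on the circle. The tilt along [b - a] does not affect [mf m], so the
    sign of [mf m w] decides in which direction to move. *)
Lemma arc_point m k (eps : R) : mf m a = k -> mf m b = k ->
  (forall x, surface M x -> mf c x = h -> mf m x = k -> x = a \/ x = b) ->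
  0 < eps -> exists y, [/\ surface M y, mf c y = h, k < mf m y & `|y - a| < eps].
Proof.
move=> ma mb nd eps0; set d := b - a; set w := cross M c a.
have md : mf m d = 0 by rewrite /d !mflin ma mb subrr.
have cd : mf c d = 0 by rewrite /d !mflin ca cb subrr.
have cw : mf c w = 0 by rewrite mfC; exact: mf_cross_l.
have aw : mf a w = 0 by rewrite mfC; exact: mf_cross_r.
have ww : 0 < mf w w.
  rewrite /w mf_cross !surface_mf// ca (mfC M a) ca -!expr2.
  exact: circle_gap cM aM bM ab ca cb.
have ad : mf a d < 0 by rewrite /d !mflin surface_mf//; have := mf_lt_sg aM bM ab; lra.
have dE : d = b - a by [].
clearbody d w.
have pt (s : R) : s ^+ 2 = 1 -> exists l, 0 < l /\ exists2 dd, 0 < dd &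
  let y := a + l *: (s *: w + dd *: d) in [/\ surface M y, mf c y = h,
    mf m y = k + l * s * mf m w, `|y - a| < eps & y != a /\ y != b].
  move=> s2.
  have [||d0 d00 hd] := @refl_near a (s *: w) d eps aM _ _ eps0.
  - by rewrite mfZr aw mulr0.
  - by rewrite mfZl mfZr mulrA -expr2 s2 mul1r.
  have [||l [lv vv yM ln]] := hd (d0 / 2); [lra|lra|].
  set dd := d0 / 2 in lv vv yM ln; have dd0 : 0 < dd by rewrite /dd; lra.
  have l0 : 0 < l.
    rewrite -(pmulr_lgt0 l vv) lv; have : 0 < dd * - mf a d by rewrite mulr_gt0//; lra.
    lra.
  exists l; split=> //; exists dd => //; split => //.
  - by rewrite !mflin ca cw cd; ring.
  - by rewrite !mflin ma md; ring.
  - by rewrite addrC addKr.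
  have v0 : s *: w + dd *: d != 0.
    by apply/eqP => v0; move: vv; rewrite v0 mf0l ltxx.
  split; first by rewrite -subr_eq0 addrC addKr scaler_eq0 negb_or v0 gt_eqF.
  apply/eqP => yb.
  have E : l *: (s *: w + dd *: d) = d.
    by apply/esym; rewrite {1}dE -yb addrC addKr.
  have := congr1 (mf a) E; rewrite !mflin aw => E1.
  have ldd : l * dd = 1.
    have : (l * dd - 1) * mf a d = 0 by lra.
    by move=> /eqP; rewrite mulf_eq0 (lt_eqF ad) orbF subr_eq0 => /eqP.
  have : s *: w = 0.
    have : l *: (s *: w) = 0.
      by move: E; rewrite scalerDr [l *: (dd *: d)]scalerA ldd scale1r -[RHS]add0r => /addIr.
    by move/eqP; rewrite scaler_eq0 gt_eqF//= => /eqP.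
  move=> /(congr1 (mf (s *: w))); rewrite mf0r mfZl mfZr mulrA -expr2 s2 mul1r => w0.
  by move: ww; rewrite w0 ltxx.
(* Otherwise [pt] would give a third point of the circle with [mf m y = k]. *)
have mw : mf m w != 0.
  apply/eqP => mw; have [l [l0 [dd dd0 [yM cy my _ [ya yb]]]]] := pt 1 (expr1n _ _).
  have my' := my; rewrite mw mulr0 addr0 in my'.
  by have [/eqP|/eqP] := nd _ yM cy my'; rewrite ?(negbTE ya) ?(negbTE yb).
have s2 : Num.sg (mf m w) ^+ 2 = 1 by rewrite sqr_sg mw.
have [l [l0 [dd dd0 [yM cy my ny _]]]] := pt (Num.sg (mf m w)) s2.
eexists; split; [exact: yM|exact: cy| |exact: ny].
by rewrite my ltrDl -mulrA mulr_gt0// -normrEsg normr_gt0.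
Qed.

End Arc.

(** Here the normal of the mirror is close to the component of [c] tangent at [y], the direction in
    which [mf c] grows; [s] chooses the side of the circle. *)
Lemma near_circle c h (s eps : R) y : surface M c -> 0 < sg * (sg ^+ 2 - h ^+ 2) -> surface M y -> mf c y = h -> s ^+ 2 = 1 -> 0 < eps ->
  exists z, [/\ surface M z, `|z - y| < eps & 0 < s * (mf c z - h)].
Proof.
move=> cM gap yM cy s2 eps0.
set w := c - (sg * h) *: y.
have yw : mf y w = 0.
  by rewrite /w !mflin (mfC M y c) cy surface_mf//; rewrite mulrAC sg2 mul1r subrr.
have cw : mf c w = sg * (sg ^+ 2 - h ^+ 2).
  by rewrite /w !mflin surface_mf// cy !expr2 sg2; ring.
have wE : w = c - (sg * h) *: y by [].
clearbody w.
have ww : mf w w = sg * (sg ^+ 2 - h ^+ 2).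
  by rewrite {1}wE mfDl mfNl mfZl cw yw; ring.
have [||d0 d00 hd] := @refl_near y (- (sg * s) *: w) y eps yM _ _ eps0.
- by rewrite mfZr yw mulr0.
- rewrite mfZl mfZr mulrA mulrNN -expr2 exprMn s2 expr2 sg2 mulr1 mul1r ww.
  exact: gap.
have n0 := normr_ge0 h; set d := Num.min (d0 / 2) (mf w w / (2 * (`|h| + 1))).
have dp : 0 < d by rewrite lt_min !divr_gt0 ?ww//; lra.
have [||l [lv vv zM ln]] := hd d => //.
  by rewrite /d gt_min; apply/orP; left; lra.
exists (y + l *: (- (sg * s) *: w + d *: y)); split=> //.
  by rewrite addrC addKr.
rewrite (surface_mf yM) in lv.
move: vv lv; set V := mf _ _ => vv lv; rewrite mfDr mfZr mfDr !mfZr cy cw -ww.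
have dh : d * (2 * (`|h| + 1)) <= mf w w.
  by rewrite -ler_pdivlMr; [rewrite /d ge_min lexx orbT|lra].
have hh : - `|h| <= s * h <= `|h|.
  rewrite -ler_norml normrM; move/eqP: s2; rewrite sqrf_eq1 => /orP[]/eqP->.
    by rewrite normr1 mul1r.
  by rewrite normrN1 mul1r.
have V0 := vv.
have : s * (l * (- (sg * s) * mf w w + d * h)) * V = s * (l * V) * (- (sg * s) * mf w w + d * h) by ring.
rewrite lv => E.
have E' : s * (l * (- (sg * s) * mf w w + d * h)) * V
  = 2 * d * (mf w w - sg * d * (s * h)).
  rewrite E; have : sg * sg = 1 by exact: sg2.
  move: (sg) => g g2.
  transitivity (2 * d * (g * g * s ^+ 2 * mf w w - g * d * (s * h))); first ring.
  by rewrite g2 s2 !mul1r.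
have pos : 0 < mf w w - sg * d * (s * h).
  move: hh dh n0; rewrite /form_sign; move: `|h| (s * h) (mf w w) => p q r.
  by case: M => /andP[]; nra.
by rewrite -(pmulr_lgt0 _ vv) addrC addKr E' mulr_gt0// mulr_gt0.
Qed.

End LocalGeometry.

(** * Geodesics as normalised segments *)

Section Geodesic.
Context {R : realType} (M : plane).
Implicit Types (x y m : 'rV[R]_3) (s : R).
Local Notation mf := (@metric_form R M).
Local Notation sg := (@form_sign R M).

Definition geo_sq x y s : R := 1 - 2 * s * (1 - s) * (1 - sg * mf x y).

(** The segment from [x] to [y], projected to the surface from the origin. *)
Definition geo x y s : 'rV[R]_3 := (Num.sqrt (geo_sq x y s))^-1 *: ((1 - s) *: x + s *: y).

Lemma geo_sqE x y s : surface M x -> surface M y ->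
  mf ((1 - s) *: x + s *: y) ((1 - s) *: x + s *: y) = sg * geo_sq x y s.
Proof.
move=> xM yM; rewrite !mflin (mfC M y x) !surface_mf// /geo_sq.
have : sg * sg = 1 by exact: sg2.
move: (sg) (mf x y) => g p g2.
transitivity (g - 2 * s * (1 - s) * (g - g * g * p)); last by ring.
by rewrite g2; ring.
Qed.

Definition not_antipodal x y := M = Sphere -> -1 < mf x y.

Lemma geo_sq_gt0 x y s : surface M x -> surface M y -> not_antipodal x y ->
  s \in `[0, 1] -> 0 < geo_sq x y s.
Proof.
move=> xM yM; have := mf_le_sg xM yM; rewrite /not_antipodal in_itv /= /geo_sq /form_sign.
have h : 4 * (s * (1 - s)) <= 1 by have := sqr_ge0 (2 * s - 1); nra.
case: M => [le /(_ erefl) lt|le _] /andP[s0 s1].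
  by have : 0 <= s * (1 - s) by [nra]; nra.
by have : 0 <= s * (1 - s) by [nra]; nra.
Qed.

Lemma mf_geo m x y s :
  mf m (geo x y s) = ((1 - s) * mf m x + s * mf m y) / Num.sqrt (geo_sq x y s).
Proof. by rewrite /geo mfZr mfDr !mfZr mulrC. Qed.

Lemma geo0 x y : geo x y 0 = x.
Proof. by rewrite /geo /geo_sq mulr0 !mul0r subr0 sqrtr1 invr1 scale0r addr0 !scale1r. Qed.

Lemma geo1 x y : geo x y 1 = y.
Proof. by rewrite /geo /geo_sq subrr mulr0 !mul0r subr0 sqrtr1 invr1 scale0r add0r !scale1r. Qed.

(* On the hyperboloid the sign of the last coordinate is checked against [x]. *)
Lemma geo_surface x y s : surface M x -> surface M y -> not_antipodal x y ->
  s \in `[0, 1] -> surface M (geo x y s).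
Proof.
move=> xM yM na s01; have q0 := geo_sq_gt0 xM yM na s01.
have r0 : 0 < Num.sqrt (geo_sq x y s) by rewrite sqrtr_gt0.
have E : mf (geo x y s) (geo x y s) = sg.
  rewrite /geo mfZl mfZr geo_sqE// -[geo_sq x y s in X in _ * (_ * X)]sqr_sqrtr ?ltW//.
  by field; rewrite gt_eqF.
move: xM yM s01 E r0; rewrite /surface; case: (M) => //= -[_ x2] [_ y2].
rewrite in_itv /= => /andP[s0 s1] -> r0; split=> //.
by rewrite /geo !mxE mulr_gt0// ?invr_gt0//; nra.
Qed.

(** This is what makes discs star-shaped about their centre. *)
Lemma geo_cap x y s : surface M x -> surface M y -> not_antipodal x y ->
  s \in `[0, 1] -> mf y x <= mf y (geo x y s).
Proof.
move=> xM yM na s01; have q0 := geo_sq_gt0 xM yM na s01.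
have r0 : 0 < Num.sqrt (geo_sq x y s) by rewrite sqrtr_gt0.
rewrite mf_geo ler_pdivlMr// (surface_mf yM).
have := mf_le_sg xM yM; move: na s01; rewrite /not_antipodal in_itv /=.
have := sqr_sqrtr (ltW q0); rewrite {2}/geo_sq (mfC M y x) /form_sign.
move: (Num.sqrt _) r0 (mf x y) => r r0 p.
case: M => rE na /andP[s0 s1] le.
  have {}na := na erefl.
  have [A0|A0] := leP 0 ((1 - s) * p + s * 1).
    have [p0|p0] := leP 0 p; last by nra.
    have : r <= 1 by have : 0 <= s * (1 - s) by [nra]; nra.
    by nra.
  rewrite -lerN2 -ler_sqr ?nnegrE; [|nra|nra].
  have : 0 <= (1 - p ^+ 2) * (s * (- (s + 2 * (1 - s) * p))).
    by apply: mulr_ge0; [nra|apply: mulr_ge0 => //; nra].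
  rewrite !sqrrN exprMn rE; nra.
have r1 : (1 - s) ^+ 2 <= r ^+ 2.
  rewrite rE; have : 0 <= s * (1 - s) by nra.
  nra.
rewrite -lerN2 -ler_sqr ?nnegrE; [|nra|nra].
rewrite !sqrrN exprMn.
have : 0 <= (p ^+ 2 - 1) * (r ^+ 2 - (1 - s) ^+ 2) by apply: mulr_ge0; nra.
rewrite rE; nra.
Qed.

Lemma geo_continuous x y : surface M x -> surface M y -> not_antipodal x y ->
  continuous (fun s => geo x y (cl s)).
Proof.
move=> xM yM na s.
have c1 : {for s, continuous (cl : R -> R)} by exact: (@cl_continuous R).
have c2 : {for s, continuous (fun s => 1 - cl s)}.
  by apply: continuousB => //; exact: cst_continuous.
have q0 := geo_sq_gt0 xM yM na (cl_in s).
apply: (@continuousZ _ _ _ (fun s => (Num.sqrt (geo_sq x y (cl s)))^-1)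
  (fun s => (1 - cl s) *: x + cl s *: y)).
  apply: continuousV; first by rewrite gt_eqF// sqrtr_gt0.
  apply: continuous_comp; last exact: sqrt_continuous.
  rewrite /geo_sq; apply: continuousB; first exact: cst_continuous.
  apply: continuousM; last exact: cst_continuous.
  apply: continuousM => //; apply: continuousM => //; exact: cst_continuous.
by apply: continuousD; apply: continuousZ => //; exact: cst_continuous.
Qed.

Lemma geo_near x (eps : R) : surface M x -> 0 < eps -> exists2 dl, 0 < dl &
  forall y, surface M y -> `|y - x| < dl ->
    not_antipodal x y /\ forall s, s \in `[0, 1] -> `|geo x y s - x| < eps.
Proof.
move=> xM eps0; have F0 := fnorm_ge0 x; have x0 := normr_ge0 x; set F := fnorm x in F0.
set B := 2 + 2 * F * (`|x| + 1).
have FX : 0 <= F * `|x| by rewrite mulr_ge0.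
have B0 : 0 < B by rewrite /B; nra.
exists (Num.min 1 (Num.min (1 / (2 * (F + 1))) (eps / B))).
  by rewrite !lt_min ltr01 !divr_gt0// mulr_gt0//; lra.
move=> y yM; rewrite !lt_min => /and3P[d1]; rewrite !ltr_pdivlMr//; last by lra.
have n0 := normr_ge0 (y - x); move=> d2 d3.
set E := 1 - sg * mf x y.
have hE : `|E| <= F * `|y - x|.
  apply: le_trans (mf_bound M x (y - x)).
  have -> : E = - (sg * mf x (y - x)).
    by rewrite /E mfDr mfNr surface_mf// mulrBr sg2; ring.
  by rewrite normrN normrM /form_sign; case: (M); rewrite ?normrN normr1 mul1r.
have E2 : `|E| <= 1 / 2 by nra.
have /andP[El Er] : - (1 / 2) <= E <= 1 / 2 by rewrite -ler_norml.
have na : not_antipodal x y.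
  by rewrite /not_antipodal; move: El Er; rewrite /E /form_sign; case: (M) => // *; lra.
split=> // s s01; move: (s01); rewrite in_itv /= => /andP[s0 s1].
have q0 := geo_sq_gt0 xM yM na s01.
have r0 : 0 < Num.sqrt (geo_sq x y s) by rewrite sqrtr_gt0.
have := sqr_sqrtr (ltW q0); rewrite /geo; move: (Num.sqrt _) r0 => r r0.
rewrite /geo_sq -/E => rE.
set v := (1 - s) *: x + s *: y.
have vx : v - x = s *: (y - x) by rewrite /v; apply/rowP => i; rewrite !mxE; ring.
have nvx : `|v - x| <= `|y - x| by rewrite vx normrZ (ger0_norm s0); nra.
have nv : `|v| <= `|x| + 1.
  have -> : v = x + (v - x) by rewrite addrC subrK.
  by apply: le_trans (ler_normD _ _) _; lra.
have ss : 0 <= 2 * s * (1 - s) <= 1.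
  have := sqr_ge0 (2 * s - 1); clear -R M s0 s1 => ?; apply/andP; split; nra.
have q1 : `|1 - r ^+ 2| <= `|E|.
  rewrite rE (_ : _ - _ = (2 * s * (1 - s)) * E); last by ring.
  by move/andP: ss => [ss0 ss1]; rewrite normrM ger0_norm// ler_piMl.
have r2 : 1 / 2 <= r.
  by clear -R M q1 E2 r0; move: q1; have /ler_normlP[] := lexx `|1 - r ^+ 2|; nra.
have rp : 0 < r * (1 + r) by rewrite mulr_gt0// addr_gt0.
have hr : `|r^-1 - 1| <= 2 * (F * `|y - x|).
  have -> : r^-1 - 1 = (1 - r ^+ 2) / (r * (1 + r)).
    by field; rewrite !gt_eqF// addr_gt0.
  rewrite normrM normfV [X in _ / X]gtr0_norm// ler_pdivrMr//.
  have : 0 <= F * `|y - x| by rewrite mulr_ge0.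
  move: q1 hE r2; clear -R M; move: (F * _) `|E| `|1 - _| => f e' d q1 hE r2 f0; nra.
have -> : r^-1 *: v - x = (r^-1 - 1) *: v + (v - x).
  by rewrite scalerBl scale1r addrA subrK.
apply: le_lt_trans (ler_normD _ _) _; rewrite normrZ.
have h : `|r^-1 - 1| * `|v| <= 2 * (F * `|y - x|) * (`|x| + 1) by exact: ler_pM.
have d3' : `|y - x| * (2 + 2 * F * (`|x| + 1)) < eps := d3.
by clear -R M h d3' nvx n0; lra.
Qed.

End Geodesic.

(** * Unions of discs and the two sides of a disc *)

Section Union.
Context {R : realType} (M : plane) (n : nat) (p : 'I_n -> 'rV[R]_3) (h : 'I_n -> R).
Implicit Types (a b c m u v w x y z : 'rV[R]_3) (i j : 'I_n) (k l s t eps : R).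
Local Notation mf := (@metric_form R M).
Local Notation sg := (@form_sign R M).

Definition outside z := surface M z /\ forall i, mf (p i) z < h i.

Definition inner : set 'rV[R]_3 := [set x | surface M x /\ exists2 eps, 0 < eps &
  forall y, surface M y -> `|y - x| < eps -> exists i, h i <= mf (p i) y].

(** Unlike [outside], this set contains the boundary points: it is what a turned disc has to
    avoid. *)
Definition outer x := surface M x /\ ~ inner x.

Lemma inner_surface x : inner x -> surface M x. Proof. by case. Qed.

Lemma inner_open x : inner x -> exists2 eps, 0 < eps &
  forall y, surface M y -> `|y - x| < eps -> inner y.
Proof.
move=> [xM [e e0 he]]; exists (e / 2); first by lra.
move=> y yM yx; split=> //; exists (e / 2); first by lra.
move=> z zM zy; apply: he => //.
have -> : z - x = (z - y) + (y - x) by rewrite addrA subrK.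
by apply: le_lt_trans (ler_normD _ _) _; lra.
Qed.

Lemma inner_cap x : inner x -> exists i, h i <= mf (p i) x.
Proof. by move=> [xM [e e0 he]]; apply: he; rewrite ?subrr ?normr0. Qed.

Lemma cap_inner i x : surface M x -> h i < mf (p i) x -> inner x.
Proof.
move=> xM hx; split=> //; have [|d d0 hd] := mf_near M (p i) x (e := mf (p i) x - h i).
  lra.
exists d => // y yM yx; exists i; have /ltr_normlP[] := hd _ yx; lra.
Qed.

Lemma outer_le i x : outer x -> mf (p i) x <= h i.
Proof. by move=> [xM nO]; rewrite leNgt; apply/negP => hx; apply: nO; exact: cap_inner hx. Qed.

Lemma outside_outer z : outside z -> outer z.
Proof. by move=> [zM hz]; split=> // /inner_cap[i]; rewrite leNgt hz. Qed.

(** Supplies the short paths that [angle_lift] asks for. *)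
Lemma inner_local x eps : inner x -> 0 < eps -> exists2 d, 0 < d &
  forall y, inner y -> `|y - x| < d -> exists g : R -> 'rV[R]_3,
  [/\ continuous g, g 0 = x, g 1 = y &
    forall t, t \in `[0, 1] -> inner (g t) /\ `|g t - x| < eps].
Proof.
move=> xO e0; have xM := inner_surface xO; have [d1 d10 h1] := inner_open xO.
have [d d0 hd] := @geo_near _ M x (Num.min eps d1) xM ltac:(by rewrite lt_min e0).
exists d => // y /inner_surface yM yx; have [na hy] := hd y yM yx.
exists (fun t => geo M x y (cl t)); split.
- exact: geo_continuous.
- by rewrite cl0 geo0.
- by rewrite cl1 geo1.
move=> t t01; rewrite cl_id//; have := hy t t01; rewrite lt_min => /andP[l1 l2].
by split=> //; apply: h1 => //; exact: geo_surface.
Qed.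

Definition inside c k := forall x, surface M x -> k < mf c x -> inner x.

Lemma inside_outer c k x : inside c k -> outer x -> mf c x <= k.
Proof. by move=> D [xM nO]; rewrite leNgt; apply/negP => kx; apply: nO; exact: D. Qed.

(** The plane [mf m = l] cuts the circle of the disc in two arcs; passing from [m] and [l] to [- m]
    and [- l] exchanges them, and the arc meant is always the one where [l < mf m]. *)
Record chord c k m l a b : Prop := Chord {
  chord_c : surface M c; chord_a : outer a; chord_b : outer b; chord_ab : a != b;
  chord_ca : mf c a = k; chord_cb : mf c b = k; chord_ma : mf m a = l; chord_mb : mf m b = l;
  chord_nd : forall x, surface M x -> mf c x = k -> mf m x = l -> x = a \/ x = b;
  chord_in : inside c k }.

Definition cont (q : 'rV[R]_3 -> R) := forall x eps, inner x -> 0 < eps ->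
  exists2 d, 0 < d & forall y, inner y -> `|y - x| < d -> `|q y - q x| < eps.

(* [q] is the direction of (mf c x - k, mf m x - l), normalised on the disc. *)
Definition angle c k m l (q : 'rV[R]_3 -> R) :=
  [/\ forall x, inner x -> ang (q x) (mf c x - k) (mf m x - l), cont q &
      forall x, surface M x -> k < mf c x -> - (pi / 2) < q x < pi / 2].

Definition path_in (g : R -> 'rV[R]_3) := continuous g /\ forall t, inner (g t).

Lemma cont_path q g : cont q -> path_in g -> continuous (q \o g).
Proof.
move=> cq [cg gO] t; apply: (@cts_near R R^o R^o) => e e0.
have [d d0 hd] := cq _ _ (gO t) e0.
have [d' d'0 hd'] := near_cts (cg t) d0.
by exists d' => // y yt; apply: hd => //; exact: hd'.
Qed.

Lemma path_ivt (f : R -> R) (v : R) : continuous f -> f 0 < v ->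
  (forall t, t \in `[0, 1] -> f t != v) -> f 1 < v.
Proof.
move=> cf f0 ne; rewrite ltNge; apply/negP => f1.
have [||t t01 ft] := @IVT R f 0 1 v ler01.
- exact: continuous_subspaceT.
- by rewrite ge_min le_max (ltW f0) f1 orbT.
by have := ne t t01; rewrite ft eqxx.
Qed.

Lemma path_ivt_gt (f : R -> R) (v : R) : continuous f -> v < f 0 ->
  (forall t, t \in `[0, 1] -> f t != v) -> v < f 1.
Proof.
move=> cf f0 ne; rewrite -ltrN2; apply: (@path_ivt (fun t => - f t)).
- by move=> t; apply: (@continuous_comp _ _ _ f (fun s : R => - s)); [exact: cf|exact: opp_continuous].
- by rewrite ltrN2.
by move=> t t01; rewrite eqr_opp ne.
Qed.

(** The cosine vanishes on the boundary of the strip, so the path cannot leave it. *)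
Lemma path_strip (f : R -> R) (v : R) : continuous f ->
  (forall t, t \in `[0, 1] -> 0 < cos (f t - v)) ->
  - (pi / 2) < f 0 - v < pi / 2 -> - (pi / 2) < f 1 - v < pi / 2.
Proof.
move=> cf cp /andP[f0 f0']; have h1 : v - pi / 2 < f 0 by lra.
have h2 : f 0 < v + pi / 2 by lra.
have := path_ivt_gt cf h1; have := path_ivt cf h2.
have n1 t : t \in `[0, 1] -> f t != v + pi / 2.
  move=> /cp ct; apply/eqP => e; move: ct; rewrite e addrAC subrr add0r cos_pihalf ltxx //.
have n2 t : t \in `[0, 1] -> f t != v - pi / 2.
  by move=> /cp ct; apply/eqP => e; move: ct; rewrite e addrAC subrr add0r cosN cos_pihalf ltxx.
by move=> /(_ n1) h3 /(_ n2) h4; apply/andP; split; lra.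
Qed.

Lemma ang_pos (u v : R) : 0 < u -> exists2 q, - (pi / 2) < q < pi / 2 & ang q u v.
Proof.
move=> u0; exists (atan (v / u)); first by rewrite atan_gtNpi2 atan_ltpi2.
have c0 : 0 < cos (atan (v / u)) by rewrite cos_gt0_pihalf// atan_gtNpi2 atan_ltpi2.
exists (u / cos (atan (v / u))); first by rewrite divr_gt0.
split; first by rewrite divfK// gt_eqF.
by rewrite mulrAC -mulrA -[X in u * X]/(tan _) atanK mulrC divfK// gt_eqF.
Qed.

Section Disc.
Variables (c m a b : 'rV[R]_3) (k l : R).
Hypotheses (scO : simply_connected R inner) (D : chord c k m l a b).

Lemma chord_lt : k < sg.
Proof.
case: D => cM [aM _] [bM _] ab ca cb *; exact: circle_h_lt cM aM bM ab ca cb.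
Qed.

Lemma chord_na x : surface M x -> k <= mf c x -> not_antipodal M x c.
Proof.
case: D => cM [aM _] [bM _] ab ca cb ? ? ? ? xM kx MS.
rewrite mfC; apply: lt_le_trans kx; exact: circle_h_gt cM aM bM ab ca cb MS.
Qed.

Lemma chord_uv0 x : inner x -> (mf c x - k) ^+ 2 + (mf m x - l) ^+ 2 != 0.
Proof.
case: D => cM [aM aO] [bM bO] ab ca cb ma mb nd _ xO; apply/eqP => E.
have [e1 e2] : mf c x - k = 0 /\ mf m x - l = 0.
  by split; apply/eqP; rewrite -sqrf_eq0; apply/eqP; have := sqr_ge0 (mf c x - k); have := sqr_ge0 (mf m x - l); lra.
have [||E'|E'] := nd _ (inner_surface xO); try lra.
  by apply: aO; rewrite -E'.
by apply: bO; rewrite -E'.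
Qed.

Lemma star_path (e x : 'rV[R]_3) (r : R) : surface M e -> inside e r -> surface M x ->
  not_antipodal M x e -> r < mf e x ->
  path_in (fun t => geo M x e (cl t)) /\ forall t, r < mf e (geo M x e (cl t)).
Proof.
move=> eM G xM na rx.
have E t : r < mf e (geo M x e (cl t)).
  by apply: (lt_le_trans rx); apply: geo_cap => //; exact: cl_in.
split=> //; split; first exact: geo_continuous.
by move=> t; apply: G => //; apply: geo_surface => //; exact: cl_in.
Qed.

(** The pair vanishes only at [a] and [b], so simple connectivity gives an argument on all of
    [inner]. Chosen in the strip at the centre, it stays there along the radii of the disc, where
    its cosine is positive. *)
Lemma angle_exists : exists q, angle c k m l q.
Proof.
have k1 := chord_lt; have cM := chord_c D; have Din := chord_in D.
have cc : k < mf c c by rewrite surface_mf.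
have cO : inner c by exact: Din.
have [|q0 q0b q0a] := @ang_pos (mf c c - k) (mf m c - l); first by lra.
have cu (w : 'rV[R]_3) (r : R) : continuous (fun x : 'rV[R]_3 => mf w x - r).
  move=> x; apply: (@continuousB _ R^o); last exact: cst_continuous.
  exact: mf_continuous.
have [q [qc qa qe]] := angle_lift (cu c k) (cu m l) chord_uv0 scO
  inner_local cO q0a.
exists q; split=> // x xM kx.
have [Pg Pk] := star_path cM Din xM (chord_na xM (ltW kx)) kx.
set g := (fun t => _) in Pg.
pose g' t := g (1 - t).
have Pg' : path_in g'.
  case: Pg => cg gO; split=> [t|t]; last exact: gO.
  apply: continuous_comp; last exact: cg.
  by apply: (@continuousB _ R^o); [exact: cst_continuous|exact: cvg_id].
have := @path_strip (q \o g') 0 (cont_path qe Pg'); rewrite !subr0 /= => H.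
have e1 : g' 1 = x by rewrite /g' /g subrr cl0 geo0.
have e0 : g' 0 = c by rewrite /g' /g subr0 cl1 geo1.
move: H; rewrite e1 e0 qc => H; apply: H => // t _; rewrite subr0.
have [r r0 [e _]] := qa _ (Pg'.2 t); rewrite -(pmulr_rgt0 _ r0) -e subr_gt0.
exact: Pk.
Qed.

End Disc.
End Union.

(** * The pencil of circles through two points *)

Section Sides.
Context {R : realType} (M : plane) (n : nat) (p : 'I_n -> 'rV[R]_3) (h : 'I_n -> R).
Implicit Types (a b c m u v w x y z : 'rV[R]_3) (i j : 'I_n) (k l s t eps : R).
Local Notation mf := (@metric_form R M).
Local Notation sg := (@form_sign R M).
Local Notation inn := (inner M p h).
Local Notation chord := (chord M p h).
Local Notation angle := (angle M p h).

Lemma perp_comb c a b k w : surface M c -> surface M a -> surface M b -> a != b ->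
  mf c a = k -> mf c b = k -> mf w (b - a) = 0 ->
  exists r s : R, w = r *: c + s *: perp M c a b.
Proof.
move=> cM aM bM ab ca cb wd; set d := b - a in wd; set P := perp M c a b.
have P0 : 0 < mf P P by exact: perp_gt0 cM aM bM ab ca cb.
have cd : mf c d = 0 by rewrite /d !mflin ca cb subrr.
have Pc : mf P c = 0 by exact: mf_cross_l.
have Pd : mf P d = 0 by exact: mf_cross_r.
exists (sg * mf w c), (mf w P / mf P P); apply/eqP; rewrite -subr_eq0 opprD; apply/eqP.
have gg : sg * sg = 1 by exact: sg2.
apply: (@det_orth _ M c d P) => //; first by rewrite /det -/P gt_eqF.
- rewrite !(mfDl, mfNl, mfZl) Pc (surface_mf cM) mulrAC gg; ring.
- rewrite !(mfDl, mfNl, mfZl) Pd cd wd; ring.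
- by rewrite !(mfDl, mfNl, mfZl) (mfC M c P) Pc; field; rewrite gt_eqF.
Qed.

(** An affine function vanishing at [a] and [b] belongs to the pencil spanned by [mf c - k] and
    [mf m - l]. *)
Lemma chord_comb c m k l a b w : chord c k m l a b -> mf w (b - a) = 0 ->
  exists r s : R, forall x, mf w x - mf w a = r * (mf c x - k) + s * (mf m x - l).
Proof.
case=> cM [aM _] [bM _] ab ca cb ma mb nd _ wd; set P := perp M c a b.
have md : mf m (b - a) = 0 by rewrite !mflin ma mb subrr.
have [r0 [s0 mE]] := perp_comb cM aM bM ab ca cb md; rewrite -/P in mE.
have Pab : mf P b = mf P a.
  by apply/eqP; rewrite -subr_eq0 -mfNr -mfDr; apply/eqP; exact: mf_cross_r.
have Pnd x : surface M x -> mf c x = k -> mf P x = mf P a -> x = a \/ x = b.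
  move=> xM cx Px; apply: (perp_nondeg cM aM bM ab ca cb) => //.
  by rewrite mfDr mfNr -/P Px subrr.
(* Were [m] a multiple of [c], the function [mf m] would be constant on the circle. *)
have s0n : s0 != 0.
  apply/eqP => s00.
  have [y [yM cy Py _]] := arc_point cM aM bM ab ca cb erefl Pab Pnd ltr01.
  have my : mf m y = l by rewrite -ma mE s00 scale0r addr0 !mfZl cy ca.
  by have [e|e] := nd y yM cy my; move: Py; rewrite e ?Pab ltxx.
have [r1 [s1 wE]] := perp_comb cM aM bM ab ca cb wd; rewrite -/P in wE.
exists (r1 - s1 * r0 / s0), (s1 / s0) => x.
rewrite -ma -ca wE mE !(mfDl, mfZl); field; exact: s0n.
Qed.

Lemma chordN c m k l a b : chord c k m l a b -> chord c k (- m) (- l) a b.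
Proof.
case=> *; split=> //; rewrite ?mfNl; try congr (- _); move=> //.
by move=> x xM cx; rewrite mfNl => /oppr_inj mx; auto.
Qed.

Lemma chordC c m k l a b : chord c k m l a b -> chord c k m l b a.
Proof.
case=> cM aO bO ab *; split=> //; first by rewrite eq_sym.
by move=> x *; apply/or_comm; auto.
Qed.

Lemma angleN c m k l q : angle c k m l q -> angle c k (- m) (- l) (fun x => - q x).
Proof.
move=> [qa qc qs]; split.
- move=> x /qa[r r0 [e1 e2]]; exists r => //; split; first by rewrite cosN.
  by rewrite sinN mfNl mulrN -e2; ring.
- move=> x eps xO e0; have [d d0 hd] := qc x eps xO e0; exists d => // y yO yx.
  by rewrite -opprD normrN; exact: hd.
- by move=> x xM kx; have := qs x xM kx; lra.
Qed.

(** Go from [x0] to [x] through the centre of the disc. *)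
Lemma inside_strip q (e : 'rV[R]_3) (r t : R) x0 : cont M p h q -> surface M e ->
  inside M p h e r -> r < sg -> (M = Sphere -> -1 <= r) ->
  (forall x, surface M x -> r < mf e x -> 0 < cos (q x - t)) ->
  surface M x0 -> r < mf e x0 -> - (pi / 2) < q x0 - t < pi / 2 ->
  forall x, surface M x -> r < mf e x -> - (pi / 2) < q x - t < pi / 2.
Proof.
move=> qc eM eO rs rS cp x0M rx0 q0 x xM rx.
have na y : surface M y -> r < mf e y -> not_antipodal M y e.
  by move=> yM ry /rS r1; rewrite mfC; exact: le_lt_trans r1 ry.
have [P0 K0] := star_path eM eO x0M (na _ x0M rx0) rx0.
have [P1 K1] := star_path eM eO xM (na _ xM rx) rx.
have := path_strip (cont_path qc P0); rewrite /= cl0 cl1 geo0 geo1 => /(_ t) H.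
have {H} qe : - (pi / 2) < q e - t < pi / 2.
  by apply: H => // s _; apply: cp; [exact/inner_surface/(P0.2)|exact: K0].
set g := (fun s => geo M x e _) in P1 K1.
have Pg' : path_in M p h (fun s => g (1 - s)).
  case: P1 => cg gO; split=> [s|s]; last exact: gO.
  apply: continuous_comp; last exact: cg.
  by apply: (@continuousB _ R^o); [exact: cst_continuous|exact: cvg_id].
have := path_strip (cont_path qc Pg') (v := t).
rewrite /= /g subr0 subrr cl0 cl1 geo0 geo1; apply => // s _.
by apply: cp; [exact/inner_surface/(P1.2)|exact: K1].
Qed.

(* Adding multiples of sg - mf a x, which is nonnegative and vanishes at [a], turns the
   equation of a disc into that of a larger set bounded by a circle through [a] and [b]. *)
Lemma window c m k l a b q (e : 'rV[R]_3) (r : R) : chord c k m l a b -> angle c k m l q ->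
  surface M e -> inside M p h e r -> r < sg -> (M = Sphere -> -1 <= r) ->
  exists t, forall x, surface M x -> r < mf e x -> - (pi / 2) < q x - t < pi / 2.
Proof.
move=> D [qa qc qs] eM eO rs rS.
have [cM aO bO ab ca cb ma mb nd _] := D; have [aM _] := aO; have [bM _] := bO.
have ta : 0 < sg - mf a b by have := mf_lt_sg aM bM ab; lra.
(* The two factors are nonnegative because [a] and [b] are not in [inner], and they make [mf w] take
   the same value at [a] and [b], which places it in the pencil. *)
set A := (r - mf e a) / (sg - mf a b); set B := (r - mf e b) / (sg - mf a b).
have A0 : 0 <= A by rewrite divr_ge0 ?(ltW ta)// subr_ge0; exact: inside_outer eO aO.
have B0 : 0 <= B by rewrite divr_ge0 ?(ltW ta)// subr_ge0; exact: inside_outer eO bO.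
set w := e - A *: b - B *: a.
have wE x : mf w x - mf w a = (mf e x - r) + A * (sg - mf b x) + B * (sg - mf a x).
  rewrite /w !(mfDl, mfNl, mfZl) (mfC M b a) (surface_mf aM) /A; field; lra.
have wb : mf w (b - a) = 0.
  by rewrite mfDr mfNr wE (surface_mf bM) /B; field; lra.
have [al [be wF]] := chord_comb D wb.
have pos x : surface M x -> r < mf e x -> 0 < al * (mf c x - k) + be * (mf m x - l).
  move=> xM rx; rewrite -wF wE.
  have : 0 <= A * (sg - mf b x) by rewrite mulr_ge0// subr_ge0 mf_le_sg.
  have : 0 <= B * (sg - mf a x) by rewrite mulr_ge0// subr_ge0 mf_le_sg.
  by lra.
have eOe : inn e by apply: eO => //; rewrite surface_mf.
have re : r < mf e e by rewrite surface_mf.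
have cospos x : surface M x -> r < mf e x -> 0 < al * cos (q x) + be * sin (q x).
  move=> xM rx; have := pos x xM rx; have [s s0 [-> ->]] := qa _ (eO _ xM rx).
  by rewrite mulrCA (mulrCA be) -mulrDr pmulr_rgt0.
(* Write [(al, be)] in polar form with the argument [q e + d] nearest to [q e]; this is the centre
   of the window. *)
have [d db [s s0 [du dv]]] := @ang_pos R (al * cos (q e) + be * sin (q e))
  (be * cos (q e) - al * sin (q e)) (cospos e eM re).
have cs := cos2Dsin2 (q e).
have alE : al = s * cos (q e + d).
  have -> : al = al * (cos (q e) ^+ 2 + sin (q e) ^+ 2) by rewrite cs mulr1.
  rewrite cosD mulrBr !mulrA (mulrC s) -(mulrA _ s) -du.
  by rewrite (mulrAC s) -dv; ring.
have beE : be = s * sin (q e + d).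
  have -> : be = be * (cos (q e) ^+ 2 + sin (q e) ^+ 2) by rewrite cs mulr1.
  transitivity (sin (q e) * (s * cos d) + cos (q e) * (s * sin d)).
    by rewrite -du -dv; ring.
  by rewrite sinD; ring.
exists (q e + d); apply: (inside_strip qc eM eO rs rS _ eM re); last by lra.
move=> x xM rx; have := cospos x xM rx; rewrite alE beE -!mulrA -mulrDr pmulr_rgt0//.
by rewrite cosB mulrC (mulrC (sin (q x))) addrC (addrC (_ * _)).
Qed.

End Sides.

(** * Leaving a disc through one of its arcs *)

Section Side.
Context {R : realType} (M : plane) (n : nat) (p : 'I_n -> 'rV[R]_3) (h : 'I_n -> R).
Implicit Types (a b c m u v w x y z : 'rV[R]_3) (i j : 'I_n) (k l s t eps : R).
Local Notation mf := (@metric_form R M).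
Local Notation sg := (@form_sign R M).
Local Notation inn := (inner M p h).
Local Notation chord := (chord M p h).
Local Notation angle := (angle M p h).

Definition exit_path c k (g : R -> 'rV[R]_3) x := [/\ path_in M p h g, mf c (g 0) = k,
  forall t, 0 < t -> t <= 1 -> mf c (g t) < k & g 1 = x].

(* The points reached by leaving the disc through the arc where mf m > l. *)
Definition side c k m l x := exists2 g, exit_path c k g x & l < mf m (g 0).

Lemma side_inner c k m l x : side c k m l x -> inn x.
Proof. by move=> [g [[_ gO] _ _ <-] _]; exact: gO. Qed.

Lemma side_out c k m l x : side c k m l x -> mf c x < k.
Proof. by move=> [g [_ _ gk <-] _]; apply: gk; rewrite ?ltr01. Qed.

Lemma path_exists x y : simply_connected R inn -> inn x -> inn y ->
  exists g, [/\ path_in M p h g, g 0 = x & g 1 = y].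
Proof.
move=> [pc _] xO yO; have [g [gc gO g0 g1]] := pc x y xO yO.
exists (g \o cl); split; rewrite /= ?cl0 ?cl1//; split.
  by apply: within_comp gc _ _; [exact: cl_continuous|exact: cl_in].
by move=> t; apply: gO; exists (cl t) => //; exact: cl_in.
Qed.

(** Cut a path from the centre to [x] at the last time [T] when it is in the closed disc. *)
Lemma exit_path_exists c k x : simply_connected R inn -> surface M c -> inside M p h c k ->
  k < sg -> inn x -> mf c x < k -> exists g, exit_path c k g x.
Proof.
move=> scO cM cO ks xO xk.
have cc : k < mf c c by rewrite surface_mf.
have [g [[gc gO] g0 g1]] := path_exists scO (cO c cM cc) xO.
have fc : continuous (fun t => mf c (g t)).
  by move=> t; apply: continuous_comp; [exact: gc|exact: mf_continuous].
pose S := [set t | 0 <= t <= 1 /\ k <= mf c (g t)].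
have S0 : S 0 by split; rewrite ?lexx ?ler01// g0 ltW.
have Sb : has_sup S by split; [exists 0|exists 1 => t [/andP[]]].
set T := sup S.
have T0 : 0 <= T by exact: sup_ubound Sb.2 _ S0.
have T1 : T <= 1 by apply: sup_le_ub Sb.1 _ => t [/andP[]].
have near := fun e e0 => @near_cts _ _ _ _ T e (fc T) e0.
have kT : k <= mf c (g T).
  rewrite leNgt; apply/negP => lt.
  have [|d d0 hd] := near (k - mf c (g T)); first lra.
  have [s [/andP[s0 s1] ks'] sT] := sup_adherent d0 Sb.
  have sT' : s <= T by apply: sup_ubound Sb.2 _ _; split; rewrite ?s0.
  have /ltr_normlP[] : `|mf c (g s) - mf c (g T)| < k - mf c (g T).
    by apply: hd; rewrite ler0_norm; [rewrite -/T in sT; lra|lra].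
  by lra.
have after t : T < t -> t <= 1 -> mf c (g t) < k.
  move=> Tt t1; rewrite ltNge; apply/negP => kt.
  have : t <= T by apply: sup_ubound Sb.2 _ _; split=> //; apply/andP; split; lra.
  lra.
have Tn1 : T < 1.
  rewrite lt_neqAle T1 andbT; apply/eqP => e; move: kT; rewrite e g1; lra.
have Tk : mf c (g T) = k.
  apply/eqP; rewrite eq_le kT andbT leNgt; apply/negP => lt.
  have [|d d0 hd] := near (mf c (g T) - k); first lra.
  set t := Num.min 1 (T + d / 2).
  have t1 : t <= 1 by rewrite ge_min lexx.
  have t2 : t <= T + d / 2 by rewrite ge_min lexx orbT.
  have t3 : T < t by rewrite lt_min Tn1/=; lra.
  have /ltr_normlP[] : `|mf c (g t) - mf c (g T)| < mf c (g T) - k.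
    by apply: hd; rewrite ger0_norm; lra.
  by have := after t t3 t1; lra.
exists (fun s => g (T + (1 - T) * s)); split.
- split=> [s|s]; last exact: gO.
  apply: (@continuous_comp _ _ _ (fun s => T + (1 - T) * s) g); last exact: gc.
  apply: (@continuousD _ R^o); first exact: cst_continuous.
  by apply: (@continuousM R R); [exact: cst_continuous|exact: cvg_id].
- by rewrite mulr0 addr0.
- by move=> s s0 s1; apply: after; nra.
- by rewrite mulr1 addrC subrK.
Qed.

(** The cosine of [q y] is 0 and its sine is positive. As [y] is a limit of points of the disc,
    [q y] is in [[- pi / 2, pi / 2]], which leaves one value. *)
Lemma circle_angle c k m l a b q y : chord c k m l a b -> angle c k m l q ->
  inn y -> mf c y = k -> l < mf m y -> q y = pi / 2.
Proof.
move=> [cM [aM _] [bM _] ab ca cb _ _ _ Din] [qa qc qs] yO cy my.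
have yM := inner_surface yO.
have near := near_circle cM (circle_gap cM aM bM ab ca cb) yM cy (expr1n _ 2).
have [r r0 [e1 e2]] := qa y yO.
have c0 : cos (q y) = 0.
  by apply/eqP; rewrite -(mulrI_eq0 _ (mulfI (lt0r_neq0 r0))) -e1 cy subrr.
have s0 : 0 < sin (q y) by rewrite -(pmulr_rgt0 _ r0) -e2 subr_gt0.
have q1 : q y <= pi / 2.
  rewrite leNgt; apply/negP => lt; have [|d d0 hd] := qc y (q y - pi / 2) yO; first lra.
  have [z [zM zy cz]] := near d d0; rewrite mul1r subr_gt0 in cz.
  have := qs z zM cz; have /ltr_normlP[] := hd z (Din z zM cz) zy; lra.
have q2 : - (pi / 2) <= q y.
  rewrite leNgt; apply/negP => lt; have [|d d0 hd] := qc y (- (pi / 2) - q y) yO; first lra.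
  have [z [zM zy cz]] := near d d0; rewrite mul1r subr_gt0 in cz.
  have := qs z zM cz; have /ltr_normlP[] := hd z (Din z zM cz) zy; lra.
apply/eqP; rewrite eq_le q1 /= leNgt; apply/negP => lt.
move: q2; rewrite le_eqVlt => /orP[/eqP e|gt].
  by move: s0; rewrite -e sinN sin_pihalf; lra.
by have := @cos_gt0_pihalf _ (q y); rewrite gt lt c0 ltxx => /(_ isT).
Qed.

(** Along an exit path the angle starts at [pi / 2] and then has negative cosine, so it goes up and
    cannot return. With [angle_side] this identifies the side with the region [pi / 2 < q]. *)
Lemma side_angle c k m l a b q x : chord c k m l a b -> angle c k m l q ->
  side c k m l x -> pi / 2 < q x.
Proof.
move=> D A [g [Pg cg gk <-] mg]; have [qa qc qs] := A.
have q0 := circle_angle D A (Pg.2 0) cg mg.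
have fc := cont_path qc Pg; have pi0 := pi_gt0 R.
have cneg t : 0 < t -> t <= 1 -> cos (q (g t)) < 0.
  move=> t0 t1; have := gk t t0 t1; have [r r0 [e _]] := qa _ (Pg.2 t).
  by rewrite -subr_lt0 e pmulr_rlt0.
have [|d d0 hd] := near_cts (fc 0) (_ : 0 < pi / 2); first by lra.
set t1 := Num.min 1 (d / 2).
have t11 : t1 <= 1 by rewrite ge_min lexx.
have t1d : t1 <= d / 2 by rewrite ge_min lexx orbT.
have t10 : 0 < t1 by rewrite lt_min ltr01 /=; lra.
have /ltr_normlP[] : `|(q \o g) t1 - (q \o g) 0| < pi / 2.
  by apply: hd; rewrite subr0 gtr0_norm//; lra.
rewrite /= q0 => h1 h2.
have ne t : 0 < t -> t <= 1 -> q (g t) != pi / 2.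
  by move=> t0 t1'; apply/eqP => e; have := cneg t t0 t1'; rewrite e cos_pihalf ltxx.
have gt1 : pi / 2 < q (g t1).
  rewrite lt_neqAle eq_sym ne//= leNgt; apply/negP => lt.
  have := cneg t1 t10 t11; have := @cos_gt0_pihalf _ (q (g t1)).
  by rewrite lt andbT => /(_ ltac:(lra)); lra.
have := @path_ivt_gt R (fun s => (q \o g) (t1 + (1 - t1) * s)) (pi / 2).
rewrite mulr0 addr0 mulr1 [t1 + (1 - t1)]addrC subrK; apply => //.
  move=> s; apply: (@continuous_comp _ _ _ (fun s => t1 + (1 - t1) * s) (q \o g)); last exact: fc.
  apply: (@continuousD _ R^o); first exact: cst_continuous.
  by apply: (@continuousM R R); [exact: cst_continuous|exact: cvg_id].
by move=> s; rewrite in_itv /= => /andP[s0 s1]; apply: ne; nra.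
Qed.

Lemma chord_uv c k m l a b x : chord c k m l a b -> inn x -> mf c x = k -> mf m x != l.
Proof.
move=> D xO cx; apply/eqP => mx; have := chord_uv0 D xO.
by rewrite cx mx !subrr expr0n addr0 eqxx.
Qed.

Lemma angle_side c k m l a b q x : simply_connected R inn -> chord c k m l a b ->
  angle c k m l q -> inn x -> pi / 2 < q x -> side c k m l x.
Proof.
move=> scO D A xO qx; have [qa qc qs] := A; have [cM aO bO ab _ _ _ _ _ Din] := D.
have pi0 := pi_gt0 R; have xM := inner_surface xO.
have AN := angleN A; have DN := chordN D.
have neg y : inn y -> mf c y = k -> mf m y < l -> q y = - (pi / 2).
  move=> yO cy my; have := circle_angle DN AN yO cy; rewrite mfNl ltrN2 => /(_ my); lra.
have xk : mf c x < k.
  rewrite ltNge le_eqVlt; apply/negP => /orP[/eqP e|gt].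
    have := chord_uv D xO (esym e); rewrite neq_lt => /orP[lt|gt].
      by have := neg x xO (esym e) lt; lra.
    by have := circle_angle D A xO (esym e) gt; lra.
  by have := qs x xM gt; lra.
have [g G] := exit_path_exists scO cM Din (chord_lt D) xO xk.
have [Pg cg gk g1] := G; exists g => //.
have := chord_uv D (Pg.2 0) cg; rewrite neq_lt => /orP[lt|//].
have := side_angle DN AN (x := x) _; have S : side c k (- m) (- l) x.
  by exists g => //; rewrite mfNl ltrN2.
by move=> /(_ S); lra.
Qed.

(* The way out of the disc decides the side, whatever the chord. *)
Lemma hit c k x : simply_connected R inn -> surface M c -> inside M p h c k -> k < sg ->
  inn x -> mf c x < k -> exists y, [/\ inn y, mf c y = k &
    forall m l a b, chord c k m l a b -> side c k m l x <-> l < mf m y].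
Proof.
move=> scO cM cO ks xO xk; have [g G] := exit_path_exists scO cM cO ks xO xk.
have [Pg cg gk g1] := G; exists (g 0); split=> //; first exact: Pg.2.
move=> m l a b D; split=> [S|my]; last by exists g.
have [q A] := angle_exists scO D; have := side_angle D A S.
have := chord_uv D (Pg.2 0) cg; rewrite neq_lt => /orP[lt|//].
have : side c k (- m) (- l) x by exists g => //; rewrite mfNl ltrN2.
by move/(side_angle (chordN D) (angleN A)); have := pi_gt0 R; lra.
Qed.

End Side.

(** By strict convexity, four distinct coplanar points of the surface form a convex quadrilateral. A
    second coordinate that is negative or zero would put the third vertex in the triangle of [y] and
    the other two. *)
Lemma bary_sign {R : realType} (M : plane) (a b e y : 'rV[R]_3) (A B G : R) :
  surface M a -> surface M b -> surface M e -> surface M y ->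
  a != b -> b != e -> e != a -> y != a -> y != b -> y != e ->
  A + B + G = 1 -> y = A *: a + B *: b + G *: e ->
  [\/ [/\ A < 0, 0 < B & 0 < G], [/\ 0 < A, B < 0 & 0 < G] | [/\ 0 < A, 0 < B & G < 0]].
Proof.
move=> aM bM eM yM ab be ea ya yb ye s1 yE.
have key (u v w z : 'rV[R]_3) (r s t : R) : surface M u -> surface M v -> surface M w ->
    surface M z -> u != v -> v != w -> w != u -> z != u -> z != v -> z != w ->
    r + s + t = 1 -> z = r *: u + s *: v + t *: w -> r < 0 -> s <= 0 -> False.
  move=> uM vM wM zM uv vw wu zu zv zw st1 zE r0 s0.
  have t0 : 0 < t by lra.
  have := @strict_convex R M u v z w (- r / t) (- s / t) t^-1 uM vM zM wM uv.
  have vz : v != z by rewrite eq_sym.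
  move=> /(_ vz zu).
  have e1 : w = - r / t *: u + - s / t *: v + t^-1 *: z.
    by rewrite zE; apply/rowP => i; rewrite !mxE; field; rewrite gt_eqF.
  have e2 : - r / t + - s / t + t^-1 = 1.
    have -> : - r / t + - s / t + t^-1 = (1 - r - s) / t by field; rewrite gt_eqF.
    by rewrite (_ : 1 - r - s = t) ?divff ?gt_eqF//; lra.
  move=> /(_ e1 e2); rewrite !divr_ge0 ?oppr_ge0 ?invr_ge0 ?(ltW t0) ?(ltW r0)//.
  move=> /(_ isT isT isT)[] /eqP; first by rewrite (negbTE wu).
    by rewrite eq_sym (negbTE vw).
  by rewrite eq_sym (negbTE zw).
have ba : b != a by rewrite eq_sym.
have ae : a != e by rewrite eq_sym.
have eb : e != b by rewrite eq_sym.
have y2 : y = B *: b + A *: a + G *: e by rewrite yE [A *: a + _]addrC.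
have y3 : y = A *: a + G *: e + B *: b by rewrite yE -addrA [B *: b + _]addrC addrA.
have y4 : y = B *: b + G *: e + A *: a by rewrite yE -addrA addrC.
have y5 : y = G *: e + A *: a + B *: b by rewrite yE addrC addrA.
have y6 : y = G *: e + B *: b + A *: a by rewrite y4 [B *: b + _]addrC.
have s2 : B + A + G = 1 by lra.
have s3 : A + G + B = 1 by lra.
have s4 : B + G + A = 1 by lra.
have s5 : G + A + B = 1 by lra.
have s6 : G + B + A = 1 by lra.
have [A0|A0] := ltP A 0.
  apply: Or31; split=> //; rewrite ltNge; apply/negP => le.
    exact: key aM bM eM yM ab be ea ya yb ye s1 yE A0 le.
  exact: key aM eM bM yM ae eb ba ya ye yb s3 y3 A0 le.
have [B0|B0] := ltP B 0.
  apply: Or32; split=> //; rewrite ltNge; apply/negP => le.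
    exact: key bM aM eM yM ba ae eb yb ya ye s2 y2 B0 le.
  exact: key bM eM aM yM be ea ab yb ye ya s4 y4 B0 le.
have [G0|G0] := ltP G 0.
  apply: Or33; split=> //; rewrite ltNge; apply/negP => le.
    exact: key eM aM bM yM ea ab be ye ya yb s5 y5 G0 le.
  exact: key eM bM aM yM eb ba ae ye yb ya s6 y6 G0 le.
exfalso; have [/eqP|/eqP|/eqP] := strict_convex aM bM eM yM ab be ea yE s1 A0 B0 G0.
- by rewrite (negbTE ya).
- by rewrite (negbTE yb).
- by rewrite (negbTE ye).
Qed.

(** * Trees of discs and the splitting of a side *)

Section Split.
Context {R : realType} (M : plane) (n : nat) (p : 'I_n -> 'rV[R]_3) (h : 'I_n -> R).
Implicit Types (a b c m u v w x y z : 'rV[R]_3) (i j : 'I_n) (k l s t eps : R).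
Local Notation mf := (@metric_form R M).
Local Notation sg := (@form_sign R M).
Local Notation inn := (inner M p h).
Local Notation chord := (chord M p h).
Local Notation angle := (angle M p h).
Local Notation side := (side M p h).

Definition reaches i (S : 'rV[R]_3 -> Prop) := exists x, [/\ surface M x, h i < mf (p i) x & S x].

Definition node : Type := ('rV[R]_3 * R)%type.

Definition lune (e : node * node) x :=
  [/\ surface M x, e.1.2 < mf e.1.1 x & mf e.2.1 x < e.2.2].

(* A list of edges (child, parent) is a tree when parents come before children. *)
Fixpoint wf (seen : seq node) (es : seq (node * node)) : Prop :=
  if es is e :: es' then e.2 \in seen /\ wf (e.1 :: seen) es' else True.

Fixpoint disj (es : seq (node * node)) : Prop :=
  if es is e :: es' then
    (forall e', e' \in es' -> forall x, lune e x -> lune e' x -> False) /\ disj es'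
  else True.

Lemma wf_sub (S1 S2 : seq node) es : {subset S1 <= S2} -> wf S1 es -> wf S2 es.
Proof.
elim: es S1 S2 => //= e es IH S1 S2 S12 [es1 w]; split; first exact: S12.
by apply: IH w => y; rewrite !inE => /orP[->//|/S12->]; rewrite orbT.
Qed.

Lemma wf_cat (S : seq node) es es' : wf S es -> wf S es' -> wf S (es ++ es').
Proof.
elim: es S => //= e es IH S [e2 w] w'; split=> //; apply: IH => //.
by apply: wf_sub w' => y; rewrite inE orbC => ->.
Qed.

Lemma disj_cat es es' : disj es -> disj es' ->
  (forall e e' x, e \in es -> e' \in es' -> lune e x -> lune e' x -> False) ->
  disj (es ++ es').
Proof.
elim: es => //= e es IH [d ds] d' H; split.
  move=> e'; rewrite mem_cat => /orP[e'i|e'i] x; first exact: d.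
  by apply: H => //; rewrite inE eqxx.
apply: IH => // f f' x fi; apply: H; by rewrite inE fi orbT.
Qed.

Definition covered (nd : node) i :=
  forall x, surface M x -> h i < mf (p i) x -> nd.2 <= mf nd.1 x.

(** The goal of the induction, for one side of one disc. Confining the lunes to the side is what
    keeps the trees built on different sides disjoint. *)
Definition resolved c k m l := exists es, [/\ wf [:: (c, k)] es, disj es,
  forall e, e \in es -> [/\ surface M e.1.1, inside M p h e.1.1 e.1.2 &
    forall x, lune e x -> side c k m l x] &
  forall i, reaches i (side c k m l) ->
    exists2 nd, nd \in (c, k) :: map fst es & covered nd i].

(** The measure of the induction; contacts with the circle may be infinite in number. *)
Definition ncaps c k m l := #|[pred i | `[< reaches i (side c k m l) >]]|.

Lemma ncaps_lt c k m l c' k' m' l' j :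
  (forall i, reaches i (side c k m l) -> reaches i (side c' k' m' l')) ->
  reaches j (side c' k' m' l') -> ~ reaches j (side c k m l) ->
  (ncaps c k m l < ncaps c' k' m' l')%N.
Proof.
move=> sub mj nj; apply: proper_card; apply/properP; split.
  by apply/fintype.subsetP => i; rewrite !unfold_in /= => /asboolP mi; apply/asboolP; exact: sub mi.
by exists j; rewrite unfold_in /=; [exact/asboolP|exact/asboolP].
Qed.

Lemma ncaps_le c k m l c' k' m' l' :
  (forall i, reaches i (side c k m l) -> reaches i (side c' k' m' l')) ->
  (ncaps c k m l <= ncaps c' k' m' l')%N.
Proof.
move=> sub; apply: subset_leq_card.
by apply/fintype.subsetP => i; rewrite !unfold_in /= => /asboolP mi; apply/asboolP; exact: sub mi.
Qed.

Lemma chord_exists c k a b e : surface M c -> outer M p h a -> outer M p h b -> a != b ->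
  mf c a = k -> mf c b = k -> inside M p h c k ->
  surface M e -> mf c e = k -> e != a -> e != b ->
  exists m l, chord c k m l a b /\ l < mf m e.
Proof.
move=> cM aO bO ab ca cb cO eM ce ea eb; have [aM _] := aO; have [bM _] := bO.
set P := perp M c a b.
have Pb : mf P b = mf P a.
  by apply/eqP; rewrite -subr_eq0 -mfNr -mfDr; apply/eqP; exact: mf_cross_r.
have D : chord c k P (mf P a) a b.
  split=> // x xM cx Px; apply: (perp_nondeg cM aM bM ab ca cb) => //.
  by rewrite mfDr mfNr -/P Px subrr.
have : mf P e != mf P a.
  by apply/eqP => /(chord_nd D eM ce)[]/eqP; rewrite ?(negbTE ea) ?(negbTE eb).
rewrite neq_lt => /orP[lt|gt]; last by exists P, (mf P a).
by exists (- P), (- mf P a); split; [exact: chordN|rewrite mfNl ltrN2].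
Qed.

Hypothesis scO : simply_connected R inn.

Section Three.
Variables (c m a b e m1 m2 : 'rV[R]_3) (k l l1 l2 : R).
Hypotheses (D : chord c k m l a b) (eO : outer M p h e) (ce : mf c e = k) (me : l < mf m e).
Hypotheses (D1 : chord c k m1 l1 b e) (m1a : mf m1 a < l1).
Hypotheses (D2 : chord c k m2 l2 e a) (m2b : mf m2 b < l2).

(** In barycentric coordinates of [y] with respect to [a], [b] and [e], each of the three functions
    is a multiple of one coordinate, with known sign. *)
Lemma three_sign y : inn y -> mf c y = k ->
  [\/ [/\ l < mf m y, l1 < mf m1 y & mf m2 y < l2],
      [/\ l < mf m y, mf m1 y < l1 & l2 < mf m2 y] |
      [/\ mf m y < l, mf m1 y < l1 & mf m2 y < l2]].
Proof.
move=> yO cy; have yM := inner_surface yO; have [eM eO'] := eO.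
have [cM [aM aO] [bM bO] ab ca cb ma mb _ _] := D.
have ea : e != a by apply/eqP => E; move: me; rewrite E ma ltxx.
have eb : e != b by apply/eqP => E; move: me; rewrite E mb ltxx.
have [A [B [G [s1 yE]]]] := bary cM aM bM ab ca cb eM ce ea eb cy.
have [_ _ _ be _ _ m1b m1e _ _] := D1; have [_ _ _ _ _ _ m2e m2a _ _] := D2.
have ya : y != a by apply/eqP => E; apply: aO; rewrite -E.
have yb : y != b by apply/eqP => E; apply: bO; rewrite -E.
have ye : y != e by apply/eqP => E; apply: eO'; rewrite -E.
have e0 : mf m y - l = G * (mf m e - l).
  by rewrite yE !(mfDr, mfZr) ma mb -[X in _ - X]mul1r -s1; ring.
have e1 : mf m1 y - l1 = A * (mf m1 a - l1).
  by rewrite yE !(mfDr, mfZr) m1b m1e -[X in _ - X]mul1r -s1; ring.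
have e2 : mf m2 y - l2 = B * (mf m2 b - l2).
  by rewrite yE !(mfDr, mfZr) m2a m2e -[X in _ - X]mul1r -s1; ring.
have [p0 [n1 n2]] : 0 < mf m e - l /\ mf m1 a - l1 < 0 /\ mf m2 b - l2 < 0 by rewrite subr_gt0 !subr_lt0.
move: p0 n1 n2 e0 e1 e2.
move: (mf m e - l) (mf m1 a - l1) (mf m2 b - l2) (mf m y) (mf m1 y) (mf m2 y).
move=> g1 g2 g3 x1 x2 x3 p0 n1 n2 e0 e1 e2.
have [[A0 B0 G0]|[A0 B0 G0]|[A0 B0 G0]] := bary_sign aM bM eM yM ab be ea ya yb ye s1 yE.
- by apply: Or31; split; [rewrite -subr_gt0 e0 pmulr_rgt0|rewrite -subr_gt0 e1 nmulr_rgt0|rewrite -subr_lt0 e2 pmulr_rlt0].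
- by apply: Or32; split; [rewrite -subr_gt0 e0 pmulr_rgt0|rewrite -subr_lt0 e1 pmulr_rlt0|rewrite -subr_gt0 e2 nmulr_rgt0].
- by apply: Or33; split; [rewrite -subr_lt0 e0 nmulr_rlt0|rewrite -subr_lt0 e1 pmulr_rlt0|rewrite -subr_lt0 e2 pmulr_rlt0].
Qed.

(** The exit point given by [hit] decides about all three chords at once. *)
Lemma split_side x : side c k m l x ->
  side c k m1 l1 x /\ side c k (- m2) (- l2) x \/
  side c k m2 l2 x /\ side c k (- m1) (- l1) x.
Proof.
move=> S; have [cM _ _ _ _ _ _ _ _ Din] := D.
have [y [yO cy H]] := hit scO cM Din (chord_lt D) (side_inner S) (side_out S).
have [_ h0] := H _ _ _ _ D; have [_ h1] := H _ _ _ _ D1; have [_ h2] := H _ _ _ _ D2.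
have [_ h1'] := H _ _ _ _ (chordN D1); have [_ h2'] := H _ _ _ _ (chordN D2).
rewrite !mfNl !ltrN2 in h1' h2'.
have [my _] := H _ _ _ _ D; have {}my := my S.
have [[_ r1 r2]|[_ r1 r2]|[r0 _ _]] := three_sign yO cy.
- by left; split; auto.
- by right; split; auto.
- by move: (lt_trans my r0); rewrite ltxx.
Qed.

Lemma side_split1 x : side c k m1 l1 x -> side c k m l x /\ side c k (- m2) (- l2) x.
Proof.
move=> S; have [cM _ _ _ _ _ _ _ _ Din] := D.
have [y [yO cy H]] := hit scO cM Din (chord_lt D) (side_inner S) (side_out S).
have [_ h0] := H _ _ _ _ D; have [_ h2'] := H _ _ _ _ (chordN D2).
rewrite !mfNl !ltrN2 in h2'; have [my _] := H _ _ _ _ D1; have {}my := my S.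
have [[? r1 r2]|[_ r1 r2]|[_ r1 _]] := three_sign yO cy; first by split; auto.
  by move: (lt_trans my r1); rewrite ltxx.
by move: (lt_trans my r1); rewrite ltxx.
Qed.

Lemma side_split2 x : side c k m2 l2 x -> side c k m l x /\ side c k (- m1) (- l1) x.
Proof.
move=> S; have [cM _ _ _ _ _ _ _ _ Din] := D.
have [y [yO cy H]] := hit scO cM Din (chord_lt D) (side_inner S) (side_out S).
have [_ h0] := H _ _ _ _ D; have [_ h1'] := H _ _ _ _ (chordN D1).
rewrite !mfNl !ltrN2 in h1'; have [my _] := H _ _ _ _ D2; have {}my := my S.
have [[_ r1 r2]|[? r1 r2]|[_ _ r1]] := three_sign yO cy; last 1 first.
- by move: (lt_trans my r1); rewrite ltxx.
- by move: (lt_trans my r2); rewrite ltxx.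
- by split; auto.
Qed.

End Three.

Lemma side_excl c k m l a b x : chord c k m l a b -> side c k m l x ->
  side c k (- m) (- l) x -> False.
Proof.
move=> D S S'; have [q A] := angle_exists scO D; have := side_angle D A S.
by have := side_angle (chordN D) (angleN A) S'; have := pi_gt0 R; lra.
Qed.

Hypotheses (pM : forall i, surface M (p i)) (hlt : forall i, h i < sg).
Hypothesis out : exists z, outside M p h z.

Lemma cap_inside i : inside M p h (p i) (h i).
Proof. by move=> x xM hx; exact: cap_inner hx. Qed.

Lemma cap_gt i : M = Sphere -> -1 <= h i.
Proof.
move=> MS; have [z [zM hz]] := out; apply/ltW; apply: le_lt_trans (hz i).
exact: mf_geN1.
Qed.

Lemma cap_gap i : 0 < sg * (sg ^+ 2 - h i ^+ 2).
Proof.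
have [z [zM hz]] := out; have := hlt i; have := @mf_geN1 R M (p i) z; have := hz i.
rewrite /form_sign; case: (M) pM zM => pM' zM hz' => [/(_ erefl (pM' i) zM)|_]; nra.
Qed.

(** By [window] the values of [q] on one disc differ by less than [pi], while the two sides are
    [q > pi / 2] and [q < - pi / 2]. *)
Lemma reaches_excl c k m l a b i : chord c k m l a b -> reaches i (side c k m l) ->
  reaches i (side c k (- m) (- l)) -> False.
Proof.
move=> D [x [xM hx S]] [y [yM hy S']]; have [q A] := angle_exists scO D.
have := side_angle D A S; have := side_angle (chordN D) (angleN A) S'.
have [t ht] := window D A (pM i) (@cap_inside i) (hlt i) (@cap_gt i).
have := ht x xM hx; have := ht y yM hy; lra.
Qed.

Lemma resolved_split c k m l a b e m1 l1 m2 l2 : chord c k m l a b ->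
  outer M p h e -> mf c e = k -> l < mf m e ->
  chord c k m1 l1 b e -> mf m1 a < l1 -> chord c k m2 l2 e a -> mf m2 b < l2 ->
  resolved c k m1 l1 -> resolved c k m2 l2 -> resolved c k m l.
Proof.
move=> D eO ce me D1 m1a D2 m2b [es1 [w1 d1 h1 v1]] [es2 [w2 d2 h2 v2]].
exists (es1 ++ es2); split.
- exact: wf_cat.
- apply: disj_cat => // f f' x /h1[_ _ H1] /h2[_ _ H2] /H1 S1 /H2 S2.
  have [_ S3] := side_split2 D eO ce me D1 m1a D2 m2b S2.
  exact: side_excl D1 S1 S3.
- move=> f; rewrite mem_cat => /orP[/h1|/h2] [? ? H]; split=> // x /H.
    by move/(side_split1 D eO ce me D1 m1a D2 m2b) => [].
  by move/(side_split2 D eO ce me D1 m1a D2 m2b) => [].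
move=> i [x [xM hx S]].
have [[S1 _]|[S2 _]] := split_side D eO ce me D1 m1a D2 m2b S.
  have [|nd ndi ndc] := v1 i; first by exists x.
  exists nd => //; move: ndi; rewrite !inE map_cat mem_cat => /orP[->//|->].
  by rewrite orbT.
have [|nd ndi ndc] := v2 i; first by exists x.
exists nd => //; move: ndi; rewrite !inE map_cat mem_cat => /orP[->//|->].
by rewrite !orbT.
Qed.

(** Just outside the disc near [y] there is a point of [inner] with angle above [pi / 2]. It is in
    one of the closed discs, and the open disc comes arbitrarily close to it. *)
Lemma arc_reaches c k m l a b y : chord c k m l a b -> inn y -> mf c y = k -> l < mf m y ->
  exists i, reaches i (side c k m l).
Proof.
move=> D yO cy my; have [cM [aM _] [bM _] ab ca cb _ _ _ Din] := D.
have [q A] := angle_exists scO D; have [qa qc qs] := A; have yM := inner_surface yO.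
have qy := circle_angle D A yO cy my; have pi0 := pi_gt0 R.
have [d1 d10 hd1] := inner_open yO.
have [|d2 d20 hd2] := qc y (pi / 2) yO; first by lra.
have s2 : (-1 : R) ^+ 2 = 1 by rewrite sqrrN expr1n.
have e0 : 0 < Num.min d1 d2 by rewrite lt_min d10.
have [z [zM]] := near_circle cM (circle_gap cM aM bM ab ca cb) yM cy s2 e0.
rewrite lt_min => /andP[zy1 zy2] cz.
have zO := hd1 z zM zy1; have /ltr_normlP[q1 q2] := hd2 z zO zy2.
have qz : pi / 2 < q z.
  rewrite ltNge; apply/negP => le; have [r r0 [e1 _]] := qa z zO.
  have : cos (q z) < 0 by rewrite -(pmulr_rlt0 _ r0) -e1; lra.
  by rewrite ltNge cos_ge0_pihalf//; apply/andP; split; lra.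
have [i hz] := inner_cap zO; exists i.
have [d3 d30 hd3] := inner_open zO.
have [|d4 d40 hd4] := qc z (q z - pi / 2) zO; first by lra.
have [gt|le] := ltP (h i) (mf (p i) z).
  by exists z; split=> //; exact: (angle_side scO D A zO qz).
have hzE : mf (p i) z = h i by apply/eqP; rewrite eq_le le.
have e3 : 0 < Num.min d3 d4 by rewrite lt_min d30.
have [x [xM]] := near_circle (pM i) (cap_gap i) zM hzE (expr1n _ 2) e3.
rewrite lt_min => /andP[xz1 xz2]; rewrite mul1r subr_gt0 => hx.
have xO := hd3 x xM xz1; exists x; split=> //; apply: (angle_side scO D A xO).
by have /ltr_normlP[] := hd4 x xO xz2; lra.
Qed.

End Split.

(** * Turning a disc about two boundary points *)

Section Pencil.
Context {R : realType} (M : plane) (n : nat) (p : 'I_n -> 'rV[R]_3) (h : 'I_n -> R).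
Implicit Types (a b c m u v w x y z : 'rV[R]_3) (i j : 'I_n) (k l s t eps : R).
Local Notation mf := (@metric_form R M).
Local Notation sg := (@form_sign R M).
Local Notation inn := (inner M p h).
Local Notation chord := (chord M p h).
Local Notation angle := (angle M p h).
Local Notation side := (side M p h).
Local Notation reaches := (reaches M p h).
Local Notation resolved := (resolved M p h).
Local Notation ncaps := (ncaps M p h).
Local Notation covered := (covered M p h).

Hypotheses (pM : forall i, surface M (p i)) (hlt : forall i, h i < sg).
Hypothesis out : exists z, outside M p h z.

(** The union of the discs is bounded: on the ray, [mf (p i)] is at most [- r * (p i 0 2 - w i)]
    with a positive second factor, and [r0] exceeds all the quotients of [|h i|] by these
    factors. *)
Lemma far_ray q : M = Hyperbolic -> exists2 r0, 0 < r0 & forall r, r0 < r ->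
  let x := vec (r * cos q) (r * sin q) (Num.sqrt (1 + r ^+ 2)) in surface M x /\ ~ inn x.
Proof.
move=> MH.
pose w i := Num.sqrt (p i 0 0 ^+ 2 + p i 0 1 ^+ 2).
have w0 i : 0 <= w i by exact: sqrtr_ge0.
have w2 i : w i ^+ 2 = p i 0 0 ^+ 2 + p i 0 1 ^+ 2 by rewrite sqr_sqrtr// addr_ge0 ?sqr_ge0.
have cs := cos2Dsin2 q.
have wp i : w i < p i 0 2.
  have := pM i; rewrite MH /= /metric_form => -[E p2].
  by have := w2 i; have := w0 i; nra.
have wq i : p i 0 0 * cos q + p i 0 1 * sin q <= w i.
  have := w2 i; have := w0 i; have := sqr_ge0 (p i 0 0 * sin q - p i 0 1 * cos q).
  set A := _ * cos q + _; move=> E W0 W2; have : A ^+ 2 <= w i ^+ 2.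
    have : (p i 0 0 * sin q - p i 0 1 * cos q) ^+ 2 + A ^+ 2 =
        (p i 0 0 ^+ 2 + p i 0 1 ^+ 2) * (cos q ^+ 2 + sin q ^+ 2) by rewrite /A; ring.
    by rewrite cs mulr1 -W2; lra.
  by nra.
pose r0 := 1 + \sum_i `|h i| / (p i 0 2 - w i).
have K0 i : 0 <= `|h i| / (p i 0 2 - w i) by rewrite divr_ge0// subr_ge0 ltW.
have r00 : 0 < r0 by rewrite ltr_pwDl// sumr_ge0.
have rK i : `|h i| / (p i 0 2 - w i) < r0.
  by rewrite /r0 (bigD1 i)//= addrCA ltrDl ltr_pwDl// sumr_ge0.
exists r0 => // r rr; set y := Num.sqrt _ => x.
have y0 : 0 <= y by exact: sqrtr_ge0.
have y2 : y ^+ 2 = 1 + r ^+ 2 by rewrite sqr_sqrtr// addr_ge0 ?sqr_ge0.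
have ry : r <= y by nra.
have xM : surface M x.
  rewrite MH /= /metric_form !vec0 !vec1 !vec2; split; last by nra.
  transitivity (r ^+ 2 * (cos q ^+ 2 + sin q ^+ 2) - y ^+ 2); first by ring.
  by rewrite cs y2; ring.
split=> // /inner_cap[i]; rewrite /metric_form MH vec0 vec1 vec2.
have := rK i; rewrite ltr_pdivrMr ?subr_gt0// => h1.
have := wq i; have := wp i; have := w0 i; have := ler_norm (- h i); rewrite normrN.
move: (p i 0 0) (p i 0 1) (p i 0 2) (w i) h1 => p0 p1 p2 W h1 h2 W0 W2 h3.
have : (p0 * cos q + p1 * sin q) * r <= W * r by rewrite ler_wpM2r//; lra.
have : p2 * r <= p2 * y by rewrite ler_wpM2l//; lra.
have : r0 * (p2 - W) <= r * (p2 - W) by rewrite ler_wpM2r//; lra.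
lra.
Qed.

(* In the hyperbolic plane, a half-space whose trace is bounded has a timelike normal. *)
Lemma normal_dir v a s : surface M a -> mf v a = s -> v != 0 ->
  (forall x, surface M x -> s < mf v x -> inn x) ->
  exists r c, [/\ 0 < r, surface M c & v = r *: c].
Proof.
move=> aM va v0 vO.
case: (boolP (`[< M = Sphere >])) => [/asboolP MS|/asboolP MS].
  have vv : 0 < mf v v.
    rewrite lt_neqAle eq_sym /metric_form MS; apply/andP; split; last first.
      by rewrite -!expr2 !addr_ge0// sqr_ge0.
    apply/eqP; rewrite -!expr2 => /sqr3_eq0[e0 e1 e2]; move/eqP: v0; apply.
    by apply: vecP; rewrite mxE.
  have r0 : 0 < Num.sqrt (mf v v) by rewrite sqrtr_gt0.
  exists (Num.sqrt (mf v v)), ((Num.sqrt (mf v v))^-1 *: v); split=> //.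
    rewrite MS /=; rewrite MS in vv r0 *; rewrite mfZl mfZr -[X in _ * (_ * X)]sqr_sqrtr ?ltW//.
    by field; rewrite gt_eqF.
  by rewrite scalerA divff ?scale1r// gt_eqF.
have MH : M = Hyperbolic by case: (M) MS.
have [q [w [w0 e0 e1]]] : exists q w : R, [/\ 0 <= w, v 0 0 = w * cos q & v 0 1 = w * sin q].
  have [e|ne] := eqVneq (v 0 0 ^+ 2 + v 0 1 ^+ 2) 0.
    exists 0, 0; rewrite !mul0r lexx; split=> //; apply/eqP; rewrite -sqrf_eq0; apply/eqP;
      have := sqr_ge0 (v 0 0); have := sqr_ge0 (v 0 1); lra.
  by have [q [w w0 [? ?]]] := ang_exists ne; exists q, w; split=> //; exact: ltW.
have cs := cos2Dsin2 q; have [r0 r00 far] := far_ray q MH.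
have up r : r0 < r -> w * r - v 0 2 * Num.sqrt (1 + r ^+ 2) <= s.
  move=> /far[xM xO]; rewrite leNgt; apply/negP => lt; apply: xO; apply: vO => //.
  rewrite /metric_form MH vec0 vec1 vec2 e0 e1; apply: lt_le_trans lt _.
  rewrite le_eqVlt; apply/orP; left; apply/eqP.
  transitivity (w * r * (cos q ^+ 2 + sin q ^+ 2) - v 0 2 * Num.sqrt (1 + r ^+ 2)).
    by rewrite cs mulr1.
  by ring.
have sq r : 0 < r -> exists y : R, [/\ y = Num.sqrt (1 + r ^+ 2), r < y, y <= r + 1 & (y - r) * r <= 1].
  move=> r1; exists (Num.sqrt (1 + r ^+ 2)); set y := Num.sqrt _.
  have y0 : 0 <= y by exact: sqrtr_ge0.
  have y2 : y ^+ 2 = 1 + r ^+ 2 by rewrite sqr_sqrtr// addr_ge0 ?sqr_ge0.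
  by split=> //; nra.
(* The first case is that of a timelike normal pointing to the upper sheet. *)
have [lt|le] := ltP w (v 0 2).
  have vv : 0 < - mf v v.
    rewrite /metric_form MH e0 e1.
    have -> : - (w * cos q * (w * cos q) + w * sin q * (w * sin q) - v 0 2 * v 0 2) =
      v 0 2 ^+ 2 - w ^+ 2 * (cos q ^+ 2 + sin q ^+ 2) by ring.
    rewrite cs mulr1; nra.
  have t0 : 0 < Num.sqrt (- mf v v) by rewrite sqrtr_gt0.
  exists (Num.sqrt (- mf v v)), ((Num.sqrt (- mf v v))^-1 *: v); split=> //.
    have E : mf ((Num.sqrt (- mf v v))^-1 *: v) ((Num.sqrt (- mf v v))^-1 *: v) = -1.
      have t2 : mf v v = - (Num.sqrt (- mf v v) ^+ 2) by rewrite sqr_sqrtr ?ltW// opprK.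
      rewrite mfZl mfZr {3}t2; field; exact: lt0r_neq0.
    rewrite MH /= -[Hyperbolic]MH; split=> //.
    by rewrite mxE mulr_gt0// ?invr_gt0//; lra.
  by rewrite scalerA divff ?scale1r// gt_eqF.
(* A lightlike normal would give a horodisc. In this case as in the remaining one, far points in the
   direction [q] satisfy the inequality, against [up]. *)
exfalso; move: le; rewrite le_eqVlt => /orP[/eqP vw|lt].
  have s0 : s < 0 \/ w = 0.
    have [->|wn] := eqVneq w 0; [by right|left].
    have wp : 0 < w by rewrite lt_neqAle eq_sym wn.
    rewrite -va /metric_form MH e0 e1 vw.
    have := aM; rewrite MH /= /metric_form => -[E a2].
    have : (a 0 0 * cos q + a 0 1 * sin q) < a 0 2.
      have := sqr_ge0 (a 0 0 * sin q - a 0 1 * cos q); set A := _ * cos q + _.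
      move=> A1; have : (a 0 0 * sin q - a 0 1 * cos q) ^+ 2 + A ^+ 2 =
        (a 0 0 ^+ 2 + a 0 1 ^+ 2) * (cos q ^+ 2 + sin q ^+ 2) by rewrite /A; ring.
      by rewrite cs mulr1; nra.
    nra.
  case: s0 => [s0|wz]; last first.
    by move/eqP: v0; apply; apply: vecP; rewrite mxE ?e0 ?e1 ?vw wz ?mul0r.
  set r := r0 + (w / - s) + 1.
  have wr : 0 <= w / - s by rewrite divr_ge0//; lra.
  have rr : r0 < r by rewrite /r; lra.
  have [|y [yE y1 y2 y3]] := sq r; first by lra.
  have := up r rr; rewrite -yE vw => U.
  have : w < r * - s by rewrite -ltr_pdivrMr; [rewrite /r; lra|lra].
  have : w * ((y - r) * r) <= w by nra.
  have : - s <= w * (y - r) by lra.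
  nra.
set r := r0 + (`|s| + `|v 0 2|) / (w - v 0 2) + 1.
have wr : 0 <= (`|s| + `|v 0 2|) / (w - v 0 2) by apply: divr_ge0; [exact: addr_ge0|lra].
have rr : r0 < r by rewrite /r; lra.
have [|y [yE y1 y2 y3]] := sq r; first by lra.
have := up r rr; rewrite -yE => U.
have : `|s| + `|v 0 2| < r * (w - v 0 2) by rewrite -ltr_pdivrMr; [rewrite /r; lra|lra].
have := ler_norm s; have := ler_norm (v 0 2); have := normr_ge0 (v 0 2); nra.
Qed.

Section Turn.
Variables (c m a b : 'rV[R]_3) (k l t : R).
Hypotheses (D : chord c k m l a b) (t0 : 0 <= t) (tpi : t < pi).

(** The member of the pencil at angle [t]: the turned disc is where it is positive. *)
Definition turn x := cos t * (mf c x - k) + sin t * (mf m x - l).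

Hypothesis turn_le : forall x, outer M p h x -> turn x <= 0.

(** As no outer point satisfies [0 < turn], [normal_dir] makes the normal a positive multiple of a
    point of the surface, the new centre; [r] is that multiple. *)
Lemma turn_chord : exists c' k' m' l' r, [/\ 0 < r, chord c' k' m' l' a b,
  forall x, r * (mf c' x - k') = turn x &
  forall x, r * (mf m' x - l') = cos t * (mf m x - l) - sin t * (mf c x - k)].
Proof.
have [cM aO bO ab ca cb ma mb nd Din] := D; have [aM _] := aO; have [bM _] := bO.
have cs := cos2Dsin2 t.
pose v := cos t *: c + sin t *: m.
have vE x : mf v x = cos t * mf c x + sin t * mf m x by rewrite mfDl !mfZl.
have v0 : v != 0.
  apply/eqP => v0; have [s0|s0] := eqVneq (sin t) 0.
    move: v0; rewrite /v s0 scale0r addr0 => /eqP; rewrite scaler_eq0 (negbTE (surface_neq0 cM)) orbF.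
    by move=> /eqP c0; move: cs; rewrite s0 c0 expr0n addr0 => /eqP; rewrite eq_sym oner_eq0.
  have [y [yM cy my _]] := arc_point cM aM bM ab ca cb ma mb nd ltr01.
  have := vE y; have := vE a; rewrite v0 !mf0l cy ca ma => ea ey.
  have : sin t * (mf m y - l) = 0 by lra.
  by move=> /eqP; rewrite mulf_eq0 (negbTE s0) subr_eq0 (gt_eqF my).
have [r [c' [r0 c'M vc]]] : exists r c, [/\ 0 < r, surface M c & v = r *: c].
  apply: (normal_dir aM (erefl _) v0) => x xM lt; apply: contrapT => xO.
  have := turn_le (conj xM xO); rewrite /turn; move: lt; rewrite !vE ca ma; lra.
have rn : r != 0 by rewrite gt_eqF.
have c'E x : mf c' x = (cos t * mf c x + sin t * mf m x) / r.
  by rewrite -vE vc mfZl mulrAC mulfV// mul1r.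
pose m' := r^-1 *: (cos t *: m - sin t *: c).
have m'E x : mf m' x = (cos t * mf m x - sin t * mf c x) / r.
  by rewrite /m' mfZl mfDl mfNl !mfZl mulrC.
pose k' := (cos t * k + sin t * l) / r; pose l' := (cos t * l - sin t * k) / r.
have E1 x : r * (mf c' x - k') = turn x by rewrite c'E /k' /turn; field.
have E2 x : r * (mf m' x - l') = cos t * (mf m x - l) - sin t * (mf c x - k).
  by rewrite m'E /l'; field.
exists c', k', m', l', r; split=> //; split=> //.
- by rewrite c'E ca ma.
- by rewrite c'E cb mb.
- by rewrite m'E ca ma.
- by rewrite m'E cb mb.
- move=> x xM cx mx; have := E1 x; have := E2 x; rewrite cx mx !subrr !mulr0 /turn => e2 e1.
  apply: nd => //; apply/eqP; rewrite -subr_eq0; apply/eqP.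
    have -> : mf c x - k = (mf c x - k) * (cos t ^+ 2 + sin t ^+ 2) by rewrite cs mulr1.
    transitivity (cos t * (cos t * (mf c x - k) + sin t * (mf m x - l)) -
      sin t * (cos t * (mf m x - l) - sin t * (mf c x - k))); first by ring.
    by rewrite -e1 -e2 !mulr0 subrr.
  have -> : mf m x - l = (mf m x - l) * (cos t ^+ 2 + sin t ^+ 2) by rewrite cs mulr1.
  transitivity (sin t * (cos t * (mf c x - k) + sin t * (mf m x - l)) +
      cos t * (cos t * (mf m x - l) - sin t * (mf c x - k))); first by ring.
  by rewrite -e1 -e2 !mulr0 addr0.
- move=> x xM kx; apply: contrapT => xO; have := turn_le (conj xM xO).
  by rewrite -E1 leNgt pmulr_rgt0// subr_gt0 kx.
Qed.

End Turn.
End Pencil.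

Section TurnStep.
Context {R : realType} (M : plane) (n : nat) (p : 'I_n -> 'rV[R]_3) (h : 'I_n -> R).
Implicit Types (a b c m u v w x y z : 'rV[R]_3) (i j : 'I_n) (k l s t eps : R).
Local Notation mf := (@metric_form R M).
Local Notation sg := (@form_sign R M).
Local Notation inn := (inner M p h).
Local Notation chord := (chord M p h).
Local Notation angle := (angle M p h).
Local Notation side := (side M p h).
Local Notation reaches := (reaches M p h).
Local Notation resolved := (resolved M p h).
Local Notation ncaps := (ncaps M p h).
Local Notation covered := (covered M p h).

Hypothesis scO : simply_connected R inn.

Variables (c m a b c' m' : 'rV[R]_3) (k l t k' l' r : R) (q : 'rV[R]_3 -> R).
Local Notation turn := (turn M c m k l t).
Hypotheses (D : chord c k m l a b) (A : angle c k m l q) (t0 : 0 <= t) (tpi : t < pi).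
Hypothesis turn_le : forall x, outer M p h x -> turn x <= 0.
Hypotheses (r0 : 0 < r) (D' : chord c' k' m' l' a b).
Hypothesis E1 : forall x, r * (mf c' x - k') = turn x.
Hypothesis E2 : forall x, r * (mf m' x - l') = cos t * (mf m x - l) - sin t * (mf c x - k).

Lemma turn_polar x : inn x -> exists2 s, 0 < s &
  [/\ mf c x - k = s * cos (q x), mf m x - l = s * sin (q x) & turn x = s * cos (q x - t)].
Proof.
move=> xO; have [qa _ _] := A; have [s s0 [e1 e2]] := qa x xO; exists s => //; split=> //.
by rewrite /turn e1 e2 cosB; ring.
Qed.

Lemma turn_gt0 x : (0 < turn x) = (k' < mf c' x).
Proof. by rewrite -E1 pmulr_rgt0// subr_gt0. Qed.

(** The strip has to be known at one point of the turned disc: its centre for [t = 0], otherwise a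
    point of the arc [l < mf m], where [q] equals [pi / 2]. *)
Lemma turn_strip x : surface M x -> k' < mf c' x -> - (pi / 2) < q x - t < pi / 2.
Proof.
have [qa qc qs] := A; have [cM [aM _] [bM _] ab ca cb ma mb nd Din] := D.
have [cM' _ _ _ ca' cb' _ _ _ Din'] := D'; have pi0 := pi_gt0 R.
have cp y : surface M y -> k' < mf c' y -> 0 < cos (q y - t).
  move=> yM ky; have yO := Din' y yM ky; have [s s0 [_ _ e]] := turn_polar yO.
  by rewrite -(pmulr_rgt0 _ s0) -e turn_gt0.
have kS : M = Sphere -> -1 <= k'.
  by move=> MS; apply/ltW; exact: circle_h_gt cM' aM bM ab ca' cb' MS.
have [x0 [x0M kx0 qx0]] : exists x0, [/\ surface M x0, k' < mf c' x0 &
    - (pi / 2) < q x0 - t < pi / 2].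
  have [tz|tn] := eqVneq t 0.
    have cc : k < mf c c by rewrite surface_mf//; exact: chord_lt D.
    exists c; split=> //; last by rewrite tz subr0 qs.
    by rewrite -turn_gt0 /turn tz cos0 sin0 mul1r mul0r addr0 subr_gt0.
  have tp : 0 < t by rewrite lt_neqAle eq_sym tn.
  have [y [yM cy my _]] := arc_point cM aM bM ab ca cb ma mb nd ltr01.
  have ky : k' < mf c' y.
    rewrite -turn_gt0 /turn cy subrr mulr0 add0r mulr_gt0 ?subr_gt0//.
    by apply: sin_gt0_pi; rewrite tp.
  exists y; split=> //; rewrite (circle_angle D A (Din' y yM ky) cy my).
  by have := tpi => ?; apply/andP; split; lra.
move=> xM kx.
exact: (inside_strip qc cM' Din' (chord_lt D') kS cp x0M kx0 qx0 xM kx).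
Qed.

Lemma turn_angle : angle c' k' m' l' (fun x => q x - t).
Proof.
have [qa qc qs] := A; split.
- move=> x xO; have [s s0 [e1 e2 e3]] := turn_polar xO; exists (s / r); first by rewrite divr_gt0.
  have rn : r != 0 by rewrite gt_eqF.
  have -> : mf c' x - k' = turn x / r by rewrite -E1; field.
  have -> : mf m' x - l' = (cos t * (mf m x - l) - sin t * (mf c x - k)) / r by rewrite -E2; field.
  by rewrite e3 e1 e2 sinB; split; field.
- move=> x eps xO e0; have [d d0 hd] := qc x eps xO e0; exists d => // y yO yx.
  have -> : q y - t - (q x - t) = q y - q x by ring.
  exact: hd.
- exact: turn_strip.
Qed.

Lemma turn_side x : side c' k' m' l' x -> side c k m l x.
Proof.
move=> S; have := side_angle D' turn_angle S => /= h1.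
by apply: (angle_side scO D A (side_inner S)); have := t0; lra.
Qed.

(** On the lune [cos (q x)] is negative while [q x] exceeds [t - pi / 2], which is at least
    [- pi / 2]. *)
Lemma turn_lune x : surface M x -> k' < mf c' x -> mf c x < k -> side c k m l x.
Proof.
move=> xM kx ck; have xO := chord_in D' xM kx; apply: (angle_side scO D A xO).
have [s s0 [e1 _ _]] := turn_polar xO.
have cn : cos (q x) < 0 by rewrite -(pmulr_rlt0 _ s0) -e1 subr_lt0.
rewrite ltNge; apply/negP => le; have := turn_strip xM kx => /andP[h1 _].
by have := t0 => ?; move: cn; rewrite ltNge cos_ge0_pihalf//; apply/andP; split; lra.
Qed.

(** The turned disc becomes a child of the old one. On a disc that reaches the old side but not the
    new one, [q - t] is at most [pi / 2], and it is above [- pi / 2] because the window is centred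
    at [tj >= t]; so the turned disc covers it. *)
Lemma turn_resolved :
  (forall j, reaches j (side c k m l) -> exists2 tj, t <= tj &
    forall x, surface M x -> h j < mf (p j) x -> - (pi / 2) < q x - tj < pi / 2) ->
  resolved c' k' m' l' -> resolved c k m l.
Proof.
move=> W [es [w d He v]]; exists (((c', k'), (c, k)) :: es); split=> /=.
- split; first by rewrite inE eqxx.
  by apply: wf_sub w => y; rewrite !inE => ->.
- split=> // e' /He[_ _ H] x [/= xM kx ck] /H S.
  have := side_angle D' turn_angle S => /= h1; have := turn_strip xM kx; lra.
- move=> e; rewrite inE => /orP[/eqP->|/He[? ? H]] /=.
    split; [exact: chord_c D'|exact: chord_in D'|move=> x [/= xM kx ck]].
    exact: turn_lune.
  by split=> // x /H; exact: turn_side.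
move=> i mi; have [m1|m1] := pselect (reaches i (side c' k' m' l')).
  have [nd ndi ndc] := v i m1; exists nd => //.
  by move: ndi; rewrite !inE => /orP[->|->]; rewrite ?orbT.
exists (c', k'); first by rewrite !inE eqxx orbT.
have [tj ttj hj] := W i mi => x xM hx /=; have xO := cap_inner xM hx.
have [s s0 [_ _ e]] := turn_polar xO.
rewrite -subr_ge0 -(pmulr_rge0 _ r0) E1 e pmulr_rge0//.
have /andP[h1 h2] := hj x xM hx.
have h3 : q x - t <= pi / 2.
  rewrite leNgt; apply/negP => lt; apply: m1; exists x; split=> //.
  exact: (angle_side scO D' turn_angle xO).
by apply: cos_ge0_pihalf; apply/andP; split; lra.
Qed.

Lemma turn_covers j tj : tj = t ->
  (forall x, surface M x -> h j < mf (p j) x -> - (pi / 2) < q x - tj < pi / 2) ->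
  ~ reaches j (side c' k' m' l').
Proof.
move=> -> hj [x [xM hx S]]; have := side_angle D' turn_angle S => /= h1.
have := hj x xM hx; lra.
Qed.

End TurnStep.

Lemma infinitely_often (n : nat) (g : nat -> 'I_n) :
  exists j, forall N, exists2 m, (N <= m)%N & g m = j.
Proof.
apply: contrapT => /forallNP H.
have /choice[f hf] : forall j, exists N, forall m, (N <= m)%N -> g m <> j.
  move=> j; have /existsNP[N hN] := H j; exists N => m Nm e; apply: hN; by exists m.
pose N := (\max_j f j)%N; apply: (hf (g N) N) => //.
exact: leq_bigmax.
Qed.

(** The arithmetic of [advance_near]: [L], [U] and [t] stand for [mf c x - k], [mf m x - l] and
    [sg - mf a x], [LJ] for the equation of a disc whose circle contains [a], and [X] for the norm
    of [x - a]. As [t] is of second order in [X], near [a] the inequality [LJ <= 0] bounds [U] by a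
    multiple of [- L]. *)
Lemma turn_estimate {R : realFieldType} (C ga be S T Cc al dl X LJ L U t : R) :
  0 < C -> 0 <= ga -> 0 < be -> 0 <= S -> S <= T * Cc -> 0 < Cc -> 0 < T -> T <= 1 ->
  T * (2 * (`|al| + 1)) <= be -> 0 < dl -> dl * (3 * C) <= 1 -> dl * (12 * C * (ga + 1)) <= be ->
  0 <= X -> LJ = al * L + be * U - ga * t -> LJ <= 0 -> X <= C * (- L + `|U| + t) ->
  t <= 3 / 2 * X ^+ 2 -> 0 <= t -> L <= 0 -> X < dl -> 0 < Cc * L + S * U -> False.
Proof.
move=> C0 ga0 bep S0 SC Cp T0 T1 T2 dl0 d1 d2 X0 jx hLJ hCx tau tau0 lx xa pos.
have al1 := ler_norm al; have al2 : - al <= `|al| by rewrite -normrN ler_norm.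
have SU : 0 < S * U by have h : Cc * L <= 0 by [rewrite pmulr_rle0]; clear -pos h; lra.
have Up : 0 < U by rewrite ltNge; apply/negP => /(mulr_ge0_le0 S0); rewrite leNgt SU.
have L1 : - L <= T * U.
  rewrite -(ler_pM2l Cp); have h : S * U <= T * Cc * U by rewrite ler_wpM2r// ltW.
  by clear -pos h; lra.
have L2 : - L <= U by apply: le_trans L1 _; rewrite ler_piMl// ltW.
rewrite (gtr0_norm Up) in hCx.
have A1 : - (be / 2 * U) <= al * L.
  have h1 : `|al| * T * U <= be / 2 * U.
    rewrite ler_wpM2r ?(ltW Up)//; have h := mulr_ge0 (normr_ge0 al) (ltW T0).
    by clear -h T0 T2; lra.
  have h2 : `|al| * (- L) <= `|al| * (T * U) by rewrite ler_wpM2l.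
  have h3 : 0 <= (`|al| - al) * - L by rewrite mulr_ge0 ?subr_ge0 ?oppr_ge0.
  by clear -h1 h2 h3; lra.
have B1 : t <= 3 / 2 * (dl * X).
  by apply: le_trans tau _; rewrite ler_pM2l ?divr_gt0// expr2 ler_wpM2r// ltW.
have B2 : C * t <= X / 2.
  have h1 : C * t <= C * (3 / 2 * (dl * X)) by rewrite ler_wpM2l// ltW.
  have h2 : dl * (3 * C) * X <= 1 * X by rewrite ler_wpM2r.
  by clear -h1 h2; lra.
have B3 : X <= 4 * C * U.
  have h : C * (- L + U + t) <= C * (U + U + t) by rewrite ler_pM2l// !lerD2r.
  by clear -h hCx B2; lra.
have B4 : t <= 6 * C * dl * U.
  have h : dl * X <= dl * (4 * C * U) by rewrite ler_pM2l.
  by clear -h B1; lra.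
have B5 : ga * t <= ga * (6 * C * dl * U) by rewrite ler_wpM2l.
have h1 : dl * (12 * C * (ga + 1)) * U <= be * U by rewrite ler_wpM2r// ltW.
have h2 : 0 < C * dl * U by rewrite !mulr_gt0.
by clear -jx hLJ A1 B5 h1 h2; lra.
Qed.

(** * Room for turning near the two fixed points *)

Section Advance.
Context {R : realType} (M : plane) (n : nat) (p : 'I_n -> 'rV[R]_3) (h : 'I_n -> R).
Implicit Types (a b c m u v w x y z : 'rV[R]_3) (i j : 'I_n) (k l s t eps : R).
Local Notation mf := (@metric_form R M).
Local Notation sg := (@form_sign R M).
Local Notation inn := (inner M p h).
Local Notation chord := (chord M p h).

Hypotheses (pM : forall i, surface M (p i)).
Hypothesis out : exists z, outside M p h z.

(** Points outside the given disc that tend to [y] lie in the discs of the family, in one of them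
    infinitely often; being closed, it contains [y]. *)
Lemma arc_cap c k m l a b y : chord c k m l a b -> inn y -> mf c y = k ->
  exists i, h i <= mf (p i) y /\ exists x, [/\ surface M x, h i <= mf (p i) x & mf c x < k].
Proof.
move=> D yO cy; have [cM [aM _] [bM _] ab ca cb _ _ _ _] := D.
have yM := inner_surface yO; have [d d0 hd] := inner_open yO.
have s2 : (-1 : R) ^+ 2 = 1 by rewrite sqrrN expr1n.
have gap := circle_gap cM aM bM ab ca cb.
have /choice[f hf] : forall N : nat, exists xi : 'rV[R]_3 * 'I_n,
    [/\ surface M xi.1, mf c xi.1 < k, `|xi.1 - y| < N.+1%:R^-1 & h xi.2 <= mf (p xi.2) xi.1].
  move=> N; have e0 : 0 < Num.min d N.+1%:R^-1 by rewrite lt_min d0 invr_gt0 ltr0n.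
  have [x [xM]] := near_circle cM gap yM cy s2 e0; rewrite lt_min => /andP[xd xN] cx.
  have [i hi] := inner_cap (hd x xM xd); exists (x, i); split=> //=; lra.
have [i hi] := infinitely_often (fun N => (f N).2); exists i; split; last first.
  have [N _ e] := hi 0%N; exists (f N).1; have [xM cx _ hx] := hf N; split=> //.
  by rewrite -e.
rewrite leNgt; apply/negP => lt; have [|e e0 he] := mf_near M (p i) y (e := h i - mf (p i) y).
  lra.
have [N Ne] : exists N : nat, N.+1%:R^-1 < e.
  exists (Num.truncn e^-1); rewrite invf_plt ?posrE//; exact: truncnS_gt.
have [N' NN' e'] := hi N; have [xM cx xN hx] := hf N'; rewrite e' in hx.
have /ltr_normlP[_] : `|mf (p i) (f N').1 - mf (p i) y| < h i - mf (p i) y.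
  apply: he; apply: lt_le_trans xN _; apply: le_trans (ltW Ne).
  by rewrite lef_pV2 ?posrE ?ltr0n// ler_nat ltnS.
lra.
Qed.

Lemma mf_self_bound x : `|mf x x| <= 3 * `|x| ^+ 2.
Proof.
have e0 := coord_norm x 0; have e1 := coord_norm x 1; have e2 := coord_norm x 2.
have f (j : 'I_3) : `|x 0 j| <= `|x| -> 0 <= x 0 j * x 0 j <= `|x| ^+ 2.
  move=> hj; rewrite -expr2 sqr_ge0 -(real_normK (num_real (x 0 j))) ler_sqr ?nnegrE//.
have /andP[h0 h0'] := f _ e0; have /andP[h1 h1'] := f _ e1; have /andP[h2 h2'] := f _ e2.
by rewrite ler_norml /metric_form; case: (M); apply/andP; split; lra.
Qed.

(** [c], [m] and [a] are independent, so their products with [x - a] control it. The last product is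
    of second order in the distance to [a], the surface being tangent to the plane [mf a x = sg]. *)
Lemma chord_norm c k m l a b : chord c k m l a b -> exists2 C, 0 < C &
  forall x, surface M x -> `|x - a| <= C * (`|mf c x - k| + `|mf m x - l| + (sg - mf a x)).
Proof.
move=> D; have [cM [aM _] [bM _] ab ca cb ma mb nd _] := D.
set d := b - a; set P := perp M c a b.
have dd : 0 < mf d d by apply: mf_sub_gt0 => //; rewrite eq_sym.
have PP : 0 < mf P P by exact: perp_gt0 cM aM bM ab ca cb.
have cd : mf c d = 0 by rewrite /d !mflin ca cb subrr.
have Pc : mf P c = 0 by exact: mf_cross_l.
have Pd : mf P d = 0 by exact: mf_cross_r.
have ad : mf a d < 0 by rewrite /d !mflin surface_mf//; have := mf_lt_sg aM bM ab; lra.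
have [r [s hP]] := chord_comb D Pd; rewrite -/P in hP.
have PE : cross M c d = P by [].
clearbody d P.
have dec v : v = (sg * mf c v) *: c + (mf P v / mf P P) *: P + (mf d v / mf d d) *: d.
  apply/eqP; rewrite -subr_eq0; apply/eqP.
  have gg : sg * sg = 1 by exact: sg2.
  apply: (@det_orth _ M c d P); first by rewrite /det PE gt_eqF.
  - rewrite !(mfDl, mfNl, mfZl) Pc (surface_mf cM) (mfC M d c) cd (mfC M v c).
    by rewrite mulrAC gg; ring.
  - rewrite !(mfDl, mfNl, mfZl) Pd cd (mfC M v d); field.
    by apply/andP; split; rewrite gt_eqF.
  - rewrite !(mfDl, mfNl, mfZl) (mfC M c P) Pc (mfC M d P) Pd (mfC M v P); field.
    by apply/andP; split; rewrite gt_eqF.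
set aP := mf a P; set ac := mf a c.
pose u1 := sg *: c + (r / mf P P) *: P - ((sg * ac + r / mf P P * aP) / mf a d) *: d.
pose u2 := (s / mf P P) *: P - (s / mf P P * aP / mf a d) *: d.
pose u3 := - (mf a d)^-1 *: d.
exists (`|u1| + `|u2| + `|u3| + 1); first by rewrite ltr_wpDl// !addr_ge0.
move=> x xM; set v := x - a.
have vl : mf c v = mf c x - k by rewrite /v mfDr mfNr ca.
have vP : mf P v = r * (mf c x - k) + s * (mf m x - l) by rewrite -hP /v mfDr mfNr.
have va : mf a v = - (sg - mf a x).
  by rewrite /v mfDr mfNr (surface_mf aM); ring.
clearbody v.
have vd : mf d v / mf d d = (- (sg - mf a x) - sg * (mf c x - k) * ac -
    (r * (mf c x - k) + s * (mf m x - l)) / mf P P * aP) / mf a d.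
  have an : mf a d != 0 by rewrite lt_eqF.
  have := congr1 (mf a) (dec v); rewrite !(mfDr, mfZr) va vl vP -/ac -/aP => e.
  by apply: (mulIf an); rewrite divfK// e; ring.
have -> : v = (mf c x - k) *: u1 + (mf m x - l) *: u2 + (sg - mf a x) *: u3.
  rewrite {1}(dec v) vd vP vl /u1 /u2 /u3; move: (mf c x - k) (mf m x - l) (sg - mf a x).
  by move=> x1 x2 x3; apply/rowP => i; rewrite !mxE; ring.
have t0 : 0 <= sg - mf a x by rewrite subr_ge0 mf_le_sg.
clearbody u1 u2 u3.
apply: le_trans (ler_normD _ _) _; rewrite normrZ (ger0_norm t0).
have := ler_normD ((mf c x - k) *: u1) ((mf m x - l) *: u2); rewrite !normrZ.
have := normr_ge0 u1; have := normr_ge0 u2; have := normr_ge0 u3.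
have := normr_ge0 (mf c x - k); have := normr_ge0 (mf m x - l).
move: `|u1| `|u2| `|u3| `|mf c x - k| `|mf m x - l| (sg - mf a x) t0 `|_ + _|.
move=> v1 v2 v3 x1 x2 x3 x30 y x20 x10 v30 v20 v10 le.
have := (mulr_ge0 v10 x20, mulr_ge0 v10 x30, mulr_ge0 v20 x10, mulr_ge0 v20 x30, mulr_ge0 v30 x10).
move: (mulr_ge0 v30 x20) => q1 [[[[q2 q3] q4] q5] q6].
by lra.
Qed.

(** [C] and [S] stand for a cosine and a sine. Some disc of the family contains points of the arc
    arbitrarily close to [a], so its circle passes through [a] and its equation involves [mf m - l]
    with a positive factor [be]. Outer points are not in its interior, which keeps them away from a
    slightly turned disc. *)
Lemma advance_near c k m l a b : chord c k m l a b ->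
  (forall e, outer M p h e -> mf c e = k -> mf m e <= l) ->
  exists2 dl, 0 < dl & exists2 T, 0 < T & forall x S C, outer M p h x -> `|x - a| < dl ->
    0 <= S -> S <= T * C -> C * (mf c x - k) + S * (mf m x - l) <= 0.
Proof.
move=> D clean; have [cM aO bO ab ca cb ma mb nd Din] := D.
have [aM aO'] := aO; have [bM bO'] := bO.
have /choice[f hf] : forall N : nat, exists yi : 'rV[R]_3 * 'I_n,
    [/\ surface M yi.1, mf c yi.1 = k, l < mf m yi.1, `|yi.1 - a| < N.+1%:R^-1 &
      h yi.2 <= mf (p yi.2) yi.1 /\
      exists x, [/\ surface M x, h yi.2 <= mf (p yi.2) x & mf c x < k]].
  move=> N; have e0 : 0 < N.+1%:R^-1 :> R by rewrite invr_gt0 ltr0n.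
  have [y [yM cy my ya]] := arc_point cM aM bM ab ca cb ma mb nd e0.
  have yO : inn y.
    by apply: contrapT => yO; have := clean y (conj yM yO) cy; rewrite leNgt my.
  by have [i hi] := arc_cap D yO cy; exists (y, i); split.
have [j hj] := infinitely_often (fun N => (f N).2).
have [N0 _ jN0] := hj 0%N.
have [y0M cy0 my0 _ [hy0 [w [wM hw cw]]]] := hf N0; rewrite jN0 in hy0 hw.
have ja : mf (p j) a = h j.
  apply/eqP; rewrite eq_le (outer_le j aO) /= leNgt; apply/negP => lt.
  have [|e e0 he] := mf_near M (p j) a (e := h j - mf (p j) a); first by lra.
  have [N' NN' e'] := hj (Num.truncn e^-1); have [xM cx _ xN [hx _]] := hf N'.
  rewrite e' in hx.
  have /ltr_normlP[_] : `|mf (p j) (f N').1 - mf (p j) a| < h j - mf (p j) a.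
    apply: he; apply: lt_trans xN _; rewrite invf_plt ?posrE ?ltr0n//.
    by apply: lt_le_trans (truncnS_gt _) _; rewrite ler_nat ltnS.
  lra.
have tb : 0 < sg - mf a b by have := mf_lt_sg aM bM ab; lra.
set ga := (h j - mf (p j) b) / (sg - mf a b).
have ga0 : 0 <= ga by rewrite divr_ge0 ?(ltW tb)// subr_ge0; exact: outer_le.
set W := p j - ga *: a.
have WE x : mf W x - mf W a = (mf (p j) x - h j) + ga * (sg - mf a x).
  by rewrite /W !(mfDl, mfNl, mfZl) ja (surface_mf aM); ring.
have Wb : mf W (b - a) = 0 by rewrite mfDr mfNr WE /ga; field; rewrite gt_eqF.
have [al [be hW]] := chord_comb D Wb.
have jE x : mf (p j) x - h j = al * (mf c x - k) + be * (mf m x - l) - ga * (sg - mf a x).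
  by rewrite -hW WE; ring.
have ta0 : 0 < sg - mf a (f N0).1.
  have ya : a != (f N0).1 by apply/eqP => E; move: my0; rewrite -E ma ltxx.
  by have := mf_lt_sg aM y0M ya; lra.
have be0 : 0 <= be.
  have := jE (f N0).1; rewrite cy0 subrr mulr0 add0r => E.
  rewrite -(pmulr_lge0 be (_ : 0 < mf m (f N0).1 - l)); last by rewrite subr_gt0.
  by have : 0 <= ga * (sg - mf a (f N0).1) by [rewrite mulr_ge0// ltW]; lra.
(* For [be = 0] also [ga = 0], and the equation of the disc [j] would be a multiple of that of the
   given disc: a positive multiple contradicts the point [w], any other an outside point. *)
have bep : 0 < be.
  rewrite lt_neqAle be0 andbT eq_sym; apply/eqP => bz.
  have gz : ga = 0.
    have := jE (f N0).1; rewrite cy0 subrr mulr0 bz mul0r addr0 sub0r => E.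
    apply/eqP; rewrite eq_le ga0 andbT -(pmulr_lle0 _ ta0); lra.
  have [al0|al0] := ltP 0 al.
    have := jE w; rewrite bz gz !mul0r addr0 subr0 => E.
    have : al * (mf c w - k) < 0 by rewrite pmulr_rlt0// subr_lt0.
    lra.
  have [z zO] := out; have [zM hz] := zO; have := inside_outer Din (outside_outer zO).
  have := jE z; rewrite bz gz !mul0r addr0 subr0 => E cz.
  have : 0 <= al * (mf c z - k) by rewrite mulr_le0// subr_le0.
  by have := hz j; lra.
have [C C0 hC] := chord_norm D.
pose T := Num.min 1 (be / (2 * (`|al| + 1))).
have T0 : 0 < T by rewrite lt_min ltr01 divr_gt0// mulr_gt0// ltr_wpDl.
pose dl := Num.min (1 / (3 * C)) (be / (12 * C * (ga + 1))).
have dl0 : 0 < dl by rewrite lt_min !divr_gt0 ?mulr_gt0 ?ltr_wpDl.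
exists dl => //; exists T => // x S Cc xO xa S0 SC; have [xM xO'] := xO.
clear D clean aO bO ab ca cb ma mb nd aO' bO' bM hf hj jN0 y0M cy0 my0 hy0 wM hw cw ja tb WE Wb hW ta0 be0.
rewrite leNgt; apply/negP => pos.
have lx : mf c x - k <= 0 by rewrite subr_le0; exact: inside_outer Din xO.
have Cp : 0 < Cc.
  rewrite ltNge; apply/negP => le; have : 0 <= T * Cc by exact: le_trans S0 SC.
  rewrite pmulr_rge0// => ge; have Cz : Cc = 0 by apply/eqP; rewrite eq_le le.
  have Sz : S = 0 by apply/eqP; rewrite eq_le S0 andbT; move: SC; rewrite Cz mulr0.
  by move: pos; rewrite Cz Sz !mul0r addr0 ltxx.
have hj' : mf (p j) x - h j <= 0 by rewrite subr_le0; exact: outer_le.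
have jx := jE x.
have hCx := hC x xM.
have tau : sg - mf a x <= 3 / 2 * `|x - a| ^+ 2.
  have := mf_self_bound (x - a); rewrite !mflin (mfC M x a) (surface_mf xM) (surface_mf aM).
  by move=> /(le_trans (ler_norm _)); lra.
have tau0 : 0 <= sg - mf a x by rewrite subr_ge0 mf_le_sg.
have T1 : T <= 1 by rewrite ge_min lexx.
have T2 : T * (2 * (`|al| + 1)) <= be.
  by rewrite -ler_pdivlMr; [rewrite ge_min lexx orbT|rewrite mulr_gt0 ?ltr_wpDl].
have d1 : dl * (3 * C) <= 1.
  by rewrite -ler_pdivlMr; [rewrite ge_min lexx|rewrite mulr_gt0].
have d2 : dl * (12 * C * (ga + 1)) <= be.
  by rewrite -ler_pdivlMr; [rewrite ge_min lexx orbT|rewrite !mulr_gt0 ?ltr_wpDl].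
move: hj' jx hCx tau tau0 lx pos xa.
rewrite (ler0_norm (x := mf c x - k)); last by rewrite subr_le0; exact: inside_outer Din xO.
have n0 := normr_ge0 (x - a).
move: `|x - a| (mf (p j) x - h j) (mf c x - k) (mf m x - l) (sg - mf a x) n0.
move=> X LJ L U t X0 hLJ jx hCx tau tau0 lx pos xa.
exact: (turn_estimate C0 ga0 bep S0 SC Cp T0 T1 T2 dl0 d1 d2 X0 jx hLJ hCx tau tau0 lx xa pos).
Qed.

End Advance.

Lemma closed_near {R : realType} {V : normedModType R} (A : set V) :
  (forall x, ~ A x -> exists2 e, 0 < e & forall y, `|y - x| < e -> ~ A y) -> closed A.
Proof.
move=> H; rewrite -[A]setCK closedC openE => x /= /H[e e0 he].
apply/nbhs_ballP; exists e => //= y; rewrite -ball_normE /= distrC => yx; exact: he.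
Qed.

Lemma compact_rV3 {R : realType} (A : set 'rV[R]_3) (B : R) :
  (forall x, A x -> `|x| <= B) ->
  (forall x, ~ A x -> exists2 e, 0 < e & forall y, `|y - x| < e -> ~ A y) -> compact A.
Proof.
move=> AB An; apply: bounded_closed_compact; last exact: (@closed_near _ 'rV[R]_3).
exists B; split; first exact: num_real.
by move=> N /ltW BN x /AB xB; exact: le_trans BN.
Qed.

Lemma far_slope {R : realFieldType} (C S T F X L u v : R) : 0 < C -> 0 <= S -> S <= T * C ->
  0 <= F * X -> 0 <= L -> v <= F * X + L -> 0 < C * u + S * v -> - u <= T * (F * X + L).
Proof.
move=> C0 S0 SC FX L0 hv pos; rewrite -(ler_pM2l C0).
have h1 : S * v <= S * (F * X + L) by exact: ler_wpM2l.
have h2 : S * (F * X + L) <= T * C * (F * X + L) by apply: ler_wpM2r => //; exact: addr_ge0.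
by clear -pos h1 h2; lra.
Qed.

(** Together with [surface_bound] this confines the points that could obstruct a turn of small slope
    to a ball. *)
Lemma far_norm {R : realFieldType} (C F T X L K u : R) : 0 < C -> 0 <= F -> 0 <= X -> 0 <= L ->
  0 <= K -> T <= (2 * C * (F + 1))^-1 -> - u <= T * (F * X + L) -> X <= C * (K - u) ->
  X <= 2 * (C * K + L).
Proof.
move=> C0 F0 X0 L0 K0 hT hu hX; have F1 : 0 < F + 1 by exact: ltr_wpDl.
have FX : 0 <= F * X + L by rewrite addr_ge0// mulr_ge0.
have h1 : - u <= (2 * C * (F + 1))^-1 * (F * X + L) by apply: le_trans hu _; exact: ler_wpM2r.
have h2 : C * - u <= (F * X + L) / (2 * (F + 1)).
  apply: le_trans (ler_wpM2l (ltW C0) h1) _; rewrite le_eqVlt; apply/orP; left.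
  by apply/eqP; field; rewrite !gt_eqF.
have h3 : (F * X + L) / (2 * (F + 1)) <= X / 2 + L.
  rewrite ler_pdivrMr ?mulr_gt0//; have := mulr_ge0 L0 F0; clear -X0 L0; lra.
by clear -h2 h3 hX; lra.
Qed.

(** * Room for turning elsewhere, by compactness *)

Section CompactOuter.
Context {R : realType} (M : plane) (n : nat) (p : 'I_n -> 'rV[R]_3) (h : 'I_n -> R).
Implicit Types (a b c m u v w x y z : 'rV[R]_3) (i j : 'I_n) (k l s t eps : R).
Local Notation mf := (@metric_form R M).
Local Notation sg := (@form_sign R M).
Local Notation inn := (inner M p h).
Local Notation chord := (chord M p h).

Lemma mf_self_near x eps : 0 < eps -> exists2 d, 0 < d &
  forall y, `|y - x| < d -> `|mf y y - mf x x| < eps.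
Proof.
move=> e0; set F := fnorm x; have F0 : 0 <= F by exact: fnorm_ge0.
exists (Num.min 1 (eps / (3 + 2 * F))); first by rewrite lt_min ltr01 divr_gt0//; lra.
move=> y; rewrite lt_min ltr_pdivlMr => [/andP[d1 d2]|]; last by lra.
have -> : mf y y - mf x x = mf (y - x) (y - x) + 2 * mf x (y - x).
  by rewrite !mflin (mfC M y x); ring.
apply: le_lt_trans (ler_normD _ _) _; rewrite normrM ger0_norm//.
have := mf_self_bound M (y - x); have := mf_bound M x (y - x); rewrite -/F.
by have := normr_ge0 (y - x); rewrite expr2; nra.
Qed.

Lemma surface_near x : ~ surface M x -> exists2 e, 0 < e &
  forall y, `|y - x| < e -> ~ surface M y.
Proof.
move=> xM; have [E|ne] := eqVneq (mf x x) sg; last first.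
  have [|d d0 hd] := @mf_self_near x `|mf x x - sg|; first by rewrite normr_gt0 subr_eq0.
  by exists d => // y /hd + /surface_mf yM; rewrite yM distrC ltxx.
move: xM E; rewrite /surface /form_sign; case: M => //= xM E.
have x2 : x 0 2 <= -1.
  have x2 : x 0 2 <= 0 by rewrite leNgt; apply/negP => x2; apply: xM.
  move: E; rewrite /metric_form; have := sqr_ge0 (x 0 0); have := sqr_ge0 (x 0 1); nra.
exists 1 => // y yx [_ y2]; have := coord_norm (y - x) 2; rewrite !mxE.
by move=> /(le_trans (ler_norm _)); lra.
Qed.

Lemma outer_near_not x : ~ outer M p h x -> exists2 e, 0 < e &
  forall y, `|y - x| < e -> ~ outer M p h y.
Proof.
move=> nx; have [xM|/surface_near[e e0 he]] := pselect (surface M x); last first.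
  by exists e => // y /he yM [].
have xO : inn x by apply: contrapT => xO; apply: nx.
by have [e e0 he] := inner_open xO; exists e => // y yx [yM yO]; apply: yO; exact: he.
Qed.

(** [- mf c] is coercive: on the hyperboloid it is at least [x 0 2] times the positive number
    [c 0 2 - w]. The 2 makes the bound work on the sphere, where [mf c x] is at most 1. *)
Lemma surface_bound c : surface M c -> exists2 C, 0 < C &
  forall x, surface M x -> `|x| <= C * (2 - mf c x).
Proof.
move=> cM.
have nx (x : 'rV[R]_3) B : `|x 0 0| <= B -> `|x 0 1| <= B -> `|x 0 2| <= B -> `|x| <= B.
  move=> h0 h1 h2; rewrite -[`|x|]/(mx_norm x) mx_normrE; apply: bigmax_le => [|[i j] _ /=].
    exact: le_trans h0.
  rewrite ord1; case: j => -[|[|[|//]]] jl /=; [move: h0|move: h1|move: h2];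
    by congr (`|x 0 _| <= _); apply/val_inj.
have := cM; rewrite /surface /metric_form; case: M => /=.
  move=> c1; exists 1 => // x x1; rewrite mul1r.
  have lx : 1 <= 2 - (c 0 0 * x 0 0 + c 0 1 * x 0 1 + c 0 2 * x 0 2).
    have := sqr_ge0 (c 0 0 - x 0 0); have := sqr_ge0 (c 0 1 - x 0 1).
    have := sqr_ge0 (c 0 2 - x 0 2); rewrite !expr2; lra.
  have s0 := sqr_ge0 (x 0 0); have s1 := sqr_ge0 (x 0 1); have s2 := sqr_ge0 (x 0 2).
  rewrite !expr2 in s0 s1 s2.
  by apply: le_trans lx; apply: nx; rewrite ler_norml; apply/andP; split; nra.
move=> [cc c2]; set w := Num.sqrt (c 0 0 ^+ 2 + c 0 1 ^+ 2).
have w0 : 0 <= w by exact: sqrtr_ge0.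
have w2 : w ^+ 2 = c 0 0 ^+ 2 + c 0 1 ^+ 2 by rewrite sqr_sqrtr// addr_ge0 ?sqr_ge0.
have wc : w < c 0 2 by nra.
exists (c 0 2 - w)^-1; first by rewrite invr_gt0 subr_gt0.
move=> x [xx x2].
have s0 := sqr_ge0 (x 0 0); have s1 := sqr_ge0 (x 0 1); rewrite !expr2 in s0 s1.
have xn : `|x| <= x 0 2 by apply: nx; rewrite ler_norml; apply/andP; split; nra.
rewrite mulrC ler_pdivlMr ?subr_gt0//.
have cs : c 0 0 * x 0 0 + c 0 1 * x 0 1 <= w * x 0 2.
  set A := _ + _; rewrite leNgt; apply/negP => lt.
  have : (w * x 0 2) ^+ 2 < A ^+ 2 by have : 0 <= w * x 0 2 by [nra]; nra.
  have : A ^+ 2 + (c 0 0 * x 0 1 - c 0 1 * x 0 0) ^+ 2 =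
    (c 0 0 ^+ 2 + c 0 1 ^+ 2) * (x 0 0 ^+ 2 + x 0 1 ^+ 2) by rewrite /A; ring.
  rewrite -w2; have := sqr_ge0 (c 0 0 * x 0 1 - c 0 1 * x 0 0).
  have : x 0 0 ^+ 2 + x 0 1 ^+ 2 <= x 0 2 ^+ 2 by rewrite !expr2; lra.
  move=> hx; have : w ^+ 2 * (x 0 0 ^+ 2 + x 0 1 ^+ 2) <= w ^+ 2 * x 0 2 ^+ 2.
    by rewrite ler_wpM2l// sqr_ge0.
  rewrite exprMn; lra.
have : `|x| * (c 0 2 - w) <= x 0 2 * (c 0 2 - w) by rewrite ler_wpM2r// subr_ge0 ltW.
lra.
Qed.

Hypotheses (pM : forall i, surface M (p i)).
Hypothesis out : exists z, outside M p h z.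

(* Away from [a] and [b], compactness; the disc is bounded, so that only a bounded part of
   the plane matters. *)
Lemma advance_far c k m l a b (da db : R) : chord c k m l a b -> 0 < da -> 0 < db ->
  (forall e, outer M p h e -> mf c e = k -> mf m e <= l) ->
  exists2 T, 0 < T & forall x S C, outer M p h x -> da <= `|x - a| -> db <= `|x - b| ->
    0 <= S -> S <= T * C -> C * (mf c x - k) + S * (mf m x - l) <= 0.
Proof.
move=> D da0 db0 clean; have [cM aO bO ab ca cb ma mb nd Din] := D.
have [C1 C10 hC1] := surface_bound cM.
set F := fnorm m; have F0 : 0 <= F by exact: fnorm_ge0.
pose T0 := (2 * C1 * (F + 1))^-1.
have T00 : 0 < T0 by rewrite invr_gt0 !mulr_gt0//; lra.
pose B := 2 * (C1 * `|2 - k| + `|l|).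
pose K := [set x | [/\ outer M p h x, `|x| <= B, da <= `|x - a| & db <= `|x - b|]].
have cK : compact K.
  apply: (@compact_rV3 _ _ B) => [x []//|x nK].
  have dist_near (y : 'rV[R]_3) (d : R) : `|x - y| < d -> exists2 e, 0 < e &
      forall z, `|z - x| < e -> `|z - y| < d.
    move=> h1; exists (d - `|x - y|); first by rewrite subr_gt0.
    move=> z zx; have -> : z - y = (z - x) + (x - y) by rewrite addrA subrK.
    by apply: le_lt_trans (ler_normD _ _) _; lra.
  have [xO|/outer_near_not[e e0 he]] := pselect (outer M p h x); last first.
    by exists e => // y /he nO [].
  have [xB|Bx] := leP `|x| B; last first.
    exists (`|x| - B); first by rewrite subr_gt0.
    move=> y yx [_ yB _ _]; have := ler_normD (x - y) y; rewrite subrK distrC; lra.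
  have [xa|ax] := leP da `|x - a|; last first.
    have [e e0 he] := dist_near _ _ ax; exists e => // y /he + [_ _ ya _]; lra.
  have [xb|bx] := leP db `|x - b|; last first.
    have [e e0 he] := dist_near _ _ bx; exists e => // y /he + [_ _ _ yb]; lra.
  by exfalso; apply: nK.
(* Positive on [K]: an outer point is not in the open disc, and on its circle, away from [a] and
   [b], [clean] and [nd] give [mf m x < l]. *)
pose f x := Num.max (k - mf c x) (l - mf m x).
have fc : {within K, continuous f}.
  apply: continuous_subspaceT => x; apply: (@continuous_max _ _ (fun x => k - mf c x) (fun x => l - mf m x)).
    by apply: (@continuousB _ R^o); [exact: cst_continuous|exact: mf_continuous].
  by apply: (@continuousB _ R^o); [exact: cst_continuous|exact: mf_continuous].
have fpos x : K x -> 0 < f x.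
  move=> [xO _ xa xb]; rewrite lt_max !subr_gt0.
  have := inside_outer Din xO; rewrite le_eqVlt => /orP[/eqP ck|->//].
  have := clean x xO ck; rewrite le_eqVlt => /orP[/eqP ml|->]; last by rewrite orbT.
  by have [e|e] := nd x xO.1 ck ml; [move: xa|move: xb]; rewrite e subrr normr0; lra.
have [eta eta0 heta] : exists2 eta, 0 < eta & forall x, K x -> eta <= f x.
  have [K0|/nonemptyPn K0] := pselect (K !=set0); last by exists 1 => // x; rewrite K0.
  have [x0 x0K hx0] := EVT_min_rV K0 cK fc; exists (f x0); first exact/fpos/set_mem.
  by move=> x xK; apply: hx0; exact: mem_set.
have BF : 0 <= F * B + `|l|.
  by rewrite addr_ge0// mulr_ge0// /B mulr_ge0// addr_ge0// mulr_ge0// ltW.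
pose T := Num.min T0 (eta / (F * B + `|l| + 1)).
exists T; first by rewrite lt_min T00 divr_gt0//; lra.
clear D clean aO bO ab ca cb ma mb nd cM cK fc fpos.
move=> x S C xO xa xb S0 SC; rewrite leNgt; apply/negP => pos; have [xM _] := xO.
have TT0 : T <= T0 by rewrite ge_min lexx.
have Tp : 0 < T by rewrite lt_min T00 divr_gt0//; lra.
have C0 : 0 <= C by rewrite -(pmulr_rge0 _ Tp); exact: le_trans SC.
have lx : mf c x - k <= 0 by rewrite subr_le0; exact: inside_outer Din xO.
have Cp : 0 < C.
  rewrite lt_neqAle C0 andbT; apply/eqP => Cz; move: pos SC; rewrite -Cz mul0r mulr0 add0r => pos Sz.
  by have S' : S = 0 by [apply/eqP; rewrite eq_le S0 Sz]; move: pos; rewrite S' mul0r ltxx.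
have mx : `|mf m x| <= F * `|x| := mf_bound M m x.
have ml1 : mf m x - l <= F * `|x| + `|l|.
  by rewrite lerD ?(le_trans (ler_norm _) mx)// (le_trans (ler_norm _))// normrN.
have FX : 0 <= F * `|x| by rewrite mulr_ge0.
have h1 := far_slope Cp S0 SC FX (normr_ge0 l) ml1 pos.
have xB : `|x| <= B.
  apply: (far_norm C10 F0 (normr_ge0 x) (normr_ge0 l) (normr_ge0 _) TT0 h1).
  apply: le_trans (hC1 x xM) _; rewrite ler_pM2l// opprB addrA lerD2r.
  by rewrite -lerBlDr ler_norm.
have xK : K x by [].
have := heta x xK; rewrite le_max => /orP[e1|e1].
  have T1 : T * (F * B + `|l| + 1) <= eta.
    by rewrite -ler_pdivlMr; [rewrite ge_min lexx orbT|exact: ltr_wpDl].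
  have h2 : T * (F * `|x| + `|l|) <= T * (F * B + `|l|).
    by rewrite ler_pM2l// lerD2r ler_wpM2l.
  clear -R M n p h pM out e1 h1 T1 h2 Tp; lra.
have h2 : S * (mf m x - l) <= 0.
  by apply: mulr_ge0_le0 => //; rewrite subr_le0 -subr_ge0 (le_trans (ltW eta0) e1).
have h3 : C * (mf c x - k) <= 0 by rewrite pmulr_rle0.
by clear -R M n p h pM out pos h2 h3; lra.
Qed.

(** The outer points near [a], those near [b] and the remaining ones each allow turning up to some
    slope; the tangent of [t] is taken below all three. *)
Lemma advance c k m l a b eps : chord c k m l a b ->
  (forall e, outer M p h e -> mf c e = k -> mf m e <= l) -> 0 < eps ->
  exists t, [/\ 0 < t, t < eps & forall x, outer M p h x -> turn M c m k l t x <= 0].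
Proof.
move=> D clean e0.
have [da da0 [Ta Ta0 ha]] := advance_near out D clean.
have [db db0 [Tb Tb0 hb]] := advance_near out (chordC D) clean.
have [T T0 hT] := advance_far D da0 db0 clean.
pose T' := Num.min T (Num.min Ta Tb).
have T'0 : 0 < T' by rewrite !lt_min T0 Ta0.
have [|d1 d10 hd1] := near_cts (@continuous_sin R 0) (e := T' / 2); first lra.
have [|d2 d20 hd2] := near_cts (@continuous_cos R 0) (e := 1 / 2); first lra.
rewrite sin0 in hd1; rewrite cos0 in hd2.
pose t := Num.min (Num.min (eps / 2) (d1 / 2)) (Num.min (d2 / 2) 1).
have [t1 t2 t3 t4] : [/\ t <= eps / 2, t <= d1 / 2, t <= d2 / 2 & t <= 1].
  by split; rewrite /t !ge_min lexx ?orbT.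
have t0 : 0 < t by rewrite !lt_min ltr01 !divr_gt0.
have [T'1 T'2 T'3] : [/\ T' <= T, T' <= Ta & T' <= Tb].
  by split; rewrite /T' !ge_min lexx ?orbT.
clearbody t T'.
have half (u : R) : 0 < u -> u / 2 < u by move=> u0; rewrite ltr_pdivrMr// ltr_pMr// ltr1n.
have s1 : sin t < T' / 2.
  have := hd1 t; rewrite !subr0 (gtr0_norm t0) => /(_ (le_lt_trans t2 (half _ d10))).
  by apply: le_lt_trans; exact: ler_norm.
have c1 : 1 / 2 < cos t.
  have := hd2 t; rewrite !subr0 (gtr0_norm t0) => /(_ (le_lt_trans t3 (half _ d20))).
  by rewrite distrC => /(le_lt_trans (ler_norm _)); clear -R M n p h pM out; lra.
have s0 : 0 <= sin t.
  by apply: sin_ge0_pi; rewrite (ltW t0) (le_trans t4)// (le_trans _ (pi_ge2 R))// ler1n.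
have sc : sin t <= T' * cos t.
  by apply: le_trans (ltW s1) _; rewrite ler_pM2l// -[2^-1]mul1r ltW.
have [sT sa sb] : [/\ sin t <= T * cos t, sin t <= Ta * cos t & sin t <= Tb * cos t].
  have c0 : 0 <= cos t by apply: le_trans (ltW c1); rewrite divr_ge0.
  by split; apply: le_trans sc _; exact: ler_wpM2r.
exists t; split=> //; first exact: le_lt_trans t1 (half _ e0).
move=> x xO; rewrite /turn; have [xa|xa] := ltP `|x - a| da; first exact: ha.
have [xb|xb] := ltP `|x - b| db; first exact: hb.
exact: hT.
Qed.

End CompactOuter.

Lemma window_lt {R : realFieldType} (a b t u : R) :
  - (a / 2) < u - b -> u - t < a / 2 -> b - t < a.
Proof. lra. Qed.

(** * The induction step for an arc without contacts *)

Section CleanStep.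
Context {R : realType} (M : plane) (n : nat) (p : 'I_n -> 'rV[R]_3) (h : 'I_n -> R).
Implicit Types (a b c m u v w x y z : 'rV[R]_3) (i j : 'I_n) (k l s t eps : R).
Local Notation mf := (@metric_form R M).
Local Notation sg := (@form_sign R M).
Local Notation inn := (inner M p h).
Local Notation outer := (outer M p h).
Local Notation chord := (chord M p h).
Local Notation angle := (angle M p h).
Local Notation side := (side M p h).
Local Notation reaches := (reaches M p h).
Local Notation resolved := (resolved M p h).
Local Notation ncaps := (ncaps M p h).
Local Notation turn := (turn M).

Hypotheses (pM : forall i, surface M (p i)) (hlt : forall i, h i < sg).
Hypothesis out : exists z, outside M p h z.

Lemma outside_open z : outside M p h z -> exists2 e, 0 < e &
  forall y, surface M y -> `|y - z| < e -> outside M p h y.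
Proof.
move=> [zM hz].
have /choice[d hd] : forall i, exists d : R, 0 < d /\
    forall y, `|y - z| < d -> mf (p i) y < h i.
  move=> i; have [|d d0 hd] := mf_near M (p i) z (e := h i - mf (p i) z).
    by rewrite subr_gt0.
  by exists d; split=> // y /hd /(le_lt_trans (ler_norm _)); lra.
exists (\big[Num.min/1]_i d i).
  by apply/bigmin_gtP; split=> // i _; have [] := hd i.
move=> y yM yz; split=> // i; have [_] := hd i; apply; apply: lt_le_trans yz _.
exact: bigmin_le_cond.
Qed.

Lemma cap_closure y : surface M y ->
  (forall eps, 0 < eps -> exists2 z, `|z - y| < eps & exists i, h i <= mf (p i) z) ->
  exists i, h i <= mf (p i) y.
Proof.
move=> yM H; apply: contrapT => nE.
have yo : outside M p h y.
  by split=> // i; rewrite ltNge; apply/negP => hi; apply: nE; exists i.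
have /choice[d hd] : forall i, exists d : R, 0 < d /\
    forall z, `|z - y| < d -> mf (p i) z < h i.
  move=> i; have [|d d0 hd] := mf_near M (p i) y (e := h i - mf (p i) y).
    by rewrite subr_gt0; case: yo.
  by exists d; split=> // z /hd /(le_lt_trans (ler_norm _)); lra.
have [|z zy [i hi]] := H (\big[Num.min/1]_i d i).
  by apply/bigmin_gtP; split=> // i _; have [] := hd i.
have [_ hz] := hd i; suff : mf (p i) z < h i by rewrite ltNge hi.
by apply: hz; apply: lt_le_trans zy _; exact: bigmin_le_cond.
Qed.

(** The admissible angles form a closed interval: for [t <= T], a positive multiple of [turn] at [t]
    is a nonnegative combination of its values at 0 and [T]. The angle [pi] is not among them, as it
    turns the disc into its complement, which contains outside points. *)
Lemma turn_max c k m l a b : chord c k m l a b -> exists T, [/\ 0 <= T, T < pi,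
  forall t x, 0 <= t -> t <= T -> outer x -> turn c m k l t x <= 0 &
  forall t, T < t -> t < pi -> ~ forall x, outer x -> turn c m k l t x <= 0].
Proof.
move=> D; have pi0 := pi_gt0 R; have [cM aO bO ab ca cb _ _ _ Din] := D.
have [aM _] := aO; have [bM _] := bO.
pose A := [set t | 0 <= t <= pi /\ forall x, outer x -> turn c m k l t x <= 0].
have A0 : A 0.
  split; first by rewrite lexx ltW.
  by move=> x xO; rewrite /turn cos0 sin0 mul1r mul0r addr0 subr_le0; exact: inside_outer Din xO.
have Ab : has_sup A by split; [exists 0|exists pi => t [/andP[]]].
set T := sup A.
have T0 : 0 <= T by exact: sup_ubound Ab.2 _ A0.
have Tpi : T <= pi by apply: sup_le_ub Ab.1 _ => t [/andP[]].
have TA x : outer x -> turn c m k l T x <= 0.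
  move=> xO; rewrite leNgt; apply/negP => pos.
  have tc : {for T, continuous (fun t => turn c m k l t x)}.
    rewrite /turn; apply: (@continuousD _ R^o); apply: (@continuousM R R);
      try exact: cst_continuous; [exact: continuous_cos|exact: continuous_sin].
  have [d d0 hd] := near_cts tc pos.
  have [s [s01 sA] sT] := sup_adherent d0 Ab.
  have sT' : s <= T by apply: sup_ubound Ab.2 _ _; split.
  have /ltr_normlP[] : `|turn c m k l s x - turn c m k l T x| < turn c m k l T x.
    by apply: hd; rewrite ler0_norm -/T in sT *; lra.
  by have := sA x xO; lra.
have Tlt : T < pi.
  rewrite lt_neqAle Tpi andbT; apply/eqP => e.
  have z0 z : outside M p h z -> mf c z = k.
    move=> /outside_outer zO; have := TA z zO; have := inside_outer Din zO.
    by rewrite /turn e cospi sinpi mul0r addr0 => h1 h2; apply/eqP; rewrite eq_le h1; lra.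
  have [z zo] := out; have [zM _] := zo; have [e0 e00 he] := outside_open zo.
  have [z' [z'M zz' ck]] := near_circle cM (circle_gap cM aM bM ab ca cb) zM (z0 z zo) (expr1n _ 2) e00.
  by move: ck; rewrite (z0 z' (he z' z'M zz')) subrr mulr0 ltxx.
exists T; split=> //; last first.
  move=> t Tt tpi H; have : t <= T by apply: sup_ubound Ab.2 _ _; split=> //; apply/andP; split; lra.
  lra.
move=> t x t0 tT xO.
have [Tz|Tn] := eqVneq T 0.
  by have -> : t = 0 by [lra]; have [_] := A0; apply.
have sT : 0 < sin T by apply: sin_gt0_pi; rewrite Tlt lt_neqAle eq_sym Tn T0.
have s1 : 0 <= sin (T - t) by apply: sin_ge0_pi; apply/andP; split; lra.
have s2 : 0 <= sin t by apply: sin_ge0_pi; apply/andP; split; lra.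
rewrite -(pmulr_rle0 _ sT).
have -> : sin T * turn c m k l t x = sin (T - t) * (mf c x - k) + sin t * turn c m k l T x.
  by rewrite /turn sinB; ring.
have lx : mf c x - k <= 0 by rewrite subr_le0; exact: inside_outer Din xO.
by have := mulr_ge0_le0 s1 lx; have := mulr_ge0_le0 s2 (TA x xO); lra.
Qed.

(** The three points span the plane of the circle, which makes [w] proportional to [c]. *)
Lemma circle_uniq c k (w : 'rV[R]_3) (s : R) a b e : surface M c -> surface M a -> surface M b ->
  surface M e -> a != b -> e != a -> e != b -> mf c a = k -> mf c b = k -> mf c e = k ->
  mf w a = s -> mf w b = s -> mf w e = s -> exists r, forall x, mf w x - s = r * (mf c x - k).
Proof.
move=> cM aM bM eM ab ea eb ca cb ce wa wb we.
have d12 : det M c (b - a) (e - a) != 0.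
  apply/eqP => E; have [/eqP|/eqP] := perp_nondeg cM aM bM ab ca cb eM ce E.
    by rewrite (negbTE ea).
  by rewrite (negbTE eb).
have gg : sg * sg = 1 by exact: sg2.
have wE : w = (sg * mf w c) *: c.
  apply/eqP; rewrite -subr_eq0; apply/eqP; apply: (det_orth d12).
  - by rewrite mfDl mfNl mfZl (surface_mf cM) mulrAC gg mul1r subrr.
  - by rewrite !(mfDl, mfDr, mfNl, mfNr, mfZl) ca cb wa wb; ring.
  - by rewrite !(mfDl, mfDr, mfNl, mfNr, mfZl) ca ce wa we; ring.
exists (sg * mf w c) => x; rewrite -wa; move: wE; move: (sg * _) => r ->.
by rewrite !mfZl ca; ring.
Qed.

(** If all points of the arc were outer, each would be on the circle of a disc of the family. One
    disc occurs arbitrarily close to [a]; its circle then shares [a] and two more points with the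
    given one, and the two discs coincide, against the hypothesis. *)
Lemma arc_inner c k m l a b : chord c k m l a b ->
  (forall j r, 0 < r -> (forall x, mf (p j) x - h j = r * (mf c x - k)) -> False) ->
  exists y, [/\ inn y, mf c y = k & l < mf m y].
Proof.
move=> D nj; apply: contrapT => nE.
have [cM aO bO ab ca cb ma mb nd Din] := D; have [aM _] := aO; have [bM _] := bO.
have gap := circle_gap cM aM bM ab ca cb.
have /choice[f hf] : forall N : nat, exists yi : 'rV[R]_3 * 'I_n,
    [/\ surface M yi.1, mf c yi.1 = k, l < mf m yi.1, `|yi.1 - a| < N.+1%:R^-1 &
      mf (p yi.2) yi.1 = h yi.2].
  move=> N; have e0 : 0 < N.+1%:R^-1 :> R by rewrite invr_gt0 ltr0n.
  have [y [yM cy my ya]] := arc_point cM aM bM ab ca cb ma mb nd e0.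
  have yO : outer y by split=> // yO; apply: nE; exists y.
  have [|i hi] := cap_closure yM.
    move=> eps eps0; have [z [zM zy cz]] := near_circle cM gap yM cy (expr1n _ 2) eps0.
    rewrite mul1r subr_gt0 in cz.
    by exists z => //; exact: inner_cap (Din z zM cz).
  by exists (y, i); split=> //=; apply/eqP; rewrite eq_le hi outer_le.
have [j hj] := infinitely_often (fun N => (f N).2).
have near (e : R) : 0 < e -> exists y, [/\ surface M y, mf c y = k, l < mf m y, `|y - a| < e &
    mf (p j) y = h j].
  move=> e0; have [N' NN' e'] := hj (Num.truncn e^-1); have [xM cx mx xN hx] := hf N'.
  rewrite e' in hx; exists (f N').1; split=> //; apply: lt_trans xN _.
  rewrite invf_plt ?posrE ?ltr0n//; apply: lt_le_trans (truncnS_gt _) _.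
  by rewrite ler_nat ltnS.
have ja : mf (p j) a = h j.
  apply/eqP; rewrite eq_le outer_le//= leNgt; apply/negP => lt.
  have [|e e0 he] := mf_near M (p j) a (e := h j - mf (p j) a); first by lra.
  have [y [_ _ _ ya hy]] := near e e0; have /ltr_normlP[_] := he y ya; lra.
have [y1 [y1M cy1 my1 _ hy1]] := near 1 ltr01.
have ya1 : y1 != a by apply/eqP => E; move: my1; rewrite E ma ltxx.
have [|y2 [y2M cy2 my2 ya2 hy2]] := near `|y1 - a|; first by rewrite normr_gt0 subr_eq0.
have y21 : y2 != y1 by apply/eqP => E; move: ya2; rewrite E ltxx.
have ya2' : y2 != a by apply/eqP => E; move: my2; rewrite E ma ltxx.
have ay1 : a != y1 by rewrite eq_sym.
have [r hr] := circle_uniq cM aM y1M y2M ay1 ya2' y21 ca cy1 cy2 ja hy1 hy2.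
apply: (nj j r _ hr); have [z zo] := out; have [zM /(_ j) hz] := zo.
have := inside_outer Din (outside_outer zo); have := hr z => E cz.
rewrite ltNge; apply/negP => r0; have : 0 <= r * (mf c z - k) by rewrite mulr_le0// subr_le0.
lra.
Qed.

Hypothesis scO : simply_connected R inn.

(** [tf j] is the centre of the window of the disc [j], and [i] is the disc reaching the side for
    which it is least. If the maximal angle [T] permits, turn by [tf i], which swallows the disc
    [i]. Otherwise turn by [T], where a third point [e] is met, and split; each part is reached by a
    disc that does not reach the other, so both have smaller [ncaps]. *)
Lemma clean_step c k m l a b : chord c k m l a b ->
  (forall e, outer e -> mf c e = k -> mf m e <= l) ->
  (exists i, reaches i (side c k m l)) ->
  (forall c' k' m' l' a' b', chord c' k' m' l' a' b' ->
    (ncaps c' k' m' l' < ncaps c k m l)%N -> resolved c' k' m' l') ->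
  resolved c k m l.
Proof.
move=> D clean [i0 ri0] IH; have pi0 := pi_gt0 R.
have [q A] := angle_exists scO D; have [qa qc qs] := A.
have [T [T0 Tpi Tle Tmax]] := turn_max D.
have Tp : 0 < T.
  have [t [t0 tpi tle]] := advance out D clean pi0.
  by rewrite ltNge; apply/negP => Tz; apply: (Tmax t) => //; lra.
have /choice[tf htf] : forall j, exists t, forall x, surface M x -> h j < mf (p j) x ->
    - (pi / 2) < q x - t < pi / 2.
  by move=> j; exact: (window D A (pM j) (@cap_inside _ _ _ _ _ j) (hlt j) (@cap_gt _ _ _ _ _ pM out j)).
pose P j := `[< reaches j (side c k m l) >].
have P0 : P i0 by exact/asboolP.
case: (arg_minP tf P0) => i /asboolP ri imin.
have imin' j : reaches j (side c k m l) -> tf i <= tf j by move=> rj; apply: imin; exact/asboolP.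
have ti0 : 0 < tf i.
  have [x [xM hx S]] := ri; have := side_angle D A S; have := htf i x xM hx; lra.
have [tiT|Tti] := leP (tf i) T.
  have tpi : tf i < pi by exact: le_lt_trans tiT Tpi.
  have tle x : outer x -> turn c m k l (tf i) x <= 0 by apply: Tle => //; exact: ltW.
  have [c' [k' [m' [l' [r [r0 D' E1 E2]]]]]] := turn_chord pM D tle.
  apply: (turn_resolved scO D A (ltW ti0) tpi r0 D' E1 E2).
    by move=> j /imin' tij; exists (tf j) => //; exact: htf.
  apply: (IH _ _ _ _ _ _ D'); apply: (@ncaps_lt _ _ _ _ _ _ _ _ _ _ _ _ _ i) => //.
    by move=> j [x [xM hx S]]; exists x; split=> //;
      exact: (turn_side scO D A (ltW ti0) tpi r0 D' E1 E2).
  exact: (turn_covers D A (ltW ti0) tpi r0 D' E1 E2 (erefl _) (htf i)).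
have tle x : outer x -> turn c m k l T x <= 0 by apply: Tle.
have [c' [k' [m' [l' [r [r0 D' E1 E2]]]]]] := turn_chord pM D tle.
have A' := turn_angle D A T0 Tpi r0 D' E1 E2.
have subD x : side c' k' m' l' x -> side c k m l x.
  exact: (turn_side scO D A T0 Tpi r0 D' E1 E2).
apply: (turn_resolved scO D A T0 Tpi r0 D' E1 E2).
  by move=> j /imin' tij; exists (tf j); [lra|exact: htf].
have [cM aO bO ab _ _ _ _ _ _] := D; have [aM _] := aO; have [bM _] := bO.
have [cM' _ _ _ ca' cb' ma' mb' nd' Din'] := D'.
(* Without a new contact, [advance] would turn the disc beyond [T]. *)
have [e [eO ce' me']] : exists e, [/\ outer e, mf c' e = k' & l' < mf m' e].
  apply: contrapT => nE.
  have clean' e : outer e -> mf c' e = k' -> mf m' e <= l'.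
    by move=> eO ce; rewrite leNgt; apply/negP => me; apply: nE; exists e.
  have [|t [t0 tpi tle']] := advance out D' clean' (eps := pi - T); first lra.
  apply: (Tmax (T + t)); [by rewrite ltrDl|by rewrite addrC -ltrBrDr|move=> x xO].
  have -> : turn c m k l (T + t) x = r * turn c' m' k' l' t x.
    have := E2 x; have := E1 x; rewrite /turn cosD sinD => e1 e2.
    have -> : r * (cos t * (mf c' x - k') + sin t * (mf m' x - l')) =
      cos t * (r * (mf c' x - k')) + sin t * (r * (mf m' x - l')) by ring.
    by rewrite e1 e2; ring.
  by rewrite pmulr_rle0//; exact: tle'.
have eM := eO.1.
have ea : e != a by apply/eqP => E; move: me'; rewrite E ma' ltxx.
have eb : e != b by apply/eqP => E; move: me'; rewrite E mb' ltxx.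
have be : b != e by rewrite eq_sym.
have ba : b != a by rewrite eq_sym.
have ae : a != e by rewrite eq_sym.
have [m1 [l1 [D1 m1a]]] := chord_exists cM' bO eO be cb' ce' Din' aM ca' ab ae.
have {D1} D1 := chordN D1; have {m1a} m1a : mf (- m1) a < - l1 by rewrite mfNl ltrN2.
have [m2 [l2 [D2 m2b]]] := chord_exists cM' eO aO ea ce' ca' Din' bM cb' be ba.
have {D2} D2 := chordN D2; have {m2b} m2b : mf (- m2) b < - l2 by rewrite mfNl ltrN2.
(* The turned disc is not in the family. If it were the disc [j], its lune would make [j] reach the
   side, so that [T < tf j]. On the disc [j] the function [turn] at angle [tf j] is positive by the
   choice of the window, yet it is negative near the arc [mf m' < l'] of the turned disc. *)
have nj j r' : 0 < r' -> (forall x, mf (p j) x - h j = r' * (mf c' x - k')) -> False.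
  move=> r'0 hj.
  have gap := circle_gap cM' aM bM ab ca' cb'.
  have hjx x : k' < mf c' x -> h j < mf (p j) x.
    by move=> kx; rewrite -subr_gt0 hj pmulr_rgt0// subr_gt0.
  have sT : 0 < sin T by apply: sin_gt0_pi; rewrite Tp.
  have [y [yM cy my _]] := arc_point cM' aM bM ab ca' cb' ma' mb' nd' ltr01.
  have ly : mf c y < k.
    rewrite -subr_lt0.
    have -> : mf c y - k = (mf c y - k) * (cos T ^+ 2 + sin T ^+ 2) by rewrite cos2Dsin2 mulr1.
    have -> : (mf c y - k) * (cos T ^+ 2 + sin T ^+ 2) = cos T * turn c m k l T y -
        sin T * (cos T * (mf m y - l) - sin T * (mf c y - k)) by rewrite /turn; ring.
    rewrite -E1 -E2 cy subrr !mulr0 sub0r oppr_lt0 !mulr_gt0// subr_gt0//.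
  have [|d d0 hd] := mf_near M c y (e := k - mf c y); first by rewrite subr_gt0.
  have [x [xM xy kx]] := near_circle cM' gap yM cy (expr1n _ 2) d0.
  rewrite mul1r subr_gt0 in kx.
  have cx : mf c x < k by have := le_lt_trans (ler_norm _) (hd x xy); rewrite ltrD2r.
  have rj : reaches j (side c k m l).
    by exists x; split=> //; [exact: hjx|exact: (turn_lune scO D A T0 Tpi r0 D' E1)].
  have tij := imin' j rj.
  have := turn_strip D A T0 Tpi r0 D' E1 xM kx; have := htf j x xM (hjx x kx) => w1 w2.
  have st : 0 < sin (tf j - T).
    apply: sin_gt0_pi; rewrite subr_gt0 (lt_le_trans Tti tij)/=.
    by move: w1 w2 => /andP[w1 _] /andP[_ w2]; exact: window_lt w1 w2.
  have DN := chordN D'; have [_ _ _ _ _ _ maN mbN ndN _] := DN.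
  have [y' [y'M cy' my' _]] := arc_point cM' aM bM ab ca' cb' maN mbN ndN ltr01.
  have ty : turn c m k l (tf j) y' < 0.
    have -> : turn c m k l (tf j) y' = cos (tf j - T) * turn c m k l T y' +
        sin (tf j - T) * (cos T * (mf m y' - l) - sin T * (mf c y' - k)).
      have eu : tf j = (tf j - T) + T by rewrite subrK.
      by rewrite {1}eu; move: (tf j - T) => u; rewrite /turn cosD sinD; ring.
    rewrite -E1 -E2 cy' subrr !mulr0 add0r pmulr_rlt0// pmulr_rlt0// subr_lt0.
    by move: my'; rewrite mfNl ltrN2.
  pose v := cos (tf j) *: c + sin (tf j) *: m.
  have vE z : turn c m k l (tf j) z = mf v z - (cos (tf j) * k + sin (tf j) * l).
    by rewrite /v mfDl !mfZl /turn; ring.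
  have [|d' d'0 hd'] := mf_near M v y' (e := - turn c m k l (tf j) y'); first by rewrite oppr_gt0.
  have [z [zM zy kz]] := near_circle cM' gap y'M cy' (expr1n _ 2) d'0.
  rewrite mul1r subr_gt0 in kz.
  have tz : turn c m k l (tf j) z < 0.
    have hz := hd' z zy; rewrite vE in hz; rewrite vE.
    by have := le_lt_trans (ler_norm _) hz; rewrite opprB ltrD2r subr_lt0.
  have [s s0 [_ _ ez]] := turn_polar (tf j) A (Din' z zM kz).
  have := cos_gt0_pihalf (htf j z zM (hjx z kz)).
  by rewrite -(pmulr_rgt0 _ s0) -ez ltNge (ltW tz).
have excl i' : reaches i' (side c' k' (- m1) (- l1)) -> reaches i' (side c' k' (- m2) (- l2)) -> False.
  move=> R1 [x [xM hx S2]]; apply: (reaches_excl scO pM hlt out D1 R1).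
  have [_ S] := side_split2 scO D' eO ce' me' D1 m1a D2 m2b S2.
  by exists x.
have [y1 [y1O cy1 my1]] := arc_inner D1 nj.
have [y2 [y2O cy2 my2]] := arc_inner D2 nj.
have [j1 rj1] := arc_reaches scO pM hlt out D1 y1O cy1 my1.
have [j2 rj2] := arc_reaches scO pM hlt out D2 y2O cy2 my2.
have R1 i' : reaches i' (side c' k' (- m1) (- l1)) -> reaches i' (side c k m l).
  move=> [x [xM hx S]]; exists x; split=> //; apply: subD.
  by have [] := side_split1 scO D' eO ce' me' D1 m1a D2 m2b S.
have R2 i' : reaches i' (side c' k' (- m2) (- l2)) -> reaches i' (side c k m l).
  move=> [x [xM hx S]]; exists x; split=> //; apply: subD.
  by have [] := side_split2 scO D' eO ce' me' D1 m1a D2 m2b S.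
apply: (resolved_split scO D' eO ce' me' D1 m1a D2 m2b).
- apply: (IH _ _ _ _ _ _ D1); apply: (@ncaps_lt _ _ _ _ _ _ _ _ _ _ _ _ _ j2) => //.
    exact: R2.
  by move=> r1; exact: excl r1 rj2.
apply: (IH _ _ _ _ _ _ D2); apply: (@ncaps_lt _ _ _ _ _ _ _ _ _ _ _ _ _ j1) => //.
  exact: R1.
by move=> r2; exact: excl rj1 r2.
Qed.

End CleanStep.

(** * The tree of discs *)

Section Resolve.
Context {R : realType} (M : plane) (n : nat) (p : 'I_n -> 'rV[R]_3) (h : 'I_n -> R).
Implicit Types (a b c m u v w x y z : 'rV[R]_3) (i j : 'I_n) (k l s t eps : R).
Local Notation mf := (@metric_form R M).
Local Notation sg := (@form_sign R M).
Local Notation inn := (inner M p h).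
Local Notation outer := (outer M p h).
Local Notation chord := (chord M p h).
Local Notation side := (side M p h).
Local Notation reaches := (reaches M p h).
Local Notation resolved := (resolved M p h).
Local Notation ncaps := (ncaps M p h).

Hypotheses (pM : forall i, surface M (p i)) (hlt : forall i, h i < sg).
Hypothesis out : exists z, outside M p h z.
Hypothesis scO : simply_connected R inn.

Section Stereo.
Variables (c y : 'rV[R]_3) (k : R).
Hypotheses (cM : surface M c) (cO : inside M p h c k) (yO : inn y) (cy : mf c y = k).

(* Stereographic coordinate, from [y], on the circle of [c] and [k]. *)
Definition stereo x := mf (cross M c y) x / (sg - mf y x).

Definition contact x := outer x /\ mf c x = k.

Lemma contact_neq x : contact x -> y != x.
Proof. by move=> [[_ xO] _]; apply/eqP => E; apply: xO; rewrite -E. Qed.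

Lemma stereo_den x : contact x -> 0 < sg - mf y x.
Proof.
move=> xC; have := mf_lt_sg (inner_surface yO) xC.1.1 (contact_neq xC); lra.
Qed.

Lemma stereo_inj a b : contact a -> contact b -> stereo a = stereo b -> a = b.
Proof.
move=> aC bC E; apply: contrapT => /eqP ab.
have yM := inner_surface yO; have [[aM _] ca] := aC; have [[bM _] cb] := bC.
have ya := contact_neq aC; have yb := contact_neq bC.
have da := stereo_den aC; have db := stereo_den bC.
have gap := circle_gap cM yM aM ya cy ca.
set w := cross M c y.
have ww : mf w w != 0.
  by rewrite /w mf_cross !surface_mf// cy (mfC M y) cy -!expr2 gt_eqF.
set X := (sg - mf y b) *: (a - y) - (sg - mf y a) *: (b - y).
have wy : mf w y = 0 by exact: mf_cross_r.
have wc : mf w c = 0 by exact: mf_cross_l.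
have X0 : X = 0.
  apply: (@det_orth _ M c y w); first by rewrite /det.
  - by rewrite mfC /X !(mfDr, mfNr, mfZr) ca cb cy; ring.
  - by rewrite mfC /X !(mfDr, mfNr, mfZr) (surface_mf yM); ring.
  - rewrite mfC /X !(mfDr, mfNr, mfZr) wy; move: E; rewrite /stereo -/w => E.
    have -> : mf w a = mf w a / (sg - mf y a) * (sg - mf y a) by rewrite divfK// gt_eqF.
    by rewrite E; field; rewrite gt_eqF.
have : a = y + ((sg - mf y a) / (sg - mf y b)) *: (b - y).
  have e1 : (sg - mf y b) *: (a - y) = (sg - mf y a) *: (b - y) by apply/eqP; rewrite -subr_eq0 -/X X0.
  have -> : ((sg - mf y a) / (sg - mf y b)) *: (b - y) = a - y.
    by rewrite mulrC -scalerA -e1 scalerA mulVf ?scale1r// gt_eqF.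
  by rewrite addrC subrK.
move=> e; have := aM; rewrite e => /(line_surface yM bM yb)[l0|l1].
  by move: ya; rewrite e l0 scale0r addr0 eqxx.
by move: ab; rewrite e l1 scale1r addrC subrK eqxx.
Qed.

(** The contacts form a compact set that avoids [y]; the extreme ones are the neighbours of [y] on
    its two sides. *)
Lemma stereo_extremal a : contact a -> exists c1 c2, [/\ contact c1, contact c2 &
  forall e, contact e -> stereo c1 <= stereo e /\ stereo e <= stereo c2].
Proof.
move=> aC.
have [C C0 hC] := surface_bound cM.
pose K := [set x | contact x].
have cK : compact K.
  apply: (@compact_rV3 R K (C * (2 - k))).
    by move=> x [[xM _] <-]; exact: hC.
  move=> x nK.
  have [xO|/outer_near_not[e e0 he]] := pselect (outer x); last first.
    by exists e => // z /he nO [].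
  have [cx|cx] := eqVneq (mf c x) k; first by exfalso; apply: nK.
  have [|d d0 hd] := mf_near M c x (e := `|mf c x - k|); first by rewrite normr_gt0 subr_eq0.
  by exists d => // z /hd + [_ cz]; rewrite cz distrC ltxx.
have sc : {within K, continuous stereo}.
  apply: continuous_in_subspaceT => x /set_mem xK; apply: (@continuousM R _ (mf (cross M c y))).
    exact: mf_continuous.
  apply: continuousV; first by rewrite gt_eqF// stereo_den.
  by apply: (@continuousB _ R^o); [exact: cst_continuous|exact: mf_continuous].
have K0 : K !=set0 by exists a.
have [c1 /set_mem c1K h1] := EVT_min_rV K0 cK sc.
have [c2 /set_mem c2K h2] := EVT_max_rV K0 cK sc.
by exists c1, c2; split=> // e eC; split; [apply: h1|apply: h2]; exact: mem_set.
Qed.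

(** Seen from [y], the contact [a] is between [b] and [e], hence the line through [b] and [e]
    separates [y] from [a]. An affine function vanishing at [y] and [a] has opposite signs at [b]
    and [e], which gives [B] and [G] the same sign. *)
Lemma between a b e : contact a -> contact b -> contact e ->
  (stereo b - stereo a) * (stereo e - stereo a) < 0 ->
  [/\ a != b, b != e, e != a & exists A B G, [/\ A < 0, 0 < B, 0 < G, A + B + G = 1 &
    y = A *: a + B *: b + G *: e]].
Proof.
move=> aC bC eC sbe; have yM := inner_surface yO.
have [[aM _] ca] := aC; have [[bM _] cb] := bC; have [[eM _] ce] := eC.
have ab : a != b by apply/eqP => E; move: sbe; rewrite E subrr mul0r ltxx.
have ea : e != a by apply/eqP => E; move: sbe; rewrite E subrr mulr0 ltxx.
have be : b != e.
  by apply/eqP => E; move: sbe; rewrite E -expr2 ltNge sqr_ge0.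
have eb : e != b by rewrite eq_sym.
split=> //; have [A [B [G [s1 yE]]]] := bary cM aM bM ab ca cb eM ce ea eb cy.
have g x : mf (cross M c y) x - stereo a * (sg - mf y x) =
    mf (cross M c y + stereo a *: y) x - stereo a * sg by rewrite mfDl mfZl; ring.
have gs x : contact x -> mf (cross M c y) x - stereo a * (sg - mf y x) =
    (stereo x - stereo a) * (sg - mf y x).
  by move=> /stereo_den d; rewrite mulrBl /stereo divfK// gt_eqF.
have gy : mf (cross M c y + stereo a *: y) y - stereo a * sg = 0.
  by rewrite mfDl mfZl (surface_mf yM) mf_cross_r add0r subrr.
have : B * ((stereo b - stereo a) * (sg - mf y b)) + G * ((stereo e - stereo a) * (sg - mf y e)) = 0.
  rewrite -!gs// !g; move: gy (g a); rewrite gs// subrr mul0r => gy ga.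
  rewrite -[RHS]gy yE !(mfDr, mfZr) -[X in _ = _ - X]mul1r -s1.
  transitivity (B * (mf (cross M c y + stereo a *: y) b - stereo a * sg) +
    G * (mf (cross M c y + stereo a *: y) e - stereo a * sg) +
    A * (mf (cross M c y + stereo a *: y) a - stereo a * sg)).
    by rewrite -ga mulr0 addr0 yE.
  by rewrite -yE; ring.
have db := stereo_den bC; have de := stereo_den eC.
move: sbe db de; move: (stereo b - stereo a) (stereo e - stereo a) (sg - mf y b) (sg - mf y e).
move=> X Y U V XY U0 V0 E.
exists A, B, G.
have ya := contact_neq aC; have yb := contact_neq bC; have ye := contact_neq eC.
have [[A0 B0 G0]|[A0 B0 G0]|[A0 B0 G0]] := bary_sign aM bM eM yM ab be ea ya yb ye s1 yE.
- by split.
- exfalso; have : 0 < B * (X * U) * (G * (Y * V)).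
    have -> : B * (X * U) * (G * (Y * V)) = (- B * G * U * V) * (- (X * Y)) by ring.
    by rewrite !mulr_gt0 ?oppr_gt0.
  have -> : G * (Y * V) = - (B * (X * U)) by lra.
  by rewrite mulrN oppr_gt0 ltNge -expr2 sqr_ge0.
- exfalso; have : 0 < B * (X * U) * (G * (Y * V)).
    have -> : B * (X * U) * (G * (Y * V)) = (B * - G * U * V) * (- (X * Y)) by ring.
    by rewrite !mulr_gt0 ?oppr_gt0.
  have -> : G * (Y * V) = - (B * (X * U)) by lra.
  by rewrite mulrN oppr_gt0 ltNge -expr2 sqr_ge0.
Qed.

Section Gap.
Variables (i : 'I_n) (x : 'rV[R]_3).
Hypotheses (xM : surface M x) (hx : h i < mf (p i) x).
Hypothesis xy : forall m l a b, chord c k m l a b -> side c k m l x <-> l < mf m y.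

(** The chord through [b] and [e] keeps [y] on its positive arc, so the disc [i] reaches its side.
    Then [i] does not reach the other part, to which the induction hypothesis applies. *)
Lemma gap_split m l a b e : chord c k m l a b -> l < mf m y -> contact e ->
  (stereo b - stereo a) * (stereo e - stereo a) < 0 ->
  (forall c' k' m' l' a' b', chord c' k' m' l' a' b' ->
    (ncaps c' k' m' l' < ncaps c k m l)%N -> resolved c' k' m' l') ->
  (forall m1 l1, chord c k m1 l1 b e -> l1 < mf m1 y ->
    (ncaps c k m1 l1 <= ncaps c k m l)%N -> resolved c k m1 l1) ->
  resolved c k m l.
Proof.
move=> D my eC sbe IH H; have [_ aO bO _ ca cb ma mb _ _] := D.
have [ab be ea [A [B [G [A0 B0 G0 s1 yE]]]]] := between (conj aO ca) (conj bO cb) eC sbe.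
have [eO ce] := eC; have aM := aO.1; have bM := bO.1; have eM := eO.1.
have ae : a != e by rewrite eq_sym.
have ba : b != a by rewrite eq_sym.
have [m1 [l1 [D1 m1a]]] := chord_exists cM bO eO be cb ce cO aM ca ab ae.
have {D1} D1 := chordN D1; have {m1a} m1a : mf (- m1) a < - l1 by rewrite mfNl ltrN2.
have [m2 [l2 [D2 m2b]]] := chord_exists cM eO aO ea ce ca cO bM cb be ba.
have {D2} D2 := chordN D2; have {m2b} m2b : mf (- m2) b < - l2 by rewrite mfNl ltrN2.
have me : l < mf m e.
  have : mf m y - l = G * (mf m e - l).
    by rewrite yE !(mfDr, mfZr) ma mb -[X in _ - X]mul1r -s1; ring.
  by move=> E; rewrite -subr_gt0 -(pmulr_rgt0 _ G0) -E subr_gt0.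
have [_ _ _ _ _ _ m1b m1e _ _] := D1.
have m1y : - l1 < mf (- m1) y.
  have : mf (- m1) y - - l1 = A * (mf (- m1) a - - l1).
    by rewrite yE !(mfDr, mfZr) m1b m1e -[X in _ - X]mul1r -s1; ring.
  by move=> E; rewrite -subr_gt0 E nmulr_rgt0// subr_lt0.
have S1 : side c k (- m1) (- l1) x by apply/(xy D1).
have ri1 : reaches i (side c k (- m1) (- l1)) by exists x.
apply: (resolved_split scO D eO ce me D1 m1a D2 m2b).
  apply: H => //; apply: ncaps_le => j [z [zM hz S]]; exists z; split=> //.
  by have [] := side_split1 scO D eO ce me D1 m1a D2 m2b S.
apply: (IH _ _ _ _ _ _ D2); apply: (@ncaps_lt _ _ _ _ _ _ _ _ _ _ _ _ _ i).
- move=> j [z [zM hz S]]; exists z; split=> //.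
  by have [] := side_split2 scO D eO ce me D1 m1a D2 m2b S.
- by exists x; split=> //; apply/(xy D).
move=> [z [zM hz S]]; apply: (reaches_excl scO pM hlt out D1 ri1).
by exists z; split=> //; have [] := side_split2 scO D eO ce me D1 m1a D2 m2b S.
Qed.

(** Splitting at [c1] and then at [c2] reduces this to the chord through these two contacts. Its arc
    around [y] has no further contact, as [clean_step] requires. *)
Lemma gap_resolved m l a b : chord c k m l a b -> l < mf m y ->
  (forall c' k' m' l' a' b', chord c' k' m' l' a' b' ->
    (ncaps c' k' m' l' < ncaps c k m l)%N -> resolved c' k' m' l') ->
  resolved c k m l.
Proof.
wlog sab : a b / stereo a < stereo b.
  move=> W D my IH; have [_ aO bO ab ca cb _ _ _ _] := D.
  have : stereo a != stereo b.
    by apply/eqP => /(stereo_inj (conj aO ca) (conj bO cb))/eqP; rewrite (negbTE ab).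
  rewrite neq_lt => /orP[lt|lt]; first exact: W lt D my IH.
  exact: W lt (chordC D) my IH.
move=> D my IH; have [_ aO bO ab ca cb _ _ _ _] := D.
have aC : contact a by []. have bC : contact b by [].
have [c1 [c2 [c1C c2C ext]]] := stereo_extremal aC.
have IHle m' l' : (ncaps c k m' l' <= ncaps c k m l)%N ->
    forall c'' k'' m'' l'' a'' b'', chord c'' k'' m'' l'' a'' b'' ->
    (ncaps c'' k'' m'' l'' < ncaps c k m' l')%N -> resolved c'' k'' m'' l''.
  by move=> le *; apply: IH; eauto; apply: leq_trans le.
have H3 m' l' : chord c k m' l' c1 c2 -> l' < mf m' y ->
    (ncaps c k m' l' <= ncaps c k m l)%N -> resolved c k m' l'.
  move=> D' my' le; apply: (clean_step pM hlt out scO D'); last exact: IHle le.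
    move=> e eO ce; rewrite leNgt; apply/negP => me.
    have [_ _ _ _ _ _ m1 m2 _ _] := D'.
    have eC : contact e by [].
    have ne1 : e != c1 by apply/eqP => E; move: me; rewrite E m1 ltxx.
    have ne2 : e != c2 by apply/eqP => E; move: me; rewrite E m2 ltxx.
    have [s1 s2] := ext e eC.
    have [|_ _ _ [A [B [G [A0 _ _ t1 yE]]]]] := between eC c2C c1C.
      have s1' : stereo c1 < stereo e.
        rewrite lt_neqAle s1 andbT; apply/eqP => /(stereo_inj c1C eC)/eqP.
        by rewrite eq_sym (negbTE ne1).
      have s2' : stereo e < stereo c2.
        rewrite lt_neqAle s2 andbT; apply/eqP => /(stereo_inj eC c2C)/eqP.
        by rewrite (negbTE ne2).
      by rewrite pmulr_rlt0 ?subr_gt0// subr_lt0.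
    have E : mf m' y - l' = A * (mf m' e - l').
      by rewrite yE !(mfDr, mfZr) m1 m2 -[X in _ - X]mul1r -t1; ring.
    by have : A * (mf m' e - l') < 0 by [rewrite nmulr_rlt0// subr_gt0]; lra.
  by exists i, x; split=> //; apply/(xy D').
have H2 m' l' : chord c k m' l' b c1 -> l' < mf m' y ->
    (ncaps c k m' l' <= ncaps c k m l)%N -> resolved c k m' l'.
  move=> D' my' le; have [bc2|bc2] := eqVneq b c2.
    by apply: H3 => //; apply: chordC; rewrite -bc2.
  apply: (gap_split D' my' c2C _ (IHle _ _ le)).
    have s2 : stereo b < stereo c2.
      rewrite lt_neqAle (ext b bC).2 andbT; apply/eqP => /(stereo_inj bC c2C)/eqP.
      by rewrite (negbTE bc2).
    rewrite nmulr_rlt0 ?subr_gt0// subr_lt0; apply: le_lt_trans sab.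
    exact: (ext a aC).1.
  by move=> m1 l1 D1 my1 le1; apply: H3 => //; exact: leq_trans le1 le.
have [ac1|ac1] := eqVneq a c1.
  by apply: H2 => //; apply: chordC; rewrite -ac1.
apply: (gap_split D my c1C _ IH H2).
rewrite pmulr_rlt0 ?subr_gt0// subr_lt0 lt_neqAle (ext a aC).1 andbT.
by apply/eqP => /(stereo_inj c1C aC)/eqP; rewrite eq_sym (negbTE ac1).
Qed.

End Gap.
End Stereo.

(** Strong induction on [ncaps]. The gap to be isolated is the one through which a path to a disc
    reaching the side leaves. *)
Lemma chord_resolved c k m l a b : chord c k m l a b -> resolved c k m l.
Proof.
have [N le] := ubnP (ncaps c k m l); elim: N c k m l a b le => // N IH c k m l a b le D.
have [[i [x [xM hx S]]]|nr] := pselect (exists i, reaches i (side c k m l)); last first.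
  by exists [::]; split=> // i ri; exfalso; apply: nr; exists i.
have [cM _ _ _ _ _ _ _ _ cO] := D.
have [y [yO cy H]] := hit scO cM cO (chord_lt D) (side_inner S) (side_out S).
have my : l < mf m y by apply/(H _ _ _ _ D).
apply: (gap_resolved cM cO yO cy xM hx H D my) => c' k' m' l' a' b' D' lt.
by apply: IH D'; rewrite -ltnS; exact: leq_trans lt le.
Qed.

End Resolve.

(** Distinct parameters give distinct geodesics in [two_contacts]: the equation factors into
    [d1 - d2] and [Q + g * (d1 * d2)], both positive. *)
Lemma contact_params {R : realFieldType} (Q g d1 d2 : R) : 0 < Q -> 0 < d2 -> d2 < d1 ->
  0 < Q + d1 ^+ 2 * g -> g = 1 \/ g = -1 ->
  d1 * (Q + d2 ^+ 2 * g - 2 * d2 ^+ 2 * g) = d2 * (Q + d1 ^+ 2 * g - 2 * d1 ^+ 2 * g) -> False.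
Proof.
move=> Q0 d20 lt V1 g1 E; have d10 := lt_trans d20 lt.
have : (d1 - d2) * (Q + g * (d1 * d2)) = 0 by clear -E; lra.
move=> /eqP; rewrite mulf_eq0 gt_eqF ?subr_gt0//= => /eqP H.
case: g1 => g1; rewrite {}g1 in H V1.
  by have := mulr_gt0 d10 d20; clear -H Q0; lra.
by have : d1 * d2 < d1 * d1 by [rewrite ltr_pM2l]; clear -H V1; lra.
Qed.

(** * A disc with two contacts, and the whole tree *)

Section Tree.
Context {R : realType} (M : plane) (n : nat) (p : 'I_n -> 'rV[R]_3) (h : 'I_n -> R).
Implicit Types (a b c m u v w x y z : 'rV[R]_3) (i j : 'I_n) (k l s t eps : R).
Local Notation mf := (@metric_form R M).
Local Notation sg := (@form_sign R M).
Local Notation inn := (inner M p h).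
Local Notation outer := (outer M p h).
Local Notation chord := (chord M p h).
Local Notation side := (side M p h).
Local Notation reaches := (reaches M p h).

Hypotheses (pM : forall i, surface M (p i)) (hlt : forall i, h i < sg).
Hypothesis out : exists z, outside M p h z.

(** Stop at the last time when the path is in the union. *)
Lemma crossing (g : R -> 'rV[R]_3) : continuous g -> (forall s, surface M (g s)) ->
  (exists i, h i <= mf (p i) (g 0)) -> outside M p h (g 1) ->
  exists s, [/\ s \in `[0, 1], outer (g s) & exists i, mf (p i) (g s) = h i].
Proof.
move=> gc gM g0 g1.
pose A := [set s | 0 <= s <= 1 /\ exists i, h i <= mf (p i) (g s)].
have A0 : A 0 by split; rewrite ?lexx ?ler01.
have Ab : has_sup A by split; [exists 0|exists 1 => s [/andP[]]].
set T := sup A.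
have T0 : 0 <= T by exact: sup_ubound Ab.2 _ A0.
have T1 : T <= 1 by apply: sup_le_ub Ab.1 _ => s [/andP[]].
have [i hi] : exists i, h i <= mf (p i) (g T).
  apply: cap_closure (gM T) _ => eps e0; have [d d0 hd] := near_cts (gc T) e0.
  have [s sA sT] := sup_adherent d0 Ab.
  have sT' : s <= T by exact: sup_ubound Ab.2 _ sA.
  exists (g s); last by case: sA.
  by apply: hd; rewrite ler0_norm -/T in sT *; lra.
have Tn1 : T < 1.
  rewrite lt_neqAle T1 andbT; apply/eqP => e; have [_ /(_ i)] := g1.
  by rewrite -e ltNge hi.
have To : outer (g T).
  split=> // gO; have [e e0 he] := inner_open gO; have [d d0 hd] := near_cts (gc T) e0.
  set s := Num.min 1 (T + d / 2).
  have s1 : s <= 1 by rewrite ge_min lexx.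
  have s2 : s <= T + d / 2 by rewrite ge_min lexx orbT.
  have s3 : T < s by rewrite lt_min Tn1/=; lra.
  have sO : inn (g s) by apply: he => //; apply: hd; rewrite ger0_norm; lra.
  have : s <= T.
    apply: sup_ubound Ab.2 _ _; split; last exact: inner_cap.
    by apply/andP; split; lra.
  lra.
exists T; split=> //; first by rewrite in_itv /= T0 T1.
by exists i; apply/eqP; rewrite eq_le hi outer_le.
Qed.

Lemma tangent_exists z : surface M z -> exists w, mf z w = 0 /\ 0 < mf w w.
Proof.
move=> zM.
have pick v : 0 < sg * (sg * mf v v - mf z v ^+ 2) -> exists w, mf z w = 0 /\ 0 < mf w w.
  move=> H; exists (cross M z v); split; first by rewrite mfC; exact: mf_cross_l.
  by rewrite mf_cross (surface_mf zM) (mfC M v z) -expr2.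
have v0 : mf (vec 1 0 0) (vec 1 0 0) = 1 by rewrite mfE !vec0 !vec1 !vec2; ring.
have v1 : mf (vec 0 1 0) (vec 0 1 0) = 1 by rewrite mfE !vec0 !vec1 !vec2; ring.
have z0 : mf z (vec 1 0 0) = z 0 0 by rewrite mfE !vec0 !vec1 !vec2; ring.
have z1 : mf z (vec 0 1 0) = z 0 1 by rewrite mfE !vec0 !vec1 !vec2; ring.
move: (pick (vec 1 0 0)) (pick (vec 0 1 0)); rewrite v0 v1 z0 z1 /form_sign.
have := surface_mf zM; rewrite /metric_form /form_sign.
case: (M) => [zz|_]; last by move=> /(_ ltac:(by have := sqr_ge0 (z 0 0); lra)).
have [lt|ge] := ltP (z 0 0 ^+ 2) 1; first by move=> /(_ ltac:(lra)).
move=> _; apply; have := sqr_ge0 (z 0 2); have := sqr_ge0 (z 0 1); rewrite !expr2 in ge *; lra.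
Qed.

(* Geodesics from an inner point towards nearby outside points cross the boundary at
   infinitely many points; two of them lie on the same circle. *)
Lemma two_contacts (i0 : 'I_n) : exists j a b,
  [/\ a != b, outer a, outer b, mf (p j) a = h j & mf (p j) b = h j].
Proof.
set c := p i0; have cM : surface M c by exact: pM.
have cap0 : h i0 <= mf c c by rewrite surface_mf// ltW.
have neqc z : outside M p h z -> c != z.
  move=> [zM hz]; apply/eqP => E; have := hz i0; rewrite -/c -E surface_mf//.
  by rewrite ltNge ltW.
(* The geodesics need an end that is not antipodal to [c]; an outside point that is antipodal gets
   moved a little. *)
have [z [zo zc]] : exists z, outside M p h z /\ not_antipodal M c z.
  have [z zo] := out; have [na|na] := pselect (not_antipodal M c z); first by exists z.
  have [zM _] := zo; have [w [zw ww]] := tangent_exists zM.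
  have [e e0 he] := outside_open zo.
  have [d0 d00 hd] := refl_near z zM zw ww e0.
  have [||l [lv vv yM ly]] := hd (d0 / 2); [lra|lra|].
  set y := z + _ in yM; exists y; split; first by apply: he => //; rewrite /y addrC addKr.
  move=> MS; rewrite /not_antipodal in na; have cz : mf c z <= -1.
    by rewrite leNgt; apply/negP => lt; apply: na.
  have zE : z = - c.
    apply/eqP; rewrite -subr_eq0; apply/eqP; apply: (surface_orth_eq0 zM).
      rewrite opprK mfDr (surface_mf zM) (mfC M z c); have := mf_geN1 MS cM zM.
      by move: cz; rewrite /form_sign MS; lra.
    rewrite opprK !mflin (surface_mf zM) (surface_mf cM) (mfC M z c).
    by have := mf_geN1 MS cM zM; move: cz; rewrite /form_sign MS; lra.
  have cE : c = - z by rewrite zE opprK.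
  rewrite /y cE mfNl !mfDr mfZr mfDr mfZr zw (surface_mf zM).
  rewrite (surface_mf zM) in lv.
  have l0 : l < 0.
    rewrite -(pmulr_llt0 _ vv) lv /form_sign MS; lra.
  rewrite /form_sign MS; nra.
have [zM _] := zo; have cz := neqc z zo.
set P := cross M c z.
have Pc : mf P c = 0 by exact: mf_cross_l.
have Pz : mf P z = 0 by exact: mf_cross_r.
have PP : 0 < mf P P.
  rewrite /P mf_cross !surface_mf// (mfC M z c) -!expr2.
  have := mf_lt_sg cM zM cz; move: zc; rewrite /not_antipodal /form_sign.
  by case: (M) => [/(_ erefl)|_]; nra.
have cP : mf c P = 0 by rewrite mfC.
have zP : mf z P = 0 by rewrite mfC.
have [e1 e10 he1] := outside_open zo.
have [e2 e20 he2] : exists2 e2, 0 < e2 & forall y, `|y - z| < e2 -> not_antipodal M c y.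
  have [na|na] := pselect (M = Sphere); last by exists 1 => // y _ /na.
  have [|d d0 hd] := mf_near M c z (e := mf c z + 1); first by have := zc na; lra.
  by exists d => // y /hd /ltr_normlP[h1 _] _; lra.
have e0 : 0 < Num.min e1 e2 by rewrite lt_min e10.
have [d0 d00 hd] := refl_near z zM zP PP e0.
pose V d := mf P P + d ^+ 2 * sg.
have VE d : mf (P + d *: z) (P + d *: z) = V d.
  by rewrite !mflin Pz zP (surface_mf zM) /V; ring.
(* Both [mf P] and [mf q] vanish at [c], so their ratio is constant along a geodesic from [c] and
   tells these geodesics apart. *)
pose q := z - (sg * mf c z) *: c.
have gg : sg * sg = 1 by exact: sg2.
have qc : mf q c = 0.
  by rewrite /q !mflin (surface_mf cM) (mfC M z c) mulrAC gg mul1r subrr.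
have qP : mf q P = 0 by rewrite /q !mflin zP cP mulr0 subrr.
have qz : mf q z = mf P P.
  by rewrite /q /P mf_cross !mflin !surface_mf// (mfC M z c) gg; ring.
(* The denominators start at 2 to keep [d] strictly below [d0]. *)
have /choice[f hf] : forall N : nat, exists X : (R * R) * ('rV[R]_3 * 'I_n),
    let: ((d, l), (a, j)) := X in
    [/\ d = d0 / N.+2%:R, 0 < V d /\ l * V d = - (2 * d * sg), outer a,
      mf (p j) a = h j & exists2 r, 0 < r & mf P a = r * l /\ mf q a = r * (1 + l * d)].
  move=> N; set d := d0 / N.+2%:R.
  have dp : 0 < d by rewrite divr_gt0.
  have dd0 : d < d0 by rewrite ltr_pdivrMr// ltr_pMr// ltr1n.
  have [l [lv vv wM]] := hd d dp dd0; rewrite lt_min => /andP[w1 w2].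
  rewrite VE (surface_mf zM) in lv vv; set w := z + _ in wM.
  have wz : w - z = l *: (P + d *: z) by rewrite /w addrC addKr.
  have wo : outside M p h w by apply: he1 => //; rewrite wz.
  have wc : not_antipodal M c w by apply: he2; rewrite wz.
  have [||||s [s01 aO [j ja]]] := @crossing (fun s => geo M c w (cl s)).
  - exact: geo_continuous.
  - by move=> s; apply: geo_surface => //; exact: cl_in.
  - by rewrite cl0 geo0; exists i0.
  - by rewrite cl1 geo1.
  rewrite cl_id// in aO ja; exists ((d, l), (geo M c w s, j)); split=> //.
  have sp : 0 < s.
    move: (s01); rewrite in_itv /= => /andP[s0 _]; rewrite lt_neqAle s0 andbT.
    apply/eqP => sz; move: aO; rewrite -sz geo0 => -[_]; apply.
    by apply: (cap_inner (i := i0)) => //; rewrite surface_mf.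
  have r0 : 0 < Num.sqrt (geo_sq M c w s) by rewrite sqrtr_gt0; exact: geo_sq_gt0.
  exists (s * mf P P / Num.sqrt (geo_sq M c w s)); first by rewrite divr_gt0// mulr_gt0.
  rewrite !mf_geo Pc qc /w !(mfDr, mfZr) Pz qP qz; split; field; exact: lt0r_neq0.
have [j hj] := infinitely_often (fun N => (f N).2.2).
have [N1 _ E1] := hj 0%N; have [N2 N12 E2] := hj N1.+1.
have := hf N1; have := hf N2; move: E1 E2.
case: (f N1) => [[d1 l1] [a1 j1]] /=; case: (f N2) => [[d2 l2] [a2 j2]] /= -> ->.
move=> [dE2 [V2 L2] aO2 ja2 [r2 r20 [X2 Y2]]] [dE1 [V1 L1] aO1 ja1 [r1 r10 [X1 Y1]]].
exists j, a1, a2; split=> //; apply/eqP => a12.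
have d10 : 0 < d1 by rewrite dE1 divr_gt0.
have d20 : 0 < d2 by rewrite dE2 divr_gt0.
have lt : d2 < d1.
  by rewrite dE1 dE2 ltr_pM2l// ltf_pV2 ?posrE ?ltr0n// ltr_nat !ltnS.
move: X1 Y1; rewrite a12 X2 Y2 => X Y.
have key : l1 * (1 + l2 * d2) = l2 * (1 + l1 * d1).
  apply: (mulfI (lt0r_neq0 (mulr_gt0 r10 r20))).
  transitivity (r1 * l1 * (r2 * (1 + l2 * d2))); first by ring.
  by rewrite -X Y; ring.
have : d1 * (V d2 - 2 * d2 ^+ 2 * sg) = d2 * (V d1 - 2 * d1 ^+ 2 * sg).
  have g0 : 2 * sg != 0.
    rewrite mulf_neq0 ?pnatr_eq0//; apply/eqP => g0.
    by move/eqP: gg; rewrite g0 mul0r eq_sym oner_eq0.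
  apply: (mulfI g0).
  transitivity (- (l1 * V d1) * (V d2 + (l2 * V d2) * d2)); first by rewrite L1 L2; ring.
  transitivity (- (l1 * (1 + l2 * d2)) * V d1 * V d2); first by ring.
  rewrite key; transitivity (- (l2 * V d2) * (V d1 + (l1 * V d1) * d1)); first by ring.
  by rewrite L1 L2; ring.
move=> E; apply: (contact_params PP d20 lt V1 _ E).
by rewrite /form_sign; case: (M); [left|right].
Qed.

Hypothesis scO : simply_connected R inn.

(** The root is a disc of the family with two contacts, and both of its sides get resolved. On a
    disc that reaches neither, the angle stays in [[- pi / 2, pi / 2]], so the root covers it. *)
Lemma disc_tree (i0 : 'I_n) : exists c k es, [/\ surface M c, inside M p h c k,
  wf [:: (c, k)] es, disj M es &
  (forall e, e \in es -> [/\ surface M e.1.1, inside M p h e.1.1 e.1.2 &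
    forall x, lune M e x -> mf c x < k]) /\
  forall i, exists2 nd, nd \in (c, k) :: map fst es & covered M p h nd i].
Proof.
have [j [a [b [ab aO bO ja jb]]]] := two_contacts i0.
have cM := pM j; have jin : inside M p h (p j) (h j) by exact: cap_inside.
have [aM _] := aO; have [bM _] := bO.
set c := p j in cM ja jb jin; set k := h j in ja jb jin.
set P := perp M c a b.
have Pb : mf P b = mf P a.
  by apply/eqP; rewrite -subr_eq0 -mfNr -mfDr; apply/eqP; exact: mf_cross_r.
have D : chord c k P (mf P a) a b.
  split=> // x xM cx Px; apply: (perp_nondeg cM aM bM ab ja jb) => //.
  by rewrite mfDr mfNr -/P Px subrr.
have DN := chordN D.
have [q A] := angle_exists scO D; have AN := angleN A.
have [es1 [w1 d1 h1 v1]] := chord_resolved pM hlt out scO D.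
have [es2 [w2 d2 h2 v2]] := chord_resolved pM hlt out scO DN.
exists c, k, (es1 ++ es2); split=> //.
- exact: wf_cat.
- apply: disj_cat => // f f' x /h1[_ _ H1] /h2[_ _ H2] /H1 S1 /H2 S2.
  exact: (side_excl scO D S1 S2).
split=> [e|i].
  by rewrite mem_cat => /orP[/h1|/h2] [? ? H]; split=> // x /H /side_out.
have [r1|r1] := pselect (reaches i (side c k P (mf P a))).
  have [nd ndi ndc] := v1 i r1; exists nd => //; move: ndi.
  by rewrite !inE map_cat mem_cat => /orP[->//|->]; rewrite orbT.
have [r2|r2] := pselect (reaches i (side c k (- P) (- mf P a))).
  have [nd ndi ndc] := v2 i r2; exists nd => //; move: ndi.
  by rewrite !inE map_cat mem_cat => /orP[->//|->]; rewrite !orbT.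
exists (c, k); first by rewrite inE eqxx.
move=> x xM hx /=; have xO := cap_inner xM hx; have [qa _ _] := A.
have [r r0 [e _]] := qa x xO; rewrite -subr_ge0 e pmulr_rge0//.
apply: cos_ge0_pihalf; apply/andP; split; rewrite leNgt; apply/negP => lt.
  by apply: r2; exists x; split=> //; apply: (angle_side scO DN AN xO); lra.
by apply: r1; exists x; split=> //; exact: (angle_side scO D A xO).
Qed.

End Tree.

(** * Geodesic distance *)

Section Distance.
Context {R : realType} (M : plane).
Implicit Types (m u v w x y z : 'rV[R]_3) (r s t : R).
Local Notation mf := (@metric_form R M).
Local Notation sg := (@form_sign R M).
Local Notation Sn := (@gsin R M).
Local Notation Cn := (@gcos R M).
Local Notation mu := (@lebesgue_measure R).

Lemma is_derive_coord (g : R -> 'rV[R]_3) t (j : 'I_3) : derivable g t 1 ->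
  is_derive t 1 (fun s => g s 0 j) (derive1 g t 0 j).
Proof.
move=> dg; have dj : derivable (fun s => g s 0 j) t 1 by move/derivable_mxP : dg; exact.
by rewrite derive1E derive_mx// mxE; exact: derivableP.
Qed.

Lemma is_derive_mf m (g : R -> 'rV[R]_3) t : derivable g t 1 ->
  is_derive t 1 (fun s => mf m (g s)) (mf m (derive1 g t)).
Proof.
move=> dg; have d j := is_derive_coord j dg.
have -> : (fun s => mf m (g s)) = (m 0 0 \*: (fun s => g s 0 0) : R -> R) +
    (m 0 1 \*: (fun s => g s 0 1) : R -> R) + ((sg * m 0 2) \*: (fun s => g s 0 2) : R -> R).
  by apply/funext => s; rewrite mfE !fctE /= /GRing.scale /=; ring.
have -> : mf m (derive1 g t) = m 0 0 *: (derive1 g t 0 0 : R) + m 0 1 *: (derive1 g t 0 1 : R) +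
    (sg * m 0 2) *: (derive1 g t 0 2 : R).
  by rewrite mfE /GRing.scale /=; ring.
exact: (is_deriveD (is_deriveD (is_deriveZ _ (d 0)) (is_deriveZ _ (d 1))) (is_deriveZ _ (d 2))).
Qed.

Definition speed (g : R -> 'rV[R]_3) t : R := Num.sqrt (mf (derive1 g t) (derive1 g t)).

Lemma mf_self_continuous : continuous (fun x : 'rV[R]_3 => mf x x).
Proof. by move=> x; apply: (@cts_near _ _ R^o) => e e0; exact: mf_self_near. Qed.

Lemma speed_continuous (g : R -> 'rV[R]_3) : continuous (derive1 g) -> continuous (speed g).
Proof.
move=> gc t; apply: (@continuous_comp _ _ _ (fun t => mf (derive1 g t) (derive1 g t))).
  by apply: (@continuous_comp _ _ _ (derive1 g) (fun x => mf x x)); [exact: gc|exact: mf_self_continuous].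
exact: sqrt_continuous.
Qed.

Lemma length_ge (g : R -> 'rV[R]_3) (F F' : R -> R) : continuous (derive1 g) ->
  (forall t, t \in `[0, 1] -> is_derive t 1 F (F' t)) ->
  (forall t, t \in `[0, 1] -> {for t, continuous F'}) ->
  (forall t, t \in `]0, 1[ -> F' t <= speed g t) -> F 1 - F 0 <= path_length M g.
Proof.
move=> gc dF cF le.
have sub t : t \in `]0, 1[ -> t \in `[0, 1].
  by rewrite !in_itv /= => /andP[t0 t1]; rewrite !ltW.
have cF' : {within `[0, 1], continuous F'}.
  by apply: continuous_in_subspaceT => t /set_mem; exact: cF.
have cS : {within `[0, 1], continuous (speed g)}.
  by apply: continuous_subspaceT; exact: speed_continuous.
have cFt t : t \in `[0, 1] -> {for t, continuous F}.
  move=> t01; have [dt _] := dF t t01.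
  by apply: differentiable_continuous; exact/derivable1_diffP.
have FTC : (\int[mu]_(t in `[0%R, 1%R]) (F' t)%:E)%E = ((F 1)%:E - (F 0)%:E)%E.
  apply: continuous_FTC2 => //.
    split.
    - by move=> t /sub t01; have [] := dF t t01.
    - by apply: cvg_at_right_filter; apply: cFt; exact: in01_0.
    - by apply: cvg_at_left_filter; apply: cFt; exact: in01_1.
  by move=> t /sub t01; rewrite derive1E; have [_ ->] := dF t t01.
have iF : mu.-integrable `[0, 1] (EFin \o F').
  by apply: continuous_compact_integrable => //; exact: segment_compact.
have iS : mu.-integrable `[0, 1] (EFin \o speed g).
  by apply: continuous_compact_integrable => //; exact: segment_compact.
have oc : (`]0, 1[%classic : set R) `<=` (`[0, 1]%classic : set R) by move=> t; exact: sub.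
have iF' : mu.-integrable `]0, 1[ (EFin \o F') by apply: integrableS iF.
have iS' : mu.-integrable `]0, 1[ (EFin \o speed g) by apply: integrableS iS.
have le' : \int[mu]_(t in `]0, 1[) F' t <= \int[mu]_(t in `]0, 1[) speed g t.
  by apply: le_Rintegral => //.
have E (f : R -> R) : mu.-integrable `]0, 1[ (EFin \o f) ->
    \int[mu]_(t in `]0, 1[) f t = \int[mu]_(t in `[0, 1]) f t.
  move=> fi; rewrite /Rintegral; congr fine; apply/esym; apply: integral_itv_bndoo.
  exact: (measurable_int mu fi).
rewrite /path_length -/(speed g) -(E _ iS'); apply: le_trans le'.
by rewrite (E _ iF') /Rintegral FTC.
Qed.

(** By [mf_le_sg], the function [mf (g t) (g s)] of [s] is maximal at [s = t]. *)
Lemma path_tangent (g : R -> 'rV[R]_3) t : (forall t, derivable g t 1) ->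
  (forall t, t \in `[0, 1] -> surface M (g t)) -> t \in `]0, 1[ ->
  mf (g t) (derive1 g t) = 0.
Proof.
move=> dg gM t01.
have sub s : s \in `]0, 1[ -> s \in `[0, 1].
  by rewrite !in_itv /= => /andP[t0 t1]; rewrite !ltW.
have [_ d1] := is_derive_mf (g t) (dg t).
have [||| |_ d2] := @derive1_at_max R (fun s => mf (g t) (g s)) 0 1 t => //.
- by move=> s _; have [] := is_derive_mf (g t) (dg s).
- move=> s s01; rewrite (surface_mf (gM t (sub t t01))).
  by apply: mf_le_sg; apply: gM; exact: sub.
by rewrite -d1 d2.
Qed.

(** Only the component [w] of [x] tangent at [z] contributes, and the form is positive definite on
    the tangent plane. *)
Lemma cauchy_schwarz x z v : surface M x -> surface M z -> mf z v = 0 ->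
  mf x v ^+ 2 <= sg * (1 - mf x z ^+ 2) * mf v v.
Proof.
move=> xM zM zv; set w := x - (sg * mf x z) *: z.
have gg : sg * sg = 1 by exact: sg2.
have zw : mf z w = 0.
  by rewrite /w !mflin (surface_mf zM) (mfC M z x) mulrAC gg mul1r subrr.
have wv : mf w v = mf x v by rewrite /w !mflin zv mulr0 subr0.
have ww : mf w w = sg * (1 - mf x z ^+ 2).
  rewrite /w !mflin (surface_mf xM) (surface_mf zM) (mfC M z x).
  transitivity (sg - 2 * sg * mf x z ^+ 2 + (sg * sg) * sg * mf x z ^+ 2); first by ring.
  by rewrite gg; ring.
clearbody w; rewrite -ww -wv.
have vv := surface_orth_ge0 zM zv.
have [v0|vn] := eqVneq (mf v v) 0.
  by rewrite (surface_orth_eq0 zM zv v0) !mf0r mulr0 expr0n.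
have : 0 <= mf (mf v v *: w - mf w v *: v) (mf v v *: w - mf w v *: v).
  by apply: (surface_orth_ge0 zM); rewrite !mflin zw zv !mulr0 subrr.
rewrite !mflin (mfC M v w) => H.
have vp : 0 < mf v v by rewrite lt_neqAle eq_sym vn.
rewrite -subr_ge0 -(pmulr_rge0 _ vp); move: H.
by congr (0 <= _); ring.
Qed.

Definition aCn r : R := match M with Sphere => acos r | Hyperbolic => acosh r end.

Lemma is_derive_acosh r : 1 < r -> is_derive r 1 (@acosh R) (Num.sqrt (r ^+ 2 - 1))^-1.
Proof.
move=> r1; have q0 : 0 < r ^+ 2 - 1 by nra.
have s0 : 0 < Num.sqrt (r ^+ 2 - 1) by rewrite sqrtr_gt0.
have d1 : is_derive r 1 (fun t : R => t ^+ 2 - 1) (2 * r).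
  apply: is_derive_eq; rewrite /GRing.scale /= ?mulr1 ?subr0 ?expr1; ring.
have d2 : is_derive r 1 (fun t : R => Num.sqrt (t ^+ 2 - 1)) (r / Num.sqrt (r ^+ 2 - 1)).
  have := @is_derive1_comp R Num.sqrt (fun t => t ^+ 2 - 1) r _ _ (is_derive1_sqrt q0) d1.
  by rewrite (_ : _ * (2 * r) = r / Num.sqrt (r ^+ 2 - 1))//; field; exact: lt0r_neq0.
have d3 : is_derive r 1 (fun t : R => t + Num.sqrt (t ^+ 2 - 1)) (1 + r / Num.sqrt (r ^+ 2 - 1)).
  exact: (is_deriveD (is_derive_id r 1) d2).
have p0 : 0 < r + Num.sqrt (r ^+ 2 - 1) by lra.
have := @is_derive1_comp R (@ln R) (fun t => t + Num.sqrt (t ^+ 2 - 1)) r _ _ (is_derive1_ln p0) d3.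
by rewrite (_ : _ * (1 + _) = (Num.sqrt (r ^+ 2 - 1))^-1)//; field; rewrite !lt0r_neq0.
Qed.

Lemma is_derive_aCn r : 0 < sg * (1 - r ^+ 2) -> (M = Hyperbolic -> 0 < r) ->
  is_derive r 1 aCn (- sg / Num.sqrt (sg * (1 - r ^+ 2))).
Proof.
rewrite /aCn /form_sign; case: M => [+ _|+ /(_ erefl) r0].
  by rewrite mul1r mulN1r => r1; apply: is_derive1_acos; apply/andP; split; nra.
rewrite mulN1r opprK mul1r opprB => r1; apply: is_derive_acosh; nra.
Qed.


Lemma aCnK r : 0 <= sg * (1 - r ^+ 2) -> (M = Hyperbolic -> 0 < r) -> Cn (aCn r) = r.
Proof.
rewrite /aCn /gcos /form_sign; case: M => [r1 _|r1 /(_ erefl) r0].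
  by apply: acosK; rewrite in_itv /=; apply/andP; split; nra.
by apply: acoshK; nra.
Qed.

(* The derivative of the distance to [x] blows up at [x] and at its antipode; multiplying the
   cosine by Cn e keeps away from them. *)
Lemma path_lower x y (g : R -> 'rV[R]_3) e : C1_path M x y g -> surface M x -> surface M y ->
  0 < e -> (M = Sphere -> path_length M g + e < pi) -> e < 1 ->
  sg * Cn (path_length M g + e) <= Cn e * mf x y.
Proof.
move=> [dg gc gM g0 g1] xM yM e0 eL e1; set L := path_length M g.
have gg : sg * sg = 1 by exact: sg2.
have Ce : 0 < Cn e.
  rewrite /gcos; case: (M); last exact: cosh_gt0.
  by apply: cos_gt0_pihalf; have := pi_ge2 R => ?; apply/andP; split; lra.
have Ce2 : 0 < sg * (1 - Cn e ^+ 2).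
  have := Cn2Sn2 M e; rewrite /gsin /gcos /form_sign; case: (M) => E.
    have s0 : 0 < sin e by apply: sin_gt0_pi; have := pi_ge2 R => ?; apply/andP; split; lra.
    nra.
  have s0 : 0 < sinh e by exact: sinh_gt0.
  nra.
pose f t := mf x (g t).
have ft t : t \in `[0, 1] -> 0 <= sg * (1 - f t ^+ 2) /\ (M = Hyperbolic -> f t < 0).
  move=> t01; have := mf_le_sg xM (gM t t01); have := @mf_geN1 R M x (g t).
  rewrite /f /form_sign; move: xM (gM t t01); case: (M) => aM bM => [/(_ erefl aM bM)|_] h1.
    by move=> h2; split=> //; nra.
  by split; [nra|move=> _; lra].
have pos t : t \in `[0, 1] -> 0 < sg * (1 - (Cn e * (sg * f t)) ^+ 2) /\
    sg * (1 - f t ^+ 2) * Cn e ^+ 2 <= sg * (1 - (Cn e * (sg * f t)) ^+ 2).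
  move=> /ft[h1 _]; have -> : (Cn e * (sg * f t)) ^+ 2 = Cn e ^+ 2 * f t ^+ 2.
    by rewrite !exprMn (expr2 sg) gg mul1r.
  have c2 : 0 < Cn e ^+ 2 by rewrite exprn_gt0.
  by split; nra.
pose den t := Num.sqrt (sg * (1 - (Cn e * (sg * f t)) ^+ 2)).
pose F t := aCn (Cn e * (sg * f t)).
pose F' t := (- sg / den t) * (Cn e * (sg * mf x (derive1 g t))).
have dt t : t \in `[0, 1] -> 0 < den t by move=> /pos[h1 _]; rewrite sqrtr_gt0.
have df t : is_derive t 1 (fun s => Cn e * (sg * f s)) (Cn e * (sg * mf x (derive1 g t))).
  exact: (is_deriveZ (Cn e) (is_deriveZ sg (is_derive_mf x (dg t)))).
have dF t : t \in `[0, 1] -> is_derive t 1 F (F' t).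
  move=> t01; have [h1 _] := pos t t01; have [_ fneg] := ft t t01.
  apply: (@is_derive1_comp R aCn (fun s => Cn e * (sg * f s)) t _ _ _ (df t)).
  apply: is_derive_aCn => // MH; rewrite mulr_gt0//; have := fneg MH.
  by rewrite /form_sign MH; lra.
have fc : continuous f.
  by move=> t; apply: (@continuous_comp _ _ _ g (mf x)); [apply: differentiable_continuous; exact/derivable1_diffP/dg|exact: mf_continuous].
have cF t : t \in `[0, 1] -> {for t, continuous F'}.
  move=> t01; apply: (@continuousM R R (fun t => - sg / den t) (fun t => Cn e * (sg * mf x (derive1 g t)))).
    apply: (@continuousM R R (fun=> - sg) (fun t => (den t)^-1)); first exact: cst_continuous.
    apply: continuousV; first by rewrite gt_eqF// dt.
    apply: (@continuous_comp _ _ _ (fun t => sg * (1 - (Cn e * (sg * f t)) ^+ 2))); last exact: sqrt_continuous.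
    have cc : {for t, continuous (fun t => Cn e * (sg * f t))}.
      apply: (@continuousM R R (fun=> Cn e) (fun t => sg * f t)); first exact: cst_continuous.
      by apply: (@continuousM R R (fun=> sg) f); [exact: cst_continuous|exact: fc].
    apply: (@continuousM R R (fun=> sg)); first exact: cst_continuous.
    apply: (@continuousB _ R^o); first exact: cst_continuous.
    exact: (@continuousM R R (fun t => Cn e * (sg * f t)) (fun t => Cn e * (sg * f t))).
  apply: (@continuousM R R (fun=> Cn e)); first exact: cst_continuous.
  apply: (@continuousM R R (fun=> sg)); first exact: cst_continuous.
  by apply: (@continuous_comp _ _ _ (derive1 g) (mf x)); [exact: gc|exact: mf_continuous].
have le t : t \in `]0, 1[ -> F' t <= speed g t.
  move=> t01; have t01' : t \in `[0, 1].
    by move: t01; rewrite !in_itv /= => /andP[t0 t1]; rewrite !ltW.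
  have tg := path_tangent dg gM t01; have cs := cauchy_schwarz xM (gM t t01') tg.
  have [h1 h2] := pos t t01'; have d0 := dt t t01'.
  have v0 := surface_orth_ge0 (gM t t01') tg.
  have -> : F' t = - (Cn e * mf x (derive1 g t)) / den t.
    rewrite /F'; transitivity (- (sg * sg) * (Cn e * mf x (derive1 g t)) / den t); first by ring.
    by rewrite gg mulN1r.
  rewrite ler_pdivrMr//; apply: le_trans (ler_norm _) _.
  rewrite -ler_sqr ?nnegrE//; last by rewrite mulr_ge0 ?sqrtr_ge0// ltW.
  rewrite real_normK ?num_real// sqrrN exprMn /speed exprMn sqr_sqrtr// sqr_sqrtr ?(ltW h1)//.
  rewrite -/(f t) in cs.
  have : mf x (derive1 g t) ^+ 2 * Cn e ^+ 2 <=
      sg * (1 - f t ^+ 2) * mf (derive1 g t) (derive1 g t) * Cn e ^+ 2 by rewrite ler_wpM2r ?sqr_ge0.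
  have : sg * (1 - f t ^+ 2) * Cn e ^+ 2 * mf (derive1 g t) (derive1 g t) <=
      sg * (1 - (Cn e * (sg * f t)) ^+ 2) * mf (derive1 g t) (derive1 g t) by rewrite ler_wpM2r.
  lra.
have := length_ge gc dF cF le; rewrite -/L.
have F0 : F 0 = e.
  rewrite /F /f g0 (surface_mf xM) gg mulr1 /aCn /gcos; case: (M); last by rewrite coshK// ltW.
  by rewrite cosK// in_itv /= (ltW e0) /=; have := pi_ge2 R; lra.
have CF : Cn (F 1) = Cn e * (sg * mf x y).
  rewrite /F /f g1; apply: aCnK.
    by have [h1 _] := pos 1 in01_1; move: (ltW h1); rewrite /f g1.
  move=> MH; rewrite mulr_gt0//; have [_ /(_ MH)] := ft 1 in01_1; rewrite /f g1.
  by rewrite /form_sign MH; lra.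
rewrite F0 => le1.
have -> : Cn e * mf x y = sg * (Cn e * (sg * mf x y)).
  by transitivity (sg * sg * (Cn e * mf x y)); [rewrite gg mul1r|ring].
have F0' : 0 <= F 1.
  rewrite /F /f g1 /aCn.
  have [h1 _] := pos 1 in01_1; have [_ fn] := ft 1 in01_1; move: h1 fn; rewrite /f g1.
  move: Ce; rewrite /form_sign; case: (M) => Ce' h1 fn; last first.
    apply: acosh_ge0; have : 0 < gcos Hyperbolic e * (-1 * metric_form Hyperbolic x y).
      by rewrite mulr_gt0//; have := fn erefl; lra.
    by move: h1; set u := gcos _ _ * _; nra.
  by apply: acos_ge0; apply/andP; split; move: h1; set u := gcos _ _ * _; nra.
rewrite -CF; move: (F 1) le1 F0' => f1 le1 F0'; rewrite -/L in eL; clearbody L.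
clear -R M e0 eL le1 F0'; move: eL le1 F0'; rewrite /gcos /form_sign; case: (M) => eL le1 F0'.
  rewrite !mul1r; have lt := eL erefl.
  have [->|ne] := eqVneq f1 (L + e); first by [].
  by rewrite ltW// ltr_cos ?in_itv/=; [rewrite lt_neqAle ne/=; lra|apply/andP; split; lra|apply/andP; split; lra].
rewrite !mulN1r lerN2 cosh_mono// ?nnegrE//; lra.
Qed.

Lemma Cn_continuous : continuous Cn.
Proof.
move=> t; have [d _] := is_derive_Cn M t.
by apply: differentiable_continuous; exact/derivable1_diffP.
Qed.

(** Let [e] tend to 0 in [path_lower]. *)
Lemma length_lower x y (g : R -> 'rV[R]_3) : C1_path M x y g -> surface M x -> surface M y ->
  (M = Sphere -> path_length M g < pi) -> sg * Cn (path_length M g) <= mf x y.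
Proof.
move=> gP xM yM Lpi; set L := path_length M g in Lpi *; rewrite leNgt; apply/negP => lt.
have kc : {for 0, continuous (fun e => Cn e * mf x y - sg * Cn (L + e))}.
  apply: (@continuousB _ R^o).
    by apply: (@continuousM R R Cn); [exact: Cn_continuous|exact: cst_continuous].
  apply: (@continuousM R R (fun=> sg)); first exact: cst_continuous.
  apply: (@continuous_comp _ _ _ (fun e => L + e) Cn); last exact: Cn_continuous.
  by apply: (@continuousD _ R^o); [exact: cst_continuous|exact: cvg_id].
have C0 : Cn 0 = 1 by rewrite /gcos; case: (M); rewrite ?cos0 ?cosh0.
have [|d d0 hd] := near_cts kc (e := sg * Cn L - mf x y); first by rewrite subr_gt0.
have [d1 d10 [d1d dp]] : exists2 d1, 0 < d1 & d1 < d /\ (M = Sphere -> L + d1 < pi) /\ d1 < 1.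
  have [MS|MH] := pselect (M = Sphere).
    exists (Num.min (d / 2) (Num.min ((pi - L) / 2) (1 / 2))).
      by have := Lpi MS => ?; rewrite !lt_min; do !(apply/andP; split); lra.
    have h1 := ge_min (d / 2) (d / 2) (Num.min ((pi - L) / 2) (1 / 2)).
    set w := Num.min _ _; have w1 : w <= d / 2 by rewrite ge_min lexx.
    have w2 : w <= (pi - L) / 2 by rewrite !ge_min lexx !orbT.
    have w3 : w <= 1 / 2 by rewrite !ge_min lexx !orbT.
    by have := Lpi MS => ?; split; [lra|split; [move=> _; lra|lra]].
  exists (Num.min (d / 2) (1 / 2)); first by rewrite !lt_min; apply/andP; split; lra.
  set w := Num.min _ _; have w1 : w <= d / 2 by rewrite ge_min lexx.
  have w3 : w <= 1 / 2 by rewrite !ge_min lexx !orbT.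
  by split; [lra|split; [move=> /MH|lra]].
have [dp1 dp2] := dp.
have := path_lower gP xM yM d10 dp1 dp2; rewrite -/L.
have := hd d1; rewrite subr0 (gtr0_norm d10) => /(_ d1d).
by rewrite C0 mul1r addr0 => /ltr_normlP[_]; lra.
Qed.

Definition gdist x y : R := aCn (sg * mf x y).

Lemma gdistP x y : surface M x -> surface M y ->
  [/\ 0 <= gdist x y, M = Sphere -> gdist x y <= pi & mf x y = sg * Cn (gdist x y)].
Proof.
move=> xM yM; have gg : sg * sg = 1 by exact: sg2.
have := mf_le_sg xM yM; have := @mf_geN1 R M x y; rewrite /gdist.
have CE : mf x y = sg * (sg * mf x y) by rewrite mulrA gg mul1r.
move=> h1 h2; have KE : Cn (aCn (sg * mf x y)) = sg * mf x y.
  apply: aCnK; last by move=> MH; move: h2; rewrite /form_sign MH; lra.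
  move: h1 h2 xM yM; rewrite /form_sign; case: (M) => h1 h2 xM yM.
    by have := h1 erefl xM yM; nra.
  by nra.
split; last by rewrite KE.
  move: h1 h2 xM yM; rewrite /aCn /form_sign; case: (M) => h1 h2 xM yM.
    by apply: acos_ge0; have := h1 erefl xM yM => ?; apply/andP; split; lra.
  by apply: acosh_ge0; lra.
move=> MS; move: h1 h2 xM yM; rewrite /aCn /form_sign MS => h1 h2 xM yM.
by apply: acos_lepi; have := h1 erefl xM yM => ?; apply/andP; split; lra.
Qed.

Lemma geodesic_dir x y : surface M x -> surface M y -> exists e,
  [/\ mf x e = 0, mf e e = 1 & y = Cn (gdist x y) *: x + Sn (gdist x y) *: e].
Proof.
move=> xM yM; have gg : sg * sg = 1 by exact: sg2.
have [A0 Api mE] := gdistP xM yM; set A := gdist x y in A0 Api mE *.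
have CS := Cn2Sn2 M A.
have w1 : mf x (y - Cn A *: x) = 0.
  by rewrite !mflin (surface_mf xM) mE; ring.
have w2 : mf (y - Cn A *: x) (y - Cn A *: x) = Sn A ^+ 2.
  rewrite !mflin (surface_mf xM) (surface_mf yM) (mfC M y x) mE.
  transitivity (sg * (1 - Cn A ^+ 2)); first by ring.
  by rewrite -CS addrAC subrr add0r mulrA gg mul1r.
have [S0|S0] := eqVneq (Sn A) 0; last first.
  exists ((Sn A)^-1 *: (y - Cn A *: x)); split.
  - by rewrite mfZr w1 mulr0.
  - by rewrite mfZl mfZr w2; field.
  by rewrite scalerA divff// scale1r addrC subrK.
(* Here [y] is [x] or its antipode, and any tangent direction serves. *)
have [w [xw ww]] := tangent_exists xM.
exists ((Num.sqrt (mf w w))^-1 *: w); split.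
- by rewrite mfZr xw mulr0.
- rewrite mfZl mfZr -[X in _ * (_ * X)]sqr_sqrtr ?ltW//.
  by have : Num.sqrt (mf w w) != 0 by [rewrite gt_eqF// sqrtr_gt0]; move=> ?; field.
rewrite S0 scale0r addr0; apply/eqP; rewrite -subr_eq0; apply/eqP.
by apply: (surface_orth_eq0 xM w1); rewrite w2 S0 expr0n.
Qed.

Lemma geodesic_path x y : surface M x -> surface M y ->
  exists2 g, C1_path M x y g & path_length M g = gdist x y.
Proof.
move=> xM yM; have gg : sg * sg = 1 by exact: sg2.
have [A0 Api mE] := gdistP xM yM; have [e [xe ee yE]] := geodesic_dir xM yM.
set A := gdist x y in A0 Api mE yE *.
have C0 : Cn 0 = 1 by rewrite /gcos; case: (M); rewrite ?cos0 ?cosh0.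
have S0 : Sn 0 = 0 by rewrite /gsin; case: (M); rewrite ?sin0 ?sinh0.
pose f (i : 'I_3) t := Cn (t * A) * x 0 i + Sn (t * A) * e 0 i.
pose f' (i : 'I_3) t := A * (Cn (t * A) * e 0 i - sg * Sn (t * A) * x 0 i).
have df i t : is_derive t 1 (f i) (f' i t).
  have dA : is_derive t 1 (fun t : R => t * A) A.
    by apply: is_derive_eq; rewrite /GRing.scale /= mulr0 add0r mulr1.
  have d1 := @is_derive1_comp R Cn (fun t => t * A) t _ _ (is_derive_Cn M (t * A)) dA.
  have d2 := @is_derive1_comp R Sn (fun t => t * A) t _ _ (is_derive_Sn M (t * A)) dA.
  have := is_deriveD (is_deriveZ (x 0 i) d1) (is_deriveZ (e 0 i) d2).
  have -> : x 0 i \*: (Cn \o (fun t => t * A)) + e 0 i \*: (Sn \o (fun t => t * A)) = f i :> (R -> R).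
    by apply/funext => s; rewrite !fctE /= /f /GRing.scale /=; ring.
  by congr is_derive; rewrite /f' /GRing.scale /=; ring.
pose g t := vec (f 0 t) (f 1 t) (f 2 t).
have gE t : g t = Cn (t * A) *: x + Sn (t * A) *: e.
  by apply: vecP; rewrite ?vec0 ?vec1 ?vec2 /f !mxE.
have dfi i t : derivable (f i) t 1 by have [] := df i t.
have dg t : derivable g t 1.
  apply/derivable_mxP => i; apply: ord3P; have -> : i = 0 by rewrite ord1.
  - exact: (eq_ind_r (fun F : R -> R => derivable F t 1) (dfi 0 t) (funext (fun s => vec0 _ _ _))).
  - exact: (eq_ind_r (fun F : R -> R => derivable F t 1) (dfi 1 t) (funext (fun s => vec1 _ _ _))).
  - exact: (eq_ind_r (fun F : R -> R => derivable F t 1) (dfi 2 t) (funext (fun s => vec2 _ _ _))).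
have g'E t : derive1 g t = A *: (Cn (t * A) *: e - (sg * Sn (t * A)) *: x).
  rewrite derive1_vec//; apply: vecP; rewrite ?vec0 ?vec1 ?vec2 !mxE derive1E.
  - by have [_ ->] := df 0 t.
  - by have [_ ->] := df 1 t.
  - by have [_ ->] := df 2 t.
have cA (h : R -> R) : continuous h -> continuous (fun t => h (t * A)).
  move=> hc t; apply: (@continuous_comp _ _ _ (fun t : R => t * A) h); last exact: hc.
  by apply: (@continuousM R R (fun t => t)); [exact: cvg_id|exact: cst_continuous].
have Snc : continuous Sn.
  move=> t; have [d _] := is_derive_Sn M t.
  by apply: differentiable_continuous; exact/derivable1_diffP.
have gc : continuous (derive1 g).
  have -> : derive1 g = fun t => A *: (Cn (t * A) *: e - (sg * Sn (t * A)) *: x).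
    by apply/funext => t; exact: g'E.
  move=> t; apply: (@continuousZ _ _ _ (fun=> A) (fun t => Cn (t * A) *: e - (sg * Sn (t * A)) *: x)).
    exact: cst_continuous.
  apply: (@continuousB _ _ _ (fun t => Cn (t * A) *: e)).
    apply: (@continuousZ _ _ _ (fun t => Cn (t * A))); last exact: cst_continuous.
    exact: (cA _ Cn_continuous).
  apply: (@continuousZ _ _ _ (fun t => sg * Sn (t * A))); last exact: cst_continuous.
  apply: (@continuousM R R (fun=> sg)); first exact: cst_continuous.
  exact: (cA _ Snc).
have gM t : surface M (g t).
  have CS := Cn2Sn2 M (t * A); apply: (surface_of xM).
    rewrite gE !mflin (surface_mf xM) (mfC M e x) xe ee.
    transitivity (sg * Cn (t * A) ^+ 2 + sg * sg * Sn (t * A) ^+ 2); first by rewrite gg; ring.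
    by rewrite -mulrA -mulrDr CS mulr1.
  rewrite gE !mflin (surface_mf xM) xe mulr0 addr0 /gcos /form_sign.
  by case: (M); [rewrite mulr1; exact: cos_le1|have := cosh_ge1 (t * A); lra].
have sp t : speed g t = A.
  have CS := Cn2Sn2 M (t * A); rewrite /speed g'E.
  set v := _ - _; have vv : mf v v = 1.
    rewrite /v !mflin (surface_mf xM) (mfC M e x) xe ee.
    transitivity (Cn (t * A) ^+ 2 + sg * sg * sg * Sn (t * A) ^+ 2); first by ring.
    by rewrite gg mul1r.
  by rewrite mfZl mfZr vv mulr1 -expr2 sqrtr_sqr ger0_norm.
exists g.
  split; [exact: dg|exact: gc|by move=> t _; exact: gM| |].
  - by rewrite gE mul0r C0 S0 scale1r scale0r addr0.
  - by rewrite gE mul1r -yE.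
rewrite /path_length -/(speed g).
have -> : speed g = fun=> A by apply/funext => t; exact: sp.
rewrite Rintegral_cst; last exact: measurable_itv.
transitivity (A * fine (1%:E : \bar R)); last by rewrite mulr1.
congr (_ * fine _); transitivity (mu (`[0%R, 1%R]%classic : set R)); first by [].
by rewrite lebesgue_measure_itv /= lte_fin ltr01 /= oppr0 adde0.
Qed.

(** The geodesic attains the value [gdist x y]. A shorter path would contradict [length_lower],
    since the cosine is strictly monotone on the range of distances; on the sphere its length is
    then below [pi], as that lemma requires. *)
Lemma distE x y : surface M x -> surface M y -> dist M x y = gdist x y.
Proof.
move=> xM yM; have [A0 Api mE] := gdistP xM yM; have [g gP gL] := geodesic_path xM yM.
have lb : lbound [set path_length M g | g in C1_path M x y] (gdist x y).
  move=> _ [g' g'P <-]; rewrite leNgt; apply/negP => lt.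
  have L0 : 0 <= path_length M g' by apply: Rintegral_ge0 => t _; exact: sqrtr_ge0.
  have Lpi : M = Sphere -> path_length M g' < pi by move=> /Api; exact: lt_le_trans.
  have := length_lower g'P xM yM Lpi; move: lt L0 Api mE.
  move: (path_length M g') (gdist x y) A0 => L A A0 lt L0 Api ->.
  clear g gP gL g' g'P Lpi.
  move: lt L0 Api; rewrite /gcos /form_sign; case: (M) => lt L0 Api.
    have pA := Api erefl; rewrite !mul1r leNgt ltr_cos ?in_itv/= ?lt//.
      by apply/andP; split; lra.
    by apply/andP; split; lra.
  by rewrite !mulN1r lerN2 cosh_mono ?nnegrE// leNgt lt.
have mem : [set path_length M g | g in C1_path M x y] (gdist x y) by exists g.
apply/eqP; rewrite eq_le /dist; apply/andP; split.
  by apply: ge_inf => //; exists (gdist x y).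
by apply: lb_le_inf => //; exists (gdist x y).
Qed.

Lemma dist_contract x y x' y' : surface M x -> surface M y -> surface M x' -> surface M y' ->
  dist M x' y' <= dist M x y -> mf x y <= mf x' y'.
Proof.
move=> xM yM x'M y'M; rewrite !distE//.
have [A0 Api ->] := gdistP xM yM; have [B0 Bpi ->] := gdistP x'M y'M.
move: A0 B0 Api Bpi; move: (gdist x y) (gdist x' y') => A B.
rewrite /gcos /form_sign; case: (M) => A0 B0 Api Bpi AB.
  have {}Api := Api erefl; have {}Bpi := Bpi erefl.
  by rewrite !mul1r leNgt ltr_cos ?in_itv/= -?leNgt ?AB//; apply/andP; split.
by rewrite !mulN1r lerN2 cosh_mono ?nnegrE.
Qed.


Lemma disk_cap r : 0 < r ->
  exists2 h, h < sg & forall x, surface M x -> disk M x r = cap M x h.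
Proof.
move=> r0; suff [h h1 H] : exists2 h, h < sg & forall x y, surface M x -> surface M y ->
    (gdist x y <= r) = (h <= mf x y).
  exists h => // x xM; apply/seteqP; split=> y [yM hy]; split=> //.
    by rewrite -H// -distE.
  by rewrite distE// H.
have gP x y (xM : surface M x) (yM : surface M y) := gdistP xM yM.
have c1 : 1 < cosh r by rewrite -cosh0; apply: cosh_lt; rewrite ?nnegrE ?lexx ?(ltW r0).
move: gP; rewrite /gcos /form_sign; case: (M) => gP; last first.
  exists (- cosh r) => [|x y xM yM]; first by rewrite ltrN2.
  have [A0 _ ->] := gP x y xM yM.
  by rewrite mulN1r lerN2 cosh_mono ?nnegrE// ltW.
have [rpi|rpi] := leP r pi.
  exists (cos r) => [|x y xM yM].
    by rewrite -cos0 ltr_cos ?in_itv/= ?lexx ?pi_ge0 ?(ltW r0).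
  have [A0 Api ->] := gP x y xM yM; have {}Api := Api erefl.
  by rewrite mul1r !leNgt ltr_cos// in_itv/= ?A0 ?(ltW r0).
(* A radius above [pi] gives the whole sphere. *)
exists (-1) => [|x y xM yM]; first by lra.
have [A0 Api E] := gP x y xM yM; have {}Api := Api erefl.
by rewrite E mul1r cos_geN1; apply/esym; lra.
Qed.

End Distance.

(** * Extension of contractions *)

Lemma mf_sum {R : realType} (M : plane) (T : Type) (l : seq T) (a : T -> R) (f : T -> 'rV[R]_3) w :
  metric_form M w (\sum_(e <- l) a e *: f e) = \sum_(e <- l) a e * metric_form M w (f e).
Proof. by elim: l => [|e l IH]; rewrite ?big_nil ?mf0r// !big_cons mfDr mfZr IH. Qed.

Lemma gram_det {R : realType} (a b c : 'rV[R]_3) (mf := @metric_form R Sphere) :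
  det Sphere a b c ^+ 2 = mf a a * (mf b b * mf c c - mf b c ^+ 2) -
    mf a b * (mf a b * mf c c - mf b c * mf a c) + mf a c * (mf a b * mf b c - mf b b * mf a c).
Proof. by rewrite /mf detE /metric_form; ring. Qed.

Section Kirszbraun.
Context {R : realType} (M : plane).
Implicit Types (u v w x y z : 'rV[R]_3) (r t : R).
Local Notation mf := (@metric_form R M).
Local Notation sg := (@form_sign R M).

(* The ball, or the convex side of the hyperboloid. *)
Definition body y := mf y y <= sg /\ (M = Hyperbolic -> 0 < y 0 2).

Lemma surface_body y : surface M y -> body y.
Proof.
move=> yM; split; first by rewrite surface_mf.
by move=> MH; move: yM; rewrite MH => -[].
Qed.

Lemma body_scale y : M = Hyperbolic -> body y -> exists2 s, 1 <= s & exists2 x, surface M x & y = s *: x.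
Proof.
move=> MH [yy /(_ MH) y2]; set s := Num.sqrt (- mf y y).
have yy1 : 1 <= - mf y y by move: yy; rewrite /form_sign MH; lra.
have s2 : s ^+ 2 = - mf y y by rewrite sqr_sqrtr//; lra.
have s0 : 0 <= s by exact: sqrtr_ge0.
have s1 : 1 <= s by nra.
have sp : 0 < s by lra.
exists s => //; exists (s^-1 *: y); last by rewrite scalerA mulfV ?scale1r// gt_eqF.
have E : mf (s^-1 *: y) (s^-1 *: y) = -1.
  rewrite mfZl mfZr; have -> : mf y y = - s ^+ 2 by rewrite s2 opprK.
  by field; rewrite gt_eqF.
move: E; rewrite MH => E; split=> //; by rewrite mxE mulr_gt0// invr_gt0.
Qed.

Lemma body_mf x y : body x -> body y -> mf x y <= sg.
Proof.
have [MS|MH] : M = Sphere \/ M = Hyperbolic by case: (M); [left|right].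
  move=> [xx _] [yy _]; have : 0 <= mf (x - y) (x - y).
    by rewrite /metric_form MS -!expr2 !addr_ge0// sqr_ge0.
  rewrite !mflin (mfC M y x); lra.
move=> /(body_scale MH)[s s1 [x' x'M ->]] /(body_scale MH)[t t1 [y' y'M ->]].
rewrite mfZl mfZr; have := mf_le_sg x'M y'M; rewrite /form_sign MH => h.
have : 1 <= s * t by nra.
nra.
Qed.

Lemma body_convex x y t : body x -> body y -> 0 <= t -> t <= 1 -> body (x + t *: (y - x)).
Proof.
move=> xB yB t0 t1; have xy := body_mf xB yB; have [xx x2] := xB; have [yy y2] := yB.
split; last first.
  by move=> MH; rewrite !mxE; have := x2 MH; have := y2 MH; nra.
have -> : x + t *: (y - x) = (1 - t) *: x + t *: y.
  by apply/rowP => i; rewrite !mxE; ring.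
rewrite !mflin (mfC M y x).
have e : 0 <= (1 - t) * t by nra.
have h1 : (1 - t) * ((1 - t) * mf x x) <= (1 - t) * ((1 - t) * sg).
  by rewrite !ler_wpM2l// subr_ge0.
have h2 : t * (t * mf y y) <= t * (t * sg) by rewrite !ler_wpM2l.
have h3 : (1 - t) * t * mf x y <= (1 - t) * t * sg by rewrite ler_wpM2l.
lra.
Qed.

Lemma body_near_not x : ~ body x -> exists2 e, 0 < e & forall y, `|y - x| < e -> ~ body y.
Proof.
move=> nx; have [le|gt] := leP (mf x x) sg; last first.
  have [|d d0 hd] := @mf_self_near R M x (mf x x - sg); first by rewrite subr_gt0.
  by exists d => // y /hd /ltr_normlP[h _] [yy _]; lra.
have [MH|MS] := pselect (M = Hyperbolic); last by exfalso; apply: nx; split.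
have x2 : x 0 2 <= 0 by rewrite leNgt; apply/negP => x2; apply: nx.
have x2' : x 0 2 <= -1.
  move: le; rewrite /metric_form /form_sign MH.
  have := sqr_ge0 (x 0 0); have := sqr_ge0 (x 0 1); nra.
exists 1 => // y yx [_ /(_ MH) y2]; have := coord_norm (y - x) 2; rewrite !mxE.
by move=> /(le_trans (ler_norm _)); lra.
Qed.

(** In the hyperbolic case the body is unbounded and [mf q] is coercive on it, which is why [defect]
    attains its minimum. *)
Lemma body_bound q : surface M q -> exists2 C, 0 < C &
  forall y, body y -> `|y| <= C * (3 + `|mf q y|).
Proof.
move=> qM; have [C C0 hC] := surface_bound qM; exists (3 * C + 1); first lra.
move=> y yB.
have [MS|MH] : M = Sphere \/ M = Hyperbolic by case: (M); [left|right].
  have [yy _] := yB; have C1 : `|y| <= 1.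
    rewrite -[`|y|]/(mx_norm y) mx_normrE; apply: bigmax_le => // -[i j] _ /=.
    rewrite ord1 -ler_sqr ?nnegrE// real_normK ?num_real// expr1n.
    move: yy; rewrite /metric_form /form_sign MS.
    have := sqr_ge0 (y 0 0); have := sqr_ge0 (y 0 1); have := sqr_ge0 (y 0 2).
    by rewrite !expr2; elim/ord3P: j => *; lra.
  by have := normr_ge0 (mf q y); nra.
have [s s1 [x xM yE]] := body_scale MH yB.
have h' : mf q x <= -1.
  by have := mf_le_sg qM xM; have -> : sg = -1 by rewrite /form_sign MH.
have := hC x xM; rewrite yE normrZ mfZr normrM ger0_norm; last by lra.
rewrite (ler0_norm (x := mf q x)); last by lra.
move: h'; move: (mf q x) `|x| (normr_ge0 x) => u X X0 h' hx.
have h1 : s * X <= s * (C * (2 - u)) by rewrite ler_wpM2l//; lra.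
have h2 : s * (C * (2 - u)) <= s * (C * (3 * - u)).
  by rewrite ler_wpM2l ?ler_wpM2l//; lra.
have h3 : 0 <= s * - u by apply: mulr_ge0; lra.
lra.
Qed.

(** First-order expansion of one term of the penalty, with an explicit quadratic error. *)
Lemma max0_sqr (a d t : R) : 0 <= t ->
  Num.max 0 (a - t * d) ^+ 2 <= Num.max 0 a ^+ 2 - 2 * t * (Num.max 0 a * d) + t ^+ 2 * d ^+ 2.
Proof.
move=> t0; have := sqr_ge0 (t * d); have := sqr_ge0 (a - t * d).
by case: (leP 0 a) => a0; case: (leP 0 (a - t * d)) => b0; nra.
Qed.

Section Extension.
Variables (s : seq ('rV[R]_3 * 'rV[R]_3)) (z : 'rV[R]_3).
Hypotheses (zM : surface M z).
Hypothesis sM : forall e, e \in s -> surface M e.1 /\ surface M e.2.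
Hypothesis sC : forall e e', e \in s -> e' \in s -> mf e.1 e'.1 <= mf e.2 e'.2.

(** It vanishes exactly when [y] satisfies all the wanted inequalities. The squares make it
    differentiable, with a gradient given up to a factor by the sum [Q] of [body_extension]. *)
Definition defect y := \sum_(e <- s) Num.max 0 (mf z e.1 - mf y e.2) ^+ 2.

Lemma defect_continuous : continuous defect.
Proof.
rewrite /defect; elim: s => [|e s' IH].
  by move=> y; rewrite (_ : (fun y => _) = fun=> 0); [exact: cst_continuous|apply/funext => ?; rewrite big_nil].
rewrite (_ : (fun y => _) = fun y => Num.max 0 (mf z e.1 - mf y e.2) ^+ 2 +
    \sum_(e <- s') Num.max 0 (mf z e.1 - mf y e.2) ^+ 2); last first.
  by apply/funext => y; rewrite big_cons.
move=> y; apply: (@continuousD _ _ _ (fun y : 'rV[R]_3 => Num.max 0 (mf z e.1 - mf y e.2) ^+ 2)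
  (fun y => \sum_(e <- s') Num.max 0 (mf z e.1 - mf y e.2) ^+ 2)); last exact: IH.
have c1 : {for y, continuous (fun y => Num.max 0 (mf z e.1 - mf y e.2))}.
  apply: (@continuous_max _ _ (fun=> 0)); first exact: cst_continuous.
  apply: (@continuousB _ R^o); first exact: cst_continuous.
  rewrite (_ : (fun y => mf y e.2) = mf e.2); first exact: mf_continuous.
  by apply/funext => w; exact: mfC.
exact: (@continuousM _ _ _ _ y c1 c1).
Qed.

Lemma defect_min : s != [::] -> exists2 y, body y & forall y', body y' -> defect y <= defect y'.
Proof.
move=> s0; have [e0 e0s] : exists e, e \in s by case: s s0 => // e ? _; exists e; rewrite inE eqxx.
have [p0M q0M] := sM e0s; have [C C0 hC] := body_bound q0M.
have df0 y : 0 <= defect y by rewrite sumr_ge0// => e _; exact: sqr_ge0.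
pose N := 1 + `|mf z e0.1| + defect z; pose B := Num.max `|z| (C * (3 + N)).
pose K := [set y | body y /\ `|y| <= B].
have zK : K z by split; [exact: surface_body|rewrite le_max lexx].
have cK : compact K.
  apply: (@compact_rV3 _ K B) => [y []//|y nK].
  have [yB|/body_near_not[d d0 hd]] := pselect (body y); last first.
    by exists d => // w /hd nB [].
  have [yle|ylt] := leP `|y| B; first by exfalso; apply: nK.
  exists (`|y| - B); first by rewrite subr_gt0.
  move=> w wy [_ wB]; have := ler_normD (y - w) w; rewrite subrK distrC; lra.
have cd : {within K, continuous defect} by apply: continuous_subspaceT; exact: defect_continuous.
have [|y /set_mem[yB _] hy] := EVT_min_rV _ cK cd; first by exists z.
exists y => // y' y'B; have [y'K|y'K] := pselect (K y'); first exact/hy/mem_set.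
apply: (le_trans (hy z (mem_set zK))).
have big : B < `|y'| by rewrite ltNge; apply/negP => le; apply: y'K.
have B2 : C * (3 + N) <= B by rewrite le_max lexx orbT.
have h1 := hC y' y'B; have h2 : N < `|mf e0.2 y'|.
  by have : C * (3 + N) < C * (3 + `|mf e0.2 y'|) by [lra]; rewrite ltr_pM2l//; lra.
have neg : mf e0.2 y' <= 1.
  have := body_mf (surface_body q0M) y'B; rewrite /form_sign; case: (M); lra.
have z0 := normr_ge0 (mf z e0.1); have dz := df0 z.
have h3 : mf y' e0.2 < - N.
  rewrite mfC; move: h2; rewrite lter_normr => /orP[h|h]; last by lra.
  by move: h; rewrite /N; lra.
have h4 : 1 + defect z < mf z e0.1 - mf y' e0.2.
  by have := ler_norm (- mf z e0.1); rewrite normrN; move: h3; rewrite /N; lra.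
rewrite {2}/defect (big_rem e0)//=.
have : 0 <= \sum_(e <- rem e0 s) Num.max 0 (mf z e.1 - mf y' e.2) ^+ 2.
  by rewrite sumr_ge0// => e _; exact: sqr_ge0.
have : defect z <= Num.max 0 (mf z e0.1 - mf y' e0.2) ^+ 2.
  rewrite max_r; last by lra.
  nra.
lra.
Qed.

(* At a minimum of the defect the weighted sums P and Q of the two configurations would
   satisfy |P| > |Q| (|P| < |Q| on the hyperboloid), against the hypothesis. *)
Lemma body_extension : exists2 y, body y & forall e, e \in s -> mf z e.1 <= mf y e.2.
Proof.
have [->|s0] := eqVneq s [::]; first by exists z => //; exact: surface_body.
have [y yB ymin] := defect_min s0; exists y => //.
pose m e := Num.max 0 (mf z e.1 - mf y e.2).
have m0 e : 0 <= m e by rewrite le_max lexx.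
pose Q := \sum_(e <- s) m e *: e.2; pose P := \sum_(e <- s) m e *: e.1.
have mfQ w : mf w Q = \sum_(e <- s) m e * mf w e.2 by exact: mf_sum.
have mfP w : mf w P = \sum_(e <- s) m e * mf w e.1 by exact: mf_sum.
(* The first-order condition at the minimum: over the convex body, the product with [Q] is largest
   at [y]. *)
have first y' : body y' -> mf y' Q <= mf y Q.
  move=> y'B; pose d (e : 'rV[R]_3 * 'rV[R]_3) := mf (y' - y) e.2.
  have key t : 0 < t -> t <= 1 -> 2 * (\sum_(e <- s) m e * d e) <= t * \sum_(e <- s) d e ^+ 2.
    move=> t0 t1; rewrite -(ler_pM2l t0).
    have := ymin _ (body_convex yB y'B (ltW t0) t1).
    have : defect (y + t *: (y' - y)) <= \sum_(e <- s)
        (Num.max 0 (mf z e.1 - mf y e.2) ^+ 2 - 2 * t * (m e * d e) + t ^+ 2 * d e ^+ 2).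
      apply: ler_sum => e _; apply: le_trans (max0_sqr _ _ (ltW t0)).
      by rewrite mfDl mfZl opprD addrA.
    rewrite big_split/= sumrB -mulr_sumr -mulr_sumr -/(defect y).
    lra.
  have le0 : \sum_(e <- s) m e * d e <= 0.
    set X := \sum_(e <- s) _ in key *; set Y := \sum_(e <- s) d _ ^+ 2 in key.
    rewrite leNgt; apply/negP => X0.
    have Y0 : 0 <= Y by rewrite sumr_ge0// => e _; exact: sqr_ge0.
    have := key (Num.min 1 (X / (Y + 1))).
    have t1 : Num.min 1 (X / (Y + 1)) <= 1 by rewrite ge_min lexx.
    have t2 : Num.min 1 (X / (Y + 1)) * (Y + 1) <= X by rewrite -ler_pdivlMr; [rewrite ge_min lexx orbT|lra].
    have t0 : 0 < Num.min 1 (X / (Y + 1)) by rewrite lt_min ltr01 divr_gt0//; lra.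
    by move=> /(_ t0 t1); lra.
  rewrite -subr_ge0 -oppr_le0 opprB -mfNl -mfDl mfQ.
  exact: le0.
move=> e es; rewrite leNgt; apply/negP => lt.
have me : 0 < m e by rewrite lt_max subr_gt0 lt orbT.
have yQ : mf y Q < mf z P.
  rewrite mfQ mfP (big_rem e es) [ltRHS](big_rem e es)/=; apply: ltr_leD.
    by rewrite ltr_pM2l.
  apply: ler_sum => e' _; rewrite /m; case: (leP 0 (mf z e'.1 - mf y e'.2)) => h.
    by rewrite ler_wpM2l//; lra.
  by rewrite !mul0r.
have PQ : mf P P <= mf Q Q.
  rewrite mfP mfQ !big_seq; apply: ler_sum => e1 e1s; rewrite ler_wpM2l//.
  rewrite mfC mfP mfC mfQ !big_seq; apply: ler_sum => e2 e2s; rewrite ler_wpM2l//.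
  exact: sC.
(* On the sphere [mf y Q] is at least the norm of [Q] and [mf z P] at most that of [P], which is
   incompatible with [yQ] and [PQ]. *)
have [MS|MH] : M = Sphere \/ M = Hyperbolic by case: (M); [left|right].
  have sgE : sg = 1 by rewrite /form_sign MS.
  have pd w : 0 <= mf w w by rewrite /metric_form MS -!expr2 !addr_ge0// sqr_ge0.
  have zz := surface_mf zM; rewrite sgE in zz.
  have QQ := pd Q; have q2 := sqr_sqrtr QQ; set q := Num.sqrt _ in q2.
  have q0 : 0 <= q by exact: sqrtr_ge0.
  have yq : q <= mf y Q.
    have [qz|qn] := eqVneq q 0.
      have : body 0 by split; [rewrite mf0l sgE ler01|rewrite MS].
      by move=> /first; rewrite mf0l qz.
    have qB : body (q^-1 *: Q).
      split; last by rewrite MS.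
      by rewrite mfZl mfZr -q2 sgE le_eqVlt; apply/orP; left; apply/eqP; field.
    have := first _ qB; rewrite mfZl -q2.
    by rewrite (_ : q^-1 * q ^+ 2 = q)//; field.
  have zP2 : mf z P ^+ 2 <= mf P P.
    have := pd (P - mf z P *: z); rewrite !mflin zz (mfC M P z); nra.
  nra.
have sgE : sg = -1 by rewrite /form_sign MH.
(* Nonnegative combinations of points of the hyperboloid stay in the cone over it, and the positive
   weight of [e] keeps the sum away from 0. *)
have fut (f : 'rV[R]_3 * 'rV[R]_3 -> 'rV[R]_3) : (forall e, e \in s -> surface M (f e)) ->
    exists r x, [/\ 0 < r, surface M x & \sum_(e <- s) m e *: f e = r *: x].
  move=> fM; set S := \sum_(e <- s) _.
  have [r [x [r0 xB SE]]] : exists r x, [/\ 0 <= r, body x & S = r *: x].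
    rewrite /S big_seq.
    apply: (big_ind (fun v => exists r x, [/\ 0 <= r, body x & v = r *: x])).
    - by exists 0, z; split; [|exact: surface_body|rewrite scale0r].
    - move=> _ _ [r [x [r0 xB ->]]] [r' [x' [r'0 x'B ->]]].
      have [rz|rn] := eqVneq (r + r') 0.
        exists 0, x; split=> //; have [-> ->] : r = 0 /\ r' = 0 by lra.
        by rewrite !scale0r addr0.
      have rp : 0 < r + r' by rewrite lt_neqAle eq_sym rn addr_ge0.
      exists (r + r'), (x + (r' / (r + r')) *: (x' - x)); split; first exact: ltW.
        apply: body_convex => //; first by rewrite divr_ge0// ltW.
        by rewrite ler_pdivrMr//; lra.
      by apply/rowP => i; rewrite !mxE; field.
    - by move=> e' e's; exists (m e'), (f e'); split=> //; exact/surface_body/fM.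
  have Sneg : mf (f e) S < 0.
    rewrite mf_sum (big_rem e es)/= (surface_mf (fM e es)) sgE.
    have : \sum_(e' <- rem e s) m e' * mf (f e) (f e') <= 0.
      rewrite big_seq; apply: sumr_le0 => e' /mem_rem e's; apply: mulr_ge0_le0 => //.
      by have := mf_le_sg (fM e es) (fM e' e's); rewrite sgE; lra.
    lra.
  have rp : 0 < r.
    rewrite lt_neqAle r0 andbT eq_sym; apply/eqP => rz.
    by move: Sneg; rewrite SE rz scale0r mf0r ltxx.
  have [t t1 [x' x'M xE]] := body_scale MH xB.
  exists (r * t), x'; split=> //; first by rewrite mulr_gt0//; lra.
  by rewrite SE xE scalerA.
have [p [x [p0 xM PE]]] := fut fst (fun e es => (sM es).1).
have [q [x' [q0 x'M QE]]] := fut snd (fun e es => (sM es).2).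
have x'B := surface_body x'M; have := first _ x'B.
have := mf_le_sg zM xM; rewrite -/P -/Q in PE QE; move: yQ PQ.
rewrite PE QE !(mfZl, mfZr) (surface_mf xM) (surface_mf x'M) sgE.
move: (mf y x') (mf z x) => u v h1 h2 h3 h4.
have : q <= p by nra.
nra.
Qed.

End Extension.
End Kirszbraun.

(** * Positive weights, and points of the sphere itself *)

Section Weights.
Context {R : realType} (M : plane).
Implicit Types (u v w x y z : 'rV[R]_3) (r t : R).
Local Notation mf := (@metric_form R M).
Local Notation sg := (@form_sign R M).

(** A smooth majorant of [Num.max 0 (- t)]; [soft_slope] is minus its derivative and is positive
    everywhere. *)
Definition soft t : R := Num.sqrt (1 + t ^+ 2) - t.
Definition soft_slope t : R := 1 - t / Num.sqrt (1 + t ^+ 2).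

Lemma soft_root t : let s := Num.sqrt (1 + t ^+ 2) in [/\ s ^+ 2 = 1 + t ^+ 2, 1 <= s & `|t| < s].
Proof.
move=> s; have s2 : s ^+ 2 = 1 + t ^+ 2 by rewrite sqr_sqrtr//; have := sqr_ge0 t; lra.
have s0 : 0 <= s by exact: sqrtr_ge0.
have t2 := sqr_ge0 t; split=> //; first by nra.
by rewrite -(ltr_pXn2r (_ : 0 < 2)%N) ?nnegrE// real_normK ?num_real// s2; lra.
Qed.

Lemma soft_slope_gt0 t : 0 < soft_slope t.
Proof.
have [_ s1 ts] := soft_root t; rewrite /soft_slope subr_gt0 ltr_pdivrMr; last by lra.
by rewrite mul1r (le_lt_trans (ler_norm t)).
Qed.

Lemma soft_ge t : - t <= soft t /\ 0 <= soft t.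
Proof.
have [_ s1 ts] := soft_root t; have := ler_norm t; have := ler_norm (- t).
by rewrite normrN /soft; move: ts s1; move: (Num.sqrt _) `|t|; split; lra.
Qed.

Lemma soft_le t d : soft (t + d) <= soft t - soft_slope t * d + d ^+ 2.
Proof.
have [s2 s1 _] := soft_root t; have [r2 r1 _] := soft_root (t + d).
rewrite /soft /soft_slope; move: (Num.sqrt (1 + t ^+ 2)) s2 s1 => s s2 s1.
move: (Num.sqrt _) r2 r1 => r r2 r1.
have sn : s != 0 by rewrite gt_eqF//; lra.
suff : r <= s + t / s * d + d ^+ 2 by lra.
rewrite -(ler_pM2l (_ : 0 < s)); last by lra.
have -> : s * (s + t / s * d + d ^+ 2) = s ^+ 2 + t * d + s * d ^+ 2 by field.
have := sqr_ge0 (r - s); have : d ^+ 2 <= s * d ^+ 2 by rewrite ler_peMl// sqr_ge0.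
have := sqr_ge0 d; nra.
Qed.

Lemma soft_continuous : continuous soft.
Proof.
rewrite /soft => t; apply: (@continuousB _ R^o R (fun t => Num.sqrt (1 + t ^+ 2)) id); last exact: cvg_id.
apply: (@continuous_comp _ _ _ (fun t : R => 1 + t ^+ 2)); last exact: sqrt_continuous.
apply: (@continuousD _ R^o R (fun=> 1) (fun t : R => t ^+ 2)); first exact: cst_continuous.
exact: exprn_continuous.
Qed.

Lemma sum_continuous (f : R -> R) (l : seq 'rV[R]_3) : continuous f ->
  continuous (fun v => \sum_(q <- l) f (mf v q)).
Proof.
move=> cf; elim: l => [|q l IH].
  by move=> y; rewrite (_ : (fun y => _) = fun=> 0); [exact: cst_continuous|apply/funext => ?; rewrite big_nil].
rewrite (_ : (fun y => _) = fun y => f (mf y q) + \sum_(q <- l) f (mf y q)); last first.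
  by apply/funext => y; rewrite big_cons.
move=> y; apply: (@continuousD _ _ _ (fun y : 'rV[R]_3 => f (mf y q))
  (fun y => \sum_(q <- l) f (mf y q))); last exact: IH.
apply: (@continuous_comp _ _ _ (fun y => mf y q)); last exact: cf.
rewrite (_ : (fun y => mf y q) = mf q); first exact: mf_continuous.
by apply/funext => w; exact: mfC.
Qed.

(* The weights are the slopes at a minimum of a smooth coercive penalty. *)
Lemma surround_weights (l : seq 'rV[R]_3) :
  (forall v, v != 0 -> exists2 q, q \in l & mf v q < 0) ->
  exists w : 'rV[R]_3 -> R, (forall q, 0 < w q) /\ \sum_(q <- l) w q *: q = 0.
Proof.
move=> lP.
(* [G] is positively homogeneous and positive away from 0, hence coercive; as [F] dominates it, [F]
   has a minimum. *)
pose G v := \sum_(q <- l) Num.max 0 (- mf v q); pose F v := \sum_(q <- l) soft (mf v q).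
have cG : continuous G.
  apply: (@sum_continuous (fun t => Num.max 0 (- t))) => t.
  apply: (@continuous_max _ _ (fun=> 0)); first exact: cst_continuous.
  exact: opp_continuous.
have cF : continuous F by apply: sum_continuous; exact: soft_continuous.
have G0 v : v != 0 -> 0 < G v.
  move=> /lP[q ql vq]; rewrite /G (big_rem q ql)/=.
  have : 0 <= \sum_(q <- rem q l) Num.max 0 (- mf v q) by rewrite sumr_ge0// => e _; rewrite le_max lexx.
  have : 0 < Num.max 0 (- mf v q) by rewrite lt_max oppr_gt0 vq orbT.
  lra.
have GF v : G v <= F v.
  by apply: ler_sum => q _; have [h1 h2] := soft_ge (mf v q); rewrite ge_max h1 h2.
have GZ t v : 0 <= t -> G (t *: v) = t * G v.
  move=> t0; rewrite /G mulr_sumr; apply: eq_bigr => q _; rewrite mfZl.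
  by rewrite -mulrN -{1}(mulr0 t) maxr_pMr.
pose S := [set v : 'rV[R]_3 | `|v| = 1].
have cS : compact S.
  apply: (@compact_rV3 _ S 1) => [v -> //|v vn].
  exists `| `|v| - 1|; first by rewrite normr_gt0 subr_eq0; apply/eqP.
  move=> w wv; rewrite /S/= => wS; have := ler_dist_dist w v; rewrite wS (distrC 1); lra.
have cGS : {within S, continuous G} by apply: continuous_subspaceT.
have [|c /set_mem cS1 cmin] := EVT_min_rV _ cS cGS.
  pose o : 'rV[R]_3 := const_mx 1; exists (`|o|^-1 *: o); rewrite /S/=.
  have : `|o| != 0.
    by rewrite normr_eq0; apply/eqP => /matrixP/(_ 0 0); rewrite !mxE => /eqP; rewrite oner_eq0.
  move=> h; rewrite normrZ normfV normr_id mulVf//.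
set eta := G c in cmin; have eta0 : 0 < eta.
  by apply: G0; apply/eqP => c0; move: cS1; rewrite c0 /S/= normr0; lra.
have GE v : eta * `|v| <= G v.
  have [->|v0] := eqVneq v 0; first by rewrite normr0 mulr0 sumr_ge0// => q _; rewrite le_max lexx.
  have vp : 0 < `|v| by rewrite normr_gt0.
  have -> : v = `|v| *: (`|v|^-1 *: v) by rewrite scalerA mulfV ?scale1r// gt_eqF.
  rewrite normrZ normr_id GZ//.
  have vS : S (`|v|^-1 *: v) by rewrite /S/= normrZ normfV normr_id mulVf// gt_eqF.
  rewrite vS mulr1 mulrC ler_wpM2l//; exact/cmin/mem_set.
pose B := F 0 / eta; pose K := [set v : 'rV[R]_3 | `|v| <= B].
have F0 : 0 <= F 0 by apply: le_trans (GF 0); rewrite sumr_ge0// => q _; rewrite le_max lexx.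
have K0 : K 0 by rewrite /K/= normr0 divr_ge0// ltW.
have cK : compact K.
  apply: (@compact_rV3 _ K B) => [v //|v vn].
  exists (`|v| - B); first by rewrite subr_gt0 ltNge; apply/negP.
  move=> w wv; rewrite /K/= => wS; have := ler_normD (v - w) w; rewrite subrK distrC; lra.
have cFK : {within K, continuous F} by apply: continuous_subspaceT.
have [|y /set_mem yK ymin'] := EVT_min_rV _ cK cFK; first by exists 0.
have ymin v : F y <= F v.
  have [/ltW vB|vB] := ltP `|v| B; first exact/ymin'/mem_set.
  apply: le_trans (ymin' 0 (mem_set K0)) _; apply: le_trans (GF v); apply: le_trans (GE v).
  by rewrite mulrC -ler_pdivrMr.
exists (fun q => soft_slope (mf y q)); split=> [q|]; first exact: soft_slope_gt0.
set Q := \sum_(q <- l) _.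
have mfQ w : mf w Q = \sum_(q <- l) soft_slope (mf y q) * mf w q by exact: mf_sum.
have first v : mf v Q <= 0.
  have key t : 0 < t -> mf v Q <= t * \sum_(q <- l) mf v q ^+ 2.
    move=> t0; rewrite -(ler_pM2l t0) mfQ.
    have := ymin (y + t *: v).
    have : F (y + t *: v) <= \sum_(q <- l)
        (soft (mf y q) - t * (soft_slope (mf y q) * mf v q) + t ^+ 2 * mf v q ^+ 2).
      apply: ler_sum => q _; rewrite mfDl mfZl; have := soft_le (mf y q) (t * mf v q); lra.
    rewrite big_split/= sumrB -mulr_sumr -mulr_sumr -/(F y); lra.
  set X := mf v Q in key *; set Y := \sum_(q <- l) _ in key.
  rewrite leNgt; apply/negP => X0.
  have Y0 : 0 <= Y by rewrite sumr_ge0// => e _; exact: sqr_ge0.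
  have t0 : 0 < X / (Y + 1) by rewrite divr_gt0//; lra.
  have := key _ t0; have : X / (Y + 1) * (Y + 1) = X by rewrite divfK// gt_eqF//; lra.
  lra.
(* With the sign of the last coordinate adjusted, the form gives the Euclidean square of [Q]. *)
have := first (vec (Q 0 0) (Q 0 1) (sg * Q 0 2)); rewrite mfE vec0 vec1 vec2 mulrA (mulrA sg) sg2 mul1r.
have := sqr_ge0 (Q 0 0); have := sqr_ge0 (Q 0 1); have := sqr_ge0 (Q 0 2).
rewrite !expr2 => h2 h1 h0 h.
have [Q0 Q1 Q2] : [/\ Q 0 0 = 0, Q 0 1 = 0 & Q 0 2 = 0] by apply: sqr3_eq0; rewrite !expr2; lra.
by apply: vecP; rewrite mxE.
Qed.

End Weights.

Section Extend.
Context {R : realType} (M : plane).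
Implicit Types (u v w x y z : 'rV[R]_3) (r t : R).
Local Notation mf := (@metric_form R M).
Local Notation sg := (@form_sign R M).
Variables (s : seq ('rV[R]_3 * 'rV[R]_3)) (z : 'rV[R]_3).
Hypotheses (zM : surface M z).
Hypothesis sM : forall e, e \in s -> surface M e.1 /\ surface M e.2.
Hypothesis sC : forall e e', e \in s -> e' \in s -> mf e.1 e'.1 <= mf e.2 e'.2.

Lemma sphere_ge0 v : M = Sphere -> 0 <= mf v v.
Proof. by move=> MS; rewrite /metric_form MS -!expr2 !addr_ge0// sqr_ge0. Qed.

Lemma sphere_eq0 v : M = Sphere -> mf v v = 0 -> v = 0.
Proof.
move=> MS; rewrite /metric_form MS -!expr2 => /sqr3_eq0[v0 v1 v2].
by apply: vecP; rewrite mxE.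
Qed.

(** [t] is the larger root of the quadratic equation for the line to meet the sphere. *)
Lemma push_to_sphere y v : M = Sphere -> mf y y <= 1 -> v != 0 ->
  exists2 t, 0 <= t & surface M (y + t *: v).
Proof.
move=> MS yy v0; set a := mf v v; set b := mf y v.
have a0 : 0 < a.
  rewrite lt_neqAle sphere_ge0// andbT eq_sym; apply: contra v0 => /eqP h.
  exact/eqP/sphere_eq0.
have D0 : 0 <= b ^+ 2 + a * (1 - mf y y) by rewrite addr_ge0 ?sqr_ge0// mulr_ge0 ?subr_ge0// ltW.
have d2 := sqr_sqrtr D0; set d := Num.sqrt _ in d2; have d0 : 0 <= d by exact: sqrtr_ge0.
exists ((d - b) / a).
  apply: divr_ge0; last exact: ltW.
  have h : b ^+ 2 <= d ^+ 2 by rewrite d2; have : 0 <= a * (1 - mf y y) by [rewrite mulr_ge0 ?subr_ge0// ltW]; lra.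
  nra.
rewrite MS /surface/= -MS !mflin (mfC M v y) -/a -/b.
have -> : mf y y = 1 - (d ^+ 2 - b ^+ 2) / a by rewrite d2; field; rewrite gt_eqF.
by field; rewrite gt_eqF.
Qed.

(** Each further vector is taken with negative product with a vector orthogonal to those already
    chosen, so it is independent of them. *)
Lemma sphere_frame (l : seq 'rV[R]_3) : M = Sphere ->
  (forall q, q \in l -> surface M q) ->
  (forall v, v != 0 -> exists2 q, q \in l & mf v q < 0) ->
  exists q1 q2 q3, [/\ q1 \in l, q2 \in l, q3 \in l & det M q1 q2 q3 != 0].
Proof.
move=> MS lM lP; have sgE : sg = 1 by rewrite /form_sign MS.
have [|q1 l1 _] := lP (vec 0 0 1).
  by apply/eqP => /(congr1 (fun v : 'rV[R]_3 => v 0 2)); rewrite vec2 mxE => /eqP; rewrite oner_eq0.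
have [w [w1 ww]] := tangent_exists (lM _ l1).
have [|q2 l2 wq2] := lP w; first by apply/eqP => w0; move: ww; rewrite w0 mf0l ltxx.
have [q11 q22] := (surface_mf (lM _ l1), surface_mf (lM _ l2)).
have n0 : cross M q1 q2 != 0.
  apply/eqP => n0; have := mf_cross M q1 q2 q1 q2; rewrite n0 mf0l q11 q22 (mfC M q2 q1) sgE => e.
  have h : mf (q2 - mf q1 q2 *: q1) (q2 - mf q1 q2 *: q1) = 0.
    by rewrite !mflin q11 q22 (mfC M q2 q1) sgE; lra.
  have /eqP := sphere_eq0 MS h; rewrite subr_eq0 => /eqP E.
  by move: wq2; rewrite E mfZr (mfC M w q1) w1 mulr0 ltxx.
have [q3 l3 q3n] := lP _ n0.
by exists q1, q2, q3; split=> //; rewrite /det lt_eqF.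
Qed.

(* If the images surround the origin, their weighted sum is 0, so the Gram matrices
   coincide and y has the coordinates of z. *)
Lemma sphere_rigid y : M = Sphere -> mf y y <= 1 ->
  (forall e, e \in s -> mf z e.1 <= mf y e.2) ->
  (forall v, v != 0 -> exists2 e, e \in s & mf v e.2 < 0) -> surface M y.
Proof.
move=> MS yy yz sP; have sgE : sg = 1 by rewrite /form_sign MS.
have sP' v : v != 0 -> exists2 q, q \in map snd s & mf v q < 0.
  by move=> /sP[e es h]; exists e.2 => //; exact: map_f.
have [w [w0 wQ]] := surround_weights sP'; rewrite big_map in wQ.
set P := \sum_(e <- s) w e.2 *: e.1.
have term (f g : 'rV[R]_3 * 'rV[R]_3 -> R) : (forall e, e \in s -> f e <= g e) ->
    \sum_(e <- s) w e.2 * g e <= \sum_(e <- s) w e.2 * f e -> forall e, e \in s -> f e = g e.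
  move=> fg le e es; apply/eqP; rewrite eq_le fg//= leNgt; apply/negP => lt.
  move: le; rewrite (big_rem e es) [leRHS](big_rem e es)/= leNgt => /negP; apply.
  apply: ltr_leD; first by rewrite ltr_pM2l.
  rewrite !big_seq; apply: ler_sum => e' /mem_rem e's; rewrite ler_wpM2l ?fg//; exact: ltW.
have PE v : mf v P = \sum_(e <- s) w e.2 * mf v e.1 by exact: mf_sum.
have QE v : \sum_(e <- s) w e.2 * mf v e.2 = 0 by rewrite -mf_sum wQ mf0r.
have row_le e : e \in s -> mf e.1 P <= 0.
  move=> es; rewrite PE; apply: (@le_trans _ _ (\sum_(e' <- s) w e'.2 * mf e.2 e'.2)); last by rewrite QE.
  by rewrite !big_seq; apply: ler_sum => e' e's; rewrite ler_wpM2l ?sC//; exact: ltW.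
have P0 : P = 0.
  apply: sphere_eq0 => //; apply/eqP; rewrite eq_le sphere_ge0// andbT PE big_seq.
  apply: sumr_le0 => e es; rewrite mulr_ge0_le0//; first exact: ltW.
  by rewrite mfC row_le.
have gram e e' : e \in s -> e' \in s -> mf e.1 e'.1 = mf e.2 e'.2.
  move=> es; move: e'; apply: term => [e' e's|]; first exact: sC.
  by rewrite QE -PE P0 mf0r.
have zy e : e \in s -> mf z e.1 = mf y e.2.
  by move: e; apply: term => //; rewrite QE -PE P0 mf0r.
have [|q1 [q2 [q3 [/mapP[e1 s1 ->] /mapP[e2 s2 ->] /mapP[e3 s3 ->] dq]]]] := sphere_frame MS _ sP'.
  by move=> q /mapP[e es ->]; have [] := sM es.
have dp : det M e1.1 e2.1 e3.1 != 0.
  apply: contra dq => /eqP dp; rewrite -sqrf_eq0; apply/eqP.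
  have := gram_det e1.1 e2.1 e3.1; have := gram_det e1.2 e2.2 e3.2.
  rewrite /= -MS => -> E; rewrite -(_ : det M e1.1 e2.1 e3.1 ^+ 2 = 0); last by rewrite dp expr0n.
  by rewrite E !gram.
set d := det _ _ _ _ in dq; have C := cramer M e1.2 e2.2 e3.2 y.
set a := det M y _ _ in C; set b := det M _ y _ in C; set c := det M _ _ y in C.
pose z' := a *: e1.1 + b *: e2.1 + c *: e3.1.
have z'p e : e \in s -> mf z' e.1 = d * mf z e.1.
  by move=> es; rewrite zy// -mfZl C !mflin !gram.
have zz : d *: z = z'.
  apply/eqP; rewrite -subr_eq0; apply/eqP; apply: (det_orth dp); rewrite mfDl mfNl z'p// mfZl; ring.
have E : d ^+ 2 * mf z z = d ^+ 2 * mf y y.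
  have -> : d ^+ 2 * mf z z = mf (d *: z) (d *: z) by rewrite !mflin; ring.
  have -> : d ^+ 2 * mf y y = mf (d *: y) (d *: y) by rewrite !mflin; ring.
  by rewrite C zz !mflin !gram.
have d2 : d ^+ 2 != 0 by rewrite expf_neq0.
by rewrite MS /surface/= -MS -(mulfI d2 E) surface_mf// sgE.
Qed.

(** The point of the body has to reach the surface without decreasing the products. On the
    hyperboloid scaling down does this, all products being negative. On the sphere, move along a
    vector that has nonnegative product with all images; if there is none, [sphere_rigid]
    applies. *)
Lemma extend_contraction : exists2 w, surface M w & forall e, e \in s -> mf z e.1 <= mf w e.2.
Proof.
have [y yB yz] := body_extension zM sM sC.
have [MS|MH] : M = Sphere \/ M = Hyperbolic by case: (M); [left|right].
  have yy : mf y y <= 1 by case: yB; rewrite /form_sign MS.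
  have [[v [v0 vs]]|nv] := pselect (exists v, v != 0 /\ forall e, e \in s -> 0 <= mf v e.2).
    have [t t0 tM] := push_to_sphere MS yy v0.
    exists (y + t *: v) => // e es; rewrite mfDl mfZl.
    have := yz e es; have : 0 <= t * mf v e.2 by rewrite mulr_ge0 ?vs.
    lra.
  exists y => //; apply: sphere_rigid => // v v0; apply: contrapT => ne.
  by apply: nv; exists v; split=> // e es; rewrite leNgt; apply/negP => h; apply: ne; exists e.
have [t t1 [x xM yE]] := body_scale MH yB.
exists x => // e es; have := yz e es; rewrite yE mfZl.
have := mf_le_sg xM (sM es).2; rewrite /form_sign MH; nra.
Qed.

End Extend.

(** Points are added one at a time, each joining [s] together with its image. *)
Lemma contraction_on_list {R : realType} (M : plane) (s : seq ('rV[R]_3 * 'rV[R]_3)) (l : seq 'rV[R]_3) :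
  (forall e, e \in s -> surface M e.1 /\ surface M e.2) ->
  (forall e e', e \in s -> e' \in s -> metric_form M e.1 e'.1 <= metric_form M e.2 e'.2) ->
  (forall c, c \in l -> surface M c) ->
  exists f : 'rV[R]_3 -> 'rV[R]_3, [/\ forall c, c \in l -> surface M (f c),
    forall c c', c \in l -> c' \in l -> metric_form M c c' <= metric_form M (f c) (f c') &
    forall c e, c \in l -> e \in s -> metric_form M c e.1 <= metric_form M (f c) e.2].
Proof.
elim: l s => [|c l IH] s sM sC lM; first by exists id.
have cM : surface M c by apply: lM; rewrite inE eqxx.
have [w wM wC] := extend_contraction cM sM sC.
have [|||f [fM fC fs]] := IH ((c, w) :: s).
- by move=> e; rewrite inE => /predU1P[->|/sM].
- move=> e e'; rewrite !inE => /predU1P[->|es] /predU1P[->|e's] /=.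
  + by rewrite !surface_mf.
  + exact: wC.
  + by rewrite (mfC M e.1) (mfC M e.2); exact: wC.
  + exact: sC.
- by move=> c' lc'; apply: lM; rewrite inE lc' orbT.
exists (fun x => if x == c then w else f x); split=> [x|x y|x e].
- by rewrite inE; case: eqVneq => //= _; exact: fM.
- rewrite !inE; case: eqVneq => [->|xc]; case: eqVneq => [->|yc] //=.
  + by rewrite !surface_mf.
  + move=> _ yl; rewrite mfC (mfC M w); have := fs y (c, w) yl; apply; by rewrite inE eqxx.
  + move=> xl _; have := fs x (c, w) xl; apply; by rewrite inE eqxx.
  + exact: fC.
- rewrite inE; case: eqVneq => [->|xc] /=; first by move=> _; exact: wC.
  by move=> xl es; apply: fs => //; rewrite inE es orbT.
Qed.

(** * Comparison of areas *)

Section Domination.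
Context {R : realType} (M : plane).
Implicit Types (c p q u v w x : 'rV[R]_3) (a b h k t : R).
Local Notation mf := (@metric_form R M).
Local Notation sg := (@form_sign R M).

(** The sine of the distance whose cosine is [t], hyperbolic sine in the hyperbolic plane. *)
Definition sine t : R := Num.sqrt (sg * (1 - t ^+ 2)).

(* The cosine of the sum of the distances with cosines a and b. *)
Definition cosine_sum a b : R := sg * (a * b) - sine a * sine b.

Lemma sine_sqr x y : surface M x -> surface M y -> sine (mf x y) ^+ 2 = sg * (1 - mf x y ^+ 2).
Proof.
move=> xM yM; rewrite sqr_sqrtr//; have := mf_le_sg xM yM; have := @mf_geN1 R M x y.
by rewrite /form_sign; case: (M) xM yM => xM yM => [/(_ erefl xM yM)|_]; nra.
Qed.

Lemma mf_tangent p x (v := x - (sg * mf p x) *: p) : surface M p -> surface M x ->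
  mf p v = 0 /\ mf v v = sg * (1 - mf p x ^+ 2).
Proof.
move=> pM xM; rewrite /v !mflin (mfC M x p) !surface_mf//; split.
  by transitivity (mf p x * (1 - sg * sg)); [ring|rewrite sg2; ring].
transitivity (sg - 2 * sg * mf p x ^+ 2 + sg * (sg * sg) * mf p x ^+ 2); first by ring.
by rewrite sg2; ring.
Qed.

(** The triangle inequality in terms of cosines, from the Cauchy-Schwarz inequality for the
    components of [c] and [x] tangent at [p]. *)
Lemma mf_ge_cosine_sum p c x : surface M p -> surface M c -> surface M x ->
  cosine_sum (mf p c) (mf p x) <= mf c x.
Proof.
move=> pM cM xM; have [pw ww] := mf_tangent pM cM; have [pv vv] := mf_tangent pM xM.
set w := c - _ in pw ww; set v := x - _ in pv vv.
have wv : mf w v = mf c x - sg * (mf p c * mf p x).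
  rewrite /w /v !mflin (mfC M c p) (surface_mf pM).
  transitivity (mf c x - 2 * sg * (mf p c * mf p x) + sg * (sg * sg) * (mf p c * mf p x)); first by ring.
  by rewrite sg2; ring.
clearbody w v; rewrite -(sine_sqr pM cM) in ww; rewrite -(sine_sqr pM xM) in vv.
rewrite /cosine_sum; have S0 : 0 <= sine (mf p c) by exact: sqrtr_ge0.
have T0 : 0 <= sine (mf p x) by exact: sqrtr_ge0.
move: (sine (mf p c)) (sine (mf p x)) ww vv S0 T0 => S T ww vv S0 T0.
suff : mf w v ^+ 2 <= (S * T) ^+ 2.
  have : 0 <= S * T by exact: mulr_ge0.
  by move: wv; nra.
have [Sz|Sn] := eqVneq S 0.
  have -> : w = 0 by apply: (surface_orth_eq0 pM pw); rewrite ww Sz expr0n.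
  by rewrite mf0l expr0n sqr_ge0.
have S2 : 0 < S ^+ 2 by rewrite exprn_gt0// lt_neqAle eq_sym Sn.
have := surface_orth_ge0 (v := S ^+ 2 *: v - mf w v *: w) pM.
rewrite mfDr mfNr !mfZr pw pv => /(_ ltac:(ring)); rewrite !mflin ww vv (mfC M v w) => h.
rewrite -(ler_pM2l S2); lra.
Qed.

(** The point where the geodesic from [c] to [p], continued beyond [p], leaves the disc about
    [p]. *)
Lemma cosine_sum_attained p c h : surface M p -> surface M c -> h < sg -> 0 <= sg * (1 - h ^+ 2) ->
  exists x, [/\ surface M x, mf p x = h & mf c x = cosine_sum (mf p c) h].
Proof.
move=> pM cM hs gap; have [pw ww] := mf_tangent pM cM.
set w := c - _ in pw ww.
have cE : c = (sg * mf p c) *: p + w by rewrite /w addrC subrK.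
clearbody w; rewrite -(sine_sqr pM cM) in ww.
have [e [pe ee we]] : exists e, [/\ mf p e = 0, mf e e = 1 & w = sine (mf p c) *: e].
  have [Sz|Sn] := eqVneq (sine (mf p c)) 0.
    have [v [pv vv]] := tangent_exists pM; have s2 := sqr_sqrtr (ltW vv).
    have s0 : Num.sqrt (mf v v) != 0 by rewrite gt_eqF// sqrtr_gt0.
    move: (Num.sqrt _) s2 s0 => t t2 t0.
    exists (t^-1 *: v); split.
    - by rewrite mfZr pv mulr0.
    - by rewrite !mflin -t2; field.
    - by rewrite Sz scale0r; apply: (surface_orth_eq0 pM pw); rewrite ww Sz expr0n.
  exists ((sine (mf p c))^-1 *: w); split.
  - by rewrite mfZr pw mulr0.
  - by rewrite !mflin ww; field.
  - by rewrite scalerA mulfV// scale1r.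
have h2 : sine h ^+ 2 = sg * (1 - h ^+ 2) by exact: sqr_sqrtr.
have px : mf p ((sg * h) *: p - sine h *: e) = h.
  by rewrite !mflin pe surface_mf// mulrAC sg2; ring.
exists ((sg * h) *: p - sine h *: e); split=> //.
- apply: (surface_of pM); last by rewrite px ltW.
  rewrite !mflin (mfC M e p) pe ee surface_mf//.
  transitivity (sg * (sg * sg) * h ^+ 2 + sine h ^+ 2); first by ring.
  by rewrite h2 sg2; ring.
- rewrite /cosine_sum [in LHS]cE we; move: (mf p c) => a.
  rewrite !mflin (mfC M e p) pe ee surface_mf//.
  transitivity (sg * (sg * sg) * (a * h) - sine a * sine h); first by ring.
  by rewrite sg2; ring.
Qed.

(** On the sphere [0 <= a + h] says that the two distances add up to at most [pi], the range where
    the cosine of their sum is monotone. *)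
Lemma cosine_sum_le a a' h : a <= a' -> a' <= sg -> h <= sg ->
  (M = Sphere -> [/\ -1 <= a, -1 <= h & 0 <= a + h]) -> cosine_sum a h <= cosine_sum a' h.
Proof.
move=> aa' a's hs HS; rewrite /cosine_sum.
have [MS|MH] : M = Sphere \/ M = Hyperbolic by case: (M); [left|right].
  have [a1 h1 ah] := HS MS; have sgE : sg = 1 by rewrite /form_sign MS.
  rewrite sgE in a's hs *.
  have sn t : -1 <= t -> t <= 1 -> 0 <= sine t /\ sine t ^+ 2 = 1 - t ^+ 2.
    by move=> t1 t2; rewrite sqrtr_ge0 sqr_sqrtr sgE ?mul1r//; nra.
  have pos t : a <= t -> t <= 1 -> 0 <= h * sine t + t * sine h.
    move=> at' t1; have [|u0 u2] := sn t _ t1; first lra.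
    have [s0 s2] := sn h h1 hs.
    have [h0|h0] := leP 0 h.
      have [t0|t0] := leP 0 t; first by rewrite addr_ge0// mulr_ge0.
      have : sine h <= sine t by rewrite -(ler_pXn2r (_ : 0 < 2)%N)// u2 s2; nra.
      nra.
    have : sine t <= sine h by rewrite -(ler_pXn2r (_ : 0 < 2)%N)// u2 s2; nra.
    nra.
  have [|u0 u2] := sn a a1 _; first lra.
  have [|v0 v2] := sn a' _ a's; first lra.
  have := pos a (lexx a) (le_trans aa' a's); have := pos a' aa' a's.
  have [s0 s2] := sn h h1 hs.
  move: (sine a) (sine a') (sine h) u0 u2 v0 v2 s0 s2 => u v s u0 u2 v0 v2 s0 s2 p' p.
  have [e|ne] := eqVneq (u + v) 0.
    have [u00 v00] : u = 0 /\ v = 0 by lra.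
    subst u v; nra.
  have uv : 0 < u + v by rewrite lt_neqAle eq_sym ne addr_ge0.
  rewrite -subr_ge0 -(pmulr_rge0 _ uv).
  have -> : (u + v) * (1 * (a' * h) - v * s - (1 * (a * h) - u * s)) =
     (a' - a) * (u + v) * h + (u ^+ 2 - v ^+ 2) * s by ring.
  have -> : u ^+ 2 - v ^+ 2 = (a' - a) * (a' + a) by rewrite u2 v2; ring.
  have -> : (a' - a) * (u + v) * h + (a' - a) * (a' + a) * s =
     (a' - a) * ((h * u + a * s) + (h * v + a' * s)) by ring.
  by rewrite mulr_ge0 ?subr_ge0// addr_ge0.
have sgE : sg = -1 by rewrite /form_sign MH.
rewrite sgE in a's hs *.
have : sine a' <= sine a by rewrite /sine ler_wsqrtr// sgE; nra.
have : 0 <= sine h by exact: sqrtr_ge0.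
nra.
Qed.

(** The inclusion of the disc about [p] in the disc about [c] is tested at the farthest point of its
    circle, which bounds the distance of the centres plus one radius by the other radius. This bound
    survives when the centres approach each other. *)
Lemma dominate p c q c' x h k : surface M p -> surface M c -> surface M q -> surface M c' ->
  surface M x -> h < sg -> 0 < sg * (sg ^+ 2 - h ^+ 2) ->
  (forall y, surface M y -> h < mf p y -> k <= mf c y) -> mf p c <= mf q c' -> h <= mf q x ->
  k <= mf c' x.
Proof.
move=> pM cM qM c'M xM hs gap cov pc hx.
have gap' : 0 <= sg * (1 - h ^+ 2) by move: gap; rewrite expr2 sg2 => /ltW.
have hle : k <= cosine_sum (mf p c) h.
  have [y [yM py <-]] := cosine_sum_attained pM cM hs gap'.
  rewrite leNgt; apply/negP => ky.
  have [|d d0 hd] := mf_near M c y (e := k - mf c y); first by rewrite subr_gt0.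
  have [z [zM zy]] := near_circle pM gap yM py (expr1n R 2) d0.
  rewrite mul1r subr_gt0 => /(cov z zM); have /ltr_normlP[_] := hd z zy; lra.
have [MS|MH] : M = Sphere \/ M = Hyperbolic by case: (M); [left|right].
  have sgE : sg = 1 by rewrite /form_sign MS.
  (* If distance and radius add up to more than [pi], then [- c] is in the disc about [p], so the
     disc about [c] is the whole sphere. *)
  have [ah|ah] := leP 0 (mf p c + h); last first.
    have NcM : surface M (- c) by move: cM; rewrite MS /surface/= /metric_form !mxE; lra.
    have := cov _ NcM; rewrite !mfNr (surface_mf cM) sgE => /(_ ltac:(lra)) k1.
    exact: le_trans k1 (mf_geN1 MS c'M xM).
  have h1 : -1 <= h by move: gap' hs; rewrite sgE; nra.
  have pc1 := mf_geN1 MS pM cM.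
  apply: (le_trans hle); apply: le_trans (mf_ge_cosine_sum qM c'M xM).
  apply: (@le_trans _ _ (cosine_sum (mf q c') h)).
    by apply: cosine_sum_le; rewrite ?mf_le_sg// ltW.
  rewrite /cosine_sum (mulrC (mf q c') h) (mulrC (sine _)) (mulrC (mf q c')) (mulrC (sine (mf q c'))).
  apply: cosine_sum_le; rewrite ?mf_le_sg// => _; split=> //; [exact: mf_geN1|lra].
apply: (le_trans hle); apply: le_trans (mf_ge_cosine_sum qM c'M xM).
apply: (@le_trans _ _ (cosine_sum (mf q c') h)).
  apply: cosine_sum_le => //; [exact: mf_le_sg|exact: ltW|by rewrite MH].
rewrite /cosine_sum (mulrC (mf q c') h) (mulrC (sine _)) (mulrC (mf q c')) (mulrC (sine (mf q c'))).
by apply: cosine_sum_le => //; [exact: mf_le_sg|exact: mf_le_sg|rewrite MH].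
Qed.

End Domination.

Section Comparison.
Context {R : realType} (M : plane).
Implicit Types (c x y z : 'rV[R]_3) (h k : R) (nd : 'rV[R]_3 * R).
Local Notation mf := (@metric_form R M).
Local Notation sg := (@form_sign R M).
Local Notation node := ('rV[R]_3 * R)%type.

Lemma nice_union (T : eqType) (s : seq T) (F : T -> set 'rV[R]_3) :
  (forall i, nice (F i)) -> nice [set x | exists2 i, i \in s & F i x].
Proof.
move=> nF; elim: s => [|a s IH].
  have := niceD (nice_surface M) (@nice_surface R M); congr nice.
  by apply/seteqP; split=> [x []|x [i]].
have := niceU (nF a) IH; congr nice; apply/seteqP; split=> x.
  by move=> [ax|[i si ix]]; [exists a|exists i]; rewrite ?inE ?eqxx ?si ?orbT.
by move=> [i]; rewrite inE => /predU1P[->|si] ix; [left|right; exists i].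
Qed.

Definition caps (f : 'rV[R]_3 -> 'rV[R]_3) (s : seq node) : set 'rV[R]_3 :=
  [set x | exists2 nd, nd \in s & cap M (f nd.1) nd.2 x].

Definition excess (e : node * node) : \bar R :=
  area M (cap M e.1.1 e.1.2 `\` cap M e.2.1 e.2.2).

(** A moved child adds at most its part outside the moved parent, and the area of that part is at
    most the original [excess] because the centres have approached. *)
Lemma area_caps_le (f : 'rV[R]_3 -> 'rV[R]_3) (l : seq 'rV[R]_3) seen es :
  (forall c, c \in l -> surface M c /\ surface M (f c)) ->
  (forall c c', c \in l -> c' \in l -> mf c c' <= mf (f c) (f c')) ->
  (forall nd, nd \in seen -> nd.1 \in l) -> (forall e, e \in es -> e.1.1 \in l) -> wf seen es ->
  (area M (caps f (seen ++ map fst es)) <= area M (caps f seen) + \sum_(e <- es) excess e)%E.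
Proof.
move=> lM fC; elim: es seen => [|e es IH] seen sl el /=.
  by rewrite cats0 big_nil adde0.
move=> [pe wes].
have e1 : e.1.1 \in l by apply: el; rewrite inE eqxx.
have e2 := sl _ pe; have [cM c'M] := lM _ e1; have [dM d'M] := lM _ e2.
have nc s : nice (caps f s) by apply: nice_union => nd; exact: nice_cap.
have := IH (e.1 :: seen) _ _ wes.
have -> : caps f ((e.1 :: seen) ++ map fst es) = caps f (seen ++ e.1 :: map fst es).
  have E nd : (nd \in (e.1 :: seen) ++ map fst es) = (nd \in seen ++ e.1 :: map fst es).
    by rewrite /= !(inE, mem_cat) orbCA.
  by apply/seteqP; split=> x [nd h hx]; exists nd => //; rewrite ?E// -E.
move=> /(_ _ _)/le_trans; apply.
- by move=> nd; rewrite inE => /predU1P[->//|/sl].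
- by move=> e' he'; apply: el; rewrite inE he' orbT.
rewrite big_cons addeA; apply: leeD => //.
set D := cap M (f e.1.1) e.1.2 `\` cap M (f e.2.1) e.2.2.
have nD : nice D by apply: niceD; exact: nice_cap.
apply: (@le_trans _ _ (area M (caps f seen `|` D))).
  apply: le_area => //; first exact: niceU.
  move=> x [[nd]]; rewrite inE => /predU1P[->|hn] ix xM; last by left; exists nd.
  have [pc|np] := pselect (cap M (f e.2.1) e.2.2 x); last by right.
  by left; exists e.2.
apply: le_trans (area_leU M (nc seen) nD) _; apply: leeD => //.
exact: area_lune_contract (fC _ _ e1 e2).
Qed.

(** The sets measured by [excess] exceed the open lunes by arcs of circles, which have area 0. *)
Lemma area_lunes_ge (A : set 'rV[R]_3) (es : seq (node * node)) : nice A -> 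
  (forall e, e \in es -> surface M e.1.1) ->
  (forall e x, e \in es -> A x -> lune M e x -> False) -> disj M es ->
  (area M A + \sum_(e <- es) excess e <=
   area M [set x | A x \/ exists2 e, e \in es & lune M e x])%E.
Proof.
have nL (e : node * node) : nice [set x | lune M e x].
  have := niceD (@nice_ocap R M e.1.1 e.1.2) (@nice_cap R M e.2.1 e.2.2); congr nice.
  apply/seteqP; split=> x /= [].
    by move=> [xM h] n; split=> //; rewrite ltNge; apply/negP => h'; apply: n.
  by move=> xM h h'; split=> // -[_]; rewrite leNgt h'.
elim: es A => [|e es IH] A nA eM eA /=.
  move=> _; rewrite big_nil adde0; apply: le_area => //; last by move=> x [? _]; left.
  have := nA; congr nice; apply/seteqP; split=> x; first by left.
  by move=> [//|[e]].
move=> [de des]; rewrite big_cons addeA.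
have := IH (A `|` [set x | lune M e x]) (niceU nA (nL e)) _ _ des.
rewrite areaU//; last by move=> x [[Ax lx] _]; apply: eA Ax lx; rewrite inE eqxx.
move=> /(_ _ _) IH'; apply: le_trans (le_trans _ (IH' _ _)) _.
- apply: leeD => //; apply: leeD => //.
  have nc := niceD (@nice_cap R M e.1.1 e.1.2) (@nice_ocap R M e.1.1 e.1.2).
  have -> : area M [set x | lune M e x] =
      (area M [set x | lune M e x] + area M (cap M e.1.1 e.1.2 `\` ocap M e.1.1 e.1.2))%E.
    by rewrite area_circle ?adde0//; apply: eM; rewrite inE eqxx.
  apply: le_trans (area_leU M (nL e) nc); apply: le_area.
  - by apply: niceD; exact: nice_cap.
  - exact: niceU.
  - move=> x [[[_ h] n] xM]; have [lt|ge] := ltP e.1.2 (mf e.1.1 x).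
      by left; split=> //; rewrite ltNge; apply/negP => h'; apply: n.
    by right; split=> // -[_]; rewrite ltNge ge.
- by move=> e' es'; apply: eM; rewrite inE es' orbT.
- move=> e' x es' [Ax|lx] l'; first by apply: eA Ax l'; rewrite inE es' orbT.
  exact: de lx l'.
- apply: le_area.
  + apply: niceU; first exact: niceU.
    exact: nice_union.
  + apply: niceU => //.
    exact: (@nice_union _ (e :: es) (fun e x => lune M e x)).
  + move=> x [[[Ax|lx]|[e' es' l']] _]; first by left.
      by right; exists e; rewrite ?inE ?eqxx.
    by right; exists e'; rewrite ?inE ?es' ?orbT.
Qed.

End Comparison.

Lemma relative_interiorE {R : realType} (M : plane) (k : nat) (p : 'I_k -> 'rV[R]_3) (h : 'I_k -> R) :
  relative_interior (surface M) (\bigcup_i cap M (p i) (h i)) = inner M p h.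
Proof.
have nb x (A : set 'rV[R]_3) : surface M x ->
    @nbhs _ (subspace (surface M)) x A <-> exists2 eps, 0 < eps & forall y, surface M y -> `|y - x| < eps -> A y.
  move=> xM; have <- : within (surface M) (nbhs x) = @nbhs _ (subspace (surface M)) x.
    exact: nbhs_subspace_in.
  split.
    move=> /nbhs_ballP[e e0 he]; exists e => // y yM yx; apply: he => //.
    by rewrite -ball_normE/= distrC.
  move=> [e e0 he]; apply/nbhs_ballP; exists e => // y; rewrite -ball_normE/= distrC => yx yM.
  exact: he.
apply/seteqP; split=> x.
  move=> xo; have [_ _ [xM _]] := @interior_subset (subspace (surface M)) _ _ xo.
  have [e e0 he] := (nb x _ xM).1 xo; split=> //; exists e => // y yM yx.
  by have [i _ [_ hi]] := he y yM yx; exists i.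
move=> [xM [e e0 he]]; apply/(nb x _ xM); exists e => // y yM yx.
by have [i hi] := he y yM yx; exists i.
Qed.

Lemma area_caps_contract {R : realType} (M : plane) (k : nat)
    (p q : 'I_k -> 'rV[R]_3) (h : 'I_k -> R)
    (pM : forall i, surface M (p i)) (qM : forall i, surface M (q i)) (hlt : forall i, h i < form_sign M)
    (pq : forall i j, metric_form M (p i) (p j) <= metric_form M (q i) (q j))
    (scO : simply_connected R (inner M p h)) :
  (area M (\bigcup_i cap M (q i) (h i)) <= area M (\bigcup_i cap M (p i) (h i)))%E.
Proof.
have nU (s : 'I_k -> 'rV[R]_3) : nice (\bigcup_i cap M (s i) (h i)).
  have := @nice_union R M _ (enum 'I_k) (fun i => cap M (s i) (h i)) (fun i => nice_cap _ _ _).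
  by congr nice; apply/seteqP; split=> x [i _ ix]; exists i; rewrite ?mem_enum.
have [[i0 _]|k0] := pselect (exists i : 'I_k, true); last first.
  by apply: le_area => // x [[i]]; case: k0; exists i.
(* Without outside points, the discs about the [p i] cover the whole surface. *)
have [out|full] := pselect (exists z, outside M p h z); last first.
  apply: le_area => // x [_ xM]; apply: contrapT => nx; apply: full; exists x; split=> // i.
  by rewrite ltNge; apply/negP => hi; apply: nx; exists i.
have [c [kc [es [cM cI wes des [eP covers]]]]] := disc_tree pM hlt out scO i0.
have [|||f [fM fC fp]] := @contraction_on_list R M [seq (p i, q i) | i <- enum 'I_k] (c :: map (fun e => e.1.1) es).
- by move=> _ /mapP[i _ ->]; split; [exact: pM|exact: qM].
- by move=> _ _ /mapP[i _ ->] /mapP[j _ ->]; exact: pq.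
- by move=> x; rewrite inE => /predU1P[->//|/mapP[e /eP[eM _ _] ->]].
set l := c :: _ in fM fC fp.
have lM x : x \in l -> surface M x.
  by rewrite inE => /predU1P[->//|/mapP[e /eP[eM _ _] ->]].
have cl : c \in l by rewrite inE eqxx.
have el e : e \in es -> e.1.1 \in l by move=> ees; rewrite inE (map_f (fun e => e.1.1) ees) orbT.
have nodes : \bigcup_i cap M (q i) (h i) `<=` caps M f ([:: (c, kc)] ++ map fst es).
  move=> x [i _ [xM hx]]; have [nd hnd cov] := covers i.
  have ndl : nd.1 \in l.
    by move: hnd; rewrite inE => /predU1P[->//|/mapP[e ees ->]]; exact: el.
  exists nd => //; split=> //.
  apply: (dominate (pM i) (lM _ ndl) (qM i) (fM _ ndl) xM (hlt i) (cap_gap pM hlt out i) cov _ hx).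
  by rewrite (mfC M (p i)) (mfC M (q i)); apply: (fp nd.1 (p i, q i) ndl); rewrite map_f// mem_enum.
have nc s : nice (caps M f s) by apply: (nice_union M) => nd; exact: nice_cap.
apply: (@le_trans _ _ (area M (caps M f ([:: (c, kc)] ++ map fst es)))).
  by apply: le_area => // x [/nodes].
apply: le_trans (area_caps_le (l := l) _ fC _ _ wes) _.
- by move=> x xl; split; [exact: lM|exact: fM].
- by move=> nd; rewrite inE => /eqP ->.
- exact: el.
have -> : caps M f [:: (c, kc)] = cap M (f c) kc.
  by apply/seteqP; split=> x; [move=> [nd]; rewrite inE => /eqP ->|exists (c, kc); rewrite ?inE].
rewrite (area_cap kc (fM _ cl) cM).
have no := nice_ocap M c kc; have nd := niceD (nice_cap M c kc) no.
have -> : cap M c kc = ocap M c kc `|` (cap M c kc `\` ocap M c kc).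
  by rewrite setUDr setDv setD0; apply/seteqP; split=> x; [right|move=> [/ocap_cap|]].
apply: (@le_trans _ _ (area M (ocap M c kc) + \sum_(e <- es) excess M e)%E).
  apply: leeD => //; apply: le_trans (area_leU M no nd) _.
  by rewrite area_circle// adde0.
apply: le_trans (area_lunes_ge no _ _ des) _.
- by move=> e /eP[].
- by move=> e x /eP[_ _ H] [_ xk] /H; rewrite ltNge (ltW xk).
apply: le_area => //.
  apply: niceU => //; apply: (@nice_union R M _ es (fun e x => lune M e x)) => e.
  have := niceD (nice_ocap M e.1.1 e.1.2) (nice_cap M e.2.1 e.2.2); congr nice.
  apply/seteqP; split=> x /= [].
    by move=> [xM h1] n; split=> //; rewrite ltNge; apply/negP => h'; apply: n.
  by move=> xM h1 h'; split=> // -[_]; rewrite leNgt h'.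
have iU x : inner M p h x -> (\bigcup_i cap M (p i) (h i)) x.
  by move=> xI; have [i hi] := inner_cap xI; exists i => //; split=> //; exact: inner_surface xI.
move=> x [[[xM xk]|[e /eP[eM eI _] [xM xe _]]] _]; apply: iU; [exact: cI|exact: eI].
Qed.

Theorem theorem1p2 (R : realType) (M : plane) (k : nat)
    (p q : 'I_k -> 'rV[R]_3) (r : 'I_k -> R)
    (hp : forall i, surface M (p i)) (hq : forall i, surface M (q i))
    (hr : forall i, 0 < r i)
    (hpq : forall i j, dist M (q i) (q j) <= dist M (p i) (p j))
    (hsc : simply_connected R (relative_interior (surface M)
             (\bigcup_i disk M (p i) (r i)))) :
  (area M (\bigcup_i disk M (q i) (r i)) <=
   area M (\bigcup_i disk M (p i) (r i)))%E.
Proof.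
have /choice[h hP] i : exists h, h < form_sign M /\ forall x, surface M x -> disk M x (r i) = cap M x h.
  by have [h h1 h2] := disk_cap M (hr i); exists h.
have E (s : 'I_k -> 'rV[R]_3) : (forall i, surface M (s i)) ->
    \bigcup_i disk M (s i) (r i) = \bigcup_i cap M (s i) (h i).
  by move=> sM; apply: eq_bigcupr => i _; rewrite (hP i).2.
rewrite !E// relative_interiorE in hsc *.
apply: area_caps_contract => // [i|i j]; first by have [] := hP i.
exact: dist_contract.
Qed.
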